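(* Let $\mathfrak g=\mathfrak{sl}(m|n)$ with $m\ne n$. For any $\Lambda=(\lambda|\mu)\in\mathfrak h^*$, $$\operatorname{GKdim}\widetilde L(\lambda|\mu)=|\Delta_0^+|-A(P(\lambda|\mu))=\frac{m(m-1)}{2}-A(P(\lambda))+\frac{n(n-1)}{2}-A(P(\mu)).$$
   Context: Everything is over $\mathbb C$; $m,n\ge1$. $\mathfrak h$ is the diagonal Cartan subalgebra of $\mathfrak{sl}(m|n)$; weights are written $\Lambda=(\lambda_1,\dots,\lambda_m|\mu_1,\dots,\mu_n)=\sum_i\lambda_i\epsilon_i+\sum_j\mu_j\delta_j$, abbreviated $(\lambda|\mu)$. Positive roots: even $\Delta_0^+=\{\epsilon_i-\epsilon_j\,(i<j\le m),\ \delta_k-\delta_l\,(k<l\le n)\}$, odd $\Delta_1^+=\{\epsilon_i-\delta_k\}$; the Borel subalgebra $\mathfrak b$ is the upper triangular one. $\widetilde L(\lambda|\mu)$ is the simple highest weight $\mathfrak g$-module with highest weight $(\lambda|\mu)$ with respect to $\mathfrak b$. $\operatorname{GKdim}M=\limsup_k\log\dim(U_k(\mathfrak g)M')/\log k$ for a finite-dimensional generating subspace $M'$ of $M$ and the standard filtration $U_k(\mathfrak g)$. Let $\rho_0=\frac12\sum_{\alpha\in\Delta_0^+}\alpha=\frac12(m-1,m-3,\dots,1-m|n-1,n-3,\dots,1-n)$ and $\Lambda+\rho_0=(\lambda^{\rho_0}|\mu^{\rho_0})$. RS insertion: let $\Gamma$ be a coset of $\mathbb Z$ in $\mathbb C$,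 ordered by $a<b$ iff $b-a\in\mathbb Z_{>0}$. For a finite sequence $x=(x_1,\dots,x_r)$ in $\Gamma$, the Young tableau $Y(x)$ is built from the empty tableau by inserting $x_1,\dots,x_r$ successively: to insert $a$ in a row, replace the leftmost entry strictly bigger than $a$ by $a$ and insert the replaced entry in the next row in the same way; if there is no such entry, append $a$ at the right end of the row and stop. $P(\lambda)$ is the collection of Young tableaux $Y(x)$, where $x$ runs over the maximal subsequences of $\lambda^{\rho_0}$ any two of whose entries differ by an integer; $P(\mu)$ is defined in the same way from $\mu^{\rho_0}$, and $P(\lambda|\mu)$ consists of the tableaux of $P(\lambda)$ together with those of $P(\mu)$ (counted with multiplicity). For a Young tableau $Y$ with column lengths $q_1,q_2,\dots$, put $A(Y)=\sum_{i\ge1}\frac{q_i(q_i-1)}2$, and for a collection $P$ of tableaux put $A(P)=\sum_{Y\in P}A(Y)$. *)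

(* Defs.v *)
From HB Require Import structures.
From mathcomp Require Import all_boot all_order all_algebra.
From mathcomp Require Import all_classical all_reals all_analysis.
From mathcomp Require Import complex ring.

Set Implicit Arguments.
Unset Strict Implicit.
Unset Printing Implicit Defensive.

Import Order.TTheory GRing.Theory Num.Theory.
Local Open Scope classical_set_scope.
Local Open Scope ring_scope.

(** * The Lie superalgebra sl(m|n) *)

Section SpecialLinear.
Variables (K : fieldType) (m n : nat).
Implicit Types X Y : 'M[K]_(m + n).

(* Homogeneous component of parity [p] ([false] is even, [true] is odd). *)
Definition mxparity (p : bool) X : 'M[K]_(m + n) :=
  if p then block_mx 0 (ursubmx X) (dlsubmx X) 0
  else block_mx (ulsubmx X) 0 0 (drsubmx X).

(* Bilinear extension of [X, Y] = XY - (-1)^(|X||Y|) YX. *)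
Definition superbracket X Y : 'M[K]_(m + n) :=
  X *m Y - \sum_(a : bool) \sum_(b : bool)
             (-1) ^+ (a && b) *: (mxparity b Y *m mxparity a X).

Definition supertrace X : K^o := \tr (ulsubmx X) - \tr (drsubmx X).

Lemma supertrace_is_linear : linear supertrace.
Proof.
move=> a X Y; rewrite /supertrace.
have -> : ulsubmx (a *: X + Y) = a *: ulsubmx X + ulsubmx Y.
  by apply/matrixP => i j; rewrite !mxE.
have -> : drsubmx (a *: X + Y) = a *: drsubmx X + drsubmx Y.
  by apply/matrixP => i j; rewrite !mxE.
rewrite !mxtraceD !mxtraceZ /GRing.scale /= mulrBr opprD.
by rewrite addrACA.
Qed.

HB.instance Definition _ :=
  GRing.isLinear.Build K 'M[K]_(m + n) K^o _ supertrace supertrace_is_linear.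

Definition sl : {vspace 'M[K]_(m + n)} := lker (linfun supertrace).

Lemma mem_sl X : (X \in sl) = (supertrace X == 0).
Proof. by rewrite memv_ker lfunE. Qed.

Lemma superbracket_sl X Y : superbracket X Y \in sl.
Proof.
rewrite mem_sl /superbracket.
under eq_bigr do rewrite big_bool.
rewrite big_bool /mxparity /= expr1 !expr0 !scale1r scaleN1r.
rewrite -[in X *m Y](submxK X) -[in _ *m Y](submxK Y) !mulmx_block.
rewrite !(mulmx0, mul0mx, addr0, add0r) opp_block_mx !add_block_mx.
rewrite opp_block_mx add_block_mx.
rewrite !(oppr0, addr0, add0r).
rewrite /supertrace block_mxKul block_mxKdr.
have trN p (A : 'M[K]_p) : \tr (- A) = - \tr A by exact: raddfN.
rewrite !mxtraceD !trN.
rewrite (mxtrace_mulC (ulsubmx X)) (mxtrace_mulC (drsubmx X)).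
rewrite (mxtrace_mulC (ursubmx X)) (mxtrace_mulC (dlsubmx X)).
by apply/eqP; ring.
Qed.

Definition slT := subvs_of sl.

Definition slbracket (x y : slT) : slT :=
  vsproj sl (superbracket (vsval x) (vsval y)).

Definition slhom (p : bool) (x : slT) : Prop :=
  mxparity p (vsval x) = vsval x.

(* The Borel subalgebra is the span of the following two kinds of elements. *)
Definition slcartan (x : slT) : Prop := is_diag_mx (vsval x).

Definition slnilp (x : slT) : Prop :=
  forall i j : 'I_(m + n), (j <= i)%N -> vsval x i j = 0.

(* The weight with coordinates Lam, as a linear form on diagonal matrices.   *)
(* On sl(m|n), coordinates differing by a multiple of the supertrace         *)
(* (1,..,1|-1,..,-1) define the same weight.                                 *)
Definition weight_eval (Lam : 'rV[K]_(m + n)) (x : slT) : K :=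
  \sum_i Lam 0 i * vsval x i i.

End SpecialLinear.

(** * Infinite-dimensional linear algebra *)

Section LinearAlgebra.
Variables (K : fieldType) (M : lmodType K).

Definition is_subspace (W : set M) : Prop :=
  W 0 /\ forall (a : K) u v, W u -> W v -> W (a *: u + v).

Definition lspan (S : set M) : set M := smallest is_subspace S.

Definition is_basis (d : nat) (b : 'I_d -> M) (W : set M) : Prop :=
  (forall c : 'I_d -> K, \sum_i c i *: b i = 0 -> forall i, c i = 0) /\
  lspan (range b) = W.

Definition has_dim (W : set M) (d : nat) : Prop :=
  exists b : 'I_d -> M, is_basis b W.

Definition findim (W : set M) : Prop := exists d, has_dim W d.

(* Arbitrary when W is infinite-dimensional. *)
Definition ldim (W : set M) : nat := get [set d | has_dim W d].

End LinearAlgebra.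

(** * Supermodules over sl(m|n) *)

Record slmodule (K : fieldType) (m n : nat) := SlModule {
  slmod_car :> lmodType K;
  slmod_part : bool -> set slmod_car;
  slact : slT K m n -> slmod_car -> slmod_car;
  slmod_part_subspace : forall p, is_subspace (slmod_part p);
  slmod_part_sum : forall v, exists v0 v1,
    [/\ slmod_part false v0, slmod_part true v1 & v = v0 + v1];
  slmod_part_direct : forall v, slmod_part false v -> slmod_part true v -> v = 0;
  slact_linearl : forall v, linear (slact^~ v);
  slact_linearr : forall x, linear (slact x);
  slact_parity : forall p q x v,
    slhom p x -> slmod_part q v -> slmod_part (p (+) q) (slact x v);
  slact_bracket : forall p q x y v, slhom p x -> slhom q y ->
    slact (slbracket x y) v =
      slact x (slact y v) - (-1) ^+ (p && q) *: slact y (slact x v) }.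

Section Modules.
Variables (K : fieldType) (m n : nat) (V : slmodule K m n).

Definition is_submodule (W : set V) : Prop :=
  [/\ is_subspace W,
      forall x v, W v -> W (slact x v) &
      forall v, W v -> exists v0 v1,
        [/\ W v0 /\ slmod_part false v0, W v1 /\ slmod_part true v1
          & v = v0 + v1]].

Definition is_simple : Prop :=
  (exists v : V, v != 0) /\
  (forall W : set V, is_submodule W -> W = [set 0] \/ W = setT).

Definition is_hwvector (Lam : 'rV[K]_(m + n)) (v : V) : Prop :=
  [/\ v != 0,
      forall x, slnilp x -> slact x v = 0 &
      forall x, slcartan x -> slact x v = weight_eval Lam x *: v].

(* By simplicity, the highest weight vector generates V. *)
Definition is_simple_hw (Lam : 'rV[K]_(m + n)) : Prop :=
  is_simple /\ exists v, is_hwvector Lam v.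

(* U_k(g) W, where U_k(g) is spanned by the products of at most k elements   *)
(* of g.                                                                     *)
Definition Ufilt (k : nat) (W : set V) : set V :=
  lspan [set w | exists (xs : seq (slT K m n)) (v : V),
           [/\ (size xs <= k)%N, W v & w = foldr (@slact _ _ _ V) v xs]].

Definition fd_generating (W : set V) : Prop :=
  [/\ is_subspace W, findim W & \bigcup_k Ufilt k W = setT].

End Modules.

(** * Gelfand-Kirillov dimension *)

Definition growth_exponent (R : realType) (K : fieldType) (m n : nat)
    (V : slmodule K m n) (W : set V) : \bar R :=
  limn_esup (fun k => (ln (ldim (Ufilt k W))%:R / ln k%:R)%:E).

(* GKdim V = d; the value does not depend on the generating subspace. *)
Definition has_GKdim (R : realType) (K : fieldType) (m n : nat)
    (V : slmodule K m n) (d : \bar R) : Prop :=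
  (exists W : set V, fd_generating W) /\
  (forall W : set V, fd_generating W -> growth_exponent R W = d).

(** * Roots *)

(* The even positive roots e_a - e_b, where e = (eps_1,..,eps_m,             *)
(* del_1,..,del_n), indexed by the pairs (a, b).                             *)
Definition Delta0p (m n : nat) : {set 'I_(m + n) * 'I_(m + n)} :=
  [set p : 'I_(m + n) * 'I_(m + n) |
     (p.1 < p.2)%N && ((p.1 < m)%N == (p.2 < m)%N)]%SET.

Definition root_vec (K : fieldType) (m n : nat)
    (p : 'I_(m + n) * 'I_(m + n)) : 'rV[K]_(m + n) :=
  delta_mx 0 p.1 - delta_mx 0 p.2.

Definition rho0 (K : fieldType) (m n : nat) : 'rV[K]_(m + n) :=
  2^-1 *: \sum_(p in Delta0p m n) root_vec K p.

(** * Robinson-Schensted insertion *)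

Section Insertion.
Variable K : fieldType.
Implicit Types (a b : K) (r : seq K) (t : seq (seq K)).

Definition intdiff a b : bool := `[< exists k : int, b - a = k%:~R >].

Definition zlt a b : bool := `[< exists k : nat, b - a = k.+1%:R >].

(* The new row, and the entry bumped out of it, if any. *)
Fixpoint row_insert a r : seq K * option K :=
  if r is b :: r' then
    if zlt a b then (a :: r', Some b)
    else let: (r'', o) := row_insert a r' in (b :: r'', o)
  else ([:: a], None).

Fixpoint tab_insert a t : seq (seq K) :=
  if t is r :: t' then
    let: (r', o) := row_insert a r in
    if o is Some b then r' :: tab_insert b t' else r' :: t'
  else [:: [:: a]].

Definition RStab (x : seq K) : seq (seq K) :=
  foldl (fun t a => tab_insert a t) [::] x.

Definition col_length t (i : nat) : nat := count (fun r => (i < size r)%N) t.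

Definition Atab t : nat :=
  (\sum_(i < \max_(r <- t) size r)
     ((col_length t i * (col_length t i).-1) %/ 2))%N.

Definition int_related (d : nat) (x : 'rV[K]_d) (J : {set 'I_d}) : bool :=
  [forall i in J, forall j in J, intdiff (x 0 i) (x 0 j)].

(* Subsequences are given by their sets of positions, and [enum] lists a     *)
(* set of positions increasingly.                                            *)
Definition RScoll (d : nat) (x : 'rV[K]_d) : seq (seq (seq K)) :=
  [seq RStab [seq x 0 i | i <- enum J]
     | J : {set 'I_d} <- enum {set 'I_d} & maxset (int_related x) J].

Definition Acoll (P : seq (seq (seq K))) : nat := (\sum_(t <- P) Atab t)%N.

End Insertion.

Section Collections.
Variables (K : fieldType) (m n : nat) (lam : 'rV[K]_m) (mu : 'rV[K]_n).

Definition Plambda := RScoll (lsubmx (row_mx lam mu + rho0 K m n)).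

Definition Pmu := RScoll (rsubmx (row_mx lam mu + rho0 K m n)).

Definition Plambdamu := Plambda ++ Pmu.

End Collections.

(* Main.v *)
Require Import Defs.
From HB Require Import structures.
From mathcomp Require Import all_boot all_order all_algebra.
From mathcomp Require Import all_classical all_reals all_analysis.
From mathcomp Require Import ring lra zify.

(** The supermodule [V] is generated by its simple top component [T], the module over the even part
generated by the highest weight vector, under the odd lowering operators. These anticommute and are
finite in number, so the filtration of [V] is larger than that of [T] by a bounded factor only
([super_filtration]). That [T] is simple follows from the simplicity of [V] by means of a central
element of the even part that counts odd lowering operators ([even_irr_gen]). Since [m <> n], the
identity matrix complements sl(m|n) in gl(m|n), and letting it act by a suitable scalar makes the
matrix units act ([gact]). The theorem is thus reduced to the growth of simple highest weight
modules of gl(m) + gl(n), and of the growth only the degree matters.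

This degree is found without computing any character. Write [Gle lam mu] when the simple module of
highest weight [mu] grows at most as fast as the one of highest weight [lam], up to rescaling, and
represent a weight by its word, with entries [lam p - p] (which differ from the entries of the
weight shifted by rho0 by a constant on each block). There are four moves.
- Two neighbours of a word may be exchanged when their difference is not a positive integer. This is
  seen by inverting the lowering operator [f] of the simple root and passing to the highest weight
  vector [f^c v] of the localization, for a complex number [c] ([Gle_swap]).
- If the exchange is an elementary Knuth transformation, then it may be undone. A singular vector for
  this is constructed by hand in a localization at the adjacent simple root ([Gle_knuth]).
- A dominant integral weight may be added, by tensoring with exterior powers of the natural module
  ([Gle_om], [Gx_dom]).
- It may also be subtracted when the Casimir operator separates the weights that occur in the tensor
  product, which must then be irreducible ([Gle_om_inv], [Gx_flat]).

The first two moves show that the growth only depends on the insertion tableaux of the integrality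
classes of the word: a word is equivalent to the concatenation of the row words of its tableaux, and
a row word is equivalent to the concatenation of the columns ([RScoll_columns]).

For the upper bound the columns are replaced, with the third move, by columns with gaps one. Then the
lowering operators inside a column kill the highest weight vector, and the ordered monomials in the
others span the module ([Upper_columns]). Their number is the number of positive roots diminished by
the number of pairs of positions in the same column, which is the claimed dimension.

For the lower bound the fourth move makes the rows of the tableaux constant. Now the columns have gaps
one from the beginning, and since in a flat tableau they may also be read from right to left, they
can be ordered by increasing averages ([RScoll_flat]). For such a word the parabolic Verma module of
the columns is irreducible, because a singular vector would violate a comparison of Casimir values.
By the theorem of Poincare, Birkhoff and Witt it is free over the lowering operators outside the
columns, and so it attains the upper bound ([Lower_columns]). *)

Set Implicit Arguments.
Unset Strict Implicit.
Unset Printing Implicit Defensive.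

Import Order.TTheory GRing.Theory Num.Theory.
Local Open Scope ring_scope.

(** * Linear identities in a module *)

(** Identities between linear combinations of vectors are proved by reflection: both sides are
reified over their atoms, and [lmod_with] leaves the equalities of the coefficients, which [ring]
then proves. *)

Section LinearExpressions.
Variables (K : fieldType) (M : lmodType K).

Inductive lexp : Type :=
  | LAtom of nat | LZero | LAdd of lexp & lexp | LOpp of lexp
  | LScale of K & lexp.

Fixpoint leval (s : seq M) (e : lexp) : M :=
  match e with
  | LAtom i => nth 0 s i
  | LZero => 0
  | LAdd a b => leval s a + leval s b
  | LOpp a => - leval s a
  | LScale k a => k *: leval s a
  end.

Fixpoint lcoef (i : nat) (e : lexp) : K :=
  match e with
  | LAtom j => if eqn i j then 1 else 0
  | LZero => 0
  | LAdd a b => lcoef i a + lcoef i b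
  | LOpp a => - lcoef i a
  | LScale k a => k * lcoef i a
  end.

Fixpoint lsame (n : nat) (a b : lexp) : Prop :=
  match n with
  | 0 => True
  | n'.+1 => lcoef n' a = lcoef n' b /\ lsame n' a b
  end.

Lemma lsameP n a b : lsame n a b -> forall i, (i < n)%N -> lcoef i a = lcoef i b.
Proof.
elim: n => [//|n IH] /= [h1 /IH h2] i; rewrite ltnS leq_eqVlt => /orP[/eqP->//|].
exact: h2.
Qed.

Lemma levalE s e : leval s e = \sum_(i < size s) lcoef i e *: s`_i.
Proof.
elim: e => [j| |a IHa b IHb|a IH|k a IH] /=.
- case: (ltnP j (size s)) => hj.
    rewrite (bigD1 (Ordinal hj)) //= (introT eqnP erefl) scale1r.
    rewrite big1 ?addr0 // => i ij.
    case E: (eqn i j); last by rewrite scale0r.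
    by move/eqnP in E; case/eqP: ij; apply/val_inj.
  rewrite nth_default // big1 // => i _.
  case E: (eqn i j); last by rewrite scale0r.
  by move/eqnP: E (ltn_ord i) => ->; rewrite ltnNge hj.
- by rewrite big1 // => i _; rewrite scale0r.
- by rewrite IHa IHb -big_split /=; apply: eq_bigr => i _; rewrite scalerDl.
- by rewrite IH -sumrN; apply: eq_bigr => i _; rewrite scaleNr.
- by rewrite IH scaler_sumr; apply: eq_bigr => i _; rewrite scalerA.
Qed.

Lemma leval_eq s a b : lsame (size s) a b -> leval s a = leval s b.
Proof.
by move=> /lsameP h; rewrite !levalE; apply: eq_bigr => i _; rewrite h.
Qed.

End LinearExpressions.

Ltac lsame_atom x y :=
  match constr:(tt) with
  | _ => let _ := match constr:(tt) with _ => constr_eq x y end in constr:(true)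
  | _ => let _ := constr:(@Logic.eq_refl _ x : x = y) in constr:(true)
  | _ => constr:(false)
  end.
Ltac lmem x s :=
  match s with
  | nil => constr:(false)
  | ?y :: ?s' => let b := lsame_atom x y in
     match b with true => constr:(true) | false => lmem x s' end
  end.
Ltac lindex x s :=
  match s with
  | ?y :: ?s' => let b := lsame_atom x y in
     match b with true => constr:(0%N) | false => let i := lindex x s' in constr:(i.+1) end
  end.
Ltac latoms s e :=
  match e with
  | (?a + ?b)%R => let s1 := latoms s a in latoms s1 b
  | (- ?a)%R => latoms s a
  | (?k *: ?a)%R => latoms s a
  | 0%R => s
  | _ => match lmem e s with true => s | false => constr:(e :: s) end
  end.
Ltac lreify K s e :=
  match e with
  | (?a + ?b)%R =>
     let a' := lreify K s a in let b' := lreify K s b in constr:(LAdd a' b')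
  | (- ?a)%R => let a' := lreify K s a in constr:(LOpp a')
  | (?k *: ?a)%R => let a' := lreify K s a in constr:(LScale k a')
  | 0%R => constr:(@LZero K)
  | _ => let i := lindex e s in constr:(@LAtom K i)
  end.
Ltac lmod_split :=
  cbn [lsame lcoef eqn size seq.size]; repeat (match goal with |- _ /\ _ => split | |- True => exact I end).
Ltac lmod_with K M :=
  match goal with
  | |- @eq _ ?a ?b =>
    let s0 := latoms (@nil M) a in
    let s := latoms s0 b in
    let a' := lreify K s a in
    let b' := lreify K s b in
    change (@leval K M s a' = @leval K M s b');
    apply: leval_eq; lmod_split
  end.

(** * Dimension modulo a subspace *)

Lemma prop_eq (T : Type) (P : T -> Prop) x y : x = y -> P y -> P x.
Proof. by move=> ->. Qed.


Section Subspaces.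
Variables (K : fieldType) (M : lmodType K).
Implicit Types (N P : M -> Prop).
Local Ltac lmod := lmod_with K M.

Inductive span (G : M -> Prop) : M -> Prop :=
  | span0 : span G 0
  | spanS k g m : G g -> span G m -> span G (k *: g + m).

Lemma span_gen (G : M -> Prop) g : G g -> span G g.
Proof.
by move=> Gg; rewrite -[g]addr0 -[g]scale1r; apply: spanS => //; apply: span0.
Qed.

Lemma spanP (G : M -> Prop) : is_subspace (span G).
Proof.
split; first exact: span0.
move=> a u v Hu Hv; elim: Hu => [|k g m Gg _ IH]; first by rewrite scaler0 add0r.
have -> : a *: (k *: g + m) + v = (a * k) *: g + (a *: m + v) by lmod; ring.
exact: spanS.
Qed.

Lemma span_min (G : M -> Prop) P :
  is_subspace P -> (forall g, G g -> P g) -> forall m, span G m -> P m.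
Proof.
move=> [P0 PS] GP m; elim=> [//|k g m' Gg _ IH]; exact: PS (GP _ Gg) IH.
Qed.

Section Closure.
Variables (N : M -> Prop) (sN : is_subspace N).

Lemma sub0 : N 0. Proof. by case: sN. Qed.
Lemma subZ a u : N u -> N (a *: u).
Proof. by move=> Nu; rewrite -[_ *: _]addr0; apply: sN.2 => //; exact: sub0. Qed.
Lemma subD u v : N u -> N v -> N (u + v).
Proof. by move=> Nu Nv; rewrite -[u]scale1r; apply: sN.2. Qed.
Lemma subN u : N u -> N (- u).
Proof. by move=> Nu; rewrite -scaleN1r; apply: subZ. Qed.
Lemma subB u v : N u -> N v -> N (u - v).
Proof. by move=> Nu Nv; apply: subD => //; apply: subN. Qed.
Lemma subZ_inv a u : a != 0 -> N (a *: u) -> N u.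
Proof. by move=> a0 /(@subZ a^-1); rewrite scalerA mulVf // scale1r. Qed.
Lemma sub_sum (I : Type) (r : seq I) (Q : pred I) (F : I -> M) :
  (forall i, Q i -> N (F i)) -> N (\sum_(i <- r | Q i) F i).
Proof. by move=> H; apply: big_ind => //; [exact: sub0|exact: subD]. Qed.
Lemma sub_trans u v w : N (u - v) -> N (v - w) -> N (u - w).
Proof. by move=> h1 h2; rewrite -(subrK v u) -addrA; apply: subD. Qed.
Lemma sub_sym u v : N (u - v) -> N (v - u).
Proof. by move=> h; rewrite -opprB; apply: subN. Qed.
Lemma sub_mem u v : N (u - v) -> N v -> N u.
Proof. by move=> h hv; rewrite -(subrK v u); apply: subD. Qed.
Lemma sub_congr u v : N (u - v) -> N u -> N v.
Proof. by move=> h; apply: sub_mem; apply: sub_sym. Qed.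
End Closure.

(** The image of [P] in the quotient by [N] has dimension at most [d]. In this form a bound makes
sense for subsets that are not finite-dimensional, and quotient modules are never formed. *)
Definition dle N P (d : nat) : Prop :=
  forall u : 'I_d.+1 -> M, (forall i, P (u i)) ->
  exists2 c : 'I_d.+1 -> K, (exists i, c i != 0) & N (\sum_i c i *: u i).

Lemma dle_basis N P d : is_subspace N -> is_subspace P -> dle N P d ->
  exists2 b : 'I_d -> M, (forall i, P (b i)) &
    forall m, P m -> exists c : 'I_d -> K, N (m - \sum_i c i *: b i).
Proof.
move=> sN sP; elim: d => [|d IH] h.
  exists (fun _ => 0); first by case.
  move=> m Pm.
  exists (fun _ => 0); rewrite big_ord0 subr0.
  have [c [i]] := h (fun _ => m) (fun _ => Pm).
  by rewrite big_ord1 ord1 => c0 /(subZ_inv sN c0).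
case: (pselect (dle N P d)) => [/IH[b Pb hb]|].
  exists (fun i => if unlift ord_max i is Some j then b j else 0); [move=> i|move=> m Pm].
    by case: unliftP => [j|] _ //; exact: sub0.
  have [c hc] := hb m Pm.
  exists (fun i => if unlift ord_max i is Some j then c j else 0).
  rewrite big_ord_recr /= unlift_none scaler0 addr0.
  rewrite (eq_bigr (fun i => c i *: b i)) // => i _.
  have -> : widen_ord (leqnSn d) i = lift ord_max i.
    by apply/val_inj; rewrite /= /bump leqNgt ltn_ord.
  by rewrite liftK.
move=> /existsNP[u /not_implyP[Pu nu]].
exists u => // m Pm.
have [c [i ci] hc] := h (fun i => if unlift ord0 i is Some j then u j else m)
  (fun i => match unlift ord0 i as o return P (if o is Some j then u j else m) with
            Some j => Pu j | None => Pm end).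
move: hc; rewrite big_ord_recl unlift_none /=.
under eq_bigr do rewrite liftK.
have [c0|c0 hc] := eqVneq (c ord0) 0.
  rewrite c0 scale0r add0r => hc; case: nu.
  exists (fun j => c (lift ord0 j)) => //.
  case: (unliftP ord0 i) ci => [j ->|->]; last by rewrite c0 eqxx.
  by exists j.
exists (fun j => - (c ord0)^-1 * c (lift ord0 j)).
apply: (subZ_inv sN c0); rewrite scalerBr scaler_sumr -sumrN.
under eq_bigr => j _ do
  rewrite scalerA mulrA mulrN divff // mulN1r scaleNr opprK.
exact: hc.
Qed.

Lemma dep_exists (I J : finType) (C : I -> J -> K) : (#|J| < #|I|)%N ->
  exists2 c : I -> K, (exists i, c i != 0) & forall j, \sum_i c i * C i j = 0.
Proof.
move=> lt; pose A := \matrix_(i < #|I|, j < #|J|) C (enum_val i) (enum_val j).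
have : kermx A != 0.
  rewrite -mxrank_eq0 mxrank_ker subn_eq0 -ltnNge.
  exact: leq_ltn_trans (rank_leq_col A) lt.
case/rowV0Pn => r /sub_kermxP rA /rV0Pn[i ri].
exists (fun i => r 0 (enum_rank i)) => [|j].
  by exists (enum_val i); rewrite enum_valK.
have := congr1 (fun M : 'rV_#|J| => M 0 (enum_rank j)) rA.
rewrite !mxE => {2}<-.
rewrite (reindex (@enum_val I predT)) /=; last exact/onW_bij/enum_val_bij.
by apply: eq_bigr => k _; rewrite mxE !enum_rankK enum_valK.
Qed.

Lemma span_dle (T : finType) N P (b : T -> M) d : is_subspace N -> (#|T| <= d)%N ->
  (forall m, P m -> exists c : T -> K, N (m - \sum_t c t *: b t)) ->
  dle N P d.
Proof.
move=> sN le h u Pu.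
pose C i := cid (h _ (Pu i)).
have [|c c0 hc] := @dep_exists _ T (fun i => sval (C i)); first by rewrite card_ord.
exists c => //.
have : N (\sum_i c i *: (u i - \sum_t sval (C i) t *: b t)).
  by apply: sub_sum => // i _; apply: subZ => //; exact: svalP (C i).
apply: sub_congr => //.
under eq_bigr do rewrite scalerBr.
rewrite sumrB addrC addKr.
under eq_bigr do rewrite scaler_sumr.
rewrite exchange_big /= big1 ?oppr0 //; first exact: sub0.
move=> t _; under eq_bigr do rewrite scalerA.
by rewrite -scaler_suml hc scale0r.
Qed.

Lemma dle_mono N P P' d d' : is_subspace N -> is_subspace P ->
  (forall m, P' m -> P m) -> (d <= d')%N -> dle N P d -> dle N P' d'.
Proof.
move=> sN sP PP dd /(dle_basis sN sP)[b Pb hb].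
by apply: (span_dle (b := b)) => // [|m /PP/hb//]; rewrite card_ord.
Qed.

End Subspaces.

(** A subspace that finitely many linear maps embed jointly has dimension at most the number of
maps times the dimension of their target. *)
Lemma dle_embed (K : fieldType) (M M' : lmodType K) (T : finType)
    (N Q : M -> Prop) (N' P : M' -> Prop) (ev : T -> M' -> M) d :
  is_subspace N -> is_subspace Q -> is_subspace P ->
  (forall t, linear (ev t)) ->
  (forall m, P m -> forall t, Q (ev t m)) ->
  (forall m, P m -> (forall t, N (ev t m)) -> N' m) ->
  dle N Q d -> dle N' P (#|T| * d).
Proof.
move=> sN sQ sP lin PQ inj /(dle_basis sN sQ)[b Qb hb] u Pu.
pose C i (p : T * 'I_d) : K := sval (cid (hb _ (PQ _ (Pu i) p.1))) p.2.
have [|c c0 hc] := @dep_exists K _ _ C; first by rewrite card_prod !card_ord.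
exists c => //; apply: inj => [|t].
  by apply: sub_sum => // i _; apply: subZ.
have -> : ev t (\sum_i c i *: u i) = \sum_i c i *: ev t (u i).
  have ev0 : ev t 0 = 0.
    by have := lin t (-1) 0 0; rewrite scaler0 addr0 scaleN1r addNr.
  elim/big_rec2: _ => [//|i y1 y2 _ <-]; exact: lin.
have : N (\sum_i c i *: (ev t (u i) - \sum_j C i (t, j) *: b j)).
  apply: sub_sum => // i _; apply: subZ => //; rewrite /C /=.
  by case: cid.
apply: sub_congr => //.
under eq_bigr do rewrite scalerBr.
rewrite sumrB addrC addKr.
under eq_bigr do rewrite scaler_sumr.
rewrite exchange_big /= big1 ?oppr0 //; first exact: sub0.
move=> j _; under eq_bigr do rewrite scalerA.
by rewrite -scaler_suml hc scale0r.
Qed.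

(** A subspace covered by finitely many linear images satisfies the bound of [dle_embed]. *)
Lemma dle_cover (K : fieldType) (M M' : lmodType K) (T : finType)
    (N P : M -> Prop) (N' Q : M' -> Prop) (pr : T -> M' -> M) d :
  is_subspace N -> is_subspace N' -> is_subspace Q ->
  (forall t, linear (pr t)) ->
  (forall t m, N' m -> N (pr t m)) ->
  (forall m, P m -> exists2 q : T -> M', (forall t, Q (q t)) &
     N (m - \sum_t pr t (q t))) ->
  dle N' Q d -> dle N P (#|T| * d).
Proof.
move=> sN sN' sQ lin prN cov /(dle_basis sN' sQ)[b Qb hb].
apply: (@span_dle _ _ _ _ _ (fun p : T * 'I_d => pr p.1 (b p.2))) => //.
  by rewrite card_prod card_ord.
move=> m /cov[q Qq hq].
exists (fun p => sval (cid (hb _ (Qq p.1))) p.2).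
apply: sub_trans hq _ => //.
rewrite -(pair_bigA _ (fun t j => sval (cid (hb _ (Qq t))) j *: pr t (b j))) /=.
rewrite -sumrB; apply: sub_sum => // t _; case: cid => c /= hc.
have /= := prN t _ hc.
have pr0 : pr t 0 = 0.
  by have := lin t (-1) 0 0; rewrite scaler0 addr0 scaleN1r addNr.
have -> : pr t (q t - \sum_i c i *: b i) = pr t (q t) - \sum_i c i *: pr t (b i).
  have -> : pr t (q t - \sum_i c i *: b i) = pr t (- 1 *: (\sum_i c i *: b i) + q t).
    by rewrite scaleN1r addrC.
  rewrite lin scaleN1r addrC; congr (_ - _).
  elim/big_rec2: _ => [//|i y1 y2 _ <-]; exact: lin.
by [].
Qed.

(** * Highest weight modules over a block diagonal Lie algebra *)

(** The Lie algebra is spanned by the matrix units whose row and column lie in the same block, the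
block of [p < n] being [bl p]. A highest weight module is a representation [hE] with a submodule
[hN] and a vector [hv] that is singular modulo [hN]; the module that is meant is the submodule of
the quotient by [hN] generated by [hv]. Changing [hN] thus passes to quotients, and different
quotients of one representation can be compared without transport. *)

Section Representations.
Variables (K : numFieldType) (n : nat) (bl : nat -> nat).

Definition okp (p q : nat) : bool := [&& (p < n)%N, (q < n)%N & bl p == bl q].

Lemma okpC p q : okp p q = okp q p.
Proof. by rewrite /okp andbCA eq_sym. Qed.

Lemma okp_trans q p r : okp p q -> okp q r -> okp p r.
Proof.
by rewrite /okp => /and3P[-> h /eqP->] /and3P[_ -> /eqP->]; rewrite eqxx.
Qed.

Lemma okpp p : okp p p = (p < n)%N.
Proof. by rewrite /okp eqxx andbT andbb. Qed.

Lemma okp_l p q : okp p q -> (p < n)%N.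
Proof. by case/and3P. Qed.

Lemma okp_r p q : okp p q -> (q < n)%N.
Proof. by case/and3P. Qed.

Record rep (M : lmodType K) := Rep {
  op :> nat -> nat -> M -> M;
  op_lin : forall p q, linear (op p q);
  op_rel : forall p q r s, okp p q -> okp r s -> forall m,
    op p q (op r s m) =
      op r s (op p q m) + ((q == r)%:R *: op p s m - (s == p)%:R *: op r q m) }.

Section OneModule.
Variables (M : lmodType K) (E : rep M).
Local Ltac lmod := lmod_with K M.
Implicit Types (m : M) (N : M -> Prop) (w : seq (nat * nat)).

Lemma opD p q a b : E p q (a + b) = E p q a + E p q b.
Proof. by have := op_lin E p q 1 a b; rewrite !scale1r. Qed.
Lemma op0 p q : E p q 0 = 0.
Proof. by have := op_lin E p q (-1) 0 0; rewrite scaler0 addr0 scaleN1r addNr. Qed.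
Lemma opZ p q k a : E p q (k *: a) = k *: E p q a.
Proof. by have := op_lin E p q k a 0; rewrite op0 !addr0. Qed.
Lemma opN p q a : E p q (- a) = - E p q a.
Proof. by rewrite -scaleN1r opZ scaleN1r. Qed.
Lemma opB p q a b : E p q (a - b) = E p q a - E p q b.
Proof. by rewrite opD opN. Qed.
Lemma op_sum p q (I : Type) (r : seq I) (Q : pred I) (F : I -> M) :
  E p q (\sum_(i <- r | Q i) F i) = \sum_(i <- r | Q i) E p q (F i).
Proof. by apply: big_morph; [exact: opD|exact: op0]. Qed.
Definition opE := (opD, opB, opN, opZ, op0).

Definition submod N : Prop :=
  is_subspace N /\ forall p q, okp p q -> forall m, N m -> N (E p q m).

Definition act w m : M := foldr (fun a x => E a.1 a.2 x) m w.

Definition okw w := all (fun a => okp a.1 a.2) w.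
Definition low w := all (fun a => okp a.1 a.2 && (a.2 < a.1)%N) w.

Lemma low_okw w : low w -> okw w.
Proof. by apply: sub_all => a /andP[]. Qed.

Lemma act_lin w : linear (act w).
Proof. by move=> k a b; elim: w => //= x w ->; rewrite opD opZ. Qed.

Lemma act0 w : act w 0 = 0.
Proof. by elim: w => //= a w ->; rewrite op0. Qed.

Lemma actZ w k m : act w (k *: m) = k *: act w m.
Proof. by have := act_lin w k m 0; rewrite act0 !addr0. Qed.

Lemma actD w a b : act w (a + b) = act w a + act w b.
Proof. by have := act_lin w 1 a b; rewrite !scale1r. Qed.

Lemma act_cat w1 w2 m : act (w1 ++ w2) m = act w1 (act w2 m).
Proof. by rewrite /act foldr_cat. Qed.

Lemma act_sub N w m : submod N -> okw w -> N m -> N (act w m).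
Proof.
by move=> [_ sN]; elim: w => //= a w IH /andP[ha hw] Nm; apply: sN => //; apply: IH.
Qed.

Definition comb (t : seq (K * seq (nat * nat))) m : M :=
  \sum_(a <- t) a.1 *: act a.2 m.

Lemma comb_cat t1 t2 m : comb (t1 ++ t2) m = comb t1 m + comb t2 m.
Proof. by rewrite /comb big_cat. Qed.

Lemma comb1 k w m : comb [:: (k, w)] m = k *: act w m.
Proof. by rewrite /comb big_seq1. Qed.

Lemma comb_nil m : comb [::] m = 0.
Proof. by rewrite /comb big_nil. Qed.

Lemma comb_scale k t m : comb [seq (k * a.1, a.2) | a <- t] m = k *: comb t m.
Proof.
rewrite /comb big_map scaler_sumr; apply: eq_bigr => a _ /=.
by rewrite scalerA.
Qed.

Lemma comb_act w t m : comb [seq (a.1, w ++ a.2) | a <- t] m = act w (comb t m).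
Proof.
rewrite /comb big_map.
elim: t => [|a t IH]; first by rewrite !big_nil; have := act_lin w (-1) 0 0;
  rewrite scaler0 addr0 scaleN1r addNr.
by rewrite !big_cons IH /= act_cat act_lin.
Qed.

Definition ccomp (s t : seq (K * seq (nat * nat))) :=
  flatten [seq [seq (b.1 * a.1, a.2) | a <- [seq (a.1, b.2 ++ a.2) | a <- t]] | b <- s].

Lemma comb_ccomp s t m : comb (ccomp s t) m = comb s (comb t m).
Proof.
rewrite /ccomp; elim: s => [|b s IH] /=; first by rewrite !comb_nil.
by rewrite comb_cat IH comb_scale comb_act [RHS]/comb big_cons.
Qed.

Lemma ccomp_all (P : seq (nat * nat) -> bool) s t :
  (forall b a, b \in s -> a \in t -> P (b.2 ++ a.2)) -> all (fun a => P a.2) (ccomp s t).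
Proof.
move=> h; apply/allP => a /flatten_mapP[b hb /mapP[a' /mapP[a'' ha -> ->]]] /=.
exact: h.
Qed.

Lemma comb_lin t : linear (comb t).
Proof.
move=> k a b; rewrite /comb scaler_sumr -big_split /=; apply: eq_bigr => x _.
by rewrite act_lin scalerDr !scalerA mulrC.
Qed.

Lemma comb_sub N t m : submod N -> all (fun a => okw a.2) t -> N m -> N (comb t m).
Proof.
move=> sN /allP h Nm; rewrite /comb big_seq; apply: sub_sum; first exact: sN.1.
by move=> a /h ha; apply: subZ; [exact: sN.1|exact: act_sub].
Qed.

Definition gen m (u : M) : Prop :=
  exists2 t, all (fun a => okw a.2) t & u = comb t m.

Lemma gen_refl m : gen m m.
Proof. by exists [:: (1, [::])] => //; rewrite comb1 scale1r. Qed.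

Lemma gen_subspace m : is_subspace (gen m).
Proof.
split; first by exists [::] => //; rewrite comb_nil.
move=> k _ _ [t1 h1 ->] [t2 h2 ->].
exists ([seq (k * a.1, a.2) | a <- t1] ++ t2); last by rewrite comb_cat comb_scale.
by rewrite all_cat h2 andbT all_map.
Qed.

Lemma gen_submod m : submod (gen m).
Proof.
split; first exact: gen_subspace.
move=> p q h _ [t ht ->]; exists [seq (a.1, [:: (p, q)] ++ a.2) | a <- t].
  by rewrite all_map; apply: sub_all ht => a /=; rewrite h.
by rewrite comb_act.
Qed.

Lemma gen_min N m u : submod N -> N m -> gen m u -> N u.
Proof. by move=> sN Nm [t ht ->]; apply: comb_sub. Qed.

Definition genN N m (u : M) : Prop := exists2 x, gen m x & N (u - x).

Lemma genN_submod N m : submod N -> submod (genN N m).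
Proof.
move=> [sN EN]; split.
  split; first by exists 0; [exact: sub0 (gen_subspace m)|rewrite subrr; exact: sub0].
  move=> k a b [x gx hx] [y gy hy]; exists (k *: x + y).
    by apply: (gen_subspace m).2.
  have -> : k *: a + b - (k *: x + y) = k *: (a - x) + (b - y) by lmod; ring.
  exact: sN.2.
move=> p q h u [x gx hx]; exists (E p q x); first exact: (gen_submod m).2.
by rewrite -opB; apply: EN.
Qed.

Lemma genN_N N m u : submod N -> N u -> genN N m u.
Proof.
move=> sN Nu; exists 0; first exact: sub0 (gen_subspace m).
by rewrite subr0.
Qed.

Lemma genN_gen N m u : submod N -> gen m u -> genN N m u.
Proof. by move=> sN gu; exists u => //; rewrite subrr; exact: sub0 sN.1. Qed.

Definition lowc (k : nat) (t : seq (K * seq (nat * nat))) :=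
  all (fun a => low a.2 && (size a.2 <= k)%N) t.

Lemma lowc_okc k t : lowc k t -> all (fun a => okw a.2) t.
Proof. by apply: sub_all => a /andP[/low_okw]. Qed.

Lemma lowc_mono k k' t : (k <= k')%N -> lowc k t -> lowc k' t.
Proof.
by move=> h; apply: sub_all => a /andP[-> h']; rewrite (leq_trans h').
Qed.

Lemma lowc_scale k c t : lowc k t -> lowc k [seq (c * a.1, a.2) | a <- t].
Proof. by rewrite /lowc all_map. Qed.

Lemma lowc_cat k t1 t2 : lowc k (t1 ++ t2) = lowc k t1 && lowc k t2.
Proof. exact: all_cat. Qed.

(** The filtration whose growth is studied. Lowering operators suffice to define it because
raising and diagonal operators do not leave it, by [reduce_op]. *)
Definition Bk v k (u : M) : Prop := exists2 t, lowc k t & u = comb t v.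

Lemma Bk_subspace v k : is_subspace (Bk v k).
Proof.
split; first by exists [::] => //; rewrite comb_nil.
move=> c _ _ [t1 h1 ->] [t2 h2 ->].
exists ([seq (c * a.1, a.2) | a <- t1] ++ t2); last by rewrite comb_cat comb_scale.
by rewrite /lowc all_cat all_map; apply/andP.
Qed.

Lemma Bk_mono v k k' u : (k <= k')%N -> Bk v k u -> Bk v k' u.
Proof. by move=> h [t ht ->]; exists t => //; apply: lowc_mono ht. Qed.

Lemma Bk_gen v k u : Bk v k u -> gen v u.
Proof. by case=> t /lowc_okc ht ->; exists t. Qed.

Lemma Bk_act v k w : low w -> (size w <= k)%N -> Bk v k (act w v).
Proof.
by move=> h1 h2; exists [:: (1, w)]; rewrite ?comb1 ?scale1r //= h1 h2.
Qed.

Lemma Bk_op v k p q u : okp p q -> (q < p)%N -> Bk v k u -> Bk v k.+1 (E p q u).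
Proof.
move=> h lt [t ht ->]; exists [seq (a.1, [:: (p, q)] ++ a.2) | a <- t].
  by rewrite /lowc all_map; apply: sub_all ht => a /=; rewrite h lt.
by rewrite comb_act.
Qed.

Definition ishw N v (lam : nat -> K) : Prop :=
  [/\ submod N, ~ N v,
      forall p q, okp p q -> (p < q)%N -> N (E p q v) &
      forall p, (p < n)%N -> N (E p p v - lam p *: v)].

End OneModule.

Record hwm (lam : nat -> K) := Hwm {
  hM : lmodType K; hE : rep hM; hN : hM -> Prop; hv : hM;
  hP : ishw hE hN hv lam }.

Definition hcomb lam (A : hwm lam) t := comb (hE A) t (hv A).

Section HwmBasics.
Variables (lam : nat -> K) (A : hwm lam).
Lemma hsub : submod (hE A) (@hN _ A). Proof. by case: (hP A). Qed.
Lemma hss : is_subspace (@hN _ A). Proof. by case: hsub. Qed.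
Lemma hvN : ~ hN (hv A). Proof. by case: (hP A). Qed.
Lemma hraise p q : okp p q -> (p < q)%N -> hN (hE A p q (hv A)).
Proof. by case: (hP A) => _ _ h _; exact: h. Qed.
Lemma hdiag p : (p < n)%N -> hN (hE A p p (hv A) - lam p *: hv A).
Proof. by case: (hP A) => _ _ _ h; exact: h. Qed.
End HwmBasics.

(** The rewriting only uses the commutation relations and the highest weight, so it is the same in
all highest weight modules with the weight [lam]. *)
Lemma reduce_op lam w p q : low w -> okp p q ->
  exists2 t, lowc (size w + (q < p)) t &
    forall A : hwm lam, hN (hE A p q (act (hE A) w (hv A)) - hcomb A t).
Proof.
elim: w p q => [|[a b] w IH] p q /=.
  move=> _ h; case: (ltngtP p q) => [lt|lt|e].
  - exists [::] => // A; rewrite /hcomb comb_nil subr0; exact: hraise.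
  - exists [:: (1, [:: (p, q)])]; first by rewrite /lowc /= h lt.
    move=> A; rewrite /hcomb comb1 scale1r subrr; exact: sub0 (hss A).
  - exists [:: (lam p, [::])] => // A; rewrite /hcomb comb1 /= -e.
    by apply: hdiag; exact: okp_l h.
move=> /andP[/andP[hab ltab] lw] h.
case: (ltnP q p) => ltqp.
  exists [:: (1, [:: (p, q), (a, b) & w])].
    by rewrite /lowc /= h ltqp hab ltab lw /= andbT addn1.
  move=> A; rewrite /hcomb comb1 scale1r subrr; exact: sub0 (hss A).
have [t1 l1 e1] := IH p q lw h.
have e0 : nat_of_bool (q < p)%N = 0%N by rewrite ltnNge ltqp.
have mono c t : (c <= 1)%N -> lowc (size w + c) t -> lowc (size w).+1 t.
  by move=> hc; apply: lowc_mono; rewrite -addn1 leq_add2l.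
have lowb (c : bool) : (c <= 1)%N by case: c.
have [t2 l2 e2] : exists2 t, lowc (size w).+1 t &
    forall A : hwm lam, hN ((q == a)%:R *: hE A p b (act (hE A) w (hv A)) - hcomb A t).
  case: eqP => [e|_]; last first.
    by exists [::] => // A; rewrite scale0r /hcomb comb_nil subrr; exact: sub0 (hss A).
  have [|t l2 e2] := IH p b lw; first by apply: okp_trans h _; rewrite e.
  exists t => [|A]; last by rewrite scale1r.
  exact: mono l2.
have [t3 l3 e3] : exists2 t, lowc (size w).+1 t &
    forall A : hwm lam, hN ((b == p)%:R *: hE A a q (act (hE A) w (hv A)) - hcomb A t).
  case: eqP => [e|_]; last first.
    by exists [::] => // A; rewrite scale0r /hcomb comb_nil subrr; exact: sub0 (hss A).
  have [|t l3 e3] := IH a q lw; first by apply: okp_trans hab _; rewrite e.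
  exists t => [|A]; last by rewrite scale1r.
  exact: mono l3.
exists ([seq (x.1, [:: (a, b)] ++ x.2) | x <- t1] ++
        (t2 ++ [seq (-1 * x.1, x.2) | x <- t3])).
  rewrite e0 addn0 in l1; rewrite /lowc !all_cat !all_map !addn0.
  apply/and3P; split => //.
  by move: l1; apply: sub_all => x /andP[/= ->]; rewrite hab ltab.
move=> A; rewrite /hcomb !comb_cat comb_act comb_scale op_rel //.
set x := act _ w _.
have -> : hE A a b (hE A p q x) + ((q == a)%:R *: hE A p b x - (b == p)%:R *: hE A a q x) -
   (act (hE A) [:: (a, b)] (comb (hE A) t1 (hv A)) +
    (comb (hE A) t2 (hv A) + -1 *: comb (hE A) t3 (hv A))) =
   hE A a b (hE A p q x - comb (hE A) t1 (hv A))
   + (((q == a)%:R *: hE A p b x - hcomb A t2) - ((b == p)%:R *: hE A a q x - hcomb A t3)).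
  rewrite opB /hcomb /=; lmod_with K (hM A); ring.
apply: subD; [exact: hss|by apply: (hsub A).2 => //; exact: e1|].
by apply: subB; [exact: hss|exact: e2|exact: e3].
Qed.

Lemma reduce_comb lam t k p q : lowc k t -> okp p q ->
  exists2 t', lowc (k + (q < p)) t' &
    forall A : hwm lam, hN (hE A p q (hcomb A t) - hcomb A t').
Proof.
move=> + h; elim: t => [|[c w] t IH] /=.
  by exists [::] => // A; rewrite /hcomb !comb_nil op0 subrr; exact: sub0 (hss A).
move=> /andP[/andP[/= lw sw] /IH[t1 l1 e1]].
have [t2 l2 e2] := reduce_op lam lw h.
exists ([seq (c * a.1, a.2) | a <- t2] ++ t1).
  rewrite lowc_cat l1 andbT; apply/lowc_scale/(lowc_mono _ l2).
  by rewrite leq_add2r.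
move=> A; rewrite /hcomb comb_cat comb_scale -cat1s comb_cat comb1 opD opZ.
set x := act _ w _; set y := comb _ t _; set z := comb _ t2 _; set u := comb _ t1 _.
have -> : c *: hE A p q x + hE A p q y - (c *: z + u) =
  c *: (hE A p q x - z) + (hE A p q y - u) by lmod_with K (hM A); ring.
apply: (hss A).2; [exact: e2|exact: e1].
Qed.

Lemma reduce_word lam w : okw w ->
  exists2 t, lowc (size w) t &
    forall A : hwm lam, hN (act (hE A) w (hv A) - hcomb A t).
Proof.
elim: w => [|[p q] w IH] /=.
  move=> _; exists [:: (1, [::])] => // A.
  by rewrite /hcomb comb1 scale1r subrr; exact: sub0 (hss A).
move=> /andP[h /IH[t l e]]; have [t' l' e'] := reduce_comb lam l h.
exists t' => [|A].
  by apply: lowc_mono l'; case: (q < p)%N; rewrite ?addn1 ?addn0.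
apply: sub_trans (e' A); first exact: hss.
by rewrite -opB; apply: (hsub A).2 => //; exact: e.
Qed.

Lemma reduce_all lam t : all (fun a => okw a.2) t ->
  exists k, exists2 t', lowc k t' & forall A : hwm lam, hN (hcomb A t - hcomb A t').
Proof.
elim: t => [_|[c w] t IH /= /andP[/(reduce_word lam)[t1 l1 e1] /IH[k [t2 l2 e2]]]].
  by exists 0%N, [::] => // A; rewrite subrr; exact: sub0 (hss A).
exists (maxn (size w) k), ([seq (c * a.1, a.2) | a <- t1] ++ t2).
  rewrite lowc_cat; apply/andP; split.
    by apply/lowc_scale/(lowc_mono _ l1); rewrite leq_maxl.
  by apply: (lowc_mono _ l2); rewrite leq_maxr.
move=> A; rewrite /hcomb comb_cat comb_scale -cat1s comb_cat comb1.
rewrite opprD addrACA -scalerBr.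
apply: (hss A).2; [exact: e1|exact: e2].
Qed.

Definition wt (w : seq (nat * nat)) (p : nat) : int :=
  \sum_(a <- w) ((a.1 == p)%:Z - (a.2 == p)%:Z).

Lemma wt_cons a w p : wt (a :: w) p = (a.1 == p)%:Z - (a.2 == p)%:Z + wt w p.
Proof. by rewrite /wt big_cons. Qed.

Lemma wt_nil p : wt [::] p = 0.
Proof. by rewrite /wt big_nil. Qed.

Lemma act_wt lam (A : hwm lam) w p : okw w -> (p < n)%N ->
  hN (hE A p p (act (hE A) w (hv A)) - (lam p + (wt w p)%:~R) *: act (hE A) w (hv A)).
Proof.
move=> + hp; elim: w => [_|[a b] w IH /= /andP[hab /IH{}IH]] /=.
  by rewrite wt_nil addr0; exact: hdiag.
rewrite op_rel ?okpp // wt_cons /=.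
set x := act _ w _ in IH *.
have e1 : (p == a)%:R *: hE A p b x = (a == p)%:R *: hE A a b x.
  by rewrite eq_sym; case: eqP => [->|]; rewrite ?scale0r.
have e2 : (b == p)%:R *: hE A a p x = (b == p)%:R *: hE A a b x.
  by case: eqP => [->|]; rewrite ?scale0r.
rewrite e1 e2.
have -> : hE A a b (hE A p p x) + ((a == p)%:R *: hE A a b x - (b == p)%:R *: hE A a b x)
  - (lam p + ((a == p)%:Z - (b == p)%:Z + wt w p)%:~R) *: hE A a b x =
  hE A a b (hE A p p x - (lam p + (wt w p)%:~R) *: x).
  rewrite opB opZ !(intrD, rmorphN) /=; lmod_with K (hM A); ring.
exact: (hsub A).2.
Qed.

Lemma height_wt w : low w ->
  \sum_(p < n) p%:Z * wt w p = \sum_(a <- w) (a.1%:Z - a.2%:Z).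
Proof.
elim: w => [_|[a b] w IH /= /andP[/andP[/and3P[ha hb _] _] /IH{}IH]].
  by rewrite big_nil big1 // => p _; rewrite wt_nil mulr0.
rewrite big_cons -IH /=.
under eq_bigr do rewrite wt_cons mulrDr mulrBr.
rewrite big_split sumrB /=; congr (_ - _ + _).
- rewrite (bigD1 (Ordinal ha)) //= eqxx mulr1 big1 ?addr0 // => i ij.
  rewrite (_ : (a == i) = false) ?mulr0 //; apply: contraNF ij => /eqP e.
  by apply/eqP/val_inj; rewrite /= e.
- rewrite (bigD1 (Ordinal hb)) //= eqxx mulr1 big1 ?addr0 // => i ij.
  rewrite (_ : (b == i) = false) ?mulr0 //; apply: contraNF ij => /eqP e.
  by apply/eqP/val_inj; rewrite /= e.
Qed.

Lemma low_wt w : low w -> w != [::] -> exists2 p, (p < n)%N & wt w p != 0.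
Proof.
move=> lw w0; apply: contrapT => h.
have : \sum_(p < n) p%:Z * wt w p = 0.
  rewrite big1 // => p _; case: (eqVneq (wt w p) 0) => [->|hp]; first by rewrite mulr0.
  by case: h; exists p.
rewrite height_wt //; case: w lw w0 {h} => // a w /= /andP[/andP[_ ha] lw] _ e.
have : (0 : int) <= \sum_(a <- w) (a.1%:Z - a.2%:Z).
  rewrite big_seq; apply: sumr_ge0 => b /(allP lw) /andP[_ hb].
  by rewrite subr_ge0 lez_nat ltnW.
move: e; rewrite big_cons; move: ha; rewrite -ltz_nat -subr_gt0.
by set x := _ - _; set S := \sum_(_ <- _) _; move=> x0 e S0; move: x0; rewrite -(addrK S x) e sub0r oppr_gt0 ltNge S0.
Qed.

(** Each summand whose weight differs from [lam] is killed by some [E p p - k p], which multiplies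
[s] by a nonzero scalar. *)
Lemma separate (M : lmodType K) (E : rep M) (P : M -> Prop) (lam : nat -> K)
    (s : M) (l : seq (M * (nat -> K))) :
  submod E P ->
  (forall p, (p < n)%N -> P (E p p s - lam p *: s)) ->
  (forall x, List.In x l -> forall p, (p < n)%N -> P (E p p x.1 - x.2 p *: x.1)) ->
  (forall x, List.In x l -> exists2 p, (p < n)%N & x.2 p != lam p) ->
  P (s + \sum_(x <- l) x.1) -> P s.
Proof.
move=> [sP EP]; have [b] := ubnP (size l).
elim: b l s => // b IH [|[x k] l] s /=; first by rewrite big_nil addr0.
rewrite ltnS => sl hs hx hk; rewrite big_cons /= => h.
have [p hp /= kp] := hk (x, k) (or_introl erefl).
have d0 : lam p - k p != 0 by rewrite subr_eq0 eq_sym.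
pose f (y : M * (nat -> K)) := ((y.2 p - k p) *: y.1, y.2).
have diagC q y : (q < n)%N -> E q q (E p p y) = E p p (E q q y).
  move=> hq; rewrite op_rel ?okpp //.
  have -> : (q == p)%:R *: E q p y = (p == q)%:R *: E p q y.
    by rewrite eq_sym; case: eqP => [->|_]; rewrite ?scale0r.
  by rewrite subrr addr0.
apply: (subZ_inv sP d0); apply: (IH [seq f y | y <- l]); first by rewrite size_map.
- move=> q hq; rewrite opZ scalerA mulrC -scalerA -scalerBr.
  by apply: subZ => //; exact: hs.
- move=> y' /List.in_map_iff[y [<- yl]] q hq.
  rewrite /= opZ scalerA mulrC -scalerA -scalerBr.
  by apply: subZ => //; apply: hx => //; right.
- by move=> y' /List.in_map_iff[y [<- yl]] /=; apply: hk; right.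
have h1 : P (E p p (s + (x + \sum_(y <- l) y.1)) - k p *: (s + (x + \sum_(y <- l) y.1))).
  by apply: subB => //; [apply: EP; rewrite ?okpp|apply: subZ].
have h2 : P (\sum_(y <- l) (E p p y.1 - y.2 p *: y.1)).
  have : forall y, List.In y l -> P (E p p y.1 - y.2 p *: y.1).
    by move=> y yl; apply: hx => //; right.
  elim: (l) => [|y l' IH'] H; first by rewrite big_nil; exact: sub0.
  rewrite big_cons; apply: subD => //; first by apply: H; left.
  by apply: IH' => z zl; apply: H; right.
have h3 := hs p hp; have h4 := hx _ (or_introl erefl) p hp.
rewrite big_map /=.
have -> : \sum_(y <- l) (y.2 p - k p) *: y.1 =
   E p p (\sum_(y <- l) y.1) - \sum_(y <- l) (E p p y.1 - y.2 p *: y.1)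
   - k p *: \sum_(y <- l) y.1.
  rewrite op_sum scaler_sumr -!sumrB; apply: eq_bigr => y _.
  by rewrite opprB addrCA subrr addr0 scalerBl.
move: h1 h2 h3 h4; rewrite !opD /=.
set S := \sum_(y <- l) y.1; set T := \sum_(y <- l) _ => h1 h2 h3 h4.
have -> : (lam p - k p) *: s + (E p p S - T - k p *: S) =
  (E p p s + (E p p x + E p p S) - k p *: (s + (x + S))) - T
  - (E p p s - lam p *: s) - (E p p x - k p *: x) by lmod_with K M; ring.
by do 3!apply: subB => //.
Qed.

Definition vac (t : seq (K * seq (nat * nat))) : K :=
  \sum_(a <- t | a.2 == [::]) a.1.

(** The empty word is the only lowering word of the highest weight, so a submodule containing a
combination with a nonzero constant term contains the highest weight vector. *)
Lemma vacP lam (A : hwm lam) (P : hM A -> Prop) k t : submod (hE A) P ->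
  (forall m, hN m -> P m) -> lowc k t -> P (hcomb A t) -> P (vac t *: hv A).
Proof.
move=> sP NP lt h.
have [sp _] := sP.
pose l := [seq (a.1 *: act (hE A) a.2 (hv A), fun p => lam p + (wt a.2 p)%:~R)
             | a <- t & a.2 != [::]].
apply: (@separate _ (hE A) P lam _ l) => //.
- move=> p hp; rewrite opZ scalerA mulrC -scalerA -scalerBr.
  by apply: subZ => //; apply: NP; exact: hdiag.
- move=> x /List.in_map_iff[a [<- /List.filter_In[ha /= _]]] p hp /=.
  rewrite opZ scalerA mulrC -scalerA -scalerBr.
  apply: subZ => //; apply: NP; apply: act_wt => //.
  move/allP: lt => /(_ a) /= h'; have /h' /andP[/low_okw //] : a \in t.
  by elim: (t) ha => //= b t' IH [->|/IH]; rewrite inE ?eqxx // => ->; rewrite orbT.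
- move=> x /List.in_map_iff[a [<- /List.filter_In[ha /= a0]]].
  have /(allP lt) /andP[la _] : a \in t.
    by elim: (t) ha => //= b t' IH [->|/IH]; rewrite inE ?eqxx // => ->; rewrite orbT.
  have [p hp wp] := low_wt la a0; exists p => //=.
  by rewrite -subr_eq0 addrAC subrr add0r intr_eq0.
have -> // : vac t *: hv A + \sum_(x <- l) x.1 = hcomb A t.
rewrite /hcomb /comb /vac [RHS](bigID (fun a : K * seq (nat * nat) => a.2 == [::])) /=.
rewrite scaler_suml big_map big_filter /=; congr (_ + _).
by apply: eq_bigr => a /eqP ->.
Qed.

Lemma vac0 lam (A : hwm lam) k t : lowc k t -> hN (hcomb A t) -> vac t = 0.
Proof.
move=> lt h; have := vacP (hsub A) (fun m h => h) lt h.
have [-> //|v0 /(subZ_inv (hss A) v0)] := eqVneq (vac t) 0; exact: (fun h => False_ind _ (hvN h)).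
Qed.

Lemma vac_cat t1 t2 : vac (t1 ++ t2) = vac t1 + vac t2.
Proof. by rewrite /vac big_cat. Qed.

Lemma vac_one : vac [:: (1, [::])] = 1.
Proof. by rewrite /vac big_cons big_nil addr0. Qed.

Lemma vac_scale k t : vac [seq (k * a.1, a.2) | a <- t] = k * vac t.
Proof. by rewrite /vac big_map /= mulr_sumr. Qed.

Lemma vac_uniq lam (A : hwm lam) k1 k2 t1 t2 : lowc k1 t1 -> lowc k2 t2 ->
  hN (hcomb A t1 - hcomb A t2) -> vac t1 = vac t2.
Proof.
move=> l1 l2 h; apply/eqP; rewrite -subr_eq0 -mulN1r -vac_scale -vac_cat; apply/eqP.
apply: (@vac0 _ A (maxn k1 k2)).
  rewrite lowc_cat (lowc_mono _ l1) ?leq_maxl //.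
  by apply/lowc_scale/(lowc_mono _ l2); rewrite leq_maxr.
by rewrite /hcomb comb_cat comb_scale scaleN1r.
Qed.

Lemma vac_ccomp s t : vac (ccomp s t) = vac s * vac t.
Proof.
rewrite /ccomp; elim: s => [|b s IH] /=; first by rewrite /vac !big_nil mul0r.
rewrite vac_cat IH vac_scale /vac big_cons big_map /=.
case: b => b [|x w] /=; first by rewrite mulrDl.
by rewrite big_pred0_eq mulr0 add0r.
Qed.

Definition irr lam (A : hwm lam) : Prop :=
  forall m, gen (hE A) (hv A) m -> ~ hN m ->
  exists2 u, gen (hE A) m u & hN (u - hv A).

Definition gle lam mu (A : hwm lam) (B : hwm mu) : Prop :=
  exists c, forall k d, dle (@hN _ A) (Bk (hE A) (hv A) (c * k + c)) d ->
    dle (@hN _ B) (Bk (hE B) (hv B) k) (c * d).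

Lemma gle_trans lam mu nu (A : hwm lam) (B : hwm mu) (C : hwm nu) :
  gle A B -> gle B C -> gle A C.
Proof.
move=> [c h] [c' h']; exists (c' * c + (c * c' + c))%N => k d hd.
have : dle (@hN _ C) (Bk (hE C) (hv C) k) (c' * (c * d)).
  apply/h'/h; apply: dle_mono hd => //; [exact: hss|exact: Bk_subspace|].
  by move=> m; apply: Bk_mono; nia.
apply: dle_mono => //; [exact: hss|exact: Bk_subspace|nia].
Qed.

Lemma gle_inj lam mu (A : hwm lam) (B : hwm mu) :
  (forall k t, lowc k t -> hN (hcomb A t) -> hN (hcomb B t)) -> gle A B.
Proof.
move=> h; exists 1%N => k d; rewrite !mul1n => hd u hu.
have /choice[t ht] : forall i, exists t, lowc k t /\ u i = hcomb B t.
  by move=> i; have [t] := hu i; exists t.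
have [|c c0 hc] := hd (fun i => hcomb A (t i)).
  by move=> i; exists (t i) => //; apply: lowc_mono (ht i).1; rewrite leq_addr.
exists c => //.
pose tt := flatten [seq [seq (c i * a.1, a.2) | a <- t i] | i <- enum 'I_d.+1].
have ett nu (D : hwm nu) : hcomb D tt = \sum_i c i *: hcomb D (t i).
  rewrite /tt -[RHS]big_enum /=; elim: (enum _) => [|i s IH] /=.
    by rewrite /hcomb comb_nil big_nil.
  by rewrite big_cons /hcomb comb_cat comb_scale; congr (_ + _).
under eq_bigr do rewrite (ht _).2.
rewrite -ett; apply: (h k); last by rewrite ett.
rewrite /tt /lowc; apply/allP => a /flatten_mapP[i _ /mapP[b hb ->]] /=.
exact: (allP (ht i).1) _ hb.
Qed.

Lemma gle_irr lam (A B : hwm lam) : irr B -> gle A B.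
Proof.
move=> iB; apply: gle_inj => k t lt hA; apply: contrapT => hB.
have [|u [s ok ->] hu] := iB (hcomb B t) _ hB.
  by exists t => //; exact: lowc_okc lt.
pose r := ccomp s t.
have er (D : hwm lam) : hcomb D r = comb (hE D) s (hcomb D t) by exact: comb_ccomp.
have okr : all (fun a => okw a.2) r.
  apply: ccomp_all => b a hb ha; rewrite /okw all_cat.
  by apply/andP; split; [exact: (allP ok) _ hb|exact: (allP (lowc_okc lt)) _ ha].
have [k' [t' l' e']] := reduce_all lam okr.
have : vac t' = 0.
  apply: (vac0 (A := A) l'); apply: sub_congr (e' A) _; first exact: hss.
  by rewrite er; apply: comb_sub => //; exact: hsub.
have -> : vac t' = vac [:: (1, [::])]; last by rewrite vac_one => /eqP; rewrite oner_eq0.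
apply: (vac_uniq (A := B) (k2 := 0) l') => //.
rewrite {2}/hcomb comb1 scale1r; apply: sub_trans hu; first exact: hss.
by apply: sub_sym; [exact: hss|rewrite -er; exact: e'].
Qed.

(** A singular vector generates a submodule of vectors with weights below its own; if this
submodule is everything, then it contains the highest weight vector. *)
Lemma irr_singular lam kap (A : hwm lam) a p : irr A -> gen (hE A) (hv A) a ->
  (forall p q, okp p q -> (p < q)%N -> hN (hE A p q a)) ->
  (forall p, (p < n)%N -> hN (hE A p p a - kap p *: a)) ->
  (p < n)%N -> kap p != lam p -> hN a.
Proof.
move=> iA ga up dg pn kp; apply: contrapT => Na.
have hwa : ishw (hE A) (@hN _ A) a kap by split => //; exact: hsub.
have [s ok ea] := ga; have [k [t lt et]] := reduce_all lam ok.
have {}et : hN (a - hcomb A t) by rewrite ea; exact: et.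
have vt : vac t = 0.
  pose t' := [seq ((lam p + (wt x.2 p)%:~R - kap p) * x.1, x.2) | x <- t].
  have lt' : lowc k t' by rewrite /lowc all_map.
  have h : hN (hcomb A t').
    have sA := hss A.
    have h1 : hN (hE A p p (hcomb A t) - kap p *: hcomb A t).
      have h2 : hN (hE A p p (a - hcomb A t) - kap p *: (a - hcomb A t)).
        by apply: subB => //; [apply: (hsub A).2; rewrite ?okpp|apply: subZ].
      have h3 := dg p pn; have := subB sA h3 h2; apply: prop_eq.
      by rewrite opB; lmod_with K (hM A); ring.
    apply: sub_congr h1 => //; rewrite /hcomb /comb big_map /= op_sum scaler_sumr -!sumrB.
    rewrite big_seq; apply: sub_sum => // x xt.
    have := subZ sA x.1 (act_wt A (low_okw (andP (allP lt _ xt)).1) pn).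
    apply: prop_eq; rewrite opZ; lmod_with K (hM A); ring.
  have := vac0 lt' h; rewrite /vac big_map /=.
  under eq_bigr => x /eqP -> do rewrite wt_nil addr0.
  rewrite -mulr_sumr => /eqP; rewrite mulf_eq0 subr_eq0 => /predU1P[e|/eqP //].
  by rewrite e eqxx in kp.
have [u [s' ok' ->] hu] := iA a ga Na.
have [k' [t' lt' et']] := reduce_all kap ok'.
have := et' (Hwm hwa); rewrite /hcomb /= => {}et'.
have : vac (ccomp t' t) = vac [:: (1, [::])].
  apply: (vac_uniq (A := A) (k1 := (k' + k)%N) (k2 := 0%N)) => //.
    apply: (ccomp_all (P := fun w => low w && (size w <= k' + k)%N)) => x y /(allP lt') /andP[l1 s1] /(allP lt) /andP[l2 s2].
    by rewrite /low all_cat size_cat leq_add // andbT; apply/andP.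
  rewrite /hcomb comb_ccomp comb1 scale1r.
  have h3 : hN (comb (hE A) t' (hcomb A t - a)).
    apply: comb_sub; [exact: hsub|exact: lowc_okc lt'|exact: (sub_sym (hss A))].
  apply: sub_trans hu; first exact: hss.
  apply: sub_trans (sub_sym (hss A) et'); first exact: hss.
  move: h3; apply: prop_eq; rewrite -scaleN1r [in RHS]addrC -scaleN1r comb_lin.
  by rewrite addrC scaleN1r.
rewrite vac_ccomp vt mulr0 vac_one => /eqP; by rewrite eq_sym oner_eq0.
Qed.

(** The vectors that generate a submodule without the highest weight vector form the largest
proper submodule. *)
Lemma exists_irr_quotient lam (A : hwm lam) : exists N' : hM A -> Prop,
  (forall m, hN m -> N' m) /\ exists hw : ishw (hE A) N' (hv A) lam, irr (Hwm hw).
Proof.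
pose N' m := genN (hE A) (@hN _ A) (hv A) m /\
  forall u k t, gen (hE A) m u -> lowc k t -> hN (u - hcomb A t) -> vac t = 0.
have sS := genN_submod (hv A) (hsub A).
have rp m u : genN (hE A) (@hN _ A) (hv A) m -> gen (hE A) m u ->
    exists k, exists2 t, lowc k t & hN (u - hcomb A t).
  move=> hm hu; have [x [s ok ->] hx] := gen_min sS hm hu.
  have [k [t l e]] := reduce_all lam ok; exists k, t => //.
  by apply: (sub_trans (hss A) hx); exact: e.
have NN' m : hN m -> N' m.
  move=> Nm; split; first exact: genN_N (hsub A) Nm.
  move=> u k t hu lt e; apply: (vac0 (A := A) lt).
  apply: sub_congr e _; [exact: hss|exact: gen_min (hsub A) Nm hu].
have sub' : submod (hE A) N'.
  split; last first.
    move=> p q h m [Sm hm]; split; first exact: sS.2.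
    move=> u k t hu; apply: hm; apply: gen_min hu; first exact: gen_submod.
    by apply: (gen_submod _ m).2 => //; exact: gen_refl.
  split; first by apply: NN'; exact: sub0 (hss A).
  move=> a x y [Sx hx] [Sy hy]; split; first exact: sS.1.2.
  move=> u k t [s ok ->] lt e.
  have gx : gen (hE A) x (comb (hE A) s x) by exists s.
  have gy : gen (hE A) y (comb (hE A) s y) by exists s.
  have [k1 [t1 l1 e1]] := rp _ _ Sx gx; have [k2 [t2 l2 e2]] := rp _ _ Sy gy.
  have v1 := hx _ _ _ gx l1 e1; have v2 := hy _ _ _ gy l2 e2.
  have -> : vac t = vac ([seq (a * b.1, b.2) | b <- t1] ++ t2).
    apply: (vac_uniq (A := A) (k2 := maxn k1 k2) lt).
      rewrite lowc_cat; apply/andP; split.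
        by apply/lowc_scale/(lowc_mono _ l1); rewrite leq_maxl.
      by apply: (lowc_mono _ l2); rewrite leq_maxr.
    apply: sub_trans (sub_sym (hss A) e) _; first exact: hss.
    rewrite comb_lin /hcomb comb_cat comb_scale opprD addrACA -scalerBr.
    exact: (hss A).2.
  by rewrite vac_cat vac_scale v1 v2 mulr0 addr0.
have hw : ishw (hE A) N' (hv A) lam.
  split => //; last 2 first.
  - by move=> p q h lt; apply: NN'; exact: hraise.
  - by move=> p h; apply: NN'; exact: hdiag.
  move=> [_ /(_ (hv A) 0%N [:: (1, [::])] (gen_refl _ _))].
  rewrite /hcomb comb1 scale1r subrr vac_one => /(_ erefl (sub0 (hss A))) /eqP.
  by rewrite oner_eq0.
exists N'; split=> //; exists hw.
move=> m /= gm hm; apply: contrapT => h0; apply: hm; split.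
  exact: genN_gen (hsub A) gm.
move=> u k t gu lt e; have [//|v0] := eqVneq (vac t) 0.
case: h0.
have sP := genN_submod m (hsub A).
have : genN (hE A) (@hN _ A) m (hcomb A t).
  by exists u => //; exact: (sub_sym (hss A) e).
move/(@vacP _ A _ _ _ sP (fun x => @genN_N _ _ _ m x (hsub A)) lt)/(subZ_inv sP.1 v0) => [x gx hx].
by exists x => //; apply: NN'; exact: (sub_sym (hss A) hx).
Qed.

Lemma exists_irr lam (A : hwm lam) : exists2 B : hwm lam, irr B & gle A B.
Proof.
have [N' [NN' [hw iB]]] := exists_irr_quotient A.
by exists (Hwm hw) => //; apply: gle_inj => k t _; exact: NN'.
Qed.

End Representations.

(** * Verma modules *)

Section Monomials.
Variables (K : numFieldType) (n : nat) (bl : nat -> nat).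
Local Notation okp := (okp n bl).
Local Notation rep := (rep (K := K) n bl).

Definition mv (a : nat -> int) (p q : nat) : nat -> int :=
  fun j => a j - (j == p)%:Z + (j == q)%:Z.

Lemma mvC a p q r s : mv (mv a p q) r s = mv (mv a r s) p q.
Proof. by apply: funext => j; rewrite /mv; lia. Qed.

Lemma mvpp a p : mv a p p = a.
Proof. by apply: funext => j; rewrite /mv; lia. Qed.

Section Tensor.
Variables (M : lmodType K) (E : rep M) (g : nat -> K).
Local Ltac lmod := lmod_with K M.

Definition mono_op p q (f : (nat -> int) -> M) : (nat -> int) -> M :=
  fun a => E p q (f a) + ((mv a p q q)%:~R + g q) *: f (mv a p q).

Lemma mono_lin p q : linear (mono_op p q).
Proof.
move=> k x y; apply: funext => a; rewrite /mono_op !fctE /= !opE.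
lmod; ring.
Qed.

Lemma mono_rel p q r s : okp p q -> okp r s -> forall m,
    mono_op p q (mono_op r s m) =
      mono_op r s (mono_op p q m)
      + ((q == r)%:R *: mono_op p s m - (s == p)%:R *: mono_op r q m).
Proof.
move=> h1 h2 m; apply: funext => a; rewrite !fctE /=.
rewrite /mono_op !opE (op_rel E h1 h2) (mvC a r s p q).
set b := mv (mv a p q) r s.
have e1 : (q == r)%:R *: (E p s (m a) + ((mv a p s s)%:~R + g s) *: m (mv a p s))
   = (q == r)%:R *: E p s (m a) + ((q == r)%:R * ((b s)%:~R + g s)) *: m b.
  case: eqP => [e|_]; last by rewrite !scale0r mul0r scale0r addr0.
  have -> : b = mv a p s by apply: funext => j; rewrite /b /mv e; lia.
  by rewrite !scale1r mul1r.
have e2 : (s == p)%:R *: (E r q (m a) + ((mv a r q q)%:~R + g q) *: m (mv a r q))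
   = (s == p)%:R *: E r q (m a) + ((s == p)%:R * ((b q)%:~R + g q)) *: m b.
  case: eqP => [e|_]; last by rewrite !scale0r mul0r scale0r addr0.
  have -> : b = mv a r q by apply: funext => j; rewrite /b /mv e; lia.
  by rewrite !scale1r mul1r.
rewrite e1 e2.
have c1 : (mv a p q q)%:~R = (b q)%:~R + (q == r)%:R - (q == s)%:R :> K.
  by rewrite -[(q == r)%:R]/(((q == r)%:Z)%:~R) -[(q == s)%:R]/(((q == s)%:Z)%:~R)
    -intrD -intrB; congr (_%:~R); rewrite /b /mv; lia.
have c2 : (mv a r s s)%:~R = (b s)%:~R + (s == p)%:R - (q == s)%:R :> K.
  by rewrite -[(s == p)%:R]/(((s == p)%:Z)%:~R) -[(q == s)%:R]/(((q == s)%:Z)%:~R)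
    -intrD -intrB; congr (_%:~R); rewrite /b /mv; lia.
have c3 : mv (mv a r s) p q = b by rewrite mvC.
have c4 : (q == s)%:R * (b q)%:~R =
    (q == s)%:R * (b s)%:~R + (q == s)%:R * g s - (q == s)%:R * g q :> K.
  by case: eqP => [->|_]; rewrite ?mul0r; ring.
rewrite c1 c2; lmod; try ring.
move: c4; move: (b s)%:~R (b q)%:~R (q == s)%:R (q == r)%:R (s == p)%:R.
by move=> x y z u w c4; ring: c4.
Qed.

Definition mono_rep : rep ((nat -> int) -> M) := Rep mono_lin mono_rel.


(** Laurent monomials in variables [x_0, x_1, ...] carry an action of the matrix units by vector
fields. The tensor product of a module with the monomials of negative exponents before the position
[k], and a complex exponent at [k], has a highest weight vector whose weight is shifted by [-1]
before [k] and by the arbitrary number [c] at [k]. *)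
Section Column.
Variables (N : M -> Prop) (v : M) (lam : nat -> K) (k : nat) (c : K).
Hypotheses (hw : ishw E N v lam) (kn : (k < n)%N).
Hypothesis gE : g = fun p => if p == k then c else 0.

Definition colreg (a : nat -> int) := forall j, (j < k)%N -> a j <= -1.
Definition a0 : nat -> int := fun j => if (j < k)%N then -1 else 0.
Definition col_v : (nat -> int) -> M := fun a => if `[< a = a0 >] then v else 0.
Definition col_N (f : (nat -> int) -> M) := forall a, colreg a -> N (f a).
Definition col_lam p := lam p + (if (p < k)%N then -1 else if p == k then c else 0).

Lemma col_hw : ishw mono_rep col_N col_v col_lam.
Proof.
case: hw => [[sN EN] vN up dg].
have g0 p : p != k -> g p = 0 by rewrite gE => /negbTE ->.
split.
- split; first split.
  + by move=> a _; exact: sub0.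
  + by move=> x f h hf hh a ha; apply: sN.2; [exact: hf|exact: hh].
  + move=> p q h f hf a ha; rewrite /= /mono_op.
    apply: subD => //; first by apply: EN => //; exact: hf.
    have [e|pq] := eqVneq p q.
      by rewrite e mvpp; apply: subZ => //; exact: hf.
    case: (boolP (`[< colreg (mv a p q) >])) => [/asboolP hr|/asboolP hr].
      by apply: subZ => //; exact: hf.
    have [qk aq] : (q < k)%N /\ mv a p q q = 0.
      apply: contrapT => h'; apply: hr => j jk.
      have := ha j jk; have [jq|jq] := eqVneq j q; last by rewrite /mv; lia.
      rewrite jq in jk *; have : mv a p q q <> 0 by move=> e; apply: h'.
      by rewrite /mv; lia.
    rewrite aq g0; last by rewrite neq_ltn qk.
    by rewrite addr0 scale0r; exact: sub0.
- move=> /(_ a0); rewrite /col_v asboolT // => h; apply: vN; apply: h => j jk.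
  by rewrite /a0 jk.
- move=> p q h lt a ha; rewrite /= /mono_op.
  apply: subD => //.
    rewrite /col_v; case: ifP => _; first exact: up.
    by rewrite op0; exact: sub0.
  rewrite /col_v; case: asboolP => [e|_]; last by rewrite scaler0; exact: sub0.
  have [pk|kp] := ltnP p k.
    have := ha p pk; have := congr1 (fun f => f p) e; rewrite /mv /a0 pk; lia.
  rewrite e /a0 ltnNge (leq_trans kp (ltnW lt)) /= g0; last first.
    by rewrite neq_ltn (leq_ltn_trans kp lt) orbT.
  by rewrite addr0 scale0r; exact: sub0.
- move=> p pn a ha; rewrite /= /mono_op !fctE mvpp /col_v.
  case: asboolP => [e|_]; last by rewrite !scaler0 op0 subr0 addr0; exact: sub0.
  rewrite e /col_lam /a0 gE.
  apply: prop_eq (dg p pn).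
  case: ltngtP => _ /=; rewrite ?addr0 ?add0r; lmod; ring.
Qed.

End Column.
End Tensor.

Lemma triv_lin : forall p q : nat, linear ((fun p q (_ : K^o) => 0 : K^o) p q).
Proof. by move=> p q k a b; rewrite scaler0 addr0. Qed.

Lemma triv_rel p q r s : okp p q -> okp r s -> forall m : K^o,
   0 = 0 + ((q == r)%:R *: 0 - (s == p)%:R *: 0) :> K^o.
Proof. by move=> _ _ m; rewrite !scaler0 subrr addr0. Qed.

Definition triv_rep : rep K^o := Rep triv_lin triv_rel.

Lemma triv_hw : ishw triv_rep (fun m => m = 0) (1 : K^o) (fun _ => 0).
Proof.
split => [|/eqP||]; rewrite ?oner_eq0 //.
  split => [|p q _ m _] //; split => // k a b -> ->.
  by rewrite scaler0 addr0.
by move=> p _ /=; rewrite scale0r subrr.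
Qed.

Definition triv_hwm : hwm n bl (fun _ => 0) := Hwm triv_hw.

End Monomials.

Lemma exists_max (T : eqType) (s : seq T) (f : T -> nat) x0 : x0 \in s ->
  exists2 x, x \in s & forall y, y \in s -> (f y <= f x)%N.
Proof.
elim: s x0 => // x s IH _ _; case: s IH => [_|y s /(_ y)].
  by exists x; rewrite ?mem_head // => y; rewrite inE => /eqP ->.
rewrite mem_head => /(_ isT)[z zs hz].
case: (leqP (f z) (f x)) => h.
  exists x; rewrite ?mem_head // => t; rewrite in_cons => /predU1P[->//|/hz h'].
  exact: leq_trans h' h.
exists z; first by rewrite in_cons zs orbT.
by move=> t; rewrite in_cons => /predU1P[->|/hz//]; exact: ltnW.
Qed.

Definition pw (T : Type) (L : seq T) (e : seq nat) : seq T :=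
  flatten [seq nseq x.2 x.1 | x <- zip L e].

Lemma pw_cat (T : Type) (L1 L2 : seq T) e1 e2 : size L1 = size e1 ->
  pw (L1 ++ L2) (e1 ++ e2) = pw L1 e1 ++ pw L2 e2.
Proof. by move=> h; rewrite /pw zip_cat // map_cat flatten_cat. Qed.

Lemma pw_cons (T : Type) (l : T) L x e : pw (l :: L) (x :: e) = nseq x l ++ pw L e.
Proof. by []. Qed.

Lemma pw_all (T : Type) (P : pred T) L e : all P L -> all P (pw L e).
Proof.
elim: L e => [[]//|l L IH [//|x e]] /= /andP[pl pL].
by rewrite pw_cons all_cat all_nseq pl orbT IH.
Qed.

Lemma size_pw (T : Type) (L : seq T) e : size e = size L -> size (pw L e) = sumn e.
Proof.
elim: L e => [[]//|l L IH [//|x e]] [/= h].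
by rewrite pw_cons size_cat size_nseq IH.
Qed.

Lemma pw_inj (T : Type) (f : T -> nat) (L : seq T) e e' :
  uniq (map f L) -> size e = size L -> size e' = size L ->
  (forall j, count (fun l => f l == j) (pw L e) = count (fun l => f l == j) (pw L e')) ->
  e = e'.
Proof.
elim: L e e' => [[]//[]//|l L IH [//|x e] [//|x' e']] /= /andP[nl uL] [s1] [s2] h.
have c0 e0 : count (fun l0 => f l0 == f l) (pw L e0) = 0%N.
  apply/eqP; rewrite eqn0Ngt -has_count -all_predC; apply: pw_all.
  by elim: (L) nl => //= y L' IH'; rewrite in_cons negb_or eq_sym => /andP[-> /IH'].
have e0 : x = x'.
  by have := h (f l); rewrite !pw_cons !count_cat !count_nseq !c0 eqxx !mul1n !addn0.
congr (_ :: _) => //; apply: IH => // j.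
by have := h j; rewrite !pw_cons !count_cat !count_nseq e0 => /addnI.
Qed.

Section Verma.
Variables (K : numFieldType) (n : nat) (bl : nat -> nat).
Local Notation okp := (okp n bl).
Local Notation rep := (rep (K := K) n bl).

Definition row_letters k := [seq (k, j) | j <- iota 0 k & okp k j].
Definition letters k := flatten [seq row_letters i | i <- iota 0 k].

Lemma lettersS k : letters k.+1 = letters k ++ row_letters k.
Proof. by rewrite /letters -addn1 iotaD map_cat flatten_cat /= cats0. Qed.

Lemma row_lettersP k x : x \in row_letters k -> [/\ x.1 = k, (x.2 < k)%N & okp k x.2].
Proof. by case/mapP=> j; rewrite mem_filter mem_iota => /and3P[h _ ?] ->. Qed.

Lemma mem_letters k x : (x \in letters k) = [&& (x.1 < k)%N, (x.2 < x.1)%N & okp x.1 x.2].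
Proof.
apply/flatten_mapP/idP => [[i]|/and3P[h1 h2 h3]].
  by rewrite mem_iota add0n => /andP[_ ik] /row_lettersP[-> -> ->]; rewrite ik.
exists x.1; first by rewrite mem_iota.
by apply/mapP; exists x.2; [rewrite mem_filter mem_iota h2 h3|case: x {h1 h2 h3}].
Qed.

Lemma uniq_letters k : uniq (letters k).
Proof.
elim: k => // k IH; rewrite lettersS cat_uniq IH /=; apply/andP; split.
  apply/hasPn => x /row_lettersP[e _ _]; rewrite mem_letters e.
  by rewrite ltnn.
by rewrite map_inj_uniq ?filter_uniq ?iota_uniq // => a b [].
Qed.

Definition free_to (k : nat) (M : lmodType K) (E : rep M) (N : M -> Prop) (v : M) :=
  forall (s : seq (seq nat)) (c : seq nat -> K), uniq s ->
    (forall e, e \in s -> size e = size (letters k)) ->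
    N (\sum_(e <- s) c e *: act E (pw (letters k) e) v) ->
    forall e, e \in s -> c e = 0.

Section Step.
Variables (M : lmodType K) (E : rep M) (g : nat -> K).
Variables (N : M -> Prop) (v : M) (k : nat) (c : K).
Hypothesis kn : (k < n)%N.
Hypothesis gE : g = fun p => if p == k then c else 0.
Hypotheses (sN : is_subspace N) (vN : ~ N v).
Local Notation E' := (mono_rep E g).
Local Notation v' := (col_v v k).

Implicit Types w : seq (nat * nat).

Definition astar (w : seq (nat * nat)) : nat -> int :=
  fun j => a0 k j + (if j == k then (size w)%:Z else 0) - (count (fun l => l.2 == j) w)%:Z.

Lemma astar_k w : all (fun l => (l.1 == k) && (l.2 < k)%N) w -> astar w k = (size w)%:Z.
Proof.
move=> h; rewrite /astar /a0 ltnn eqxx add0r.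
have -> : count (fun l => l.2 == k) w = 0%N; last by rewrite subr0.
apply/eqP; rewrite eqn0Ngt -has_count -all_predC; move: h; apply: sub_all => x /=.
by case/andP => _ h; rewrite neq_ltn h.
Qed.

Lemma row_act w : all (fun l => (l.1 == k) && (l.2 < k)%N) w ->
  (forall a, (size w)%:Z < a k -> act E' w v' a = 0) /\
  (exists2 C, C != 0 & forall a, a k = (size w)%:Z ->
     act E' w v' a = if `[< a = astar w >] then C *: v else 0).
Proof.
elim: w => [_|[i j] w IH] /=.
  have e0 : astar [::] = a0 k.
    by apply: funext => j; rewrite /astar /=; case: (j == k); lia.
  split=> [a h|]; rewrite /col_v.
    case: asboolP => // e; move: h; rewrite e /a0 ltnn; lia.
  by exists 1; rewrite ?oner_eq0 // => a _; rewrite e0 scale1r.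
case/andP => /andP[/eqP -> jk] hw; have [h0 [C C0 h1]] := IH hw.
have jk' : j != k by rewrite neq_ltn jk.
have mk (a : nat -> int) : mv a k j k = a k - 1.
  by rewrite /mv eqxx eq_sym (negbTE jk') addr0.
split=> [a h|].
  rewrite /mono_op h0; last by lia.
  by rewrite op0 h0 ?scaler0 ?addr0 // mk; lia.
exists ((-1 - (count (fun l => l.2 == j) w)%:R) * C).
  rewrite mulf_neq0 // -opprD oppr_eq0 -[1]/(1%:R) -natrD pnatr_eq0 //.
move=> a ak; rewrite /mono_op h0; last by lia.
rewrite op0 add0r h1; last by rewrite mk; lia.
have -> : `[< mv a k j = astar w >] = `[< a = astar ((k, j) :: w) >].
  apply: asbool_equiv_eq; split => [e|->]; apply: funext => t.
    by have := congr1 (fun f => f t) e; rewrite /mv /astar /=; case: ifP => tk; lia.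
  by rewrite /mv /astar /=; case: ifP => tk; lia.
case: asboolP => [e|_]; last by rewrite scaler0.
rewrite scalerA; congr (_ * _ *: _).
rewrite gE (negbTE jk') addr0.
have -> : mv a k j j = - 1 - (count (fun l => l.2 == j) w)%:Z.
  by rewrite e /mv /astar /a0 /= jk eqxx (negbTE jk') /=; lia.
by rewrite intrB rmorphN.
Qed.

Definition theta (a : nat -> int) : int := \sum_(t < k) t%:Z * a t.

Lemma sum_one x : (x < k)%N -> \sum_(t < k) t%:Z * (t == x :> nat)%:Z = x%:Z.
Proof.
move=> xk; rewrite (bigD1 (Ordinal xk)) //= eqxx mulr1 big1 ?addr0 // => t tx.
rewrite (_ : (t == x :> nat) = false) ?mulr0 //.
by apply: contraNF tx => /eqP e; apply/eqP/val_inj.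
Qed.

Lemma theta_mv a i j : (i < k)%N -> (j < k)%N ->
  theta (mv a i j) = theta a - i%:Z + j%:Z.
Proof.
move=> ik jk; rewrite /theta /mv.
under eq_bigr do rewrite mulrDr mulrBr.
by rewrite big_split sumrB /= !sum_one.
Qed.

Lemma theta_astar w : all (fun l => (l.1 == k) && (l.2 < k)%N) w ->
  theta (astar w) = theta (a0 k) - (sumn (map snd w))%:Z.
Proof.
elim: w => [_|[i j] w IH] /=.
  rewrite subr0; congr theta; apply: funext => j.
  by rewrite /astar /=; case: (j == k); lia.
case/andP => /andP[/eqP -> jk] /IH e.
have -> : theta (astar ((k, j) :: w)) = theta (astar w) - j%:Z; last by rewrite e; lia.
rewrite -(sum_one jk) /theta -sumrB /=; apply: eq_bigr => t _.
rewrite /astar /= (_ : (t == k :> nat) = false); last by rewrite ltn_eqF.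
by rewrite -mulrBr eq_sym; congr (_ * _); lia.
Qed.

Lemma tail_act (m : int) (th : int) (as_ : nat -> int) (x : M) w (f : (nat -> int) -> M) :
  all (fun l => (l.2 < l.1)%N && (l.1 < k)%N) w ->
  (forall a, m < a k -> f a = 0) ->
  (forall a, a k = m -> theta a < th -> f a = 0) ->
  (forall a, a k = m -> theta a = th -> f a = if `[< a = as_ >] then x else 0) ->
  [/\ forall a, m < a k -> act E' w f a = 0,
      forall a, a k = m -> theta a < th -> act E' w f a = 0 &
      forall a, a k = m -> theta a = th ->
         act E' w f a = if `[< a = as_ >] then act E w x else 0].
Proof.
elim: w => [_|[i j] w IH] //= /andP[/andP[ji ik] hw] h0 h1 h2.
have [{}h0 {}h1 {}h2] := IH hw h0 h1 h2.
have jk := ltn_trans ji ik.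
have mk (a : nat -> int) : mv a i j k = a k.
  by rewrite /mv !gtn_eqF // subr0 addr0.
split=> [a h|a h ht|a h ht]; rewrite /mono_op.
- by rewrite h0 // op0 h0 ?mk // scaler0 addr0.
- by rewrite h1 // op0 h1 ?mk ?theta_mv // ?scaler0 ?addr0 //; lia.
- rewrite h2 // (h1 (mv a i j)) ?mk ?theta_mv // ?scaler0 ?addr0; last by lia.
  by case: ifP => _; rewrite ?op0.
Qed.

Lemma free_step : free_to k E N v -> free_to k.+1 E' (col_N N k) v'.
Proof.
move=> fr s d us ss hN e0 e0s.
apply: contrapT => /eqP de0.
pose L := letters k; pose R := row_letters k.
have sz e : e \in s -> size (take (size L) e) = size L /\ size (drop (size L) e) = size R.
  move=> /ss; rewrite lettersS size_cat => h.
  by rewrite size_takel ?h ?leq_addr // size_drop h addKn.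
pose e2 (e : seq nat) := drop (size L) e.
pose w2 (e : seq nat) := pw R (e2 e).
have aR : all (fun l => (l.1 == k) && (l.2 < k)%N) R.
  by apply/allP => x /row_lettersP[-> -> _]; rewrite eqxx.
have aw e : all (fun l => (l.1 == k) && (l.2 < k)%N) (w2 e) by exact: pw_all.
have aL : all (fun l => (l.2 < l.1)%N && (l.1 < k)%N) L.
  by apply/allP => x; rewrite mem_letters => /and3P[-> -> _].
have [e1 e1s m1] : exists2 x, x \in [seq e <- s | d e != 0] &
    forall y, y \in [seq e <- s | d e != 0] -> (size (w2 y) <= size (w2 x))%N.
  by apply: (exists_max (fun e => size (w2 e)) (x0 := e0)); rewrite mem_filter de0.
have [es ess m2] : exists2 x, x \in [seq e <- s | (d e != 0) && (size (w2 e) == size (w2 e1))] &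
    forall y, y \in [seq e <- s | (d e != 0) && (size (w2 e) == size (w2 e1))] ->
    (sumn (map snd (w2 y)) <= sumn (map snd (w2 x)))%N.
  apply: (exists_max (fun e => sumn (map snd (w2 e))) (x0 := e1)).
  by move: e1s; rewrite !mem_filter eqxx andbT.
move: ess; rewrite mem_filter => /andP[/andP[ces /eqP ses] es_s].
pose as_ := astar (w2 es).
have as_k : as_ k = (size (w2 es))%:Z by rewrite /as_ astar_k.
have reg : colreg k as_.
  move=> j jk; rewrite /as_ /astar /a0 jk ltn_eqF //; lia.
have := hN as_ reg; rewrite fct_sumE.
pose Cc := sval (cid2 (row_act (aw es)).2).
have C0 : Cc != 0 by rewrite /Cc; case: cid2.
have val e : e \in s -> (d e *: act E' (pw (letters k.+1) e) v') as_ =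
   (if e2 e == e2 es then (d e * Cc) *: act E (pw L (take (size L) e)) v else 0).
  move=> e_s; have [st sd] := sz _ e_s.
  have [c0|de] := eqVneq (d e) 0.
    by rewrite c0 mul0r !scale0r; case: ifP.
  have scE (x : K) (f : (nat -> int) -> M) a : (x *: f) a = x *: f a by [].
  have -> : pw (letters k.+1) e = pw L (take (size L) e) ++ w2 e.
    by rewrite lettersS -[in LHS](cat_take_drop (size L) e) pw_cat ?st.
  rewrite scE act_cat.
  have [r0 [C C0' r1]] := row_act (aw e).
  have le1 : (size (w2 e) <= size (w2 es))%N by rewrite ses; apply: m1; rewrite mem_filter de.
  have le2 : size (w2 e) = size (w2 es) -> (sumn (map snd (w2 e)) <= sumn (map snd (w2 es)))%N.
    by move=> eq; apply: m2; rewrite mem_filter de eq ses eqxx.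
  have alw : all (fun l => (l.2 < l.1)%N && (l.1 < k)%N) (pw L (take (size L) e)).
    exact: pw_all.
  have r2 a : a k = (size (w2 e))%:Z -> theta a < theta (astar (w2 e)) ->
      act E' (w2 e) v' a = 0.
    by move=> h1 h2; rewrite r1 //; case: asboolP => // h; rewrite h ltxx in h2.
  have [t0 t1 t2] := @tail_act _ _ (astar (w2 e)) (C *: v) _ _ alw r0 r2 (fun a h _ => r1 a h).
  have [eq1|ne1] := eqVneq (size (w2 e)) (size (w2 es)); last first.
    rewrite t0 ?scaler0; last by rewrite as_k ltz_nat ltn_neqAle ne1.
    by case: eqP => // h; case/eqP: ne1; rewrite /w2 h.
  have ask' : as_ k = (size (w2 e))%:Z by rewrite as_k eq1.
  have [eq2|ne2] := eqVneq (sumn (map snd (w2 e))) (sumn (map snd (w2 es))); last first.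
    rewrite t1 ?scaler0 //; last first.
      have := le2 eq1; rewrite leq_eqVlt (negbTE ne2) /= => lt.
      by rewrite /as_ !theta_astar // ltrD2l ltrN2 ltz_nat.
    by case: eqP => // h; case/eqP: ne2; rewrite /w2 h.
  rewrite t2 //; last by rewrite /as_ !theta_astar // eq2.
  case: asboolP => [eqa|ne].
    have ee : e2 e = e2 es.
      have uR : uniq (map snd R).
        by rewrite /R /row_letters -map_comp map_id_in ?filter_uniq ?iota_uniq.
      apply: (pw_inj uR sd (sz _ es_s).2) => j.
      have := congr1 (fun f => f j) eqa; rewrite /as_ /astar eq1.
      by move/addrI/oppr_inj => [] h; exact: esym h.
    rewrite ee eqxx.
    have -> : C = Cc.
      rewrite /Cc; case: cid2 => C2 C20 h2 /=; have := h2 as_ as_k.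
      have := r1 (astar (w2 e)); rewrite astar_k // => /(_ erefl).
      rewrite asboolT // -eqa /w2 ee -/(w2 es) => ->; rewrite asboolT //.
      move=> h; apply/eqP; rewrite -subr_eq0; apply/eqP.
      have [//|d0] := eqVneq (C - C2) 0; case: vN; apply: (subZ_inv sN d0).
      by rewrite scalerBl h subrr; exact: sub0.
    by rewrite -[in RHS]scalerA actZ.
  by rewrite scaler0; case: eqP => // h; case: ne; rewrite /as_ /w2 h.
rewrite big_seq (eq_bigr _ val) -big_seq -big_mkcond /=.
set s1 := [seq take (size L) e | e <- s & e2 e == e2 es].
pose d1 e1 := d (e1 ++ e2 es) * Cc.
have catK e : e2 e == e2 es -> take (size L) e ++ e2 es = e.
  by move=> /eqP <-; rewrite cat_take_drop.
have us1 : uniq s1.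
  rewrite map_inj_in_uniq ?filter_uniq // => x y; rewrite !mem_filter.
  by case/andP=> hx _ /andP[hy _] e; rewrite -(catK _ hx) -(catK _ hy) e.
have ss1 e : e \in s1 -> size e = size L.
  by case/mapP => x; rewrite mem_filter => /andP[_ /sz[h _]] ->.
have -> : \sum_(e <- s | e2 e == e2 es) (d e * Cc) *: act E (pw L (take (size L) e)) v =
    \sum_(e <- s1) d1 e *: act E (pw L e) v.
  rewrite /s1 big_map big_filter; apply: eq_bigr => e he.
  by rewrite /d1 catK.
move=> /(fr s1 d1 us1 ss1 ) h.
have /eqP : d1 (take (size L) es) = 0.
  by apply/h/mapP; exists es => //; rewrite mem_filter eqxx.
by rewrite /d1 catK ?eqxx // mulf_eq0 (negbTE ces) (negbTE C0).
Qed.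

End Step.

(** Tensoring the trivial module with one column of monomials for every position produces an
arbitrary highest weight. The monomials remember the lowering operators that were applied, so the
ordered words act freely. *)
Lemma exists_verma (lam : nat -> K) :
  exists A : hwm n bl lam, free_to n (hE A) (@hN _ _ _ _ A) (hv A).
Proof.
have ext (l1 l2 : nat -> K) k : (forall p, (p < n)%N -> l1 p = l2 p) ->
    (exists A : hwm n bl l1, free_to k (hE A) (@hN _ _ _ _ A) (hv A)) ->
    exists A : hwm n bl l2, free_to k (hE A) (@hN _ _ _ _ A) (hv A).
  move=> h [[M E N v hw] fr]; case: (hw) => a b c d.
  have hw2 : ishw E N v l2 by split => // p pn; rewrite -h //; exact: d.
  by exists (Hwm hw2).
have step k (l : nat -> K) (c : K) : (k < n)%N ->
    (exists A : hwm n bl l, free_to k (hE A) (@hN _ _ _ _ A) (hv A)) ->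
    exists A : hwm n bl (col_lam l k c), free_to k.+1 (hE A) (@hN _ _ _ _ A) (hv A).
  move=> kn [A fr]; have hw := col_hw (hP A) kn (erefl (fun p => if p == k then c else 0)).
  by exists (Hwm hw); exact: free_step (erefl _) (hss A) (@hvN _ _ _ _ A) fr.
have main k (f : nat -> K) : (k <= n)%N ->
    exists A : hwm n bl (fun p => if (p < k)%N then f p else 0),
      free_to k (hE A) (@hN _ _ _ _ A) (hv A).
  elim: k f => [|k IH] f kn.
    apply: (ext (fun=> 0)) => //; exists (triv_hwm K n bl) => s c us ss.
    have {}ss e : e \in s -> e = [::] by move/ss/size0nil.
    case: s us ss => [//|x [|y s]]; last first.
      move=> /= /and3P[xy _ _] h; have ex := h x (mem_head _ _).
      have ey : y = [::] by apply: h; rewrite !inE eqxx orbT.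
      by rewrite ex ey mem_head in xy.
    move=> _ h; have -> : x = [::] by apply: h; exact: mem_head.
    rewrite big_seq1 /= => e0 e; rewrite inE => /eqP ->.
    by move: e0; rewrite /GRing.scale /= mulr1.
  have := step k _ (f k) kn (IH (fun p => f p + 1) (ltnW kn)).
  apply: ext => p pn; rewrite /col_lam ltnS.
  case: (ltngtP p k) => h; rewrite ?addrK ?add0r //.
  by rewrite h.
have := main n lam (leqnn n); apply: ext => p pn; by rewrite pn.
Qed.
End Verma.

(** * Localization *)

(** A lowering operator [f] of a simple root is inverted as follows. A fraction is the sequence of
its products with the powers of [f], indexed by [int]; only the behaviour far to the right matters.
Since [ad f] is nilpotent, the conjugate of an operator by a complex power of [f] is a finite
expansion, which makes sense on sequences. *)

Section Commutators.
Variables (K : numFieldType) (M : lmodType K) (f : M -> M).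
Hypothesis lf : linear f.
Local Ltac lmod := lmod_with K M.

Lemma linopD (X : M -> M) : linear X -> forall a b, X (a + b) = X a + X b.
Proof. by move=> h a b; have := h 1 a b; rewrite !scale1r. Qed.
Lemma linop0 (X : M -> M) : linear X -> X 0 = 0.
Proof. by move=> h; have := h (-1) 0 0; rewrite scaler0 addr0 scaleN1r addNr. Qed.
Lemma linopZ (X : M -> M) : linear X -> forall k a, X (k *: a) = k *: X a.
Proof. by move=> h k a; have := h k a 0; rewrite (linop0 h) !addr0. Qed.
Lemma linopN (X : M -> M) : linear X -> forall a, X (- a) = - X a.
Proof. by move=> h a; rewrite -scaleN1r linopZ // scaleN1r. Qed.

Definition ad (X : M -> M) (m : M) := f (X m) - X (f m).

Lemma ad_lin X : linear X -> linear (ad X).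
Proof.
move=> h k a b; rewrite /ad h !lf h; lmod; ring.
Qed.

Lemma ad_comm X Y m : linear X -> linear Y ->
  ad (fun m => X (Y m) - Y (X m)) m =
  (ad X (Y m) - Y (ad X m)) + (X (ad Y m) - ad Y (X m)).
Proof.
move=> hX hY; rewrite /ad !(linopD lf, linopD hX, linopD hY) !(linopN lf, linopN hX, linopN hY).
lmod; ring.
Qed.

Definition loc (c : K) (X : M -> M) (s : int -> M) : int -> M := fun k =>
  let t := c + k%:~R in
  X (s k) + t *: ad X (s (k - 1)) + (t * (t - 1) / 2) *: ad (ad X) (s (k - 2)).

Lemma loc_lin c X : linear X -> linear (loc c X).
Proof.
move=> h k a b; apply: funext => j; rewrite /loc !fctE /=.
have h1 := ad_lin h; have h2 := ad_lin h1.
by rewrite h h1 h2; lmod; field.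
Qed.

(** The iterated commutators satisfy the Leibniz rule, so the expansion of a commutator is the
commutator of the expansions; only the terms of order at most two survive. *)
Lemma loc_comm c X Y s : linear X -> linear Y ->
  (forall m, ad (ad (ad X)) m = 0) -> (forall m, ad (ad (ad Y)) m = 0) ->
  (forall m, ad (ad (ad (fun m => X (Y m) - Y (X m)))) m = 0) ->
  loc c X (loc c Y s) - loc c Y (loc c X s) = loc c (fun m => X (Y m) - Y (X m)) s.
Proof.
move=> hX hY X3 Y3 Z3.
have hX1 := ad_lin hX; have hX2 := ad_lin hX1.
have hY1 := ad_lin hY; have hY2 := ad_lin hY1.
pose B (P Q : M -> M) m := P (Q m) - Q (P m).
have B_lin P Q : linear P -> linear Q -> linear (B P Q).
  by move=> hP hQ k a b; rewrite /B hP hQ hP hQ; lmod; ring.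
pose S (P Q : M -> M) m := P m + Q m.
have S_lin P Q : linear P -> linear Q -> linear (S P Q).
  by move=> hP hQ k a b; rewrite /S hP hQ; lmod; ring.
have adB P Q : linear P -> linear Q -> ad (B P Q) = S (B (ad P) Q) (B P (ad Q)).
  by move=> hP hQ; apply: funext => m; rewrite [LHS]ad_comm.
have adS P Q : ad (S P Q) = S (ad P) (ad Q).
  by apply: funext => m; rewrite /ad /S (linopD lf); lmod; ring.
have ZB : forall m, ad (ad (ad (B X Y))) m = 0 by [].
have BE P Q m : B P Q m = P (Q m) - Q (P m) by [].
have SE P Q m : S P Q m = P m + Q m by [].
have locB : loc c (fun m => X (Y m) - Y (X m)) s = loc c (B X Y) s by [].
rewrite locB {locB}; clearbody B S.
have Z1 := adB _ _ hX hY.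
have Z2 : ad (ad (B X Y)) =
    S (S (B (ad (ad X)) Y) (B (ad X) (ad Y))) (S (B (ad X) (ad Y)) (B X (ad (ad Y)))).
  by rewrite Z1 adS !adB.
have BX3 P : linear P -> B (ad (ad (ad X))) P = fun=> 0.
  by move=> hP; apply: funext => m; rewrite BE !X3 (linop0 hP) subrr.
have BY3 P : linear P -> B P (ad (ad (ad Y))) = fun=> 0.
  by move=> hP; apply: funext => m; rewrite BE !Y3 (linop0 hP) subrr.
have Z3' m : 3%:R *: (B (ad (ad X)) (ad Y) m + B (ad X) (ad (ad Y)) m) = 0.
  have := ZB m; rewrite Z2 !adS !adB // BX3 // BY3 // !SE => <-.
  by lmod; ring.
have {}Z3' m : B (ad (ad X)) (ad Y) m = - B (ad X) (ad (ad Y)) m.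
  have := Z3' m => /eqP; rewrite scaler_eq0 pnatr_eq0 /= => /eqP h.
  by apply/eqP; rewrite -addr_eq0 h.
have Z4 m : B (ad (ad X)) (ad (ad Y)) m = 0.
  have h : ad (B (ad (ad X)) (ad Y)) m = ad (fun m => - B (ad X) (ad (ad Y)) m) m.
    by congr (ad _ m); apply: funext.
  have h2 : ad (fun m => - B (ad X) (ad (ad Y)) m) m = - ad (B (ad X) (ad (ad Y))) m.
    have adN (P : M -> M) : ad (fun m => - P m) m = - ad P m.
      by rewrite /ad (linopN lf); lmod; ring.
    exact: adN.
  move: h; rewrite h2 !adB // BX3 // BY3 // !SE add0r addr0 => h.
  have : 2%:R *: B (ad (ad X)) (ad (ad Y)) m = 0.
    by rewrite scaler_nat mulr2n {1}h addNr.
  by move/eqP; rewrite scaler_eq0 pnatr_eq0 /= => /eqP.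
have Z4' m : ad (ad X) (ad (ad Y) m) = ad (ad Y) (ad (ad X) m).
  by apply/eqP; rewrite -subr_eq0 -BE Z4.
have Z3'' m : ad (ad X) (ad Y m) = ad Y (ad (ad X) m) - ad X (ad (ad Y) m) + ad (ad Y) (ad X m).
  by have := Z3' m; rewrite !BE => /eqP; rewrite subr_eq => /eqP ->; lmod; ring.
apply: funext => k.
have e (a b : int -> M) j : (a - b) j = a j - b j by [].
rewrite e {1 2 3 4 5}/loc Z2 Z1 !SE !BE.
move: hX1 hX2 hY1 hY2 Z4' Z3''.
move: (ad (ad X)) (ad (ad Y)) => X2 Y2; move: (ad X) (ad Y) => X1 Y1.
move=> hX1 hX2 hY1 hY2 Z4' Z3''.
rewrite !intrB !(linopD hX, linopD hX1, linopD hX2, linopD hY, linopD hY1, linopD hY2).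
rewrite !(linopZ hX, linopZ hX1, linopZ hX2, linopZ hY, linopZ hY1, linopZ hY2).
have -> : k - 1 - 1 = k - 2 :> int by lia.
have -> : k - 1 - 2 = k - 3 :> int by lia.
have -> : k - 2 - 1 = k - 3 :> int by lia.
by rewrite Z4' Z3''; lmod; field.
Qed.

End Commutators.

Section LocalRep.
Variables (K : numFieldType) (n : nat) (bl : nat -> nat).
Local Notation okp := (okp n bl).
Local Notation rep := (rep (K := K) n bl).
Variables (M : lmodType K) (E : rep M) (i : nat).
Hypothesis oki : okp i i.+1.
Local Ltac lmod := lmod_with K M.
Local Notation f := (E i.+1 i).

Lemma okf : okp i.+1 i. Proof. by rewrite okpC. Qed.

Lemma adE p q m : okp p q ->
  ad f (E p q) m = (p == i)%:R *: E i.+1 q m - (q == i.+1)%:R *: E p i m.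
Proof.
by move=> h; rewrite /ad (op_rel E okf h) eq_sym addrAC subrr add0r.
Qed.

Lemma adE_notin p q : okp p q -> p != i -> q != i.+1 -> ad f (E p q) = fun=> 0.
Proof.
move=> h /negbTE p1 /negbTE q1; apply: funext => m.
by rewrite adE // p1 q1 !scale0r subrr.
Qed.

Lemma ad2E p q m : okp p q ->
  ad f (ad f (E p q)) m = - (2 * (p == i)%:R * (q == i.+1)%:R) *: f m.
Proof.
move=> h; rewrite {1}/ad !adE // !opE.
have nei : (i == i.+1) = false by rewrite ltn_eqF.
have e1 : (p == i)%:R *: f (E i.+1 q m) = (p == i)%:R *: E i.+1 q (f m)
     - ((p == i)%:R * (q == i.+1)%:R) *: f m.
  have [e|_] := eqVneq p i; last by rewrite mul0r !scale0r subrr.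
  have h' : okp i.+1 q by apply: okp_trans okf _; rewrite -e.
  rewrite (op_rel E okf h') nei /= ?mulr1n ?mulr0n; lmod; ring.
have e2 : (q == i.+1)%:R *: f (E p i m) = (q == i.+1)%:R *: E p i (f m)
     + ((p == i)%:R * (q == i.+1)%:R) *: f m.
  have [e|_] := eqVneq q i.+1; last by rewrite mulr0 !scale0r addr0.
  have h' : okp p i by apply: (okp_trans h); rewrite e okf.
  rewrite (op_rel E okf h') nei [i == p]eq_sym /= ?mulr1n ?mulr0n; lmod; ring.
rewrite e1 e2; lmod; ring.
Qed.

Lemma ad3E p q m : okp p q -> ad f (ad f (ad f (E p q))) m = 0.
Proof.
by move=> h; rewrite {1}/ad !ad2E // opZ subrr.
Qed.

Variable c : K.

Definition loc_op p q := loc f c (E p q).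

Lemma loc_op_lin p q : linear (loc_op p q).
Proof. apply: loc_lin; exact: op_lin. Qed.

Lemma loc_sum (X Y : M -> M) a b s : linear X -> linear Y ->
  loc f c (fun m => a *: X m - b *: Y m) s = a *: loc f c X s - b *: loc f c Y s.
Proof.
move=> hX hY; apply: funext => k; rewrite /loc !fctE /ad /= !(opD, opN, opZ).
lmod; ring.
Qed.

Lemma loc_op_rel p q r s : okp p q -> okp r s -> forall m,
    loc_op p q (loc_op r s m) =
      loc_op r s (loc_op p q m)
      + ((q == r)%:R *: loc_op p s m - (s == p)%:R *: loc_op r q m).
Proof.
move=> h1 h2 m; rewrite /loc_op -loc_sum; try exact: op_lin.
have eZ : (fun x => E p q (E r s x) - E r s (E p q x)) =
          (fun x => (q == r)%:R *: E p s x - (s == p)%:R *: E r q x).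
  by apply: funext => x; rewrite (op_rel E h1 h2) addrAC subrr add0r.
apply/eqP; rewrite -subr_eq0 opprD addrA subr_eq0 -eZ; apply/eqP.
apply: loc_comm; try exact: op_lin.
- by move=> x; exact: ad3E.
- by move=> x; exact: ad3E.
move=> x; rewrite eZ.
have adl (X Y : M -> M) a b :
    ad f (fun m => a *: X m - b *: Y m) = fun y => a *: ad f X y - b *: ad f Y y.
  by apply: funext => y; rewrite /ad !opE; lmod; ring.
rewrite !adl.
have [e|_] := eqVneq q r; last first.
  have [e|_] := eqVneq s p; last by rewrite !scale0r subrr.
  by rewrite scale0r ad3E ?scaler0 ?subrr //; apply: (okp_trans h2); rewrite e.
rewrite ad3E; last by apply: (okp_trans h1); rewrite e.
have [e2|_] := eqVneq s p; last by rewrite scaler0 !scale0r subrr.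
by rewrite ad3E ?scaler0 ?subrr //; apply: (okp_trans h2); rewrite e2.
Qed.

Definition loc_rep : rep (int -> M) := Rep loc_op_lin loc_op_rel.

Lemma loc_coh p q s k : okp p q ->
  loc_op p q s (k + 1) - f (loc_op p q s k) =
  E p q (s (k + 1) - f (s k)) + (c + k%:~R) *: ad f (E p q) (s k - f (s (k - 1)))
  + ((c + k%:~R) * (c + k%:~R - 1) / 2) *:
      ad f (ad f (E p q)) (s (k - 1) - f (s (k - 2))).
Proof.
move=> h; have h3 := fun m => ad3E m h.
have l1 := ad_lin (op_lin E i.+1 i) (op_lin E p q).
have l2 := ad_lin (op_lin E i.+1 i) l1.
have f0 m : f (E p q m) = E p q (f m) + ad f (E p q) m by rewrite /ad addrC subrK.
have f1 m : f (ad f (E p q) m) = ad f (E p q) (f m) + ad f (ad f (E p q)) m.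
  by rewrite {3}/ad addrC subrK.
have f2 m : f (ad f (ad f (E p q)) m) = ad f (ad f (E p q)) (f m).
  by apply/eqP; rewrite -subr_eq0; apply/eqP; exact: h3.
rewrite /loc_op /loc.
have -> : k + 1 - 1 = k by lia.
have -> : k + 1 - 2 = k - 1 by lia.
rewrite intrD; move: l1 l2 f0 f1 f2 {h3}.
move: (ad f (ad f (E p q))) => X2; move: (ad f (E p q)) => X1 l1 l2 f0 f1 f2.
rewrite !(linopD l1, linopD l2, linopN l1, linopN l2) !opE f0 f1 f2.
by lmod; field.
Qed.

Definition emb (a : M) : int -> M :=
  fun k => if k is Posz m then iter m f a else 0.

Lemma emb_lin : linear emb.
Proof.
move=> k a b; apply: funext => -[m|m]; rewrite !fctE /=; last by rewrite scaler0 addr0.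
elim: m => //= m ->; by rewrite opD opZ.
Qed.

End LocalRep.

Section Coherence.
Variables (K : numFieldType) (n : nat) (bl : nat -> nat).
Local Notation okp := (okp n bl).
Local Notation rep := (rep (K := K) n bl).
Variables (M : lmodType K) (E : rep M) (i : nat).
Hypothesis oki : okp i i.+1.
Local Ltac lmod := lmod_with K M.
Local Notation f := (E i.+1 i).
Local Notation loc_op := (loc_op E i).
Local Notation emb := (emb E i).

(** The sequence is that of a genuine fraction as soon as [f] carries each term to the next. *)
Definition coh (s : int -> M) (k0 : nat) : Prop :=
  forall k : nat, (k0 <= k)%N -> s (Posz k.+1) = f (s (Posz k)).

Lemma coh_mono s k0 k1 : (k0 <= k1)%N -> coh s k0 -> coh s k1.
Proof. by move=> h c k hk; apply: c; exact: leq_trans hk. Qed.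

Lemma coh_iter s k0 j : coh s k0 -> s (Posz (j + k0)) = iter j f (s (Posz k0)).
Proof.
by move=> h; elim: j => //= j <-; rewrite addSn h // leq_addl.
Qed.

Lemma coh_op c p q s k0 : okp p q -> coh s k0 -> coh (loc_op c p q s) (k0 + 2).
Proof.
move=> h cs k hk.
have e1 : (Posz k.+1) = Posz k + 1 by lia.
have c1 j : (k0 <= j)%N -> s (Posz j + 1) - f (s (Posz j)) = 0.
  by move=> hj; rewrite (_ : Posz j + 1 = Posz j.+1) ?cs ?subrr //; lia.
have e2 : Posz k - 1 = Posz (k - 1) by lia.
have e3 : Posz k - 2 = Posz (k - 2) by lia.
have h1 : s (Posz k) - f (s (Posz k - 1)) = 0.
  by rewrite -(c1 (k - 1)%N); [congr (s _ - f (s _))|]; lia.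
have h2 : s (Posz k - 1) - f (s (Posz k - 2)) = 0.
  by rewrite -(c1 (k - 2)%N); [congr (s _ - f (s _))|]; lia.
have l1 := ad_lin (op_lin E i.+1 i) (op_lin E p q).
have l2 := ad_lin (op_lin E i.+1 i) l1.
apply/eqP; rewrite -subr_eq0 e1 loc_coh // c1; last by lia.
by rewrite h1 h2 op0 (linop0 l1) (linop0 l2) !scaler0 !addr0.
Qed.

Lemma coh_emb a : coh (emb a) 0.
Proof. by move=> k _. Qed.

Lemma emb_act p q a (k : nat) : okp p q -> (2 <= k)%N ->
  loc_op 0 p q (emb a) (Posz k) = iter k f (E p q a).
Proof.
move=> h hk; have := coh_op 0 h (coh_emb a) => /coh_iter e.
rewrite -(subnK hk) (e (k - 2)%N) iterD; congr (iter _ _ _).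
have -> : loc_op 0 p q (emb a) (Posz (0 + 2)) =
   E p q (f (f a)) + 2%:R *: ad f (E p q) (f a) + (2%:R * (2%:R - 1) / 2) *: ad f (ad f (E p q)) a.
  by rewrite /loc_op /loc add0r.
rewrite /= (_ : 2%:R * (2%:R - 1) / 2 = 1 :> K); last by field.
have l1 := ad_lin (op_lin E i.+1 i) (op_lin E p q).
have f0 m : f (E p q m) = E p q (f m) + ad f (E p q) m by rewrite /ad addrC subrK.
have f1 m : f (ad f (E p q) m) = ad f (E p q) (f m) + ad f (ad f (E p q)) m.
  by rewrite {3}/ad addrC subrK.
rewrite f0; move: f0 f1; move: (ad f (ad f (E p q))) => X2; move: (ad f (E p q)) l1 => X1 l1 f0 f1.
rewrite opD f0 f1; lmod; ring.
Qed.

Lemma iter_lin j : linear (iter j f).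
Proof. by move=> k a b; elim: j => //= j ->; rewrite opD opZ. Qed.

Lemma iter_sub (N : M -> Prop) j a : submod E N -> N a -> N (iter j f a).
Proof.
by move=> sN Na; elim: j => //= j IH; apply: sN.2 => //; rewrite okpC.
Qed.

Lemma ad_sub (N : M -> Prop) (X : M -> M) a :
  submod E N -> (forall a, N a -> N (X a)) -> N a -> N (ad f X a).
Proof.
move=> sN hX Na; have okf := okf oki.
by apply: subB; [exact: sN.1|apply: sN.2 => //; exact: hX|apply/hX/sN.2].
Qed.

Lemma loc_sub c (N : M -> Prop) p q s k : submod E N -> okp p q ->
  N (s k) -> N (s (k - 1)) -> N (s (k - 2)) -> N (loc_op c p q s k).
Proof.
move=> sN h h0 h1 h2; have sN' := sN.1.
have hX a : N a -> N (E p q a) by exact: sN.2.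
have hX1 a : N a -> N (ad f (E p q) a) by exact: ad_sub.
apply: subD => //; first by apply: subD => //; [exact: hX|apply: subZ => //; exact: hX1].
by apply: subZ => //; exact: ad_sub.
Qed.

(** Since [ad f] is nilpotent, an operator can be moved past a large power of [f]. *)
Lemma torsion_submod (N : M -> Prop) : submod E N ->
  submod E (fun a => exists m, N (iter m f a)).
Proof.
move=> sN; have sN' := sN.1.
have mono a m m' : (m <= m')%N -> N (iter m f a) -> N (iter m' f a).
  by move=> h Na; rewrite -(subnK h) iterD; exact: iter_sub.
split.
  split; first by exists 0%N; exact: sub0.
  move=> k a b [m ha] [m' hb]; exists (maxn m m'); rewrite iter_lin.
  apply: sN'.2; [apply: mono ha; exact: leq_maxl|apply: mono hb; exact: leq_maxr].
move=> p q h a [m ha]; exists m.+2; rewrite -emb_act //.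
apply: loc_sub => //.
- by apply: mono ha; rewrite -addn2 leq_addr.
- have -> : Posz m.+2 - 1 = Posz m.+1 by lia.
  exact: mono (leqnSn m) ha.
- by have -> : Posz m.+2 - 2 = Posz m by lia.
Qed.

Lemma iter_wt (N : M -> Prop) a kap p m : submod E N -> (p < n)%N ->
  N (E p p a - kap *: a) ->
  N (E p p (iter m f a) - (kap + m%:R * ((p == i.+1)%:R - (p == i)%:R)) *: iter m f a).
Proof.
move=> sN pn h; have okf := okf oki; elim: m => [|m IH] /=.
  by rewrite mul0r addr0.
have e : E p p (f (iter m f a)) =
   f (E p p (iter m f a)) + ((p == i.+1)%:R - (p == i)%:R) *: f (iter m f a).
  rewrite op_rel ?okpp //; set x := iter m f a.
  have -> : (p == i.+1)%:R *: E p i x = (p == i.+1)%:R *: f x.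
    by case: eqP => [->|]; rewrite ?scale0r.
  have -> : (i == p)%:R *: E i.+1 p x = (p == i)%:R *: f x.
    by rewrite eq_sym; case: eqP => [->|]; rewrite ?scale0r.
  by rewrite scalerBl.
move: (sN.2 _ _ okf _ IH); apply: prop_eq; rewrite e opB opZ -[m.+1]addn1 natrD.
lmod; ring.
Qed.

Lemma sl2_ef (N : M -> Prop) a k1 k2 m : submod E N ->
  N (E i i.+1 a) -> N (E i i a - k1 *: a) -> N (E i.+1 i.+1 a - k2 *: a) ->
  N (E i i.+1 (iter m.+1 f a) - (m.+1%:R * (k1 - k2 - m%:R)) *: iter m f a).
Proof.
move=> sN h0 h1 h2; have okf := okf oki.
have ni := okp_l oki; have ni1 := okp_r oki; have sN' := sN.1.
have nei : (i == i.+1) = false by rewrite ltn_eqF.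
elim: m => [|m IH].
  rewrite /= op_rel // !eqxx !scale1r.
  have h3 := sN.2 _ _ okf _ h0.
  have -> : f (E i i.+1 a) + (E i i a - E i.+1 i.+1 a) - (1 * (k1 - k2 - 0)) *: a =
    f (E i i.+1 a) + ((E i i a - k1 *: a) - (E i.+1 i.+1 a - k2 *: a)) by lmod; ring.
  by apply: subD => //; apply: subB.
have w1 := iter_wt m.+1 sN ni h1; have w2 := iter_wt m.+1 sN ni1 h2.
rewrite iterS op_rel // !eqxx !scale1r.
move: w1 w2; rewrite nei !eqxx eq_sym nei /=; set x := iter m.+1 f a => w1 w2.
have {}IH := sN.2 _ _ okf _ IH.
have := subD sN' IH (subB sN' w1 w2); apply: prop_eq.
rewrite opB opZ -/(iter m.+1 f a) -/x -[m.+2]addn1 -[m.+1]addn1 !natrD mulr0n mulr1n.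
lmod; ring.
Qed.

End Coherence.

(** * Comparison of growth between highest weights *)

Section Moves.
Variables (K : numFieldType) (n : nat) (bl : nat -> nat).
Hypothesis bl_mono : forall p q, (p <= q)%N -> (q < n)%N -> (bl p <= bl q)%N.
Local Notation okp := (okp n bl).
Local Notation rep := (rep (K := K) n bl).
Local Notation hwm := (@hwm K n bl).
Local Notation hE := (@hE K n bl _).
Local Notation hN A := (@hN K n bl _ A).
Local Notation hv := (@hv K n bl _).

Definition Gle (lam mu : nat -> K) : Prop :=
  forall A : hwm lam, irr A -> forall B : hwm mu, irr B -> gle A B.

Lemma Gle_intro lam mu :
  (forall A : hwm lam, irr A -> exists B : hwm mu, gle A B) -> Gle lam mu.
Proof.
move=> h A iA B iB; have [C gC] := h A iA.
exact: gle_trans gC (gle_irr C iB).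
Qed.

Lemma exists_irr_hwm lam : exists A : hwm lam, irr A.
Proof.
by have [A _] := exists_verma n bl lam; have [B iB _] := exists_irr A; exists B.
Qed.

Lemma Gle_trans mu lam nu : Gle lam mu -> Gle mu nu -> Gle lam nu.
Proof.
move=> h1 h2 A iA C iC; have [B iB] := exists_irr_hwm mu.
exact: gle_trans (h1 A iA B iB) (h2 B iB C iC).
Qed.

Lemma okp_between p q r : okp p r -> (p <= q <= r)%N -> okp p q /\ okp q r.
Proof.
case/and3P=> pn rn /eqP e /andP[pq qr].
have h1 := bl_mono pq (leq_ltn_trans qr rn); have h2 := bl_mono qr rn.
have e2 : bl p = bl q by apply/eqP; rewrite eqn_leq h1 e h2.
by rewrite /okp pn rn (leq_ltn_trans qr rn) -e -e2 e eqxx.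
Qed.

Lemma ishw_simple (M : lmodType K) (E : rep M) N v lam :
  submod E N -> ~ N v ->
  (forall j, okp j j.+1 -> N (E j j.+1 v)) ->
  (forall p, (p < n)%N -> N (E p p v - lam p *: v)) -> ishw E N v lam.
Proof.
move=> sN vN up dg; split => // p q.
elim: q => // q IH h; rewrite ltnS leq_eqVlt => /predU1P[e|lt]; first by rewrite e in h *; exact: up.
have [h1 h2] := okp_between h (introT andP (conj (ltnW lt) (leqnSn q))).
have : E p q.+1 v = E p q (E q q.+1 v) - E q q.+1 (E p q v).
  by rewrite op_rel // eqxx scale1r (gtn_eqF (ltnW lt : (p < q.+1)%N)) scale0r subr0 addrC addKr.
move=> ->; apply: subB; first exact: sN.1.
  by apply: sN.2 => //; exact: up.
by apply: sN.2 => //; exact: IH.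
Qed.

Section Growth.
Variables (lam : nat -> K) (A : hwm lam) (i : nat) (c : K).
Hypothesis oki : okp i i.+1.
Local Notation M := (hM A).
Local Notation f := (hE A i.+1 i).

(** The fractions that vanish in the localization of the quotient. *)
Definition evN (s : int -> M) : Prop :=
  exists k0 : nat, forall k, (k0 <= k)%N -> hN A (s (Posz k)).

Lemma evN_submod : submod (loc_rep (hE A) oki c) evN.
Proof.
have sN := hss A; split.
  split; first by exists 0%N => k _; exact: sub0.
  move=> a s t [k1 h1] [k2 h2]; exists (maxn k1 k2) => k; rewrite geq_max => /andP[l1 l2].
  by rewrite !fctE; apply: sN.2; [exact: h1|exact: h2].
move=> p q h s [k0 hk]; exists (k0 + 2)%N => k lk.
have e1 : Posz k - 1 = Posz (k - 1) by lia.
have e2 : Posz k - 2 = Posz (k - 2) by lia.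
apply: (loc_sub oki) => //; rewrite ?e1 ?e2; [exact: hsub|apply: hk; lia..].
Qed.

Definition sB (s : int -> M) (k0 C : nat) : Prop :=
  forall k, (k0 <= k)%N -> Bk (hE A) (hv A) (k + C) (s (Posz k)).

Lemma sB_op p q s k0 C : okp p q -> (q < p)%N -> sB s k0 C ->
  sB (loc_op (hE A) i c p q s) (k0 + 2) (C + 3).
Proof.
move=> h lt hs k hk; rewrite /loc_op /loc.
have okf := okf oki.
have B j b : (k0 <= j)%N -> (j + C <= b)%N -> Bk (hE A) (hv A) b (s (Posz j)).
  by move=> hj hb; apply: Bk_mono (hs j hj).
have e1 : Posz k - 1 = Posz (k - 1) by lia.
have e2 : Posz k - 2 = Posz (k - 2) by lia.
have sb b := Bk_subspace (hE A) (hv A) b.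
have BX b m : Bk (hE A) (hv A) b m -> Bk (hE A) (hv A) b.+1 (hE A p q m) by exact: Bk_op.
have Bf b m : Bk (hE A) (hv A) b m -> Bk (hE A) (hv A) b.+1 (f m) by exact: Bk_op.
have BX1 b m : Bk (hE A) (hv A) b m -> Bk (hE A) (hv A) b.+2 (ad f (hE A p q) m).
  by move=> hm; apply: subB => //; [apply/Bf/BX|apply/BX/Bf].
have BX2 b m : Bk (hE A) (hv A) b m -> Bk (hE A) (hv A) b.+3 (ad f (ad f (hE A p q)) m).
  by move=> hm; apply: subB => //; [apply/Bf/BX1|apply/BX1/Bf].
rewrite e1 e2; apply: subD => //; first apply: subD => //.
- by apply: (Bk_mono (k := (k + C).+1)); [lia|apply: BX; apply: B; lia].
- apply: subZ => //; apply: (Bk_mono (k := (k + C).+2)); [lia|].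
  by apply: BX1; apply: B; lia.
- apply: subZ => //; apply: (Bk_mono (k := (k + C).+3)); [lia|].
  by apply: BX2; apply: B; lia.
Qed.

Variables (mu : nat -> K) (N' : (int -> M) -> Prop) (z : int -> M) (k1 : nat).
Hypothesis hw : ishw (loc_rep (hE A) oki c) N' z mu.
Hypothesis evN' : forall s, evN s -> N' s.
Hypotheses (cz : coh (hE A) i z k1) (bz : sB z k1 k1).

(** A sequence of linear degree that is a highest weight vector in the localization: a power of [f]
growing linearly in [k] clears the denominators of its filtered piece of degree [k]. *)
Lemma loc_growth : gle A (Hwm hw).
Proof.
set E' := loc_rep (hE A) oki c.
have aw w : low n bl w -> coh (hE A) i (act E' w z) (k1 + 2 * size w) /\
     sB (act E' w z) (k1 + 2 * size w) (k1 + 3 * size w).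
  elim: w => [_|[p q] w IH /= /andP[/andP[h lt] /IH[h1 h2]]]; first by rewrite !muln0 !addn0.
  split.
    by apply: coh_mono (coh_op oki c h h1); lia.
  have := sB_op h lt h2 => h3 k hk.
  by apply: Bk_mono (h3 k _); lia.
exists (5 + 2 * k1)%N => k d hd.
have sN := hss A; have sB' := Bk_subspace (hE A) (hv A) ((5 + 2 * k1) * k + (5 + 2 * k1)).
have : dle N' (Bk E' z k) (#|{: unit}| * d).
  apply: (dle_embed (N := hN A) (Q := Bk (hE A) (hv A) ((5 + 2 * k1) * k + (5 + 2 * k1)))
     (ev := fun _ (s : int -> M) => s (Posz (k1 + 2 * k)))) => //.
  - exact: Bk_subspace.
  - move=> m [t lt ->] _; rewrite /comb fct_sumE big_seq; apply: sub_sum => // a /(allP lt) /andP[la sa].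
    have [_ h2] := aw _ la; apply: subZ => //.
    apply: Bk_mono (h2 _ _); nia.
  - move=> m [t lt ->] hm; apply: evN'; exists (k1 + 2 * k)%N => j hj.
    have hc : coh (hE A) i (comb E' t z) (k1 + 2 * k).
      move=> j' hj'; rewrite /comb !fct_sumE op_sum big_seq [RHS]big_seq; apply: eq_bigr => a /(allP lt) /andP[la sa].
      have [h1 _] := aw _ la; rewrite !fctE opZ h1 //; lia.
    rewrite -(subnK hj) (coh_iter _ hc); apply: iter_sub => //; [exact: hsub|exact: hm tt].
apply: dle_mono => //; [exact: (hss (Hwm hw))|exact: Bk_subspace|].
by rewrite card_unit; nia.
Qed.

End Growth.

Lemma torsion_free lam (A : hwm lam) i a : irr A -> okp i i.+1 ->
  (forall m, ~ hN A (iter m (hE A i.+1 i) (hv A))) ->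
  gen (hE A) (hv A) a -> hN A (hE A i.+1 i a) -> hN A a.
Proof.
move=> iA oki tf ga h; apply: contrapT => Na.
have [u gu hu] := iA a ga Na.
have sT := torsion_submod oki (hsub A).
have [m hm] := gen_min sT (ex_intro _ 1%N h) gu.
case: (tf m); have sN := hss A.
have := iter_sub oki m (hsub A) hu.
have -> : iter m (hE A i.+1 i) (u - hv A) = iter m (hE A i.+1 i) u - iter m (hE A i.+1 i) (hv A).
  by rewrite [u - _]addrC -[- hv A]scaleN1r iter_lin scaleN1r addrC.
by move/(sub_congr sN); apply.
Qed.

(** In the representation of [sl_2] generated by the highest weight vector, raising takes each power
of [f] back to a nonzero multiple of the preceding one. *)
Lemma f_free lam (A : hwm lam) i : okp i i.+1 ->
  (forall m : nat, lam i - lam i.+1 != m%:R) ->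
  forall m, ~ hN A (iter m (hE A i.+1 i) (hv A)).
Proof.
move=> oki h; elim=> [|m IH]; first exact: hvN.
move=> hm; apply: IH.
have := sl2_ef oki m (hsub A) (hraise A oki (ltnSn i)) (hdiag A (okp_l oki)) (hdiag A (okp_r oki)).
have hem := (hsub A).2 _ _ oki _ hm.
move/(sub_congr (hss A))/(_ hem)/(subZ_inv (hss A)); apply.
by rewrite mulf_neq0 ?pnatr_eq0 // subr_eq0.
Qed.

Definition swap_wt (lam : nat -> K) i : nat -> K := fun p =>
  if p == i then lam i.+1 - 1 else if p == i.+1 then lam i + 1 else lam p.

(** The complex power [f ^ (lam_i - lam_(i+1) + 1)] of the highest weight vector is a highest
weight vector in the localization, and a filtered piece of the module that it generates is carried
back into the original module by a power of [f] that grows linearly. *)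
Lemma Gle_swap lam i : okp i i.+1 -> (forall m : nat, lam i - lam i.+1 != m%:R) ->
  Gle lam (swap_wt lam i).
Proof.
move=> oki h; apply: Gle_intro => A iA.
have tf := @f_free _ A _ oki h.
set c := - (lam i - lam i.+1 + 1).
have sN := hss A; have okf := okf oki.
have ni := okp_l oki; have ni1 := okp_r oki.
have dec k : (2 <= k)%N -> exists2 m, k = m.+2 & [/\ Posz k - 1 = Posz m.+1, Posz k - 2 = Posz m
     & (Posz m.+2)%:~R = m%:R + 2 :> K].
  case: k => [|[|m]] // _; exists m => //; split; [lia|lia|].
  by rewrite -[m.+2]addn2 -pmulrn natrD.
have hw : ishw (loc_rep (hE A) oki c) (@evN _ A) (emb (hE A) i (hv A)) (swap_wt lam i).
  apply: ishw_simple.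
  - exact: evN_submod.
  - by case=> k0 /(_ k0 (leqnn k0)); exact: tf.
  - move=> j okj; exists 2%N => k hk.
    have [m ek [e1 e2 e3]] := dec k hk.
    have [ji|ji] := eqVneq j i; last first.
      have a0 : ad (hE A i.+1 i) (hE A j j.+1) = fun=> 0.
        by apply: adE_notin.
      rewrite /= /loc_op /loc a0 scaler0 addr0 /ad op0 subrr scaler0 addr0.
      have cm x : hE A j j.+1 (hE A i.+1 i x) = hE A i.+1 i (hE A j j.+1 x).
        by have := congr1 (fun g => g x) a0; rewrite /ad => /eqP; rewrite subr_eq0 => /eqP.
      have -> : hE A j j.+1 (iter k (hE A i.+1 i) (hv A)) = iter k (hE A i.+1 i) (hE A j j.+1 (hv A)).
        by elim: (k) => //= k' <-; rewrite cm.
      by apply: iter_sub => //; [exact: hsub|exact: hraise].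
    rewrite ji /= /loc_op /loc e1 e2 ek e3 /=.
    set y := iter m _ _.
    have nei : (i == i.+1) = false by rewrite ltn_eqF.
    rewrite adE // ad2E // !eqxx !scale1r.
    have s1 := sl2_ef oki m.+1 (hsub A) (hraise A oki (ltnSn i)) (hdiag A ni) (hdiag A ni1).
    have w1 := iter_wt oki m.+1 (hsub A) ni (hdiag A ni).
    have w2 := iter_wt oki m.+1 (hsub A) ni1 (hdiag A ni1).
    move: s1 w1 w2; rewrite nei !eqxx [i.+1 == i]eq_sym nei /= -/y => s1 w1 w2.
    have := subB sN s1 (subZ sN (c + (m%:R + 2)) (subB sN w1 w2)).
    apply: prop_eq; rewrite -[m.+2]addn2 -[m.+1]addn1 !natrD /c.
    by lmod_with K (hM A); field.
  - move=> p pn; exists 2%N => k hk.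
    have [m ek [e1 e2 e3]] := dec k hk.
    have h0 : (p == i) && (p == i.+1) = false.
      by case: eqP => // ->; rewrite ltn_eqF.
    have z0 : 2 * (p == i)%:R * (p == i.+1)%:R = 0 :> K.
      by case: eqP => [->|_]; rewrite ?mulr0 ?mul0r // ltn_eqF // mulr0.
    rewrite !fctE /= /loc_op /loc e1 e2 adE ?okpp // ad2E ?okpp // z0 oppr0 scale0r scaler0 addr0.
    rewrite ek e3 /=; set y := iter m _ _.
    have -> : (p == i)%:R *: hE A i.+1 p (hE A i.+1 i y) = (p == i)%:R *: hE A i.+1 i (hE A i.+1 i y).
      by case: eqP => [->|]; rewrite ?scale0r.
    have -> : (p == i.+1)%:R *: hE A p i (hE A i.+1 i y) = (p == i.+1)%:R *: hE A i.+1 i (hE A i.+1 i y).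
      by case: eqP => [->|]; rewrite ?scale0r.
    have w := iter_wt oki m.+2 (hsub A) pn (hdiag A pn).
    move: w; rewrite /= -/y; apply: prop_eq.
    rewrite /swap_wt /c -[m.+2]addn2 natrD; move: h0.
    case: eqP => [->|_] /=.
      by rewrite ltn_eqF // => _; rewrite /= ?mulr0n ?mulr1n; lmod_with K (hM A); ring.
    by case: eqP => [->|_] _; rewrite /= ?mulr0n ?mulr1n; lmod_with K (hM A); ring.
exists (Hwm hw); apply: (loc_growth (k1 := 0%N)) => //.
move=> k _; have -> : emb (hE A) i (hv A) (Posz k) = act (hE A) (nseq k (i.+1, i)) (hv A).
  by elim: k => //= k ->.
apply: Bk_act; last by rewrite size_nseq addn0.
by rewrite /low all_nseq okf ltnSn orbT.
Qed.

End Moves.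

(** * Two adjacent simple roots *)

Section Adjacent.
Variables (K : numFieldType) (n : nat) (bl : nat -> nat).
Local Notation okp := (okp n bl).
Local Notation rep := (rep (K := K) n bl).
Variables (M : lmodType K) (E : rep M) (a b : nat).
Hypotheses (oka : okp a a.+1) (okb : okp b b.+1).
Hypothesis adj : (b == a.+1) || (a == b.+1).
Local Ltac lmod := lmod_with K M.
Local Notation f := (E b.+1 b).
Local Notation h := (E a.+1 a).

(** The lowering operator of the sum of the two simple roots, up to sign: it commutes with both
simple lowering operators, whichever of [a] and [b] comes first. *)
Definition gop m := h (f m) - f (h m).
Local Notation g := gop.

Lemma gop_lin : linear g.
Proof. by move=> k x y; rewrite /gop !opE; lmod; ring. Qed.

Lemma gopE : exists sg t, [/\ okp t t.+2, t \in [:: a; b], t.+1 \in [:: a; b] &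
  forall m, g m = sg *: E t.+2 t m].
Proof.
have okfb := okf okb; have okfa := okf oka.
rewrite /gop; case/orP: adj => /eqP e.
  exists (-1), a; split; try by rewrite !inE ?e eqxx ?orbT.
    by apply: (okp_trans oka); rewrite -e.
  move=> m; rewrite (op_rel E okfa okfb) e eqxx scale1r [a == a.+2]ltn_eqF // scale0r.
  by rewrite sub0r addrC addKr scaleN1r.
exists 1, b; split; try by rewrite !inE ?e eqxx ?orbT.
  by apply: (okp_trans okb); rewrite -e.
move=> m; rewrite (op_rel E okfa okfb) e eqxx scale1r [b == b.+2]ltn_eqF // scale0r.
by rewrite subr0 addrC addKr.
Qed.

Lemma hf m : h (f m) = f (h m) + g m.
Proof. by rewrite /gop addrC subrK. Qed.

Lemma gsub (N : M -> Prop) m : submod E N -> N m -> N (g m).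
Proof.
move=> sN hm; have [s [t [ok _ _ ->]]] := gopE; apply: subZ; first exact: sN.1.
by apply: sN.2 => //; rewrite okpC.
Qed.

Lemma nab : (a == b) = false.
Proof. by case/orP: adj => /eqP ->; lia. Qed.

Lemma fg m : f (g m) = g (f m).
Proof.
have okfb := okf okb; have okfa := okf oka.
have [s [t [ok ta tb eg]]] := gopE; have okt : okp t.+2 t by rewrite okpC.
rewrite !eg opZ (op_rel E okfb okt).
have -> : (b == t.+2) = false.
  by move: ta tb; rewrite !inE; case/orP: adj => /eqP ->; lia.
have -> : (t == b.+1) = false.
  by move: ta tb; rewrite !inE; case/orP: adj => /eqP ->; lia.
by rewrite !scale0r subrr addr0.
Qed.

Lemma hg m : h (g m) = g (h m).
Proof.
have okfb := okf okb; have okfa := okf oka.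
have [s [t [ok ta tb eg]]] := gopE; have okt : okp t.+2 t by rewrite okpC.
rewrite !eg opZ (op_rel E okfa okt).
have -> : (a == t.+2) = false.
  by move: ta tb; rewrite !inE; case/orP: adj => /eqP ->; lia.
have -> : (t == a.+1) = false.
  by move: ta tb; rewrite !inE; case/orP: adj => /eqP ->; lia.
by rewrite !scale0r subrr addr0.
Qed.

Lemma comm_ef p q m : okp p p.+1 -> okp q q.+1 -> p != q ->
  E p p.+1 (E q.+1 q m) = E q.+1 q (E p p.+1 m).
Proof.
move=> hp hq pq; rewrite (op_rel E hp (okf hq)) eqSS (negbTE pq) eq_sym (negbTE pq).
by rewrite !scale0r subrr addr0.
Qed.

Lemma ef p m : okp p p.+1 ->
  E p p.+1 (E p.+1 p m) = E p.+1 p (E p p.+1 m) + (E p p m - E p.+1 p.+1 m).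
Proof. by move=> hp; rewrite (op_rel E hp (okf hp)) !eqxx !scale1r. Qed.

Definition rt (i p : nat) : K := (p == i.+1)%:R - (p == i)%:R.

Lemma wt_f i p m : okp i i.+1 -> (p < n)%N ->
  E p p (E i.+1 i m) = E i.+1 i (E p p m) + rt i p *: E i.+1 i m.
Proof.
move=> hi pn; rewrite op_rel ?okpp ?(okf hi) // /rt scalerBl.
have -> : (p == i.+1)%:R *: E p i m = (p == i.+1)%:R *: E i.+1 i m.
  by case: eqP => [->|]; rewrite ?scale0r.
have -> // : (i == p)%:R *: E i.+1 p m = (p == i)%:R *: E i.+1 i m.
by rewrite eq_sym; case: eqP => [->|]; rewrite ?scale0r.
Qed.

Lemma rtii i : rt i i = -1.
Proof. by rewrite /rt eqxx ltn_eqF // sub0r. Qed.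
Lemma rtiS i : rt i i.+1 = 1.
Proof. by rewrite /rt eqxx gtn_eqF // subr0. Qed.
Lemma rt_ab : rt a b - rt a b.+1 = 1.
Proof.
have e t : (t == t.+2) = false /\ (t.+2 == t) = false by lia.
rewrite /rt eqSS [b == a]eq_sym nab; case/orP: adj => /eqP ->;
  by rewrite eqxx ?(e a).1 ?(e a).2 ?(e b).1 ?(e b).2 /= ?mulr0n ?mulr1n; ring.
Qed.
Lemma rt_ba : rt b a - rt b a.+1 = 1.
Proof.
have e t : (t == t.+2) = false /\ (t.+2 == t) = false by lia.
rewrite /rt eqSS nab; case/orP: adj => /eqP ->;
  by rewrite eqxx ?(e a).1 ?(e a).2 ?(e b).1 ?(e b).2 /= ?mulr0n ?mulr1n; ring.
Qed.

Lemma ebg m : E b b.+1 (g m) = g (E b b.+1 m) - h m.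
Proof.
have nab' := nab.
have ba : b != a by rewrite eq_sym nab.
have bn := okp_l okb; have bn1 := okp_r okb.
rewrite /gop opB comm_ef // !ef // comm_ef // !opE.
rewrite !wt_f // -[h m in RHS]scale1r -rt_ab; lmod; ring.
Qed.

Lemma eag m : E a a.+1 (g m) = g (E a a.+1 m) + f m.
Proof.
have an := okp_l oka; have an1 := okp_r oka.
have ab : a != b by rewrite nab.
rewrite /gop opB [E a a.+1 (f (h m))]comm_ef // !ef // comm_ef // !opE.
rewrite !wt_f // -[f m in RHS]scale1r -rt_ba; lmod; ring.
Qed.

Lemma wt_g p m : (p < n)%N -> E p p (g m) = g (E p p m) + (rt a p + rt b p) *: g m.
Proof.
move=> pn; by rewrite /gop opB !wt_f // !opE; lmod; ring.
Qed.

Lemma comm_eg j m : okp j j.+1 -> j != a -> j != b -> E j j.+1 (g m) = g (E j j.+1 m).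
Proof. by move=> hj ja jb; rewrite /gop opB !comm_ef. Qed.

Lemma iter_fg l m : iter l f (g m) = g (iter l f m).
Proof. by elim: l => //= l ->; rewrite fg. Qed.

Lemma iter_gD j l m : iter j g (iter l f m) = iter l f (iter j g m).
Proof. by elim: j => //= j ->; rewrite iter_fg. Qed.

Lemma h_iter_g j m : h (iter j g m) = iter j g (h m).
Proof. by elim: j => //= j <-; rewrite hg. Qed.

Lemma iterg_lin j : linear (iter j g).
Proof. by move=> k x y; elim: j => //= j ->; rewrite gop_lin. Qed.

Lemma h_iter_f l m : h (iter l.+1 f m) = iter l.+1 f (h m) + l.+1%:R *: g (iter l f m).
Proof.
elim: l => [|l IH]; first by rewrite /= hf scale1r.
rewrite iterS hf IH opD opZ fg -!iterS -[l.+2]addn1 natrD; lmod; ring.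
Qed.

Lemma eb_iter_g j m :
  E b b.+1 (iter j.+1 g m) = iter j.+1 g (E b b.+1 m) - j.+1%:R *: iter j g (h m).
Proof.
elim: j => [|j IH]; first by rewrite /= ebg scale1r.
rewrite iterS ebg IH h_iter_g (linopD gop_lin) (linopN gop_lin) (linopZ gop_lin) -!iterS.
by rewrite -[j.+2]addn1 natrD; lmod; ring.
Qed.

Lemma ea_iter_g j m :
  E a a.+1 (iter j.+1 g m) = iter j.+1 g (E a a.+1 m) + j.+1%:R *: iter j g (f m).
Proof.
elim: j => [|j IH]; first by rewrite /= eag scale1r.
have e : f (iter j.+1 g m) = iter j.+1 g (f m).
  by elim: (j.+1) => //= j' <-; rewrite fg.
rewrite iterS eag IH e (linopD gop_lin) (linopZ gop_lin) -!iterS.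
by rewrite -[j.+2]addn1 natrD; lmod; ring.
Qed.

End Adjacent.

Section Straighten.
Variables (K : numFieldType) (n : nat) (bl : nat -> nat).
Local Notation okp := (okp n bl).
Local Notation rep := (rep (K := K) n bl).
Variables (M : lmodType K) (E : rep M) (a b : nat).
Hypotheses (oka : okp a a.+1) (okb : okp b b.+1).
Hypothesis adj : (b == a.+1) || (a == b.+1).
Local Ltac lmod := lmod_with K M.
Local Notation f := (E b.+1 b).
Local Notation h := (E a.+1 a).
Local Notation g := (gop E a b).

(** Ordered monomials in the lowering operators of the rank two subalgebra. *)
Definition T (j l r : nat) (w : M) : M := iter j g (iter l f (iter r h w)).

Lemma hT j l r w : h (T j l.+1 r w) = T j l.+1 r.+1 w + l.+1%:R *: T j.+1 l r w.
Proof.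
rewrite /T h_iter_g // h_iter_f // (linopD (iterg_lin E a b j)) (linopZ (iterg_lin E a b j)).
congr (_ + _ *: _); last by rewrite -iterSr.
Qed.

Lemma hT0 j r w : h (T j 0 r w) = T j 0 r.+1 w.
Proof. by rewrite /T h_iter_g. Qed.

Lemma fT j l r w : f (T j l r w) = T j l.+1 r w.
Proof. by rewrite /T !iter_gD. Qed.

Lemma gT j l r w : g (T j l r w) = T j.+1 l r w.
Proof. by []. Qed.

Lemma iter_hf m j w :
  iter m h (iter j f w) = \sum_(c < j.+1) ('C(m, c) * j ^_ c)%:R *: T c (j - c) (m - c) w.
Proof.
elim: m => [|m IH].
  rewrite big_ord_recl big1 ?addr0 /=; last by move=> i _; rewrite mul0n scale0r.
  by rewrite bin0 ffactn0 subn0 /= scale1r.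
rewrite iterS IH op_sum.
have e (c : 'I_j.+1) : h (('C(m, c) * j ^_ c)%:R *: T c (j - c) (m - c) w) =
   ('C(m, c) * j ^_ c)%:R *: T c (j - c) (m.+1 - c) w
   + (if (c < j)%N then ('C(m, c) * j ^_ c.+1)%:R *: T c.+1 (j - c.+1) (m - c) w else 0).
  have [mc|cm] := ltnP m c.
    by rewrite bin_small // !mul0n !scale0r op0; case: ifP; rewrite !addr0.
  rewrite opZ subSn //; case: ifP => cj.
    rewrite -(subnSK cj) hT subnSK // scalerDr scalerA -natrM; congr (_ + _%:R *: _).
    by rewrite ffactnSr mulnA.
  have -> : (j - c)%N = 0%N by have := ltn_ord c; lia.
  by rewrite hT0 addr0.
under eq_bigr do rewrite e; rewrite big_split /=.
rewrite [in X in _ + X]big_ord_recr /= ltnn addr0.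
rewrite big_ord_recl [RHS]big_ord_recl /= -addrA; congr (_ + _); first by rewrite !bin0.
rewrite -big_split /=; apply: eq_bigr => c _; rewrite /bump /= !add1n subSS ltn_ord.
by rewrite -scalerDl -natrD -mulnDl binS.
Qed.

Section Germs.
Local Notation D := (loc_rep E okb 0).

Lemma locF s k : loc_op E b 0 b.+1 b s k = f (s k).
Proof.
rewrite /loc_op /loc.
have e m : ad f f m = 0 by rewrite /ad subrr.
have -> : ad f f = fun=> 0 by apply: funext.
by rewrite /ad op0 subrr !scaler0 !addr0.
Qed.

Lemma locA s k : loc_op E b 0 a.+1 a s k = h (s k) - k%:~R *: g (s (k - 1)).
Proof.
rewrite /loc_op /loc add0r.
have -> : ad f h = fun m => - g m by apply: funext => m; rewrite /ad /gop opprB.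
by rewrite /ad opN fg // opprK addNr scaler0 addr0 scalerN.
Qed.

(** The fraction [f^(-sg) y]. *)
Definition germ (sg : nat) (y : M) : int -> M :=
  fun k => if k is Posz m then if (sg <= m)%N then iter (m - sg) f y else 0 else 0.

(** The monomial [h^m f^(-sg)] is straightened as for a natural exponent of [f], since [h] and [f]
commute up to the central [g]; the binomial coefficients of the negative exponent appear as
products. *)
Lemma iter_germ sg y m k : (sg + m <= k)%N ->
  iter m (D a.+1 a) (germ sg y) (Posz k) =
  \sum_(c < m.+1) ('C(m, c)%:R * \prod_(i < c) - (sg + i)%:R) *: T c (k - sg - c) (m - c) y.
Proof.
elim: m k => [|m IH] k hk.
  rewrite big_ord1 /= bin0 big_ord0 mulr1 scale1r /T /= !subn0.
  by rewrite ifT //; lia.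
rewrite iterS [LHS]locA IH; last by lia.
have -> : Posz k - 1 = Posz k.-1 by lia.
rewrite IH; last by lia.
have Zg := linopZ (gop_lin E a b).
have -> : g (\sum_(c < m.+1) ('C(m, c)%:R * \prod_(i < c) - (sg + i)%:R) *: T c (k.-1 - sg - c) (m - c) y) =
   \sum_(c < m.+1) ('C(m, c)%:R * \prod_(i < c) - (sg + i)%:R) *: T c.+1 (k.-1 - sg - c) (m - c) y.
  elim/big_rec2: _ => [|i y1 y2 _ <-]; first exact: linop0 (gop_lin E a b).
  by rewrite (linopD (gop_lin E a b)) Zg gT.
rewrite op_sum scaler_sumr -sumrB.
have e (c : 'I_m.+1) :
   h (('C(m, c)%:R * \prod_(i < c) - (sg + i)%:R) *: T c (k - sg - c) (m - c) y)
   - (Posz k)%:~R *: (('C(m, c)%:R * \prod_(i < c) - (sg + i)%:R) *: T c.+1 (k.-1 - sg - c) (m - c) y) =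
   ('C(m, c)%:R * \prod_(i < c) - (sg + i)%:R) *: T c (k - sg - c) (m.+1 - c) y
   + ('C(m, c)%:R * \prod_(i < c.+1) - (sg + i)%:R) *: T c.+1 (k - sg - c.+1) (m - c) y.
  have cm : (c <= m)%N by rewrite -ltnS.
  have ek : (k - sg - c)%N = (k - sg - c.+1).+1 by lia.
  have -> : (k.-1 - sg - c)%N = (k - sg - c.+1)%N by lia.
  rewrite opZ ek hT -ek subSn // big_ord_recr /=.
  have -> : (k - sg - c)%:R = (Posz k)%:~R - (sg + c)%:R :> K.
    by rewrite -pmulrn -natrB; [congr (_%:R); lia|lia].
  lmod; ring.
rewrite (eq_bigr _ (fun c _ => e c)) big_split /=.
rewrite big_ord_recl [RHS]big_ord_recl /= -addrA; congr (_ + _).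
  by rewrite !bin0.
transitivity (\sum_(c < m.+1) ('C(m, c.+1)%:R * \prod_(i < c.+1) - (sg + i)%:R) *: T c.+1 (k - sg - c.+1) (m - c) y
  + \sum_(c < m.+1) ('C(m, c)%:R * \prod_(i < c.+1) - (sg + i)%:R) *: T c.+1 (k - sg - c.+1) (m - c) y).
  congr (_ + _); rewrite big_ord_recr /= bin_small // mul0r scale0r addr0.
  by apply: eq_bigr => c _; rewrite /bump /= !add1n subSS.
rewrite -big_split /=; apply: eq_bigr => c _; rewrite /bump /= !add1n subSS.
by rewrite -scalerDl -mulrDl -natrD binS.
Qed.

End Germs.
End Straighten.

(** * Comparison of growth for Knuth moves *)

Section Knuth.
Variables (K : numFieldType) (n : nat) (bl : nat -> nat).
Hypothesis bl_mono : forall p q, (p <= q)%N -> (q < n)%N -> (bl p <= bl q)%N.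
Local Notation okp := (okp n bl).
Local Notation rep := (rep (K := K) n bl).
Local Notation hwm := (@hwm K n bl).
Local Notation hE := (@hE K n bl _).
Local Notation hN A := (@hN K n bl _ A).
Local Notation hv := (@hv K n bl _).

(** The raising operators of the other roots are commutators of these. *)
Lemma simple_up (M : lmodType K) (E : rep M) N v : submod E N ->
  (forall j, okp j j.+1 -> N (E j j.+1 v)) ->
  forall p q, okp p q -> (p < q)%N -> N (E p q v).
Proof.
move=> sN up p q; elim: q => // q IH h; rewrite ltnS leq_eqVlt.
case/predU1P => [e|lt]; first by rewrite e in h *; exact: up.
have [h1 h2] := okp_between bl_mono h (introT andP (conj (ltnW lt) (leqnSn q))).
have -> : E p q.+1 v = E p q (E q q.+1 v) - E q q.+1 (E p q v).
  rewrite op_rel // eqxx scale1r (gtn_eqF (ltnW lt : (p < q.+1)%N)) scale0r.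
  by rewrite subr0 addrC addKr.
apply: subB; first exact: sN.1.
  by apply: sN.2 => //; exact: up.
by apply: sN.2 => //; exact: IH.
Qed.

Lemma irr_singular_simple lam kap (A : hwm lam) x p : irr A -> gen (hE A) (hv A) x ->
  (forall j, okp j j.+1 -> hN A (hE A j j.+1 x)) ->
  (forall p, (p < n)%N -> hN A (hE A p p x - kap p *: x)) ->
  (p < n)%N -> kap p != lam p -> hN A x.
Proof.
move=> iA gx up dg pn kp; apply: (irr_singular iA gx _ dg pn kp).
exact: simple_up (hsub A) up.
Qed.

(** The next power of [f] applied to the highest weight vector is singular of another weight,
hence vanishes in an irreducible module. *)
Lemma irr_int lam (A : hwm lam) i m : irr A -> okp i i.+1 ->
  lam i - lam i.+1 = m%:R -> hN A (iter m.+1 (hE A i.+1 i) (hv A)).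
Proof.
move=> iA oki e; have sN := hsub A.
have ni := okp_l oki; have ni1 := okp_r oki.
apply: (irr_singular_simple (kap := fun p => lam p + m.+1%:R * rt K i p) (p := i) iA) => //.
- apply: iter_sub => //; [exact: gen_submod|exact: gen_refl].
- move=> j okj; have [->|ji] := eqVneq j i.
    have := sl2_ef oki m sN (hraise A oki (ltnSn i)) (hdiag A ni) (hdiag A ni1).
    by rewrite e subrr mulr0 scale0r subr0.
  have -> : forall l, hE A j j.+1 (iter l (hE A i.+1 i) (hv A)) = iter l (hE A i.+1 i) (hE A j j.+1 (hv A)).
    by elim=> //= l <-; rewrite comm_ef.
  by apply: iter_sub => //; exact: hraise.
- move=> p pn; exact: (iter_wt oki m.+1 sN pn (hdiag A pn)).
- by rewrite rtii mulrN1 -subr_eq0 addrAC subrr add0r oppr_eq0 pnatr_eq0.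
Qed.

Lemma irr_int_neq lam (A : hwm lam) i m j : okp i i.+1 ->
  lam i - lam i.+1 = m%:R -> (j <= m)%N -> ~ hN A (iter j (hE A i.+1 i) (hv A)).
Proof.
move=> oki e; elim: j => [_|j IH jm h]; first exact: hvN.
apply: (IH (ltnW jm)); have sN := hsub A.
have := sl2_ef oki j sN (hraise A oki (ltnSn i)) (hdiag A (okp_l oki)) (hdiag A (okp_r oki)).
have hem := sN.2 _ _ oki _ h.
move/(sub_congr (hss A))/(_ hem)/(subZ_inv (hss A)); apply.
rewrite mulf_neq0 ?pnatr_eq0 // e subr_eq0 eqr_nat; lia.
Qed.

(** The setting of a Knuth move: for one of two adjacent simple roots the weight is dominant
integral, for the other one it is negative integral. The module is localized at [f], the lowering
operator of the root [b], and a highest weight vector of weight [swap_wt lam a] is constructed in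
the quotient of the localization by the original module. *)

Variables (lam : nat -> K) (A : hwm lam) (a b d0 s : nat).
Hypotheses (iA : irr A) (oka : okp a a.+1) (okb : okp b b.+1).
Hypothesis adj : (b == a.+1) || (a == b.+1).
Hypotheses (lama : lam a - lam a.+1 = d0%:R) (lamb : lam b - lam b.+1 = - s%:R - 1).
Hypothesis sd : (s <= d0)%N.
Local Notation M := (hM A).
Local Notation E := (hE A).
Local Notation v := (hv A).
Local Notation N := (hN A).
Local Notation f := (E b.+1 b).
Local Notation h := (E a.+1 a).
Local Notation g := (gop E a b).
Local Notation D := (loc_rep E okb 0).
Local Notation evN := (@evN _ _ _ _ A).
Local Notation TE := (T E a b).
Local Notation TD := (T (loc_rep E okb 0) a b).
Local Notation d' := (d0.+1 - s)%N.
Local Ltac lmod := lmod_with K (hM A).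
Let sN := hsub A.
Let sN' := hss A.
Let sev : submod D evN := evN_submod A 0 okb.

Lemma fb_free m : ~ N (iter m f v).
Proof.
apply: f_free => // k; rewrite lamb -opprD -[1]/(1%:R) -natrD addn1 eqr_oppLR.
by rewrite -subr_eq0 opprK -natrD pnatr_eq0.
Qed.

Lemma f_inj m x : gen E v x -> N (iter m f x) -> N x.
Proof.
move=> gx; elim: m => //= m IH hm; apply: IH.
apply: (torsion_free iA okb fb_free) hm.
by apply: iter_sub gx => //; exact: gen_submod.
Qed.

Lemma evN_eq (x y : int -> M) k0 : (forall k, (k0 <= k)%N -> x (Posz k) = y (Posz k)) ->
  evN (x - y).
Proof. by move=> e; exists k0 => k hk; rewrite !fctE e // subrr; exact: sub0. Qed.

Definition genS (x : int -> M) := forall k, gen E v (x k).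

Lemma genS_submod : submod D genS.
Proof.
have [g1 g2] := gen_submod E v; split.
  split; first by move=> k; exact: sub0.
  by move=> k x y hx hy j; apply: g1.2; [exact: hx|exact: hy].
by move=> p q ok x hx k; apply: loc_sub.
Qed.

Lemma genS_germ sg y : gen E v y -> genS (germ E b sg y).
Proof.
move=> gy [k|k] /=; last exact: sub0 (gen_subspace E v).
case: ifP => _; last exact: sub0 (gen_subspace E v).
by apply: iter_sub => //; exact: gen_submod.
Qed.

Lemma evN_F x : genS x -> evN (D b.+1 b x) -> evN x.
Proof.
move=> gx [k0 hk]; exists k0 => k lk; apply: (@f_inj 1); first exact: gx.
by have := hk k lk; rewrite /= locF.
Qed.

Lemma germ_emb y : emb E b y = germ E b 0 y.
Proof. by apply: funext => -[k|k] //=; rewrite subn0. Qed.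

Lemma germ_lin sg : linear (germ E b sg).
Proof.
move=> c x y; apply: funext => -[k|k] /=; rewrite !fctE /= ?scaler0 ?addr0 //.
by case: ifP => _; rewrite ?scaler0 ?addr0 //; exact: iter_lin.
Qed.

Lemma germ0 sg : germ E b sg 0 = 0.
Proof.
by apply: funext => -[k|k] //=; case: ifP => // _; exact: linop0 (iter_lin E b _).
Qed.

Lemma germZ sg c x : germ E b sg (c *: x) = c *: germ E b sg x.
Proof. by have := germ_lin sg c x 0; rewrite germ0 !addr0. Qed.

Lemma germB sg x y : germ E b sg (x - y) = germ E b sg x - germ E b sg y.
Proof. by rewrite addrC -scaleN1r germ_lin scaleN1r addrC. Qed.

Lemma germ_N sg y : N y -> evN (germ E b sg y).
Proof.
move=> h; exists 0%N => k _ /=; case: ifP => _; last exact: sub0.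
exact: iter_sub.
Qed.

Lemma germ_congr sg x y : N (x - y) -> evN (germ E b sg x - germ E b sg y).
Proof.
move=> h; have := germ_N sg h; apply: prop_eq.
by rewrite germB.
Qed.

Lemma germ_eb sg y kb kb1 : N (E b b.+1 y) -> N (E b b y - kb *: y) ->
  N (E b.+1 b.+1 y - kb1 *: y) ->
  evN (D b b.+1 (germ E b sg y) - (- sg%:R * (kb - kb1 + sg%:R + 1)) *: germ E b sg.+1 y).
Proof.
move=> y0 yb yb1; exists (sg + 2)%N => k hk.
have nb := okp_l okb; have nb1 := okp_r okb.
have [m ek] : exists m, k = (sg + m.+2)%N by exists (k - sg - 2)%N; lia.
set u := germ E b sg y.
have u0 : u (Posz k) = iter m.+2 f y by rewrite /u /= ek leq_addr addKn.
have u1 : u (Posz k - 1) = iter m.+1 f y.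
  have -> : Posz k - 1 = Posz (sg + m.+1) by lia.
  by rewrite /u /= leq_addr addKn.
have u2 : u (Posz k - 2) = iter m f y.
  have -> : Posz k - 2 = Posz (sg + m) by lia.
  by rewrite /u /= leq_addr addKn.
have u3 : germ E b sg.+1 y (Posz k) = iter m.+1 f y.
  have hs : (sg < k)%N by lia.
  have -> : m.+1 = (k - sg.+1)%N by lia.
  by rewrite /= hs.
rewrite !fctE u3 /= /loc_op /loc u0 u1 u2 add0r.
have neb : (b == b.+1) = false by rewrite ltn_eqF.
rewrite adE // ad2E // !eqxx !scale1r.
have s1 := sl2_ef okb m.+1 sN y0 yb yb1.
have w1 := iter_wt okb m.+1 sN nb yb.
have w2 := iter_wt okb m.+1 sN nb1 yb1.
move: s1 w1 w2; rewrite neb !eqxx [b.+1 == b]eq_sym neb => s1 w1 w2.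
have ek' : (Posz k)%:~R = sg%:R + m%:R + 2 :> K.
  by rewrite ek -pmulrn -[m.+2]addn2 !natrD addrA.
have := subB sN' s1 (subZ sN' (sg%:R + m%:R + 2) (subB sN' w1 w2)).
apply: prop_eq; rewrite ek' -iterS -[m.+2]addn2 -[m.+1]addn1 !natrD /=.
by lmod; field.
Qed.

Lemma germ_ej sg y j : okp j j.+1 -> j != b ->
  D j j.+1 (germ E b sg y) = germ E b sg (E j j.+1 y).
Proof.
move=> okj jb; apply: funext => k; rewrite /= /loc_op /loc.
have -> : ad f (E j j.+1) = fun=> 0 by apply: adE_notin.
rewrite scaler0 addr0 /ad op0 subrr scaler0 addr0; case: k => k /=; last by rewrite op0.
case: ifP => _; last by rewrite op0.
by elim: (k - sg)%N => // l IH; rewrite !iterS -IH comm_ef.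
Qed.

Lemma germ_pp sg y p kap : (p < n)%N -> N (E p p y - kap *: y) ->
  evN (D p p (germ E b sg y) - (kap - sg%:R * rt K b p) *: germ E b sg y).
Proof.
move=> pn yp; exists (sg + 2)%N => k hk; set u := germ E b sg y.
have [m ek] : exists m, k = (sg + m.+2)%N by exists (k - sg - 2)%N; lia.
have u0 : u (Posz k) = iter m.+2 f y by rewrite /u /= ek leq_addr addKn.
have u1 : u (Posz k - 1) = iter m.+1 f y.
  have -> : Posz k - 1 = Posz (sg + m.+1) by lia.
  by rewrite /u /= leq_addr addKn.
rewrite !fctE u0 /= /loc_op /loc u0 u1 add0r.
have adp : ad f (E p p) = fun x => - rt K b p *: f x.
  by apply: funext => x; rewrite /ad wt_f // opprD addrA subrr sub0r scaleNr.
have -> : ad f (ad f (E p p)) = fun=> 0.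
  by apply: funext => x; rewrite adp /ad opZ subrr.
rewrite adp scaler0 addr0.
have w := iter_wt okb m.+2 sN pn yp; move: w; apply: prop_eq.
have -> : (Posz k)%:~R = sg%:R + m.+2%:R :> K by rewrite ek -pmulrn natrD.
by rewrite -/(rt K b p) -iterS; lmod; ring.
Qed.

(** The value [- s - 1] of the weight at [b] makes [f^(-s) v] singular in the localization. *)
Local Notation u := (germ E b s v).

Lemma u_up j : okp j j.+1 -> evN (D j j.+1 u).
Proof.
move=> okj; have [->|jb] := eqVneq j b; last first.
  by rewrite germ_ej //; apply: germ_N; exact: hraise.
have := germ_eb s (hraise A okb (ltnSn b)) (hdiag A (okp_l okb)) (hdiag A (okp_r okb)).
rewrite lamb (_ : - s%:R - 1 + s%:R + 1 = 0); last by ring.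
by rewrite mulr0 scale0r subr0.
Qed.

Lemma u_diag p : (p < n)%N -> evN (D p p u - (lam p - s%:R * rt K b p) *: u).
Proof. by move=> pn; apply: germ_pp => //; exact: hdiag. Qed.

Local Notation FA := (D a.+1 a).
Local Notation F := (D b.+1 b).

Lemma d'gt0 : (0 < d')%N. Proof. by rewrite subn_gt0 ltnS. Qed.

Lemma x_up j : okp j j.+1 -> evN (D j j.+1 (iter d' FA u)).
Proof.
move=> okj; have [->|ja] := eqVneq j a; last first.
  have -> : forall l, D j j.+1 (iter l FA u) = iter l FA (D j j.+1 u).
    by elim=> // l IH; rewrite !iterS -IH comm_ef.
  by apply: iter_sub => //; exact: u_up.
have := sl2_ef oka d'.-1 sev (u_up oka) (u_diag (okp_l oka)) (u_diag (okp_r oka)).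
rewrite (prednK d'gt0).
have -> : lam a - s%:R * rt K b a - (lam a.+1 - s%:R * rt K b a.+1) - d'.-1%:R = 0.
  have -> : d'.-1%:R = d0%:R - s%:R :> K by rewrite -natrB //; congr _%:R; lia.
  by rewrite -lama; have := rt_ba K oka okb adj => /(canRL (subrK _)) ->; ring.
by rewrite mulr0 scale0r subr0.
Qed.

Lemma x_diag p : (p < n)%N ->
  evN (D p p (iter d' FA u) - (lam p - s%:R * rt K b p + d'%:R * rt K a p) *: iter d' FA u).
Proof. by move=> pn; have := iter_wt oka d' sev pn (u_diag pn). Qed.

Lemma y_up j : okp j j.+1 -> evN (D j j.+1 (iter d0.+1 F (iter d' FA u))).
Proof.
move=> okj; have [->|jb] := eqVneq j b; last first.
  have -> : forall l, D j j.+1 (iter l F (iter d' FA u)) = iter l F (D j j.+1 (iter d' FA u)).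
    by elim=> // l IH; rewrite !iterS -IH comm_ef.
  by apply: iter_sub => //; exact: x_up.
have := sl2_ef okb d0 sev (x_up okb) (x_diag (okp_l okb)) (x_diag (okp_r okb)).
have -> : lam b - s%:R * rt K b b + d'%:R * rt K a b -
   (lam b.+1 - s%:R * rt K b b.+1 + d'%:R * rt K a b.+1) - d0%:R = 0.
  have -> : d'%:R = d0%:R + 1 - s%:R :> K by rewrite natrB ?[d0.+1%:R]mulrS ?[1 + _]addrC // ltnW.
  have lb : lam b = lam b.+1 - s%:R - 1 by rewrite -[LHS](subrK (lam b.+1)) lamb; ring.
  have e : rt K a b = 1 + rt K a b.+1 by rewrite -(rt_ab K oka okb adj) subrK.
  by rewrite lb e rtii rtiS; ring.
by rewrite mulr0 scale0r subr0.
Qed.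

(** The vector of the original module obtained from the straightening of [h^d' f^(-s) v] by
clearing the denominators. *)
Definition wvec : M := \sum_(c < d'.+1)
  ('C(d', c)%:R * \prod_(i < c) - (s + i)%:R) *: TE c (d' - c) (d' - c) v.

Lemma gen_T j l r y : gen E v y -> gen E v (TE j l r y).
Proof.
have sg := gen_submod E v => gy; rewrite /T.
elim: j => [|j IH] /=; first by apply: iter_sub => //; exact: iter_sub.
exact: gsub.
Qed.

Lemma y_emb : evN (iter d0.+1 F (iter d' FA u) - emb E b wvec).
Proof.
apply: (@evN_eq _ _ (s + d')) => k hk.
have -> : forall l x, iter l F x (Posz k) = iter l f (x (Posz k)).
  by elim=> //= l IH x; rewrite locF IH.
rewrite iter_germ // /wvec /= .
have linf m := iter_lin E b m.
have sumf m (G : 'I_d'.+1 -> M) : iter m f (\sum_c G c) = \sum_c iter m f (G c).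
  elim/big_rec2: _ => [|i y1 y2 _ <-]; first exact: linop0 (linf m).
  by rewrite (linopD (linf m)).
have fT m j l r y : iter m f (TE j l r y) = TE j (m + l) r y.
  by elim: m => //= m ->; rewrite fT.
rewrite -iterS !sumf; apply: eq_bigr => c _.
rewrite !(linopZ (linf _)) !fT; congr (_ *: TE _ _ _ _).
by have := ltn_ord c; lia.
Qed.

(** The vector [h^d' u] is singular in the localization. A power of [f] brings it into the original
module as a singular vector, which vanishes because its weight is not the highest weight. *)
Lemma x_zero : evN (iter d' FA u).
Proof.
have gw : gen E v wvec.
  apply: sub_sum; first exact: gen_subspace.
  by move=> c _; apply: subZ; [exact: gen_subspace|apply/gen_T/gen_refl].
have ge (X : M -> M) : True by [].
have embN y : gen E v y -> evN (emb E b y) -> N y.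
  by move=> gy [k0 /(_ k0 (leqnn _))] /=; exact: f_inj.
have act_emb p q y : okp p q -> evN (D p q (emb E b y) - emb E b (E p q y)).
  by move=> ok; apply: (@evN_eq _ _ 2) => k hk; rewrite /= emb_act.
have genE p q : okp p q -> gen E v (E p q wvec) by move=> ok; exact: (gen_submod E v).2.
have yw := sub_sym sev.1 y_emb.
pose kap p := lam p - s%:R * rt K b p + d'%:R * rt K a p + d0.+1%:R * rt K b p.
have yd p : (p < n)%N -> evN (D p p (iter d0.+1 F (iter d' FA u)) - kap p *: iter d0.+1 F (iter d' FA u)).
  by move=> pn; have := iter_wt okb d0.+1 sev pn (x_diag pn).
have wN : N wvec.
  have [p pn rp] : exists2 p, (p < n)%N & rt K a p + rt K b p != 0.
    case/orP: adj => /eqP e.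
      exists a; first exact: okp_l oka.
      rewrite rtii /rt e ltn_eqF // [a == a.+1]ltn_eqF // subrr addr0 oppr_eq0 oner_eq0 //.
    exists b; first exact: okp_l okb.
    by rewrite rtii /rt e ltn_eqF // [b == b.+1]ltn_eqF // subrr add0r oppr_eq0 oner_eq0.
  apply: (irr_singular_simple (kap := kap) (p := p) iA) => //.
  - move=> j okj; apply: embN; first exact: genE.
    apply: sub_congr (act_emb _ _ wvec okj) _; first exact: sev.1.
    apply: sub_congr (y_up okj); first exact: sev.1.
    by rewrite -opB; apply: sev.2 => //; exact: y_emb.
  - move=> q qn; apply: embN.
      by apply: subB; [exact: gen_subspace|apply: genE; rewrite okpp|apply: subZ; [exact: gen_subspace|]].
    have -> : emb E b (E q q wvec - kap q *: wvec) = emb E b (E q q wvec) - kap q *: emb E b wvec.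
      by rewrite addrC -scaleNr emb_lin addrC scaleNr.
    have okq : okp q q by rewrite okpp.
    apply: sub_congr (subB sev.1 (yd q qn) (subB sev.1 (sev.2 _ _ okq _ y_emb) (subZ sev.1 (kap q) y_emb))).
      exact: sev.1.
    apply: sub_sym; first exact: sev.1.
    have := sub_sym sev.1 (act_emb _ _ wvec okq); apply: prop_eq.
    by rewrite opB scalerBr; set x := D q q _; lmod_with K (int -> M : lmodType K); ring.
  - rewrite /kap -subr_eq0.
    have -> : lam p - s%:R * rt K b p + d'%:R * rt K a p + d0.+1%:R * rt K b p - lam p =
      d'%:R * (rt K a p + rt K b p).
      by rewrite natrB; [ring|exact: leqW].
    by rewrite mulf_neq0 // pnatr_eq0 -lt0n d'gt0.
have : evN (iter d0.+1 F (iter d' FA u)).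
  apply: sub_congr yw _; first exact: sev.1.
  by exists 0%N => k _; exact: iter_sub.
have gS l : genS (iter l F (iter d' FA u)).
  apply: (iter_sub okb l genS_submod).
  by apply: (iter_sub oka d' genS_submod); apply/genS_germ/gen_refl.
move: gS; set x := iter d' FA u => gS.
by elim: (d0.+1) => // l IH e; apply: IH; apply: (evN_F (gS l)); exact: e.
Qed.


Local Notation G := (gop D a b).
Local Notation Gi j := (iter j G).
Local Notation hv' r := (iter r h v).

Lemma GE x k : G x k = g (x k).
Proof.
rewrite {1}/gop !fctE [D a.+1 a (D b.+1 b x) k]locA // [D b.+1 b (D a.+1 a x) k]locF.
rewrite [D a.+1 a x k]locA // [D b.+1 b x k]locF [D b.+1 b x (k - 1)]locF.
by rewrite opB opZ (fg E oka okb adj) hf; lmod; ring.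
Qed.

Lemma GiE j x k : Gi j x k = iter j g (x k).
Proof. by elim: j => //= j IH; rewrite GE IH. Qed.

Lemma Gi_sub j x : evN x -> evN (Gi j x).
Proof. by move=> hx; elim: j => //= j IH; exact: (gsub oka okb adj sev). Qed.

Lemma GiB j x y : Gi j (x - y) = Gi j x - Gi j y.
Proof. by rewrite (linopD (iterg_lin D a b j)) (linopN (iterg_lin D a b j)). Qed.

Lemma Gi_congr j x y : evN (x - y) -> evN (Gi j x - Gi j y).
Proof.
move=> h; have := Gi_sub j h; apply: prop_eq.
by rewrite GiB.
Qed.

Lemma germ_fa sg y : evN (D a.+1 a (germ E b sg y) - (germ E b sg (h y) - sg%:R *: G (germ E b sg.+1 y))).
Proof.
apply: (@evN_eq _ _ sg.+1) => k hk.
have [m ek] : exists m, k = (sg + m.+1)%N by exists (k - sg - 1)%N; lia.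
rewrite [LHS]locA // !fctE GE.
have -> : germ E b sg y (Posz k) = iter m.+1 f y by rewrite /= ek leq_addr addKn.
have -> : germ E b sg (h y) (Posz k) = iter m.+1 f (h y) by rewrite /= ek leq_addr addKn.
have -> : germ E b sg.+1 y (Posz k) = iter m f y by rewrite /= hk; congr (iter _ f y); lia.
have -> : germ E b sg y (Posz k - 1) = iter m f y.
  have -> : Posz k - 1 = Posz (sg + m) by lia.
  by rewrite /= leq_addr addKn.
rewrite h_iter_f // ek -pmulrn natrD; lmod; ring.
Qed.

Lemma germ_fb sg y : evN (D b.+1 b (germ E b sg.+1 y) - germ E b sg y).
Proof.
apply: (@evN_eq _ _ sg.+1) => k hk; rewrite [LHS]locF /= hk ltnW //.
by rewrite -iterS; congr (iter _ f y); lia.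
Qed.

Lemma h_wt r p : (p < n)%N -> N (E p p (hv' r) - (lam p + r%:R * rt K a p) *: hv' r).
Proof. by move=> pn; exact: (iter_wt oka r sN pn (hdiag A pn)). Qed.

Lemma h_ej r j : okp j j.+1 -> j != a -> N (E j j.+1 (hv' r)).
Proof.
move=> okj ja; have -> : E j j.+1 (hv' r) = iter r h (E j j.+1 v).
  by elim: r => // l IH; rewrite !iterS -IH comm_ef.
by apply: iter_sub => //; exact: hraise.
Qed.

Lemma h_ea r : (r <= d0)%N ->
  N (E a a.+1 (hv' r) - (r%:R * (d0%:R - r%:R + 1)) *: hv' r.-1).
Proof.
case: r => [_|r rd]; first by rewrite mul0r scale0r subr0; exact: hraise.
have := sl2_ef oka r sN (hraise A oka (ltnSn a)) (hdiag A (okp_l oka)) (hdiag A (okp_r oka)).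
by apply: prop_eq; rewrite lama -[r.+1]addn1 natrD addn1; lmod; ring.
Qed.

Lemma h_top : N (hv' d0.+1). Proof. exact: irr_int. Qed.

Let w j : K := (-1) ^+ j * (d'.-1 ^_ j)%:R.
Let C j : K := w j / j.+1%:R.

Lemma wE j : w j = C j * j.+1%:R.
Proof. by rewrite /C mulfVK // pnatr_eq0. Qed.

Lemma wS j : (j < d')%N -> w j.+1 = - (d0%:R - s%:R - j%:R) * w j.
Proof.
move=> jd; rewrite /w exprS ffactnSr natrM natrB; last by lia.
have -> : d'.-1%:R = d0%:R - s%:R :> K by rewrite -natrB //; congr _%:R; lia.
by ring.
Qed.

Lemma w0 : w 0 = 1. Proof. by rewrite /w ffactn0 mulr1. Qed.
Lemma wd : w d' = 0.
Proof. by rewrite /w ffact_small ?mulr0 //; have := d'gt0; lia. Qed.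

(** A vector whose weight is that of [h^(d0+1) v], which vanishes. The coefficients are chosen such
that [zvec_eb] and [zvec_ea] hold: the raising operator of [b] kills it, and that of [a] maps it to
a multiple of [h^d0 v], a vector of the original module. *)
Definition zvec : int -> M := \sum_(j < d') C j *: Gi j.+1 (germ E b j.+1 (hv' (d0 - j))).

Lemma zvec_eb : evN (D b b.+1 zvec).
Proof.
pose U j := Gi j (germ E b j.+1 (hv' (d0.+1 - j))).
have main : evN (D b b.+1 zvec - \sum_(j < d') (w j.+1 *: U j.+1 - w j *: U j)).
  rewrite /zvec op_sum -sumrB; apply: sub_sum => [|j _]; first exact: sev.1.
  have jd := ltn_ord j; have jd0 : (j <= d0)%N by lia.
  have ed : (d0.+1 - j = (d0 - j).+1)%N by rewrite subSn.
  rewrite opZ (eb_iter_g D oka okb adj) /U subSS ed.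
  have hb := h_wt (d0 - j) (okp_l okb); have hb1 := h_wt (d0 - j) (okp_r okb).
  have ba : b != a by rewrite eq_sym (nab oka okb adj).
  have h1 := Gi_congr j.+1 (germ_eb j.+1 (h_ej (d0 - j) okb ba) hb hb1).
  have h2 := Gi_congr j (germ_fa j.+1 (hv' (d0 - j))).
  move: h1 h2; rewrite -[hv' (d0 - j).+1]/(h (hv' (d0 - j))).
  have GiZ i := linopZ (iterg_lin D a b i); rewrite GiB !GiZ -iterSr => h1 h2.
  have := subB sev.1 (subZ sev.1 (C j) h1) (subZ sev.1 (C j * j.+1%:R) h2).
  apply: prop_eq; rewrite wS // wE.
  have lb : lam b = lam b.+1 - s%:R - 1 by rewrite -[LHS](subrK (lam b.+1)) lamb; ring.
  have e : rt K a b = 1 + rt K a b.+1 by rewrite -(rt_ab K oka okb adj) subrK.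
  rewrite lb e natrB // -[j.+1]addn1 natrD.
  by lmod_with K (int -> M : lmodType K); ring.
apply: (sub_congr sev.1 (sub_sym sev.1 main)).
have := telescope_sumr (fun j => w j *: U j) (leq0n d'); rewrite big_mkord => ->.
rewrite wd scale0r sub0r w0 scale1r -scaleN1r; apply: subZ; first exact: sev.1.
by apply: germ_N; rewrite subn0; exact: h_top.
Qed.

Let V j := Gi j (germ E b j (hv' (d0 - j))).

Lemma Fpow_u j : evN (iter (s + j) F u - iter j F (emb E b v)).
Proof.
rewrite addnC iterD.
have e : evN (iter s F u - emb E b v).
  apply: (@evN_eq _ _ s) => k hk.
  have -> : forall l x, iter l F x (Posz k) = iter l f (x (Posz k)).
    by elim=> //= l IH x; rewrite locF IH.
  by rewrite /= hk -iterD; congr (iter _ f v); lia.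
elim: j => // j IH; rewrite !iterS; have := sev.2 _ _ (okf okb) _ IH.
by rewrite opB.
Qed.

(** A fraction with denominator [f] which [h^d'] kills, by [x_zero]. *)
Lemma star_germ : (0 < s)%N -> evN (iter d' FA (germ E b 1 (hv' s.-1))).
Proof.
move=> s0; set p := germ _ _ _ _.
pose q := \sum_(c < s) ('C(s.-1, c) * s ^_ c)%:R *: TD c (s.-1 - c) (s.-1 - c) u.
have xm m : evN (iter (d' + m) FA u).
  by rewrite addnC iterD; apply: iter_sub => //; exact: x_zero.
have qN : evN (iter d' FA q).
  have -> : iter d' FA q = \sum_(c < s) ('C(s.-1, c) * s ^_ c)%:R *: iter d' FA (TD c (s.-1 - c) (s.-1 - c) u).
    rewrite /q; elim: (d') => [//|l IH]; rewrite iterS IH op_sum.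
    by apply: eq_bigr => c _; rewrite opZ.
  apply: sub_sum => [|c _]; first exact: sev.1.
  apply: subZ; first exact: sev.1.
  have -> : iter d' FA (TD c (s.-1 - c) (s.-1 - c) u) = Gi c (iter d' FA (iter (s.-1 - c) F (iter (s.-1 - c) FA u))).
    rewrite /T; move: (iter (s.-1 - c) F _) => Y.
    elim: (nat_of_ord c) => // c' IH; rewrite !iterS.
    have hg l y : iter l FA (G y) = G (iter l FA y).
      by elim: l => // l IHl; rewrite !iterS IHl; exact: (h_iter_g D oka okb adj 1).
    by rewrite hg IH.
  apply: Gi_sub; rewrite iter_hf //; apply: sub_sum => [|c' _]; first exact: sev.1.
  have [lt|ge] := ltnP d' c'; first by rewrite bin_small // mul0n scale0r; exact: sub0 sev.1.
  apply: subZ; first exact: sev.1.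
  rewrite /T; apply: Gi_sub; apply: iter_sub => //; rewrite -iterD.
  have -> : (d' - c' + (s.-1 - c) = d' + (s.-1 - c - c'))%N by have := ltn_ord c'; lia.
  exact: xm.
have gp : genS p by apply: genS_germ; apply: (iter_sub oka s.-1 (gen_submod E v)); exact: gen_refl.
have gq : genS q.
  apply: (sub_sum genS_submod.1) => c _.
  apply: (subZ genS_submod.1).
  rewrite /T; move: (s.-1 - c)%N => r.
  elim: (nat_of_ord c) => [|c' IH]; last exact: (gsub oka okb adj genS_submod IH).
  apply: (iter_sub okb _ genS_submod); apply: (iter_sub oka _ genS_submod).
  by apply/genS_germ/gen_refl.
suff pq : evN (p - q).
  have h : evN (iter d' FA p - iter d' FA q).
    elim: (d') => // l IH; rewrite !iterS; have := sev.2 _ _ (okf oka) _ IH.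
    by rewrite opB.
  exact: (sub_congr sev.1 (sub_sym sev.1 h) qN).
apply: evN_F; first exact: (subB genS_submod.1 gp gq).
rewrite opB.
have e1 : evN (F p - emb E b (hv' s.-1)) by rewrite germ_emb; exact: germ_fb.
have e2 : F q = iter s.-1 FA (iter s F u).
  rewrite iter_hf // /q op_sum big_ord_recr bin_small; last by rewrite /= prednK.
  rewrite mul0n scale0r [RHS]addr0; apply: eq_bigr => c _; rewrite opZ fT //=.
  by have -> : (s.-1 - c).+1 = (s - c)%N by have := ltn_ord c; lia.
have e3 : evN (iter s.-1 FA (iter s F u) - emb E b (hv' s.-1)).
  elim: (s.-1) => [|l IH]; first by have := Fpow_u 0; rewrite addn0.
  have i1 : evN (FA (emb E b (hv' l)) - emb E b (hv' l.+1)).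
    by apply: (@evN_eq _ _ 2) => k hk; rewrite /= emb_act // okf.
  have i2 := sev.2 _ _ (okf oka) _ IH; rewrite opB in i2.
  by have := subD sev.1 i2 i1; apply: prop_eq; rewrite iterS addrA subrK.
have := subB sev.1 e1 e3; rewrite e2; apply: prop_eq.
by rewrite opprB addrA subrK.
Qed.

(** The straightened form of [star_germ]: the linear relation between the terms of [zvec] that makes
[zvec_ea] true. *)
Lemma star : (0 < s)%N -> evN (\sum_(c < d'.+1) ((-1) ^+ c * (d' ^_ c)%:R) *: V c).
Proof.
move=> s0; have := sev.2 _ _ (okf okb) _ (star_germ s0).
apply: sub_congr; first exact: sev.1.
apply: (@evN_eq _ _ d'.+1) => k hk; rewrite [LHS]locF iter_germ //.
rewrite op_sum fct_sumE; apply: eq_bigr => c _; have cd := ltn_ord c.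
rewrite fctE opZ fT // /V GiE /= ifT; last by lia.
have -> : \prod_(i < c) - (1 + i)%:R = (-1) ^+ c * c`!%:R :> K.
  elim: (nat_of_ord c) => [|c' IH]; first by rewrite big_ord0 mulr1.
  by rewrite big_ord_recr /= IH exprS factS natrM add1n; ring.
rewrite mulrCA -natrM bin_ffact /T -iterD.
have -> : ((k - 1 - c).+1 = k - c)%N by lia.
by have -> : (d' - c + s.-1 = d0 - c)%N by lia.
Qed.

Lemma zvec_ea : evN (D a a.+1 zvec - (d0.+1%:R / d'%:R) *: emb E b (hv' d0)).
Proof.
have main : evN (D a a.+1 zvec - \sum_(j < d') w j *: ((d0%:R - j%:R) *: V j.+1 + V j)).
  rewrite /zvec op_sum -sumrB; apply: sub_sum => [|j _]; first exact: sev.1.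
  have jd := ltn_ord j; have jd0 : (j <= d0)%N by lia.
  have ab : a != b by rewrite (nab oka okb adj).
  rewrite opZ (ea_iter_g D oka okb adj) germ_ej //.
  have h1 := Gi_congr j.+1 (germ_congr j.+1 (h_ea (leq_subr j d0))).
  have h2 := Gi_congr j (germ_fb j (hv' (d0 - j))).
  have GiZ i := linopZ (iterg_lin D a b i).
  move: h1 h2; rewrite germZ GiZ -subnS -/(V j) -/(V j.+1) => h1 h2.
  have := subD sev.1 (subZ sev.1 (C j) h1) (subZ sev.1 (C j * j.+1%:R) h2).
  apply: prop_eq; rewrite wE natrB // -[j.+1]addn1 natrD addn1.
  by lmod_with K (int -> M : lmodType K); ring.
have [d'E d'0] : d0.+1%:R = d'%:R + s%:R :> K /\ d'%:R != 0 :> K.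
  by rewrite -natrD subnK ?pnatr_eq0 -?lt0n ?d'gt0 // ltnW.
pose S := \sum_(j < d') w j *: V j.+1.
have e : \sum_(j < d') w j *: ((d0%:R - j%:R) *: V j.+1 + V j) = V 0 + s%:R *: S.
  have t := telescope_sumr (fun j => w j *: V j) (leq0n d').
  rewrite big_mkord wd scale0r sub0r w0 scale1r in t.
  rewrite -[V 0]opprK -t /S scaler_sumr -sumrN -big_split; apply: eq_bigr => j _ /=.
  by rewrite wS //; lmod_with K (int -> M : lmodType K); ring.
have sS : evN (s%:R *: S - (s%:R / d'%:R) *: V 0).
  have [s0|s0] := posnP s; first have -> : s%:R = 0 :> K by rewrite s0.
    by rewrite mul0r !scale0r subr0; exact: sub0 sev.1.
  have := star s0; rewrite big_ord_recl ffactn0 mulr1 scale1r.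
  have -> : \sum_(i < d') ((-1) ^+ lift ord0 i * (d' ^_ lift ord0 i)%:R) *: V (lift ord0 i) = - d'%:R *: S.
    rewrite /S scaler_sumr; apply: eq_bigr => j _; rewrite lift0 exprS ffactnS natrM /w.
    by rewrite scalerA; congr (_ *: _); ring.
  move/(subZ sev.1 (- (s%:R / d'%:R))); apply: prop_eq.
  by lmod_with K (int -> M : lmodType K); field.
have := subD sev.1 main sS; rewrite e; apply: prop_eq.
have -> : V 0 = emb E b (hv' d0) by rewrite /V /= subn0 germ_emb.
rewrite d'E; lmod_with K (int -> M : lmodType K); by field.
Qed.

Lemma zvec_ej j : okp j j.+1 -> j != a -> j != b -> evN (D j j.+1 zvec).
Proof.
move=> okj ja jb; rewrite /zvec op_sum; apply: sub_sum => [|i _]; first exact: sev.1.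
rewrite opZ; apply: subZ; first exact: sev.1.
have -> : forall m y, D j j.+1 (Gi m y) = Gi m (D j j.+1 y).
  by elim=> // m IH y; rewrite !iterS -IH; exact: comm_eg.
by apply: Gi_sub; rewrite germ_ej //; apply: germ_N; exact: h_ej.
Qed.

Lemma Gi_wt m y p kap : (p < n)%N -> evN (D p p y - kap *: y) ->
  evN (D p p (Gi m y) - (kap + m%:R * (rt K a p + rt K b p)) *: Gi m y).
Proof.
move=> pn h; elim: m => [|m IH]; first by rewrite mul0r addr0.
have := gsub oka okb adj sev IH; rewrite (linopD (gop_lin D a b)) (linopN (gop_lin D a b)).
rewrite (linopZ (gop_lin D a b)); apply: prop_eq.
rewrite iterS wt_g // -natr1.
by lmod_with K (int -> M : lmodType K); ring.
Qed.

Lemma zvec_pp p : (p < n)%N ->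
  evN (D p p zvec - (lam p + d0.+1%:R * rt K a p) *: zvec).
Proof.
move=> pn; rewrite /zvec op_sum scaler_sumr -sumrB; apply: sub_sum => [|j _]; first exact: sev.1.
have jd := ltn_ord j; have jd0 : (j <= d0)%N by lia.
rewrite opZ; have := Gi_wt j.+1 pn (germ_pp j.+1 pn (h_wt (d0 - j) pn)).
move/(subZ sev.1 (C j)); apply: prop_eq; rewrite natrB // -!natr1.
by lmod_with K (int -> M : lmodType K); ring.
Qed.

Lemma zvec_at k : (d' <= k)%N ->
  zvec (Posz k) = \sum_(j < d') C j *: TE j.+1 (k - j.+1) (d0 - j) v.
Proof.
move=> hk; rewrite /zvec fct_sumE; apply: eq_bigr => j _; rewrite fctE GiE /= ifT //.
exact: leq_trans (ltn_ord j) hk.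
Qed.

Lemma zvec_coh : coh E b zvec d'.
Proof.
move=> k hk; rewrite !zvec_at //; last exact: leqW.
rewrite op_sum; apply: eq_bigr => j _; rewrite opZ fT //.
by have -> : (k.+1 - j.+1 = (k - j.+1).+1)%N by have := ltn_ord j; lia.
Qed.

Lemma Bk_T j l r : Bk E v (j + l + r) (TE j l r v).
Proof.
have [sg [t [okt _ _ gt]]] := gopE E oka okb adj.
rewrite /T; elim: j => [|j IH] /=.
  elim: l => [|l IH] /=; last by apply: Bk_op => //; exact: okf.
  by elim: r => [|r IH] /=; [exact: (Bk_act E v (w := [::]))|apply: Bk_op => //; exact: okf].
rewrite gt; apply: subZ; first exact: Bk_subspace.
by apply: Bk_op => //; rewrite okpC.
Qed.

Lemma zvec_sB : sB zvec d' d0.+1.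
Proof.
move=> k hk; rewrite zvec_at //; apply: sub_sum => [|j _]; first exact: Bk_subspace.
apply: subZ; first exact: Bk_subspace.
by apply: Bk_mono (Bk_T _ _ _); have := ltn_ord j; lia.
Qed.

(** The image of the original module in its localization. *)
Definition globN (x : int -> M) := exists2 l, gen E v l & evN (x - emb E b l).

Lemma act_emb p q y : okp p q -> evN (D p q (emb E b y) - emb E b (E p q y)).
Proof. by move=> ok; apply: (@evN_eq _ _ 2) => k hk; rewrite /= emb_act. Qed.

Lemma emb_N y : gen E v y -> evN (emb E b y) -> N y.
Proof. by move=> gy [k0 /(_ k0 (leqnn _))] /=; exact: f_inj. Qed.

Lemma globN_submod : submod D globN.
Proof.
have sg := gen_subspace E v; split.
  split.
    exists 0; first exact: sub0.
    by rewrite germ_emb germ0 subrr; exact: sub0 sev.1.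
  move=> c x y [l1 g1 h1] [l2 g2 h2]; exists (c *: l1 + l2); first exact: sg.2.
  have := sev.1.2 c _ _ h1 h2; apply: prop_eq.
  by rewrite emb_lin; lmod_with K (int -> M : lmodType K); ring.
move=> p q ok x [l g1 h1]; exists (E p q l); first exact: (gen_submod E v).2.
have := subD sev.1 (sev.2 p q ok _ h1) (act_emb l ok); apply: prop_eq.
by rewrite opB addrA subrK.
Qed.

Lemma evN_globN x : evN x -> globN x.
Proof.
move=> h; exists 0; first exact: sub0 (gen_subspace E v).
by rewrite germ_emb germ0 subr0.
Qed.

Lemma h_ea_gen l kap m : N (E a a l - (lam a + kap) *: l) ->
  N (E a.+1 a.+1 l - (lam a.+1 - kap) *: l) ->
  N (E a a.+1 (iter m h l) - iter m h (E a a.+1 l)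
     - (m%:R * (d0%:R + kap *+ 2 - m%:R + 1)) *: iter m.-1 h l).
Proof.
move=> l1 l2; elim: m => [|m IH]; first by rewrite mul0r scale0r subr0 subrr; exact: sub0.
have nea : (a == a.+1) = false by rewrite ltn_eqF.
have w1 := iter_wt oka m sN (okp_l oka) l1; have w2 := iter_wt oka m sN (okp_r oka) l2.
move: w1 w2; rewrite nea !eqxx [a.+1 == a]eq_sym nea /= => w1 w2.
have := subD sN' (sN.2 _ _ (okf oka) _ IH) (subB sN' w1 w2); apply: prop_eq.
have -> : h (E a a.+1 (iter m h l) - iter m h (E a a.+1 l) - (m%:R * (d0%:R + kap *+ 2 - m%:R + 1)) *: iter m.-1 h l)
  = h (E a a.+1 (iter m h l)) - h (iter m h (E a a.+1 l)) - (m%:R * (d0%:R + kap *+ 2 - m%:R + 1)) *: iter m h l.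
  by rewrite !opB opZ; case: (m) => [|m'] //; rewrite !mul0r !scale0r.
have okh := okf oka.
rewrite op_rel // !eqxx !scale1r -natr1 /=.
have la : lam a = d0%:R + lam a.+1 by rewrite -lama subrK.
by rewrite la; lmod; ring.
Qed.

Lemma swap_wtE p : swap_wt lam a p = lam p + d0.+1%:R * rt K a p.
Proof.
have la : lam a = d0%:R + lam a.+1 by rewrite -lama subrK.
rewrite /swap_wt /rt -natr1; case: eqP => [->|_].
  by rewrite la ltn_eqF // /= ?mulr1n ?mulr0n; ring.
by case: eqP => [->|_]; rewrite /= ?mulr1n ?mulr0n ?la; ring.
Qed.

(** A vector of the original module with the weight of [zvec] cannot be raised to a nonzero multiple
of [h^d0 v], since [h^(d0+1)] kills the highest weight vector. *)
Lemma zvec_globN : ~ globN zvec.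
Proof.
move=> [l gl hl]; set c : K := d0.+1%:R / d'%:R.
have c0 : c != 0 by rewrite mulf_neq0 ?invr_eq0 ?pnatr_eq0 // -lt0n d'gt0.
have gE p q : okp p q -> gen E v (E p q l) by move=> ok; exact: (gen_submod E v).2.
have sg := gen_subspace E v.
have el : N (E a a.+1 l - c *: hv' d0).
  apply: emb_N.
    by apply: subB => //; [exact: gE|apply: subZ => //; apply: iter_sub => //; [exact: gen_submod|exact: gen_refl]].
  have := subB sev.1 (subB sev.1 zvec_ea (sev.2 _ _ oka _ hl)) (act_emb l oka).
  apply: prop_eq; rewrite opB !germ_emb germB germZ.
  by rewrite -/c; lmod_with K (int -> M : lmodType K); ring.
have wl p : (p < n)%N -> N (E p p l - (lam p + d0.+1%:R * rt K a p) *: l).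
  move=> pn; have ok : okp p p by rewrite okpp.
  apply: emb_N; first by apply: subB => //; [exact: gE|exact: subZ].
  have := subB sev.1 (subB sev.1 (subB sev.1 (zvec_pp pn) (sev.2 _ _ ok _ hl)) (act_emb l ok))
    (subZ sev.1 (- (lam p + d0.+1%:R * rt K a p)) hl).
  apply: prop_eq; rewrite opB !germ_emb germB germZ.
  by lmod_with K (int -> M : lmodType K); ring.
have w1 := wl a (okp_l oka); have w2 := wl a.+1 (okp_r oka).
rewrite rtii mulrN1 in w1; rewrite rtiS mulr1 -[d0.+1%:R]opprK in w2.
have [m hm] := gen_min (torsion_submod oka sN) (ex_intro _ d0.+1 h_top) gl.
have lN : N l.
  elim: m hm => // m IH hm; apply: IH.
  have := h_ea_gen m.+1 w1 w2 => h1.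
  have h2 : N (E a a.+1 (iter m.+1 h l)) by apply: sN.2.
  have h3 : N (iter m.+1 h (E a a.+1 l)).
    have : N (iter m.+1 h (c *: hv' d0)).
      rewrite (linopZ (iter_lin E a m.+1)) -iterD addSnnS iterD; apply: subZ => //.
      by apply: iter_sub => //; exact: h_top.
    apply: sub_congr => //; have := iter_sub oka m.+1 sN (sub_sym sN' el).
    by rewrite (linopD (iter_lin E a m.+1)) (linopN (iter_lin E a m.+1)).
  have h4 := subB sN' (subB sN' h2 h3) h1; move: h4; rewrite opprB addrC subrK.
  move/(subZ_inv sN'); apply; rewrite mulf_neq0 ?pnatr_eq0 //.
  have -> : d0%:R + (- d0.+1%:R) *+ 2 - m.+1%:R + 1 = - (d0 + m + 2)%:R :> K.
    by rewrite !natrD -!natr1; ring.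
  by rewrite oppr_eq0 pnatr_eq0; lia.
apply: (irr_int_neq oka lama (leqnn d0)).
apply: (subZ_inv sN' c0); apply: (sub_congr sN' el); exact: sN.2.
Qed.

Lemma zvec_hw : ishw D globN zvec (swap_wt lam a).
Proof.
have sG := globN_submod; have hE0 : globN (emb E b (hv' d0)).
  exists (hv' d0); last by rewrite subrr; exact: sub0 sev.1.
  by apply: iter_sub => //; [exact: gen_submod|exact: gen_refl].
split=> //; first exact: zvec_globN.
  apply: (simple_up sG) => j okj.
  have [->|ja] := eqVneq j a.
    apply: (sub_congr sG.1 (sub_sym sG.1 (evN_globN zvec_ea))); exact: subZ sG.1 _ _ hE0.
  have [->|jb] := eqVneq j b; apply: evN_globN; [exact: zvec_eb|exact: zvec_ej].
by move=> p pn; rewrite swap_wtE; apply/evN_globN/zvec_pp.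
Qed.

Lemma gle_knuth : gle A (Hwm zvec_hw).
Proof.
apply: (loc_growth (k1 := (d' + d0.+1)%N)) => //.
- exact: evN_globN.
- by apply: coh_mono zvec_coh; exact: leq_addr.
- by move=> k hk; apply: Bk_mono (zvec_sB _); lia.
Qed.

End Knuth.

Lemma Gle_knuth (K : numFieldType) n bl (lam : nat -> K) a b d0 s :
  (forall p q, (p <= q)%N -> (q < n)%N -> (bl p <= bl q)%N) ->
  okp n bl a a.+1 -> okp n bl b b.+1 -> (b == a.+1) || (a == b.+1) ->
  lam a - lam a.+1 = d0%:R -> lam b - lam b.+1 = - s%:R - 1 -> (s <= d0)%N ->
  Gle n bl lam (swap_wt lam a).
Proof.
move=> bm oka okb adj la lb sd; apply: Gle_intro => A iA.
by eexists; exact: (gle_knuth bm iA oka okb adj la lb sd).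
Qed.

(** * Weights and irreducibility *)

Section Weights.
Variables (K : numFieldType) (n : nat) (bl : nat -> nat).
Local Notation okp := (okp n bl).
Local Notation low := (low n bl).
Local Notation lowc := (lowc n bl).
Local Notation rep := (rep (K := K) n bl).
Local Notation hwm := (@hwm K n bl).
Local Notation hE := (@hE K n bl _).
Local Notation hN A := (@hN K n bl _ A).
Local Notation hv := (@hv K n bl _).
Variables (lam : nat -> K) (A : hwm lam).
Local Notation M := (hM A).
Local Notation E := (hE A).
Local Notation v := (hv A).
Local Notation N := (hN A).
Local Ltac lmod := lmod_with K (hM A).

Definition shift_wt (w : seq (nat * nat)) p : K := lam p + (wt w p)%:~R.

Let wkey (w : seq (nat * nat)) := [seq wt w p | p <- iota 0 n].

Lemma wkeyP w w' : reflect (forall p, (p < n)%N -> wt w p = wt w' p) (wkey w == wkey w').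
Proof.
apply: (iffP eqP) => [/eq_in_map h p pn|h]; first by apply: h; rewrite mem_iota.
by apply/eq_in_map => p; rewrite mem_iota => /andP[_]; exact: h.
Qed.

Lemma comb_component (P : M -> Prop) k t kap : submod E P -> (forall m, N m -> P m) ->
  lowc k t -> (forall p, (p < n)%N -> P (E p p (hcomb A t) - kap p *: hcomb A t)) ->
  (forall a, a \in t -> exists2 p, (p < n)%N & shift_wt a.2 p != kap p) -> P (hcomb A t).
Proof.
move=> sP NP lt ht hk.
pose l := [seq (- (a.1 *: act E a.2 v), shift_wt a.2) | a <- t].
have tin a : List.In a t -> a \in t.
  by elim: (t) => //= b t' IH [->|/IH]; rewrite inE ?eqxx // => ->; rewrite orbT.
apply: (@separate K n bl _ E P kap _ l) => //.
- move=> x /List.in_map_iff[a [<- /tin ha]] p hp /=.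
  have /andP[la _] := allP lt _ ha.
  have := subZ sP.1 (- a.1) (NP _ (act_wt A (low_okw la) hp)); apply: prop_eq.
  by rewrite opN opZ /shift_wt; lmod; ring.
- by move=> x /List.in_map_iff[a [<- /tin ha]]; exact: hk.
- by rewrite big_map /= sumrN /hcomb /comb subrr; exact: sub0 sP.1.
Qed.

Lemma comb_split (P : pred (seq (nat * nat))) t :
  hcomb A t = hcomb A [seq a <- t | P a.2] + hcomb A [seq a <- t | ~~ P a.2].
Proof. by rewrite /hcomb /comb !big_filter; exact: bigID. Qed.

Lemma component_mem (P : M -> Prop) k t w : submod E P -> (forall m, N m -> P m) ->
  lowc k t -> P (hcomb A t) -> P (hcomb A [seq a <- t | wkey a.2 == wkey w]).
Proof.
move=> sP NP lt ht; set t1 := [seq a <- t | _].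
pose l := [seq (a.1 *: act E a.2 v, shift_wt a.2) | a <- t & wkey a.2 != wkey w].
have tin a : List.In a [seq a <- t | wkey a.2 != wkey w] -> a \in t /\ wkey a.2 != wkey w.
  move=> /List.filter_In[hin ->]; split=> //.
  by elim: (t) hin => //= b t' IH [->|/IH]; rewrite inE ?eqxx // => ->; rewrite orbT.
apply: (@separate K n bl _ E P (shift_wt w) _ l) => //.
- move=> p pn; apply: NP; rewrite /hcomb /comb op_sum scaler_sumr -sumrB big_seq.
  apply: sub_sum => [|a]; first exact: hss.
  rewrite mem_filter => /andP[/wkeyP/(_ _ pn) e ha]; have /andP[la _] := allP lt _ ha.
  have := subZ (hss A) a.1 (act_wt A (low_okw la) pn); apply: prop_eq.
  by rewrite opZ /shift_wt e; lmod; ring.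
- move=> x /List.in_map_iff[a [<- /tin[ha _]]] p pn /=; apply: NP.
  have /andP[la _] := allP lt _ ha.
  have := subZ (hss A) a.1 (act_wt A (low_okw la) pn); apply: prop_eq.
  by rewrite opZ /shift_wt; lmod; ring.
- move=> x /List.in_map_iff[a [<- /tin[_ /wkeyP ha]]] /=.
  apply: contrapT => h; apply: ha => p pn; apply: contrapT => /eqP e; apply: h.
  exists p => //; rewrite /shift_wt -subr_eq0 opprD addrACA subrr add0r -rmorphB intr_eq0.
  by rewrite subr_eq0.
- by rewrite big_map /=; move: ht; rewrite (comb_split (fun b => wkey b == wkey w)).
Qed.

Lemma component_ex k t : lowc k t -> ~ N (hcomb A t) -> exists w,
  ~ N (hcomb A [seq a <- t | wkey a.2 == wkey w]).
Proof.
have [b] := ubnP (size t); elim: b t => // b IH [|a t] sb lt Nt.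
  by case: Nt; rewrite /hcomb comb_nil; exact: sub0 (hss A).
have [h|h] := pselect (N (hcomb A [seq c <- a :: t | wkey c.2 == wkey a.2])); last by exists a.2.
pose t' := [seq c <- a :: t | wkey c.2 != wkey a.2].
have [|||w hw] := IH t'.
- rewrite ltnS in sb; rewrite /t' /= eqxx size_filter; exact: leq_ltn_trans (count_size _ _) sb.
- by apply/allP => x; rewrite mem_filter => /andP[_]; exact: (allP lt).
- move=> h'; apply: Nt; rewrite (comb_split (fun b => wkey b == wkey a.2)).
  by apply: subD => //; exact: hss.
exists w => h'; apply: hw; move: h'; rewrite /t' -filter_predI.
have [e|e] := eqVneq (wkey w) (wkey a.2).
  move=> _; rewrite (eq_filter (a2 := pred0)) ?filter_pred0; last first.
    by move=> c /=; rewrite -e andbN.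
  by rewrite /hcomb comb_nil; exact: sub0 (hss A).
apply: prop_eq; congr hcomb; apply: eq_filter => c /=.
by case: eqVneq => //= ->; rewrite e.
Qed.

Lemma wt_of y kap : gen E v y -> ~ N y ->
  (forall p, (p < n)%N -> N (E p p y - kap p *: y)) ->
  exists2 w, low w & forall p, (p < n)%N -> kap p = shift_wt w p.
Proof.
move=> [s ok ey] Ny dg; have sN := hss A; have [k [t lt et]] := reduce_all lam ok.
have {}et : N (y - hcomb A t) by rewrite ey; exact: et.
apply: contrapT => h; apply: Ny; apply: (sub_congr sN (sub_sym sN et)).
apply: (comb_component (k := k) (kap := kap)) => //; first exact: hsub.
  move=> p pn; have okpp : okp p p by rewrite okpp.
  have := subB sN (dg p pn) (subB sN ((hsub A).2 _ _ okpp _ et) (subZ sN (kap p) et)).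
  by apply: prop_eq; rewrite opB; lmod; ring.
move=> a ta; apply: contrapT => h'; apply: h; exists a.2; first by have /andP[] := allP lt _ ta.
move=> p pn; apply: contrapT => /eqP e; apply: h'; exists p => //; by rewrite eq_sym.
Qed.

Lemma hw_mult y : gen E v y -> ~ N y ->
  (forall p, (p < n)%N -> N (E p p y - lam p *: y)) ->
  exists2 c, c != 0 & N (y - c *: v).
Proof.
move=> [s ok ey] Ny dg; have sN := hss A; have [k [t lt et]] := reduce_all lam ok.
have {}et : N (y - hcomb A t) by rewrite ey; exact: et.
pose t' := [seq a <- t | a.2 != [::]].
have e : hcomb A t = vac t *: v + hcomb A t'.
  rewrite /hcomb /comb /vac [LHS](bigID (fun a : K * seq (nat * nat) => a.2 == [::])) /=.
  rewrite scaler_suml big_filter /=; congr (_ + _).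
  by apply: eq_bigr => a /eqP ->.
have lt' : lowc k t' by apply/allP => x; rewrite mem_filter => /andP[_]; exact: (allP lt).
have Nt' : N (hcomb A t').
  apply: (comb_component (k := k) (kap := lam)) => //; first exact: hsub.
    move=> p pn; have okpp : okp p p by rewrite okpp.
    have := subB sN (subB sN (dg p pn) (subB sN ((hsub A).2 _ _ okpp _ et) (subZ sN (lam p) et)))
       (subZ sN (vac t) (hdiag A pn)).
    by apply: prop_eq; rewrite opB e opD opZ; lmod; ring.
  move=> a; rewrite mem_filter => /andP[a0 ta].
  have /andP[la _] := allP lt _ ta; have [p pn wp] := low_wt la a0; exists p => //.
  by rewrite /shift_wt -subr_eq0 addrAC subrr add0r intr_eq0.
have h : N (y - vac t *: v).
  by have := subD sN et Nt'; apply: prop_eq; rewrite e; lmod; ring.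
exists (vac t) => //; apply/eqP => v0; apply: Ny.
by move: h; rewrite v0 scale0r subr0.
Qed.

(** A nonzero submodule contains a vector that is maximal for the height, hence singular, and its
weight components are singular weight vectors. If these have the highest weight, then they are
multiples of the highest weight vector. *)
Lemma irr_crit :
  (forall y kap, gen E v y -> ~ N y ->
    (forall p q, okp p q -> (p < q)%N -> N (E p q y)) ->
    (forall p, (p < n)%N -> N (E p p y - kap p *: y)) ->
    forall p, (p < n)%N -> kap p = lam p) -> irr A.
Proof.
move=> crit x gx Nx; have sN := hss A.
pose G := genN E N x; have sG : submod E G := genN_submod x (hsub A).
have NG m : N m -> G m by exact: genN_N (hsub A).
have Ggen m : G m -> exists2 u, gen E v u & N (m - u).
  move=> [u gu hu]; exists u => //; apply: gen_min gx gu; exact: gen_submod.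
pose Q (h : nat) := exists y kap, [/\ gen E v y, G y, ~ N y,
  (forall p, (p < n)%N -> N (E p p y - kap p *: y)) &
  \sum_(p < n) p%:R * kap p = \sum_(p < n) p%:R * lam p + h%:R].
have wtQ y kap : gen E v y -> G y -> ~ N y ->
    (forall p, (p < n)%N -> N (E p p y - kap p *: y)) ->
    exists2 h : nat, Q h & \sum_(p < n) p%:R * kap p = \sum_(p < n) p%:R * lam p + h%:R.
  move=> gy Gy Ny dg; have [w lw ew] := wt_of gy Ny dg.
  have [h eh] : exists h : nat, \sum_(p < n) p%:R * kap p = \sum_(p < n) p%:R * lam p + h%:R.
    have : (0 : int) <= \sum_(p < n) p%:Z * wt w p.
      rewrite (height_wt lw) big_seq; apply: sumr_ge0 => b /(allP lw) /andP[_ hb].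
      by rewrite subr_ge0 lez_nat ltnW.
    case e : (\sum_(p < n) p%:Z * wt w p) => [h|//] _; exists h.
    have -> : h%:R = (Posz h)%:~R :> K by [].
    rewrite -e rmorph_sum -big_split; apply: eq_bigr => p _ /=.
    by rewrite ew // /shift_wt mulrDr intrM.
  by exists h => //; exists y, kap.
have : exists h, Q h.
  have [s ok ex] := gx; have [k [t lt et]] := reduce_all lam ok.
  have {}et : N (x - hcomb A t) by rewrite ex; exact: et.
  have [|w Nw] := component_ex lt.
    by move=> h; apply: Nx; apply: (sub_congr sN (sub_sym sN et)).
  set t1 := [seq a <- t | _] in Nw.
  have G1 : G (hcomb A t1).
    apply: (component_mem (k := k)) => //; apply: (sub_congr sG.1 (NG _ et)).
    exact: genN_gen (hsub A) (gen_refl _ _).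
  have lt1 : lowc k t1 by apply/allP => a; rewrite mem_filter => /andP[_]; exact: (allP lt).
  have g1 : gen E v (hcomb A t1) by exists t1 => //; exact: lowc_okc lt1.
  have [|h Qh _] := wtQ _ (shift_wt w) g1 G1 Nw; last by exists h.
  move=> p pn; rewrite /hcomb /comb op_sum scaler_sumr -sumrB big_seq.
  apply: sub_sum => [|a]; first exact: hss.
  rewrite mem_filter => /andP[/wkeyP/(_ _ pn) e ha]; have /andP[la _] := allP lt _ ha.
  have := subZ (hss A) a.1 (act_wt A (low_okw la) pn); apply: prop_eq.
  by rewrite opZ /shift_wt e; lmod; ring.
case=> h; have [b] := ubnP h; elim: b h => // b IH h hb [y [kap [gy Gy Ny dg eh]]].
have [[p [q [ok pq Npq]]]|sing] := pselect (exists p q, [/\ okp p q, (p < q)%N & ~ N (E p q y)]).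
  pose kap' r := kap r + ((r == p)%:R - (r == q)%:R).
  have gy' : gen E v (E p q y) by exact: (gen_submod E v).2.
  have Gy' : G (E p q y) by exact: sG.2.
  have dg' r : (r < n)%N -> N (E r r (E p q y) - kap' r *: E p q y).
    move=> rn; have okr : okp r r by rewrite okpp.
    have := (hsub A).2 _ _ ok _ (dg r rn); apply: prop_eq; rewrite op_rel // /kap' opB opZ.
    have -> : (r == p)%:R *: E r q y = (r == p)%:R *: E p q y.
      by case: eqP => [->|_]; rewrite ?scale0r.
    have -> : (q == r)%:R *: E p r y = (r == q)%:R *: E p q y.
      by rewrite eq_sym; case: eqP => [->|_]; rewrite ?scale0r.
    by lmod; ring.
  have [h' Qh' eh'] := wtQ _ kap' gy' Gy' Npq dg'.
  apply: (IH h') => //; rewrite ltnS in hb; apply: leq_trans hb.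
  have pn := okp_l ok; have qn := okp_r ok.
  have : \sum_(r < n) r%:R * kap' r = \sum_(r < n) r%:R * kap r + (p%:R - q%:R).
    rewrite (eq_bigr (fun r : 'I_n => r%:R * kap r + (r%:R * (r == p :> nat)%:R - r%:R * (r == q :> nat)%:R))); last first.
      by move=> r _; rewrite /kap'; ring.
    rewrite big_split sumrB /=; congr (_ + (_ - _)).
      rewrite (bigD1 (Ordinal pn)) //= eqxx mulr1 big1 ?addr0 // => i ij.
      rewrite (_ : (nat_of_ord i == p) = false) ?mulr0 //; apply: contraNF ij => /eqP e.
      by apply/eqP/val_inj; rewrite /= e.
    rewrite (bigD1 (Ordinal qn)) //= eqxx mulr1 big1 ?addr0 // => i ij.
    rewrite (_ : (nat_of_ord i == q) = false) ?mulr0 //; apply: contraNF ij => /eqP e.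
    by apply/eqP/val_inj; rewrite /= e.
  rewrite eh' eh -addrA => /addrI e.
  have : (h' + q)%:R = (h + p)%:R :> K by rewrite !natrD e; ring.
  by move=> /eqP; rewrite eqr_nat => /eqP; lia.
have up p q : okp p q -> (p < q)%N -> N (E p q y).
  by move=> ok pq; apply: contrapT => h'; apply: sing; exists p, q.
have kl := crit y kap gy Ny up dg.
have [|c c0 hc] := hw_mult gy Ny; first by move=> p pn; rewrite -kl //; exact: dg.
have [u gu hu] : G v.
  apply: (subZ_inv sG.1 c0); apply: (sub_congr sG.1 (NG _ hc)) => //.
by exists u => //; exact: sub_sym.
Qed.

End Weights.

(** * Tensor product with the exterior algebra *)

Section Clifford.
Variables (K : numFieldType) (M : lmodType K).
Local Notation FM := ((nat -> bool) -> M).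
Implicit Types (S : nat -> bool) (F : FM).
Local Ltac lmod := lmod_with K (FM : lmodType K).

Definition flip p S : nat -> bool := fun r => if r == p then ~~ S r else S r.

Lemma flip_eq p S : flip p S p = ~~ S p. Proof. by rewrite /flip eqxx. Qed.
Lemma flip_ne p q S : (q == p) = false -> flip p S q = S q.
Proof. by rewrite /flip => ->. Qed.
Lemma flipK p S : flip p (flip p S) = S.
Proof. by apply: funext => r; rewrite /flip; case: eqP => // _; rewrite negbK. Qed.
Lemma flipC p q S : flip p (flip q S) = flip q (flip p S).
Proof. by apply: funext => r; rewrite /flip; case: eqP => // _; case: eqP. Qed.

Definition sgn p S : K := \prod_(r < p) (-1) ^+ (S r).

Lemma sgn_sq p S : sgn p S * sgn p S = 1.
Proof.
by rewrite /sgn -big_split big1 //= => r _; case: (S r); rewrite /= ?mulrNN mulr1.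
Qed.

Lemma sgn_flip p q S : sgn q (flip p S) = if (p < q)%N then - sgn q S else sgn q S.
Proof.
rewrite /sgn; case: ifP => pq; last first.
  apply: eq_bigr => r _; rewrite flip_ne //.
  by apply/negP => /eqP e; rewrite -e ltn_ord in pq.
rewrite (bigD1 (Ordinal pq)) //= [in RHS](bigD1 (Ordinal pq)) //= -mulNr; congr (_ * _).
  by rewrite flip_eq; case: (S p); rewrite /= ?opprK.
apply: eq_bigr => r; rewrite -val_eqE /= => rp; rewrite flip_ne //; exact: negbTE.
Qed.

(** Creation ([e = true]) and annihilation operators of the exterior algebra, realized on functions
of subsets of the positions. *)
Definition car p (e : bool) F : FM :=
  fun S => if S p == e then sgn p S *: F (flip p S) else 0.

Lemma car_lin p e : linear (car p e).
Proof.
move=> c F G; apply: funext => S; rewrite /car !fctE; case: ifP => _.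
  by rewrite scalerDr !scalerA mulrC.
by rewrite scaler0 addr0.
Qed.

Lemma carD p e F G : car p e (F + G) = car p e F + car p e G.
Proof. by rewrite -[F]scale1r car_lin !scale1r. Qed.
Lemma car0 p e : car p e 0 = 0.
Proof. by apply: funext => S; rewrite /car; case: ifP => // _; rewrite scaler0. Qed.
Lemma carZ p e c F : car p e (c *: F) = c *: car p e F.
Proof. by rewrite -[c *: F]addr0 car_lin car0 addr0. Qed.
Lemma carN p e F : car p e (- F) = - car p e F.
Proof. by rewrite -scaleN1r carZ scaleN1r. Qed.

Lemma car_anti p e q e' F : car p e (car q e' F) =
  - car q e' (car p e F) + ((p == q) && (e != e'))%:R *: F.
Proof.
apply: funext => S; rewrite !fctE /car; have [->|pq] := eqVneq p q.
  rewrite flip_eq flipK sgn_flip ltnn.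
  case: (S q); case: e; case: e'; rewrite /= ?scaler0 ?scale0r ?oppr0 ?addr0 ?add0r //;
  by rewrite scalerA sgn_sq scale1r ?addNr.
rewrite /= scale0r addr0 (flip_ne S (negbTE pq)).
rewrite [flip p S q]flip_ne; last by rewrite eq_sym; exact: negbTE.
case: eqP => _; last by case: eqP => _; rewrite ?scaler0 oppr0.
case: eqP => _; last by rewrite scaler0 oppr0.
rewrite flipC !scalerA !sgn_flip -scaleNr; congr (_ *: _).
by case: (ltngtP p q) pq => // _ _; ring.
Qed.

Definition wedge p q F : FM := car p true (car q false F).

Lemma wedge_rel p q r s F : wedge p q (wedge r s F) =
  wedge r s (wedge p q F) + ((q == r)%:R *: wedge p s F - (s == p)%:R *: wedge r q F).
Proof.
rewrite /wedge (car_anti q false r true) andbT carD carN carZ.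
rewrite (car_anti p true r true) andbF scale0r addr0 opprK.
rewrite (car_anti q false s false) andbF scale0r addr0 !carN.
rewrite (car_anti p true s false) andbT carD carN carZ [p == s]eq_sym.
by lmod; ring.
Qed.

Lemma wedge_diag p F S : wedge p p F S = (S p)%:R *: F S.
Proof.
rewrite /wedge /car flip_eq flipK sgn_flip ltnn.
by case: (S p); rewrite /= ?scale1r ?scale0r // scalerA sgn_sq scale1r.
Qed.

Lemma wedge_ne p q F S : (p == q) = false -> exists c : K,
  wedge p q F S = c *: F (flip q (flip p S)) /\ (~~ (S p && ~~ S q) -> c = 0).
Proof.
move=> pq; rewrite /wedge /car flip_ne; last by rewrite eq_sym.
case: (S p); case: (S q); rewrite /= ?scaler0.
- by exists 0; rewrite scale0r.
- by eexists; rewrite scalerA; split.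
- by exists 0; rewrite scale0r.
- by exists 0; rewrite scale0r.
Qed.

Variables (n : nat) (bl : nat -> nat) (E : rep (K := K) n bl M).

Definition fock_op p q F : FM := (fun S => E p q (F S)) + wedge p q F.

Lemma fock_lin p q : linear (fock_op p q).
Proof.
move=> c F G; rewrite /fock_op /wedge !(carD, carZ).
have -> : (fun S => E p q ((c *: F + G) S)) =
   c *: (fun S => E p q (F S)) + (fun S => E p q (G S)) :> FM.
  by apply: funext => S; rewrite !fctE opD opZ.
by lmod; ring.
Qed.

Lemma wedge_E p q r s F :
  wedge p q (fun S => E r s (F S)) = fun S => E r s (wedge p q F S).
Proof.
apply: funext => S; rewrite /wedge /car; case: ifP => _; last by rewrite op0.
by case: ifP => _; rewrite ?scaler0 ?op0 // !opZ.
Qed.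

Lemma fock_rel p q r s : okp n bl p q -> okp n bl r s -> forall F,
  fock_op p q (fock_op r s F) = fock_op r s (fock_op p q F)
   + ((q == r)%:R *: fock_op p s F - (s == p)%:R *: fock_op r q F).
Proof.
move=> h1 h2 F; rewrite {1 3}/fock_op.
have e p' q' r' s' : (fun S => E p' q' (fock_op r' s' F S)) =
    (fun S => E p' q' (E r' s' (F S))) + (fun S => E p' q' (wedge r' s' F S)) :> FM.
  by apply: funext => S; rewrite !fctE opD.
have e2 p' q' r' s' : wedge p' q' (fock_op r' s' F) =
    (fun S => E r' s' (wedge p' q' F S)) + wedge p' q' (wedge r' s' F).
  by rewrite /fock_op -wedge_E /wedge !carD.
rewrite !e !e2 wedge_rel.
have -> : (fun S => E p q (E r s (F S))) = (fun S => E r s (E p q (F S)))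
   + ((q == r)%:R *: (fun S => E p s (F S)) - (s == p)%:R *: (fun S => E r q (F S))) :> FM.
  by apply: funext => S; rewrite op_rel.
by rewrite /fock_op; lmod; ring.
Qed.

Definition fock_rep : rep n bl FM := Rep fock_lin fock_rel.

Definition fock_supp F := forall S p, (n <= p)%N -> S p -> F S = 0.

Lemma fock_supp_submod : submod fock_rep fock_supp.
Proof.
split; first split.
- by [].
- by move=> c F G hF hG S p np Sp; rewrite !fctE (hF S p) // (hG S p) // scaler0 addr0.
move=> p q ok F hF S r nr Sr; rewrite /= /fock_op fctE (hF S r) // op0 add0r.
have [pn qn] := (okp_l ok, okp_r ok).
have [e|pq] := eqVneq p q; first by rewrite e wedge_diag (hF S r) // scaler0.
have [c [-> _]] := wedge_ne F S (negbTE pq).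
by rewrite (hF _ r) ?scaler0 // !flip_ne //; apply/eqP; lia.
Qed.

Definition ext (s : {ffun 'I_n -> bool}) : nat -> bool :=
  fun p => if insub p is Some i then s i else false.

Lemma extP S : (forall p, (n <= p)%N -> S p = false) -> exists s, S = ext s.
Proof.
move=> h; exists [ffun i : 'I_n => S i]; apply: funext => p; rewrite /ext.
case: insubP => [i _ <-|]; first by rewrite ffunE.
by rewrite -leqNgt; exact: h.
Qed.

Lemma ext_out s p : (n <= p)%N -> ext s p = false.
Proof. by rewrite /ext leqNgt; case: insubP => // i ->. Qed.

Lemma fock_supp_out F S : fock_supp F -> (exists s, S = ext s) \/ F S = 0.
Proof.
move=> hF; have [h|/existsNP[p /not_implyP[np /negP/negPn Sp]]] :=
  pselect (forall p, (n <= p)%N -> ~ S p).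
  by left; apply: extP => p /h /negP/negbTE.
by right; exact: hF np (negbNE Sp).
Qed.

End Clifford.

Section Fock.
Variables (K : numFieldType) (n : nat) (bl : nat -> nat).
Local Notation okp := (okp n bl).
Local Notation low := (low n bl).
Local Notation rep := (rep (K := K) n bl).
Local Notation hwm := (@hwm K n bl).
Local Notation hE := (@hE K n bl _).
Local Notation hN A := (@hN K n bl _ A).
Local Notation hv := (@hv K n bl _).
Variables (lam : nat -> K) (A : hwm lam) (k0 : nat).
Hypothesis kn : (k0 <= n)%N.
Local Notation M := (hM A).
Local Notation E := (hE A).
Local Notation v := (hv A).
Local Notation N := (hN A).
Local Notation FM := ((nat -> bool) -> M).
Local Notation FE := (fock_rep E).

Definition om_wt : nat -> K := fun p => lam p + (p < k0)%:R.
Definition fockN (F : FM) := forall S, N (F S).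
Definition top_set : nat -> bool := fun p => (p < k0)%N.
Definition fockv : FM := fun S => if `[< S = top_set >] then v else 0.

Lemma fockv_top : fockv top_set = v.
Proof. by rewrite /fockv; case: asboolP. Qed.

Lemma fockN_submod : submod FE fockN.
Proof.
have sN := hsub A; split; first split.
- by move=> S; exact: sub0 sN.1.
- by move=> c F G hF hG S; exact: sN.1.2.
move=> p q ok F hF S; rewrite /= /fock_op fctE; apply: subD; first exact: sN.1.
  by apply: sN.2.
have [->|pq] := eqVneq p q; first by rewrite wedge_diag; apply: subZ => //; exact: sN.1.
have [c [-> _]] := wedge_ne F S (negbTE pq); apply: subZ => //; exact: sN.1.
Qed.

Lemma fock_ishw : ishw FE fockN fockv om_wt.
Proof.
have sN := hsub A; split.
- exact: fockN_submod.
- by move/(_ top_set); rewrite fockv_top; exact: hvN.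
- move=> p q ok pq S; rewrite /= /fock_op fctE; apply: subD; first exact: sN.1.
    rewrite /fockv; case: asboolP => _; first exact: hraise.
    by rewrite op0; exact: sub0 sN.1.
  have npq : (p == q) = false by rewrite ltn_eqF.
  have [c [-> hc]] := wedge_ne fockv S npq.
  have [h|h] := boolP (S p && ~~ S q); last first.
    by rewrite hc // scale0r; exact: sub0 sN.1.
  rewrite /fockv; case: asboolP => e; last by rewrite scaler0; exact: sub0 sN.1.
  have := congr1 (fun T => T p) e; have := congr1 (fun T => T q) e.
  rewrite /= flip_eq flip_ne 1?eq_sym // [flip q _ p]flip_ne // flip_eq /top_set.
  by case/andP: h => -> /negbTE -> /= /esym q0 /esym p0; lia.
- move=> p pn S; rewrite !fctE /= /fock_op fctE wedge_diag /fockv.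
  case: asboolP => [->|_]; last by rewrite op0 !scaler0 addr0 subrr; exact: sub0 sN.1.
  have := hdiag A pn; apply: prop_eq; rewrite /om_wt /top_set; lmod_with K (hM A); ring.
Qed.

Definition fock_hwm : hwm om_wt := Hwm fock_ishw.

Lemma fockv_supp : fock_supp n fockv.
Proof.
move=> S p np Sp; rewrite /fockv; case: asboolP => // e.
by move: Sp; rewrite e /top_set; lia.
Qed.

Lemma fock_gen F : gen FE fockv F -> fock_supp n F /\ forall S, gen E v (F S).
Proof.
move=> gF; split; first exact: gen_min (fock_supp_submod E) fockv_supp gF.
have sg := gen_submod E v.
have sG : submod FE (fun F => forall S, gen E v (F S)).
  split; first split.
  - by move=> S; exact: sub0 sg.1.
  - by move=> c G H hG hH S; apply: sg.1.2; [exact: hG|exact: hH].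
  move=> p q ok G hG S; rewrite /= /fock_op fctE; apply: (subD sg.1); first exact: sg.2.
  have [->|pq] := eqVneq p q; first by rewrite wedge_diag; exact: (subZ sg.1).
  by have [c [-> _]] := wedge_ne G S (negbTE pq); exact: (subZ sg.1).
apply: gen_min sG _ gF => S; rewrite /fockv; case: asboolP => _.
  exact: gen_refl.
exact: sub0 sg.1.
Qed.

Lemma fock_Bk k F : Bk FE fockv k F -> forall S, Bk E v k (F S).
Proof.
have sB j := Bk_subspace E v j.
have aw w : low w -> forall S, Bk E v (size w) (act FE w fockv S).
  elim: w => [_ S|[p q] w IH /= /andP[/andP[ok lt] /IH{}IH] S].
    rewrite /= /fockv; case: asboolP => _; last exact: sub0.
    exact: (Bk_act E v (w := [::])).
  rewrite /fock_op fctE; apply: subD => //; first exact: Bk_op.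
  have h S' : Bk E v (size w).+1 (act FE w fockv S') by apply: Bk_mono (IH S'); exact: leqnSn.
  have pq : (p == q) = false by rewrite gtn_eqF.
  by have [c [-> _]] := wedge_ne (act FE w fockv) S pq; apply: subZ.
move=> [t lt ->] S; rewrite /comb fct_sumE big_seq; apply: sub_sum => // a ta.
have /andP[la sa] := allP lt _ ta; rewrite fctE; apply: subZ => //.
exact: Bk_mono sa (aw _ la S).
Qed.

Lemma fock_le : gle A fock_hwm.
Proof.
exists #|{: {ffun 'I_n -> bool}}| => k d hd.
have c0 : (0 < #|{: {ffun 'I_n -> bool}}|)%N by apply/card_gt0P; exists [ffun=> false].
have hd' : dle N (Bk E v k) d.
  apply: dle_mono hd => //; [exact: hss|exact: Bk_subspace|].
  by move=> m; apply: Bk_mono; nia.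
apply: (dle_embed (ev := fun s F => F (ext s)) _ _ _ _ _ _ hd').
- exact: hss.
- exact: Bk_subspace.
- exact: Bk_subspace.
- by [].
- by move=> F hF s; exact: fock_Bk hF _.
move=> F hF h S; have [/(_ S)] := fock_gen (Bk_gen hF).
move=> _ _; have [[s ->]|->] := fock_supp_out S (fock_gen (Bk_gen hF)).1; first exact: h.
exact: sub0 (hss A).
Qed.

Let cov k m := exists2 q : {ffun 'I_n -> bool} -> FM,
  (forall s, Bk FE fockv k (q s)) & m = \sum_s q s (ext s).

Lemma cov_subspace k : is_subspace (cov k).
Proof.
have sB := Bk_subspace FE fockv k; split.
  exists (fun=> 0) => [s|]; first exact: sub0.
  by rewrite big1.
move=> c _ _ [q1 h1 ->] [q2 h2 ->]; exists (fun s => c *: q1 s + q2 s).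
  by move=> s; exact: sB.2.
by rewrite scaler_sumr -big_split.
Qed.

Lemma cov_one k F (s : {ffun 'I_n -> bool}) : Bk FE fockv k F -> cov k (F (ext s)).
Proof.
move=> hF; exists (fun s' => if s' == s then F else 0).
  by move=> s'; case: ifP => _ //; exact: sub0 (Bk_subspace _ _ _).
by rewrite (bigD1 s) //= eqxx big1 ?addr0 // => s' /negbTE ->.
Qed.

Lemma cov_op k m p q : okp p q -> (q < p)%N -> cov k m -> cov k.+1 (E p q m).
Proof.
move=> ok lt [f hf ->]; have sC := cov_subspace k.+1.
rewrite op_sum; apply: sub_sum => // s _.
have pq : (p == q) = false by rewrite gtn_eqF.
have [c [ec _]] := wedge_ne (f s) (ext s) pq.
have -> : E p q (f s (ext s)) = FE p q (f s) (ext s) - c *: f s (flip q (flip p (ext s))).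
  by rewrite /= /fock_op fctE ec addrK.
apply: subB => //; first by apply: cov_one; exact: Bk_op.
have [s' ->] : exists s' : {ffun 'I_n -> bool}, flip q (flip p (ext s)) = ext s'.
  apply: extP => r nr; have [pn qn] := (okp_l ok, okp_r ok).
  by rewrite !flip_ne ?ext_out //; apply/eqP; lia.
apply: subZ => //; apply: cov_one; exact: Bk_mono (leqnSn k) (hf s).
Qed.

Lemma cov_Bk k m : Bk E v k m -> cov k m.
Proof.
have aw w : low w -> cov (size w) (act E w v).
  elim: w => [_|[p q] w IH /= /andP[/andP[ok lt] /IH{}IH]]; last exact: cov_op.
  have [s es] : exists s : {ffun 'I_n -> bool}, top_set = ext s.
    by apply: extP => p np; rewrite /top_set; lia.
  rewrite /= -fockv_top es; apply: cov_one; exact: (Bk_act FE fockv (w := [::])).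
have mono j l x : (j <= l)%N -> cov j x -> cov l x.
  by move=> jl [q hq ->]; exists q => // s; exact: Bk_mono jl (hq s).
move=> [t lt ->]; rewrite /comb big_seq; apply: sub_sum => [|a ta]; first exact: cov_subspace.
have /andP[la sa] := allP lt _ ta; apply: subZ; first exact: cov_subspace.
exact: mono sa (aw _ la).
Qed.

Lemma fock_ge : gle fock_hwm A.
Proof.
exists #|{: {ffun 'I_n -> bool}}| => k d hd.
have c0 : (0 < #|{: {ffun 'I_n -> bool}}|)%N by apply/card_gt0P; exists [ffun=> false].
have hd' : dle fockN (Bk FE fockv k) d.
  apply: dle_mono hd => //; [exact: fockN_submod.1|exact: Bk_subspace|].
  by move=> m; apply: Bk_mono; nia.
apply: (dle_cover (pr := fun s F => F (ext s)) _ _ _ _ _ _ hd').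
- exact: hss.
- exact: fockN_submod.1.
- exact: Bk_subspace.
- by [].
- by move=> s F; exact.
move=> m /cov_Bk[q hq ->]; exists q => //; rewrite subrr; exact: sub0 (hss A).
Qed.

End Fock.

Lemma sum_delta (K : pzRingType) (V : lmodType K) n s (F : nat -> V) : (s < n)%N ->
  \sum_(p < n) (s == p)%:R *: F p = F s.
Proof.
move=> sn; rewrite (bigD1 (Ordinal sn)) //= eqxx scale1r big1 ?addr0 // => i.
by rewrite -val_eqE /= eq_sym => /negbTE ->; rewrite scale0r.
Qed.

(** * The Casimir operator and translation of weights *)

Section Casimir.
Variables (K : numFieldType) (n : nat) (bl : nat -> nat).
Hypothesis bl_mono : forall p q, (p <= q)%N -> (q < n)%N -> (bl p <= bl q)%N.
Local Notation okp := (okp n bl).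
Local Notation low := (low n bl).
Local Notation rep := (rep (K := K) n bl).
Local Notation hwm := (@hwm K n bl).
Local Notation hE := (@hE K n bl _).
Local Notation hN A := (@hN K n bl _ A).
Local Notation hv := (@hv K n bl _).

Lemma okpE p q : (p < n)%N -> (q < n)%N -> okp p q = (bl p == bl q).
Proof. by rewrite /okp => -> ->. Qed.

Lemma wt_block (F : pzRingType) w (g : nat -> F) : okw n bl w ->
  \sum_(p < n) g (bl p) * (wt w p)%:~R = 0.
Proof.
elim: w => [_|[a b] w IH /= /andP[ok /IH{}IH]].
  by rewrite big1 // => p _; rewrite wt_nil mulr0.
have d s : (s < n)%N -> \sum_(p < n) g (bl p) * (s == p :> nat)%:R = g (bl s).
  move=> sn; rewrite (bigD1 (Ordinal sn)) //= eqxx mulr1 big1 ?addr0 // => i.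
  by rewrite -val_eqE /= eq_sym => /negbTE ->; rewrite mulr0.
transitivity (\sum_(p < n) (g (bl p) * (a == p)%:R - g (bl p) * (b == p)%:R + g (bl p) * (wt w p)%:~R)).
  by apply: eq_bigr => p _; rewrite wt_cons /= !(intrD, rmorphN) /= mulrDr mulrBr.
rewrite big_split sumrB /= IH !d ?(okp_l ok) ?(okp_r ok) // addr0.
have [an bn] := (okp_l ok, okp_r ok).
by move: ok; rewrite okpE // => /eqP ->; rewrite subrr.
Qed.

Section Op.
Variables (M : lmodType K) (E : rep M).
Local Ltac lmod := lmod_with K M.

Definition casimir m : M :=
  \sum_(p < n) \sum_(q < n) (bl p == bl q)%:R *: E p q (E q p m).

Lemma casimir_lin : linear casimir.
Proof.
move=> c x y; rewrite /casimir scaler_sumr -big_split; apply: eq_bigr => p _.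
rewrite scaler_sumr -big_split; apply: eq_bigr => q _ /=.
by rewrite !opD !opZ; lmod; ring.
Qed.

Lemma casimir_comm r s m : okp r s -> E r s (casimir m) = casimir (E r s m).
Proof.
move=> ok; have [rn sn] := (okp_l ok, okp_r ok).
have brs : bl r = bl s by move: ok; rewrite okpE // => /eqP.
pose T p q := (s == p)%:R *: E r q (E q p m) - (q == r)%:R *: E p s (E q p m)
  + ((s == q)%:R *: E p q (E r p m) - (p == r)%:R *: E p q (E q s m)).
have e p q : (p < n)%N -> (q < n)%N ->
    E r s ((bl p == bl q)%:R *: E p q (E q p m)) =
    (bl p == bl q)%:R *: E p q (E q p (E r s m)) + (bl p == bl q)%:R *: T p q.
  move=> pn qn; rewrite opZ -scalerDr; have [b|_] := eqVneq (bl p) (bl q); last by rewrite !scale0r.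
  have o1 : okp p q by rewrite okpE // b.
  have o2 : okp q p by rewrite okpE // b.
  rewrite (op_rel E ok o1) (op_rel E ok o2) !opE /T; lmod; ring.
rewrite /casimir op_sum.
transitivity (\sum_(p < n) \sum_(q < n) ((bl p == bl q)%:R *: E p q (E q p (E r s m)) +
   (bl p == bl q)%:R *: T p q)).
  by apply: eq_bigr => p _; rewrite op_sum; apply: eq_bigr => q _; exact: e.
under eq_bigr do rewrite big_split /=; rewrite big_split /= -[RHS]addr0; congr (_ + _).
have t1 : \sum_(p < n) \sum_(q < n) (bl p == bl q)%:R *: ((s == p)%:R *: E r q (E q p m)) =
   \sum_(q < n) (bl s == bl q)%:R *: E r q (E q s m).
  rewrite -(sum_delta (fun p => \sum_(q < n) (bl p == bl q)%:R *: E r q (E q p m)) sn).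
  apply: eq_bigr => p _; rewrite scaler_sumr; apply: eq_bigr => q _.
  by rewrite !scalerA mulrC.
have t2 : \sum_(p < n) \sum_(q < n) (bl p == bl q)%:R *: ((q == r :> nat)%:R *: E p s (E q p m)) =
   \sum_(p < n) (bl p == bl r)%:R *: E p s (E r p m).
  apply: eq_bigr => p _; rewrite -(sum_delta (fun q => (bl p == bl q)%:R *: E p s (E q p m)) rn).
  by apply: eq_bigr => q _; rewrite !scalerA mulrC eq_sym.
have t3 : \sum_(p < n) \sum_(q < n) (bl p == bl q)%:R *: ((s == q)%:R *: E p q (E r p m)) =
   \sum_(p < n) (bl p == bl s)%:R *: E p s (E r p m).
  apply: eq_bigr => p _; rewrite -(sum_delta (fun q => (bl p == bl q)%:R *: E p q (E r p m)) sn).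
  by apply: eq_bigr => q _; rewrite !scalerA mulrC.
have t4 : \sum_(p < n) \sum_(q < n) (bl p == bl q)%:R *: ((p == r :> nat)%:R *: E p q (E q s m)) =
   \sum_(q < n) (bl r == bl q)%:R *: E r q (E q s m).
  rewrite -(sum_delta (fun p => \sum_(q < n) (bl p == bl q)%:R *: E p q (E q s m)) rn).
  apply: eq_bigr => p _; rewrite scaler_sumr; apply: eq_bigr => q _.
  by rewrite !scalerA mulrC eq_sym.
transitivity (\sum_(p < n) \sum_(q < n) (bl p == bl q)%:R *: ((s == p)%:R *: E r q (E q p m))
  - \sum_(p < n) \sum_(q < n) (bl p == bl q)%:R *: ((q == r :> nat)%:R *: E p s (E q p m))
  + (\sum_(p < n) \sum_(q < n) (bl p == bl q)%:R *: ((s == q)%:R *: E p q (E r p m))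
  - \sum_(p < n) \sum_(q < n) (bl p == bl q)%:R *: ((p == r :> nat)%:R *: E p q (E q s m)))).
  rewrite -!sumrB -big_split; apply: eq_bigr => p _.
  rewrite -!sumrB -big_split; apply: eq_bigr => q _ /=.
  by rewrite /T; lmod; ring.
by rewrite t1 t2 t3 t4 brs; lmod; ring.
Qed.

Definition cas_val (kap : nat -> K) : K :=
  \sum_(p < n) \sum_(q < n) (bl p == bl q)%:R *
    (if p == q then kap p ^+ 2 else if (p < q)%N then kap p - kap q else 0).

Lemma casimir_singular (N : M -> Prop) y kap : submod E N ->
  (forall p q, okp p q -> (p < q)%N -> N (E p q y)) ->
  (forall p, (p < n)%N -> N (E p p y - kap p *: y)) ->
  N (casimir y - cas_val kap *: y).
Proof.
move=> sN up dg; rewrite /casimir /cas_val scaler_suml -sumrB.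
apply: sub_sum => [|p _]; first exact: sN.1.
rewrite scaler_suml -sumrB; apply: sub_sum => [|q _]; first exact: sN.1.
rewrite -scalerA -scalerBr; have [b|_] := eqVneq (bl p) (bl q); last first.
  by rewrite scale0r; exact: sub0 sN.1.
apply: subZ; first exact: sN.1.
have o1 : okp p q by rewrite okpE // b.
have o2 : okp q p by rewrite okpE // b.
have okpp' (r : 'I_n) : okp r r by rewrite okpp.
rewrite -val_eqE /=; case: ltngtP => [lt|gt|e].
- have -> : E p q (E q p y) = E q p (E p q y) + (E p p y - E q q y).
    by rewrite (op_rel E o1 o2) !eqxx !scale1r.
  have := subD sN.1 (sN.2 _ _ o2 _ (up _ _ o1 lt)) (subB sN.1 (dg p (ltn_ord p)) (dg q (ltn_ord q))).
  by apply: prop_eq; lmod; ring.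
- by rewrite scale0r subr0; apply: sN.2 => //; exact: up.
- rewrite -e; have h := dg p (ltn_ord p).
  have := subD sN.1 (sN.2 _ _ (okpp' p) _ h) (subZ sN.1 (kap p) h); apply: prop_eq.
  by rewrite opB opZ; lmod; ring.
Qed.

End Op.

Let blK (b : nat) : K := \sum_(q < n) (bl q == b)%:R - 1 + (\sum_(q < n) (bl q < b)%:R + \sum_(q < n) (bl q < b)%:R).

Lemma cas_valE kap : cas_val kap =
  \sum_(p < n) (kap p - p%:R) ^+ 2 + \sum_(p < n) blK (bl p) * kap p - \sum_(p < n) p%:R ^+ 2.
Proof.
have e1 : cas_val kap = \sum_(p < n) kap p ^+ 2 +
    \sum_(p < n) \sum_(q < n) ((bl p == bl q) && (p < q)%N)%:R * (kap p - kap q).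
  rewrite /cas_val -big_split; apply: eq_bigr => p _ /=.
  rewrite (bigD1 p) //= !eqxx mul1r; congr (_ + _).
  rewrite [RHS](bigD1 p) //= ltnn andbF mul0r add0r; apply: eq_bigr => q /negbTE qp.
  by rewrite [p == q]eq_sym qp; case: (bl p == bl q); case: (p < q)%N; rewrite /= ?mul1r ?mul0r ?mulr0.
have e2 : \sum_(p < n) \sum_(q < n) ((bl p == bl q) && (p < q)%N)%:R * (kap p - kap q) =
    \sum_(p < n) kap p * \sum_(q < n) (((bl p == bl q) && (p < q)%N)%:R - ((bl p == bl q) && (q < p)%N)%:R).
  transitivity (\sum_(p < n) \sum_(q < n) ((bl p == bl q) && (p < q)%N)%:R * kap p
     - \sum_(p < n) \sum_(q < n) ((bl p == bl q) && (p < q)%N)%:R * kap q).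
    by rewrite -sumrB; apply: eq_bigr => p _; rewrite -sumrB; apply: eq_bigr => q _; rewrite mulrBr.
  rewrite [X in _ - X]exchange_big /= -sumrB; apply: eq_bigr => p _.
  rewrite -sumrB mulr_sumr; apply: eq_bigr => q _ /=.
  by rewrite [bl q == _]eq_sym; ring.
have e3 (p : 'I_n) : \sum_(q < n) (((bl p == bl q) && (p < q)%N)%:R - ((bl p == bl q) && (q < p)%N)%:R)
   = blK (bl p) - (p%:R + p%:R).
  have -> : p%:R = \sum_(q < n) (q < p)%N%:R :> K.
    rewrite -natr_sum; congr _%:R; rewrite -[LHS]card_ord -sum1_card.
    by rewrite (big_ord_widen n (fun=> 1%N) (ltnW (ltn_ord p))) big_mkcond; apply: eq_bigr => q _; case: ifP.
  transitivity (\sum_(q < n) ((bl q == bl p)%:R - (p == q)%:R + ((bl q < bl p)%N%:R + (bl q < bl p)%N%:R) - ((q < p)%N%:R + (q < p)%N%:R)) : K).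
    apply: eq_bigr => q _; rewrite -val_eqE /=.
    have m1 := @bl_mono p q; have m2 := @bl_mono q p; have qn := ltn_ord q; have pn := ltn_ord p.
    by case: (ltngtP p q) m1 m2 => [lt|lt|e] m1 m2; case: (ltngtP (bl q) (bl p)) => h; rewrite /=; try ring; exfalso; lia.
  rewrite /blK !(sumrB, big_split) /=; congr (_ - _ + _ - _).
  by rewrite (bigD1 p) //= eqxx big1 ?addr0 // => q /negbTE qp; rewrite eq_sym qp.
transitivity (\sum_(p < n) ((kap p - p%:R) ^+ 2 + blK (bl p) * kap p - p%:R ^+ 2)); last first.
  by rewrite sumrB big_split.
by rewrite e1 e2 -[LHS]big_split /=; apply: eq_bigr => p _; rewrite e3; ring.
Qed.

Variables (lam : nat -> K) (A : hwm lam).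

(** The Casimir operator is central, so it acts on a singular vector by the scalar by which it
acts on the highest weight vector. *)
Lemma central_sq y kap : gen (hE A) (hv A) y -> ~ hN A y ->
  (forall p q, okp p q -> (p < q)%N -> hN A (hE A p q y)) ->
  (forall p, (p < n)%N -> hN A (hE A p p y - kap p *: y)) ->
  \sum_(p < n) (lam p - p%:R) ^+ 2 = \sum_(p < n) (kap p - p%:R) ^+ 2.
Proof.
move=> gy Ny up dg; have sN := hsub A.
have [w lw ew] := wt_of gy Ny dg.
have sC : submod (hE A) (fun m => hN A (casimir (hE A) m - cas_val lam *: m)).
  have clin := casimir_lin (hE A).
  split; first split.
  - have -> : casimir (hE A) 0 = 0 by exact: linop0 clin.
    by rewrite scaler0 subrr; exact: sub0 sN.1.
  - move=> c m1 m2 h1 h2; have := sN.1.2 c _ _ h1 h2; apply: prop_eq.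
    by rewrite clin; lmod_with K (hM A); ring.
  move=> p q ok m h; have := sN.2 p q ok _ h; apply: prop_eq.
  by rewrite opB opZ casimir_comm.
have h1 := gen_min sC (casimir_singular sN (hraise A) (hdiag A)) gy.
have h2 := casimir_singular sN up dg.
have cE : cas_val lam = cas_val kap.
  apply/eqP; rewrite -subr_eq0; apply/negP => /negP c0; apply: Ny.
  apply: (subZ_inv sN.1 c0); have := subB sN.1 h2 h1; apply: prop_eq.
  by lmod_with K (hM A); ring.
move: cE; rewrite !cas_valE => /addIr.
have -> : \sum_(p < n) blK (bl p) * kap p = \sum_(p < n) blK (bl p) * lam p.
  transitivity (\sum_(p < n) (blK (bl p) * lam p + blK (bl p) * (wt w p)%:~R)).
    by apply: eq_bigr => p _; rewrite ew // /shift_wt mulrDr.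
  by rewrite big_split /= (wt_block blK (low_okw lw)) addr0.
exact: addIr.
Qed.

End Casimir.

Section Translation.
Variables (K : numFieldType) (n : nat) (bl : nat -> nat).
Hypothesis bl_mono : forall p q, (p <= q)%N -> (q < n)%N -> (bl p <= bl q)%N.
Local Notation okp := (okp n bl).
Local Notation low := (low n bl).
Local Notation rep := (rep (K := K) n bl).
Local Notation hwm := (@hwm K n bl).
Local Notation hE := (@hE K n bl _).
Local Notation hN A := (@hN K n bl _ A).
Local Notation hv := (@hv K n bl _).
Local Notation Gle := (@Gle K n bl).

Lemma Gle_ext (lam mu : nat -> K) : (forall p, (p < n)%N -> lam p = mu p) -> Gle lam mu.
Proof.
move=> e; apply: Gle_intro => A iA.
have hw : ishw (hE A) (hN A) (hv A) mu.
  case: (hP A) => h1 h2 h3 h4; split=> // p pn; rewrite -e //; exact: h4.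
exists (Hwm hw); exists 1%N => k d; rewrite !mul1n.
apply: dle_mono => //; [exact: hss|exact: Bk_subspace|].
by move=> m; apply: Bk_mono; rewrite leq_addr.
Qed.

(** The action of [E p p] may be shifted by a scalar that depends only on the block of [p]. *)
Lemma Gle_twist lam (c : nat -> K) : Gle lam (fun p => lam p + c (bl p)).
Proof.
apply: Gle_intro => A iA; have sN := hsub A.
pose op' p q m := hE A p q m + ((p == q)%:R * c (bl p)) *: m.
have l1 p q : linear (op' p q).
  by move=> k x y; rewrite /op' opD opZ; lmod_with K (hM A); ring.
have l2 p q r s : okp p q -> okp r s -> forall m, op' p q (op' r s m) =
      op' r s (op' p q m) + ((q == r)%:R *: op' p s m - (s == p)%:R *: op' r q m).
  move=> h1 h2 m; rewrite /op' !opD !opZ (op_rel (hE A) h1 h2).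
  have e : ((q == r)%:R * ((p == s)%:R * c (bl p)) - (s == p)%:R * ((r == q)%:R * c (bl r)) = 0).
    rewrite [r == q]eq_sym [p == s]eq_sym.
    case: eqVneq => [e|_]; last by rewrite !mul0r mulr0 subrr.
    case: eqVneq => [_|_]; last by rewrite !mul0r mulr0 subrr.
    rewrite -e; have [pn qn] := (okp_l h1, okp_r h1).
    by move: h1; rewrite okpE // => /eqP ->; rewrite !mul1r subrr.
  have : ((q == r)%:R * ((p == s)%:R * c (bl p)) - (s == p)%:R * ((r == q)%:R * c (bl r))) *: m = 0.
    by rewrite e scale0r.
  set x := (_ * (_ * c (bl p))); set y := (_ * (_ * c (bl r))) => e'.
  rewrite -[LHS]addr0 -e' /x /y; lmod_with K (hM A); ring.
pose E' := Rep l1 l2.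
have sN' : submod E' (hN A).
  split; first exact: sN.1.
  move=> p q ok m hm; rewrite /= /op'; apply: subD; first exact: sN.1.
    exact: sN.2.
  by apply: subZ => //; exact: sN.1.
have hw : ishw E' (hN A) (hv A) (fun p => lam p + c (bl p)).
  split=> //; first exact: hvN.
    by move=> p q ok lt; rewrite /= /op' ltn_eqF // mul0r scale0r addr0; exact: hraise.
  move=> p pn; rewrite /= /op' eqxx mul1r; have := hdiag A pn; apply: prop_eq.
  by lmod_with K (hM A); ring.
exists (Hwm hw); exists 1%N => k d; rewrite !mul1n.
have aw w : low w -> act E' w (hv A) = act (hE A) w (hv A).
  elim: w => //= -[p q] w IH /= /andP[/andP[_ lt] /IH ->].
  by rewrite /op' gtn_eqF // mul0r scale0r addr0.
apply: dle_mono => //; [exact: hss|exact: Bk_subspace|].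
move=> m [t lt ->]; exists t.
  by apply: lowc_mono lt; rewrite leq_addr.
rewrite /comb !big_seq; apply: eq_bigr => a ta.
by have /andP[la _] := allP lt _ ta; rewrite aw.
Qed.

(** The tensor product with the exterior algebra of the natural module has the growth of the module,
and the product of the highest weight vector with [e_1 /\ ... /\ e_k0] is singular. *)
Lemma Gle_om lam k0 : (k0 <= n)%N -> Gle lam (om_wt lam k0).
Proof. by move=> kn; apply: Gle_intro => A iA; exists (fock_hwm A kn); exact: fock_le. Qed.

Variables (R : realDomainType) (re : {additive K -> R}).
Hypothesis re1 : re 1 = 1.

Lemma re_nat m : re m%:R = m%:R.
Proof. by rewrite raddfMn re1. Qed.

Lemma re_int (z : int) : re z%:~R = z%:~R.
Proof. by case: z => m; rewrite ?NegzE ?mulrNz ?raddfN /= -?pmulrn re_nat. Qed.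

Lemma re_bool (b : bool) x : re (x * b%:R) = re x * b%:R.
Proof. by case: b; rewrite ?mulr1 ?mulr0 ?raddf0. Qed.

(** The converse of [Gle_om] away from the walls. A singular vector of the tensor product with the
exterior algebra has a weight [lam + eps_S] for a set [S] of positions. Comparing the real parts of
the Casimir values leaves only the set of the first [k0] positions, so the tensor product is
irreducible, and it has the growth of the original module. *)
Lemma Gle_om_inv lam k0 : (k0 <= n)%N ->
  (forall p, okp p k0.-1 -> (p < k0.-1)%N -> re (lam k0.-1 - k0.-1%:R) <= re (lam p - p%:R)) ->
  (forall q, okp k0.-1 q -> (k0 <= q)%N -> re (lam q - q%:R) < re (lam k0.-1 - k0.-1%:R)) ->
  Gle (om_wt lam k0) lam.
Proof.
move=> kn wd sd; case: (posnP k0) => [->|k0p].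
  by apply: Gle_ext => p _; rewrite /om_wt ltn0 addr0.
move=> C iC A iA.
suff iF : irr (fock_hwm A kn) by exact: (gle_trans (gle_irr C iF) (fock_ge A kn)).
apply: irr_crit => y kap gy Ny up dg; have sN := hsub A.
have [sy gyS] := fock_gen kn gy.
have [s0 Ns0] : exists s0 : {ffun 'I_n -> bool}, ~ hN A (y (ext s0)).
  apply: contrapT => h; apply: Ny => S; have [[s ->]|->] := fock_supp_out S sy.
    by apply: contrapT => h'; apply: h; exists s.
  exact: sub0 sN.1.
pose wgt (s : {ffun 'I_n -> bool}) := (\sum_(p < n) p * ext s p)%N.
have [s Ns smax] : exists2 s : {ffun 'I_n -> bool}, ~ hN A (y (ext s)) &
    forall s', (wgt s < wgt s')%N -> hN A (y (ext s')).
  case: (@arg_maxnP _ s0 (fun s => `[< ~ hN A (y (ext s)) >]) wgt); first exact/asboolP.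
  move=> s /asboolP Ns smax; exists s => // s' lt; apply: contrapT => h.
  by have := smax s' (asboolT h); rewrite /= leqNgt lt.
set S := ext s in Ns.
have upS p q : okp p q -> (p < q)%N -> hN A (hE A p q (y S)).
  move=> ok lt; have pq : (p == q) = false by rewrite ltn_eqF.
  have [pn qn] := (okp_l ok, okp_r ok).
  have [c [ec hc]] := wedge_ne y S pq.
  have := up p q ok lt S; rewrite /= /fock_op fctE ec.
  have [/andP[Sp Sq]|/hc ->] := boolP (S p && ~~ S q); last by rewrite scale0r addr0.
  have [s' es] : exists s' : {ffun 'I_n -> bool}, flip q (flip p S) = ext s'.
    apply: extP => r nr; rewrite !flip_ne /S ?ext_out //; apply/eqP; lia.
  have Ns' : hN A (y (flip q (flip p S))).
    rewrite es; apply: smax; rewrite /wgt -es -/S.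
    rewrite (bigD1 (Ordinal pn)) // (bigD1 (Ordinal qn)) //=; last by rewrite -val_eqE /= eq_sym pq.
    rewrite [ltnRHS](bigD1 (Ordinal pn)) // [in ltnRHS](bigD1 (Ordinal qn)) //=; last by rewrite -val_eqE /= eq_sym pq.
    rewrite flip_eq [flip q _ p]flip_ne // flip_eq flip_ne; last by rewrite eq_sym.
    rewrite Sp (negbTE Sq) /= [X in (_ < _ + (_ + X))%N](eq_bigr (fun i : 'I_n => i * S i)%N); last first.
      by move=> i /andP[ip iq]; rewrite !flip_ne //; apply: negbTE; rewrite -val_eqE in ip iq.
    by move: (\sum_(i < n | _) _)%N => X; lia.
  move=> h; have := subB sN.1 h (subZ sN.1 c Ns'); apply: prop_eq; by rewrite addrK.
have dgS p : (p < n)%N -> hN A (hE A p p (y S) - (kap p - (S p)%:R) *: y S).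
  move=> pn; have := dg p pn S; rewrite /= !fctE /fock_op fctE wedge_diag; apply: prop_eq.
  by lmod_with K (hM A); ring.
have kS p : (p < n)%N -> kap p = lam p + (S p)%:R.
  move=> pn; apply/eqP; rewrite -subr_eq; apply/negP => /negP ne.
  exact: (Ns (irr_singular (kap := fun p => kap p - (S p)%:R) iA (gyS S) upS dgS pn ne)).
have [w lw ew] := wt_of gy Ny dg.
pose D p : R := (p < k0)%N%:R - (S p)%:R.
have Dw p : (p < n)%N -> D p = - (wt w p)%:~R.
  move=> pn; have := ew p pn; rewrite kS // /shift_wt /om_wt -addrA => /addrI e.
  have : re (S p)%:R = re ((p < k0)%N%:R + (wt w p)%:~R) by rewrite e.
  by rewrite raddfD /= re_int !re_nat /D => ->; ring.
have sD : \sum_(p < n) D p = 0.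
  transitivity (- \sum_(p < n) 1 * (wt w p)%:~R : R).
    by rewrite -sumrN; apply: eq_bigr => p _; rewrite Dw // mul1r.
  by rewrite (wt_block (fun=> 1 : R) (low_okw lw)) oppr0.
have sq := central_sq bl_mono gy Ny up dg.
pose x p := re (lam p - p%:R).
have xD : \sum_(p < n) x p * D p = 0.
  have : \sum_(p < n) ((om_wt lam k0 p - p%:R) ^+ 2 - (kap p - p%:R) ^+ 2) = 0.
    by rewrite sumrB sq subrr.
  rewrite (eq_bigr (fun p : 'I_n => (lam p - p%:R) * (p < k0)%N%:R *+ 2 - (lam p - p%:R) * (S p)%:R *+ 2
     + ((p < k0)%N%:R - (S p)%:R))); last first.
    move=> p _; rewrite kS // /om_wt; case: (p < k0)%N; case: (S p) => /=; ring.
  move/(congr1 re); rewrite raddf0 raddf_sum /= => e.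
  have : \sum_(p < n) (x p * D p *+ 2 + D p) = 0.
    rewrite -[RHS]e; apply: eq_bigr => p _.
    rewrite /x /D; move: (lam p - p%:R) => z.
    by rewrite raddfD !raddfB /= !re_nat !raddfMn /= !re_bool; ring.
  rewrite big_split /= sumrMnl.
  by rewrite sD addr0 => /eqP; rewrite mulrn_eq0 => /eqP.
have bn : (bl k0.-1 <= bl k0.-1)%N by [].
pose B := 1 + \sum_(p < n) `|x p|.
have xB p : (p < n)%N -> - B < x p < B.
  move=> pn; rewrite -ltr_norml /B (bigD1 (Ordinal pn)) //= addrCA ltrDl.
  by rewrite ltr_pwDl // sumr_ge0.
pose th b := if b == bl k0.-1 then x k0.-1 else if (b < bl k0.-1)%N then - B else B.
have thA p : (p < k0)%N -> th (bl p) <= x p.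
  move=> pk; have pn : (p < n)%N by exact: leq_trans pk kn.
  have k1 : (k0.-1 < n)%N by lia.
  rewrite /th; case: eqP => [e|/eqP ne].
    have [->//|lt] : p = k0.-1 \/ (p < k0.-1)%N by lia.
    by apply: wd => //; rewrite okpE // e.
  have -> : (bl p < bl k0.-1)%N by rewrite ltn_neqAle ne /=; apply: bl_mono => //; lia.
  by have /andP[/ltW] := xB p pn.
have thB p : (k0 <= p)%N -> (p < n)%N -> x p < th (bl p).
  move=> pk pn; have k1 : (k0.-1 < n)%N by lia.
  rewrite /th; case: eqP => [e|/eqP ne].
    by apply: sd => //; rewrite okpE // e.
  have -> : (bl p < bl k0.-1)%N = false.
    by apply/negbTE; rewrite -leqNgt; apply: bl_mono => //; lia.
  by have /andP[] := xB p pn.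
have tD : \sum_(p < n) (x p - th (bl p)) * D p = 0.
  under eq_bigr do rewrite mulrBl.
  have thD : \sum_(p < n) th (bl p) * D p = - \sum_(p < n) th (bl p) * (wt w p)%:~R.
    by rewrite -sumrN; apply: eq_bigr => p _; rewrite Dw // mulrN.
  by rewrite sumrB xD thD (wt_block th (low_okw lw)) oppr0 subrr.
have S0 p : (k0 <= p)%N -> (p < n)%N -> S p = false.
  move=> pk pn.
  have /psumr_eq0P/(_ tD) h : forall i : 'I_n, true -> 0 <= (x i - th (bl i)) * D i.
    move=> i _; rewrite /D; case: (ltnP i k0) => ik.
      by rewrite mulr_ge0 ?subr_ge0 ?thA //; case: (S i); rewrite ?lexx.
    by rewrite sub0r mulr_le0 ?oppr_le0 ?ler0n // subr_le0 ltW // thB.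
  have := h (Ordinal pn) isT; rewrite /= /D ltnNge pk /= => /eqP.
  rewrite mulf_eq0 subr_eq0 lt_eqF ?thB //= sub0r oppr_eq0 pnatr_eq0.
  by case: (S p).
have D0 : forall i : 'I_n, true -> 0 <= D i.
  move=> i _; rewrite /D; case: (ltnP i k0) => ik; last by rewrite S0 // subrr.
  by case: (S i); rewrite /= ?subrr // subr0 ler01.
move=> p pn; rewrite kS // /om_wt; have := psumr_eq0P D0 sD (i := Ordinal pn) isT.
rewrite /= /D => /eqP; rewrite subr_eq0 eqr_nat.
by case: (p < k0)%N; case: (S p).
Qed.

End Translation.

Definition exps l k : seq (seq nat) :=
  [seq e <- [seq map val (val t) | t <- enum {: l.-tuple 'I_k.+1}] | (sumn e <= k)%N].

Lemma exps_uniq l k : uniq (exps l k).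
Proof.
rewrite filter_uniq // map_inj_uniq ?enum_uniq // => t1 t2 h.
by apply/val_inj/(inj_map val_inj).
Qed.

Lemma mem_le_sumn (e : seq nat) x : x \in e -> (x <= sumn e)%N.
Proof.
elim: e => //= y e IH; rewrite inE => /predU1P[->|/IH h]; first exact: leq_addr.
exact: leq_trans h (leq_addl _ _).
Qed.

Lemma tuple_exps l k (e : seq nat) : size e = l -> all (fun x => x <= k)%N e ->
  exists t : l.-tuple 'I_k.+1, e = map val (val t).
Proof.
move=> se le; have st : size [seq inord x : 'I_k.+1 | x <- e] == l by rewrite size_map se.
exists (Tuple st); rewrite /= -map_comp -[LHS]map_id; apply/eq_in_map => x /(allP le) h.
by rewrite /= inordK.
Qed.

Lemma mem_exps l k e : (e \in exps l k) = (size e == l) && (sumn e <= k)%N.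
Proof.
rewrite mem_filter andbC; apply: andb_id2r => sk.
apply/mapP/eqP => [[t _ ->]|se]; first by rewrite size_map size_tuple.
have [|t et] := tuple_exps se (k := k); last by exists t => //; exact: mem_enum.
by apply/allP => x /mem_le_sumn h; exact: leq_trans h sk.
Qed.

Lemma count_pw (T : eqType) (L : seq T) (f : T -> nat) a : uniq L ->
  count_mem a (pw L (map f L)) = if a \in L then f a else 0%N.
Proof.
elim: L => //= b L IH /andP[bL uL]; rewrite pw_cons count_cat count_nseq IH // inE eq_sym.
rewrite /=; have [e|_] := eqVneq b a; last by rewrite mul0n.
by rewrite mul1n -e (negbTE bL) addn0.
Qed.

(** * Ordered monomials *)

Section PBW.
Variables (K : numFieldType) (n : nat) (bl : nat -> nat).
Local Notation okp := (okp n bl).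
Local Notation low := (low n bl).
Variables (M : lmodType K) (E : rep n bl M).
Implicit Types (w u : seq (nat * nat)).

Definition wspan (P : pred (seq (nat * nat))) m x :=
  exists2 t, all (fun a => P a.2) t & x = comb E t m.

Lemma wspan_subspace P m : is_subspace (wspan P m).
Proof.
split; first by exists [::] => //; rewrite comb_nil.
move=> c _ _ [t1 h1 ->] [t2 h2 ->].
exists ([seq (c * a.1, a.2) | a <- t1] ++ t2); last by rewrite comb_cat comb_scale.
by rewrite all_cat all_map; apply/andP.
Qed.

Lemma wspan_one (P : pred (seq (nat * nat))) w m : P w -> wspan P m (act E w m).
Proof. by move=> Pw; exists [:: (1, w)]; rewrite ?comb1 ?scale1r //= Pw. Qed.

Lemma wspan_sub (P : pred (seq (nat * nat))) (Q : M -> Prop) m x : is_subspace Q ->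
  (forall w, P w -> Q (act E w m)) -> wspan P m x -> Q x.
Proof.
move=> sQ PQ [t ht ->]; rewrite /comb big_seq; apply: sub_sum => // a ta.
by apply: subZ => //; apply: PQ; exact: (allP ht).
Qed.

Lemma wspan_pre (P Q : pred (seq (nat * nat))) u m x :
  (forall w, P w -> Q (u ++ w)) -> wspan P m x -> wspan Q m (act E u x).
Proof.
move=> PQ [t ht ->]; exists [seq (a.1, u ++ a.2) | a <- t]; last by rewrite comb_act.
by rewrite all_map; apply: sub_all ht => a /=; exact: PQ.
Qed.

Variable S : pred (nat * nat).
Hypotheses (S_ok : forall a, S a -> okp a.1 a.2)
  (S_closed : forall p q s, S (p, q) -> S (q, s) -> S (p, s)).

Let F j u := [&& all S u, (0 < size u)%N & (size u <= j)%N].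

Lemma swap_mod a b w m : S a -> S b -> all S w ->
  wspan (F (size w).+1) m (act E [:: a, b & w] m - act E [:: b, a & w] m).
Proof.
case: a => p q; case: b => r s Sa Sb Sw /=; have sF := wspan_subspace (F (size w).+1) m.
rewrite (op_rel E (S_ok Sa) (S_ok Sb)) /= addrAC subrr add0r.
apply: subB => //.
  have [e|_] := eqVneq q r; last by rewrite scale0r; exact: sub0.
  rewrite scale1r; apply: (wspan_one (w := (p, s) :: w)).
  by apply/and3P; split=> //=; rewrite Sw andbT; apply: (S_closed Sa); rewrite e.
have [e|_] := eqVneq s p; last by rewrite scale0r; exact: sub0.
rewrite scale1r; apply: (wspan_one (w := (r, q) :: w)).
by apply/and3P; split=> //=; rewrite Sw andbT; apply: (S_closed Sb); rewrite e.
Qed.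

Lemma move_mod a s1 s2 m : S a -> all S (s1 ++ s2) ->
  wspan (F (size (s1 ++ s2))) m (act E (a :: s1 ++ s2) m - act E (s1 ++ a :: s2) m).
Proof.
move=> Sa; elim: s1 => [_|b s1 IH /= /andP[Sb Ss]].
  by rewrite subrr; exact: sub0 (wspan_subspace _ _).
have h1 := swap_mod m Sa Sb Ss.
have h2 : wspan (F (size (s1 ++ s2)).+1) m
    (act E [:: b] (act E (a :: s1 ++ s2) m - act E (s1 ++ a :: s2) m)).
  apply: wspan_pre (IH Ss) => w /and3P[Sw w0 sw].
  by rewrite /F /= Sb Sw.
have := subD (wspan_subspace _ _) h1 h2; apply: prop_eq.
by rewrite /= opB addrA subrK.
Qed.

Lemma perm_mod w w' m : all S w -> perm_eq w w' ->
  wspan (F (size w).-1) m (act E w m - act E w' m).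
Proof.
elim: w w' => [w' _|a w IH w' /= /andP[Sa Sw] pw'].
  by rewrite perm_sym => /perm_nilP ->; rewrite subrr; exact: sub0 (wspan_subspace _ _).
have aw : a \in w' by rewrite -(perm_mem pw') mem_head.
case/splitPr: aw pw' => s1 s2 pw'.
have pws : perm_eq w (s1 ++ s2).
  by apply/permP => P; move/permP/(_ P): pw'; rewrite /= !count_cat /=; lia.
have Ss : all S (s1 ++ s2) by rewrite -(perm_all S pws).
have h1 : wspan (F (size w)) m (act E [:: a] (act E w m - act E (s1 ++ s2) m)).
  apply: wspan_pre (IH _ Sw pws) => u /and3P[Su u0 su].
  by rewrite /F /= Sa Su; lia.
have h2 := move_mod m Sa Ss; rewrite -(perm_size pws) in h2.
have := subD (wspan_subspace _ _) h1 h2; apply: prop_eq.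
by rewrite /= opB addrA subrK.
Qed.

Definition pspan L (P : pred (seq nat)) m x := exists2 t : seq (K * seq nat),
  all (fun a => P a.2) t & x = \sum_(a <- t) a.1 *: act E (pw L a.2) m.

Lemma pspan_subspace L P m : is_subspace (pspan L P m).
Proof.
split; first by exists [::] => //; rewrite big_nil.
move=> c _ _ [t1 h1 ->] [t2 h2 ->].
exists ([seq (c * a.1, a.2) | a <- t1] ++ t2).
  by rewrite all_cat all_map; apply/andP.
rewrite big_cat big_map scaler_sumr; congr (_ + _).
by apply: eq_bigr => a _; rewrite scalerA.
Qed.

Lemma pspan_one L (P : pred (seq nat)) e m : P e -> pspan L P m (act E (pw L e) m).
Proof. by move=> Pe; exists [:: (1, e)]; rewrite ?big_seq1 ?scale1r //= Pe. Qed.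

Lemma pspan_sub L (P : pred (seq nat)) (Q : M -> Prop) m x : is_subspace Q ->
  (forall e, P e -> Q (act E (pw L e) m)) -> pspan L P m x -> Q x.
Proof.
move=> sQ PQ [t ht ->]; rewrite big_seq; apply: sub_sum => // a ta.
by apply: subZ => //; apply: PQ; exact: (allP ht).
Qed.

(** The spanning half of the theorem of Poincare, Birkhoff and Witt, by induction on the length of
the word: reordering the letters costs only shorter words. *)
Lemma pbw_span L w m : uniq L -> (forall a, S a = (a \in L)) -> all S w ->
  pspan L (fun e => [&& size e == size L, (sumn e <= size w)%N & (size w == 0)%N || (0 < sumn e)%N])
    m (act E w m).
Proof.
move=> uL SL; have [k] := ubnP (size w); elim: k w => // k IH w; rewrite ltnS => wk Sw.
pose e0 := [seq count_mem a w | a <- L].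
have pe : perm_eq w (pw L e0).
  apply/allP => a _ /=; rewrite count_pw //; case: ifP => // /negbT aL.
  by rewrite eqn0Ngt -has_count; apply: contra aL => /hasP[b bw /eqP <-]; rewrite -SL (allP Sw).
have s0 : sumn e0 = size w by rewrite (perm_size pe) size_pw // size_map.
have sP P := pspan_subspace L P m.
rewrite -[act E w m](subrK (act E (pw L e0) m)); apply: subD => //; last first.
  by apply: pspan_one; rewrite size_map eqxx s0 leqnn /=; case: (size w).
apply: wspan_sub (perm_mod m Sw pe) => // u /and3P[Su u0 su].
have uk : (size u < k)%N by lia.
apply: pspan_sub (IH u uk Su) => // e /and3P[se le h]; apply: pspan_one.
by rewrite se /=; lia.
Qed.

End PBW.

Section Free.
Variables (K : numFieldType) (n : nat) (bl : nat -> nat).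
Local Notation okp := (okp n bl).
Local Notation low := (low n bl).
Variables (M : lmodType K) (E : rep n bl M) (N : M -> Prop) (v : M).
Hypothesis sN : is_subspace N.
Local Notation letters := (letters n bl n).

Definition lowletter (a : nat * nat) := okp a.1 a.2 && (a.2 < a.1)%N.

Lemma lowletter_ok a : lowletter a -> okp a.1 a.2. Proof. by case/andP. Qed.

Lemma lowletter_closed p q s : lowletter (p, q) -> lowletter (q, s) -> lowletter (p, s).
Proof.
case/andP=> /= h1 l1 /andP[/= h2 l2]; rewrite /lowletter /= (okp_trans h1 h2) /=.
exact: ltn_trans l2 l1.
Qed.

Lemma lowletter_mem a : lowletter a = (a \in letters).
Proof.
rewrite mem_letters /lowletter; apply/andP/and3P => [[h l]|[_ l h]] //.
by split=> //; exact: okp_l h.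
Qed.

Definition freeL L := forall (s : seq (seq nat)) (c : seq nat -> K), uniq s ->
  (forall e, e \in s -> size e = size L) ->
  N (\sum_(e <- s) c e *: act E (pw L e) v) -> forall e, e \in s -> c e = 0.

Definition Csp L ek x := exists c : seq nat -> K, N (x - \sum_(e <- ek) c e *: act E (pw L e) v).

Lemma Csp_subspace L ek : is_subspace (Csp L ek).
Proof.
split.
  exists (fun=> 0); rewrite big1 ?subrr; first exact: sub0.
  by move=> e _; rewrite scale0r.
move=> a x y [c1 h1] [c2 h2]; exists (fun e => a * c1 e + c2 e).
have := sN.2 a _ _ h1 h2; apply: prop_eq.
rewrite (eq_bigr (fun e => a *: (c1 e *: act E (pw L e) v) + c2 e *: act E (pw L e) v)).
  by rewrite big_split -scaler_sumr /= scalerBr opprD addrACA.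
by move=> e _; rewrite scalerDl scalerA.
Qed.

Lemma Csp_one L ek e : uniq ek -> e \in ek -> Csp L ek (act E (pw L e) v).
Proof.
move=> uk ek_e; exists (fun e' => (e' == e)%:R).
rewrite (bigD1_seq e) //= eqxx scale1r big1 ?addr0 ?subrr; first exact: sub0.
by move=> i /negbTE ->; rewrite scale0r.
Qed.

Lemma Csp_N L ek x : N x -> Csp L ek x.
Proof.
exists (fun=> 0); rewrite big1 ?subr0 // => e _; by rewrite scale0r.
Qed.

Lemma Csp_dle L ek (P : M -> Prop) : (forall m, P m -> Csp L ek m) -> dle N P (size ek).
Proof.
move=> h; apply: (span_dle (T := 'I_(size ek)) (b := fun i => act E (pw L (nth [::] ek i)) v)) => //.
  by rewrite card_ord.
move=> m /h[c hc]; exists (fun i : 'I_(size ek) => c (nth [::] ek i)); move: hc; apply: prop_eq.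
by rewrite (big_nth [::]) big_mkord.
Qed.

Lemma Bk_Csp L k x : uniq L -> (forall a, lowletter a = (a \in L)) -> Bk E v k x ->
  Csp L (exps (size L) k) x.
Proof.
move=> uL SL [t lt ->]; rewrite /comb big_seq; apply: sub_sum => [|a ta].
  exact: Csp_subspace.
apply: subZ; first exact: Csp_subspace.
have /andP[la sa] := allP lt _ ta.
apply: pspan_sub (pbw_span E lowletter_ok lowletter_closed v uL SL la).
  exact: Csp_subspace.
move=> e /and3P[/eqP se le _]; apply: Csp_one; first exact: exps_uniq.
by rewrite mem_exps se eqxx (leq_trans le sa).
Qed.

Lemma freeL_sub L ek d (P : M -> Prop) : freeL L -> uniq ek ->
  (forall e, e \in ek -> size e = size L) -> (forall e, e \in ek -> P (act E (pw L e) v)) ->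
  dle N P d -> (size ek <= d)%N.
Proof.
move=> fr uk sk hP hd; rewrite leqNgt; apply/negP => lt.
pose s := take d.+1 ek; have ss : size s = d.+1 by rewrite size_takel.
have sub e : e \in s -> e \in ek by exact: mem_take.
have us : uniq s by rewrite take_uniq.
have [|c [i ci] hc] := hd (fun i => act E (pw L (nth [::] s i)) v).
  by move=> i; apply/hP/sub/mem_nth; rewrite ss.
pose c' e := c (inord (index e s)).
have c'E (j : 'I_d.+1) : c' (nth [::] s j) = c j.
  by rewrite /c' index_uniq ?ss // inord_val.
have : c' (nth [::] s i) = 0.
  apply: (fr s) => //; [by move=> e /sub/sk| |by apply: mem_nth; rewrite ss].
  move: hc; apply: prop_eq; rewrite (big_nth [::]) ss big_mkord.
  by apply: eq_bigr => j _; rewrite c'E.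
by rewrite c'E => c0; rewrite c0 eqxx in ci.
Qed.

(** The ordered monomials of bounded degree span the same filtered piece for both orders, and they
are equally many: if they are independent for one order, then also for the other. *)
Lemma freeL_perm L1 L2 : uniq L1 -> (forall a, lowletter a = (a \in L1)) ->
  uniq L2 -> (forall a, lowletter a = (a \in L2)) -> freeL L1 -> freeL L2.
Proof.
move=> u1 h1 u2 h2 fr s c us ss hs e0 e0s; apply/eqP/negP => /negP c0.
pose k := (\sum_(e <- s) sumn e)%N.
have sk e : e \in s -> (sumn e <= k)%N.
  by move=> es; rewrite /k (bigD1_seq e) //= leq_addr.
have pL : perm_eq L1 L2.
  by apply: uniq_perm => // a; rewrite -h1 h2.
have sE : size L1 = size L2 by exact: perm_size.
pose ek := exps (size L2) k; have uk : uniq ek by exact: exps_uniq.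
have sek e : e \in s -> e \in ek by move=> es; rewrite mem_exps ss // eqxx sk.
have low1 : low (pw L1 (nseq (size L1) 0)%N) || true by rewrite orbT.
have d1 d : dle N (Bk E v k) d -> (size ek <= d)%N.
  move=> hd; rewrite /ek -sE; apply: (freeL_sub fr _ _ _ hd).
  - exact: exps_uniq.
  - by move=> e; rewrite mem_exps => /andP[/eqP].
  move=> e; rewrite mem_exps => /andP[/eqP se le]; apply: Bk_act.
    by apply: pw_all; apply/allP => a; rewrite -h1.
  by rewrite size_pw.
have : dle N (Bk E v k) (size (rem e0 ek)).
  apply: (Csp_dle (L := L2)) => m /(Bk_Csp u2 h2) [f hf].
  apply: (sub_congr (Csp_subspace _ _) (Csp_N L2 (rem e0 ek) (sub_sym sN hf))).
  rewrite big_seq; apply: sub_sum => [|e eek]; first exact: Csp_subspace.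
  apply: subZ; first exact: Csp_subspace.
  have [->|ne] := eqVneq e e0; last first.
    by apply: Csp_one; [exact: rem_uniq|rewrite mem_rem_uniq // inE ne].
  apply: (subZ_inv (Csp_subspace _ _) c0).
  have h : Csp L2 (rem e0 ek) (\sum_(e <- s) c e *: act E (pw L2 e) v) by exact: Csp_N.
  move: h; rewrite (bigD1_seq e0) //= => h.
  have sC := Csp_subspace L2 (rem e0 ek).
  have hR : Csp L2 (rem e0 ek) (\sum_(e <- s | e != e0) c e *: act E (pw L2 e) v).
    rewrite big_seq_cond; apply: sub_sum => // e' /andP[e's ne']; apply: subZ => //.
    by apply: Csp_one; [exact: rem_uniq|rewrite mem_rem_uniq // inE ne' /=; exact: sek].
  by have := subB sC h hR; apply: prop_eq; rewrite addrK.
move/d1; rewrite size_rem ?sek //; have : e0 \in ek by exact: sek.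
by case: (ek) => //= a l _; lia.
Qed.

End Free.

(** * Growth of modules with weights of columns *)

Section Growth.
Variables (K : numFieldType) (n : nat) (bl : nat -> nat).
Local Notation hwm := (@hwm K n bl).
Local Notation hE := (@hE K n bl _).
Local Notation hN A := (@hN K n bl _ A).
Local Notation hv := (@hv K n bl _).

Definition lower D lam (A : hwm lam) := exists c, forall k d,
  dle (hN A) (Bk (hE A) (hv A) (c * k + c)) d -> (k.+1 ^ D <= c * d)%N.
Definition upper D lam (A : hwm lam) := exists c, forall k,
  dle (hN A) (Bk (hE A) (hv A) k) (c * k.+1 ^ D).
Definition Lower D lam := forall A : hwm lam, irr A -> lower D A.
Definition Upper D lam := forall A : hwm lam, irr A -> upper D A.

Lemma lower_gle D lam mu (A : hwm lam) (B : hwm mu) : gle A B -> lower D B -> lower D A.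
Proof.
move=> [c1 h1] [c2 h2]; exists (c2 * c1 + (c1 * c2 + c1))%N => k d hd.
have : (k.+1 ^ D <= c2 * (c1 * d))%N.
  apply/h2/h1; apply: dle_mono hd => //; [exact: hss|exact: Bk_subspace|].
  by move=> m; apply: Bk_mono; nia.
by nia.
Qed.

Lemma upper_gle D lam mu (A : hwm lam) (B : hwm mu) : gle A B -> upper D A -> upper D B.
Proof.
move=> [c1 h1] [c2 h2]; exists (c1 * (c2 * (c1.+1 ^ D)))%N => k.
have := h1 k _ (h2 _); apply: dle_mono => //; [exact: hss|exact: Bk_subspace|].
rewrite -!mulnA !leq_mul2l; apply/orP; right; apply/orP; right.
by rewrite -expnMn; case: (posnP D) => [->//|D0]; rewrite leq_exp2r //; nia.
Qed.

Lemma Lower_Gle D lam mu : Gle n bl lam mu -> Lower D mu -> Lower D lam.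
Proof.
move=> g l A iA; have [B iB] := exists_irr_hwm n bl mu.
exact: lower_gle (g A iA B iB) (l B iB).
Qed.

Lemma Upper_Gle D lam mu : Gle n bl lam mu -> Upper D lam -> Upper D mu.
Proof.
move=> g u B iB; have [A iA] := exists_irr_hwm n bl lam.
exact: upper_gle (g A iA B iB) (u A iA).
Qed.

Lemma wt_sum (F : pzRingType) w (g : nat -> F) : okw n bl w ->
  \sum_(p < n) g p * (wt w p)%:~R = \sum_(l <- w) (g l.1 - g l.2).
Proof.
elim: w => [_|[a b] w IH /= /andP[ok /IH{}IH]].
  by rewrite big_nil big1 // => p _; rewrite wt_nil mulr0.
have d s : (s < n)%N -> \sum_(p < n) g p * (s == p :> nat)%:R = g s.
  move=> sn; rewrite (bigD1 (Ordinal sn)) //= eqxx mulr1 big1 ?addr0 // => i.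
  by rewrite -val_eqE /= eq_sym => /negbTE ->; rewrite mulr0.
transitivity (\sum_(p < n) (g p * (a == p)%:R - g p * (b == p)%:R + g p * (wt w p)%:~R)).
  by apply: eq_bigr => p _; rewrite wt_cons /= !(intrD, rmorphN) /= mulrDr mulrBr.
have [an bn] := (okp_l ok, okp_r ok).
by rewrite big_split sumrB /= IH !d // big_cons.
Qed.

Section Columns.
Variables (cb : nat -> nat).
Hypothesis bl_mono : forall p q, (p <= q)%N -> (q < n)%N -> (bl p <= bl q)%N.
Hypothesis cb_mono : forall p q, (p <= q)%N -> (q < n)%N -> (cb p <= cb q)%N.
Hypothesis cb_bl : forall p q, okp n cb p q -> okp n bl p q.

Lemma col_between p q r : okp n cb p r -> (p <= q <= r)%N -> okp n cb p q /\ okp n cb q r.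
Proof. exact: okp_between. Qed.

Lemma col_homo (R : numDomainType) (f : nat -> R) : (forall i, okp n cb i i.+1 -> f i.+1 <= f i) ->
  forall p q, okp n cb p q -> (p <= q)%N -> f q <= f p.
Proof.
move=> h p; elim=> [|q IH] ok; first by rewrite leqn0 => /eqP ->.
rewrite leq_eqVlt => /predU1P[->//|]; rewrite ltnS => pq.
have [h1 h2] := col_between ok (introT andP (conj pq (leqnSn q))).
exact: le_trans (h _ h2) (IH h1 pq).
Qed.

Lemma simple_down (M : lmodType K) (E : rep n bl M) (N : M -> Prop) y : submod E N ->
  (forall i, okp n cb i i.+1 -> N (E i.+1 i y)) ->
  forall p q, okp n cb q p -> (q < p)%N -> N (E p q y).
Proof.
move=> sN h; elim=> [//|p IH] q ok; rewrite ltnS leq_eqVlt => /predU1P[e|lt].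
  by rewrite e in ok *; exact: h.
have [h1 h2] := col_between ok (introT andP (conj (ltnW lt) (leqnSn p))).
have o1 : okp n bl p.+1 p by rewrite okpC; exact: cb_bl.
have o2 : okp n bl p q by rewrite okpC; exact: cb_bl.
have -> : E p.+1 q y = E p.+1 p (E p q y) - E p q (E p.+1 p y).
  rewrite (op_rel E o1 o2) eqxx scale1r (ltn_eqF (leq_trans lt (leqnSn p))) scale0r.
  by rewrite subr0 addrC addKr.
apply: subB; first exact: sN.1.
  by apply: sN.2 => //; exact: IH.
by apply: sN.2 => //; exact: h.
Qed.

(** The columns are the blocks of [cb], a refinement of [bl]; [ul] lists the lowering operators
between different columns, and [cl] those inside a column. *)
Definition ul := [seq a <- letters n bl n | cb a.1 != cb a.2].
Definition cl := [seq a <- letters n bl n | cb a.1 == cb a.2].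
Definition cletter (a : nat * nat) := lowletter n bl a && (cb a.1 == cb a.2).

Lemma cletter_mem a : cletter a = (a \in cl).
Proof. by rewrite mem_filter andbC -lowletter_mem. Qed.

Lemma cletter_closed p q s : cletter (p, q) -> cletter (q, s) -> cletter (p, s).
Proof.
by case/andP=> h1 /eqP /= e1 /andP[h2 /eqP /= e2]; rewrite /cletter (lowletter_closed h1 h2) /= e1 e2.
Qed.

Lemma cletter_ok a : cletter a -> okp n bl a.1 a.2.
Proof. by case/andP => /lowletter_ok. Qed.

Lemma uniq_cl : uniq cl. Proof. by rewrite filter_uniq // uniq_letters. Qed.

Lemma uniq_ucl : uniq (ul ++ cl).
Proof.
rewrite cat_uniq !filter_uniq ?uniq_letters // andbT /=; apply/hasPn => a.
by rewrite !mem_filter => /andP[-> _].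
Qed.

Lemma ucl_mem a : lowletter n bl a = (a \in ul ++ cl).
Proof. by rewrite mem_cat !mem_filter -!lowletter_mem; case: (lowletter _ _ _); case: eqP. Qed.

Lemma cletter_okcb p q : cletter (p, q) -> okp n cb q p.
Proof.
case/andP => /andP[/= ok _] /= /eqP e; rewrite okpC okpE ?(okp_l ok) ?(okp_r ok) //; exact/eqP.
Qed.

Lemma cword_N (M : lmodType K) (E : rep n bl M) (N : M -> Prop) v w : submod E N ->
  (forall i, okp n cb i i.+1 -> N (E i.+1 i v)) -> all cletter w -> w != [::] -> N (act E w v).
Proof.
move=> sN h; case/lastP: w => // w [p q]; rewrite all_rcons => /andP[ca cw] _.
rewrite -cats1 act_cat; elim: w cw => [_|[r s] w IH /= /andP[cr cw]] /=.
  by apply: (simple_down sN h); [exact: cletter_okcb|case/andP: ca => /andP[]].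
by apply: sN.2; [exact: (cletter_ok cr)|exact: IH].
Qed.

Lemma sumn0_nseq (e : seq nat) : sumn e = 0%N -> e = nseq (size e) 0%N.
Proof. by elim: e => //= x e IH /eqP; rewrite addn_eq0 => /andP[/eqP -> /eqP /IH {1}->]. Qed.

Lemma pw_nseq0 (T : Type) (L : seq T) : pw L (nseq (size L) 0%N) = [::].
Proof. by elim: L => //= a L IH; rewrite pw_cons. Qed.

Lemma pw_split e : size e = size (ul ++ cl) ->
  pw (ul ++ cl) e = pw ul (take (size ul) e) ++ pw cl (drop (size ul) e).
Proof.
move=> se; rewrite -{1}(cat_take_drop (size ul) e) pw_cat // size_takel //.
by rewrite se size_cat leq_addr.
Qed.

Variable lam : nat -> K.
Hypothesis gap1 : forall i, okp n cb i i.+1 -> lam i = lam i.+1.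

Lemma gap1_N (A : hwm lam) : irr A -> forall i, okp n cb i i.+1 -> hN A (hE A i.+1 i (hv A)).
Proof.
move=> iA i oki; apply: (irr_int bl_mono (m := 0) iA (cb_bl oki)).
by rewrite (gap1 oki) subrr.
Qed.

(** The simple lowering operators inside the columns kill the highest weight vector, because the
representations of [sl_2] that it generates are trivial; hence all lowering operators inside the columns do. Ordering the
monomials with these letters last leaves the monomials in [ul], whose number is polynomial of
degree [size ul]. *)
Lemma Upper_columns : Upper (size ul) lam.
Proof.
move=> A iA; exists 1%N => k; rewrite mul1n.
have sN := hsub A.
pose ek := [seq map val (val t) ++ nseq (size cl) 0%N | t <- enum {: (size ul).-tuple 'I_k.+1}].
have uk : uniq ek.
  rewrite map_inj_uniq ?enum_uniq // => t1 t2 /eqP.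
  by rewrite eqseq_cat ?size_map ?size_tuple // => /andP[/eqP /(inj_map val_inj) /val_inj].
have <- : size ek = (k.+1 ^ size ul)%N by rewrite size_map -cardE card_tuple card_ord.
apply: (Csp_dle (hss A) (E := hE A) (v := hv A) (L := ul ++ cl)) => x [t lt ->]; rewrite /comb big_seq.
have sC := Csp_subspace (hE A) (hv A) (hss A) (ul ++ cl) ek.
apply: sub_sum => // a ta; apply: subZ => //; have /andP[la sa] := allP lt _ ta.
apply: pspan_sub (pbw_span (hE A) (@lowletter_ok n bl) (@lowletter_closed n bl) (hv A) uniq_ucl ucl_mem la) => //.
move=> e /and3P[/eqP se le _]; have [e2|e2] := posnP (sumn (drop (size ul) e)).
  apply: Csp_one => //; first exact: hss.
  have [||t' et] := @tuple_exps (size ul) k (take (size ul) e).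
  - by rewrite size_takel // se size_cat leq_addr.
  - apply/allP => z /mem_take /mem_le_sumn h; exact: leq_trans h (leq_trans le sa).
  apply/mapP; exists t'; first exact: mem_enum.
  rewrite -et -[LHS](cat_take_drop (size ul) e); congr (_ ++ _).
  by rewrite [LHS]sumn0_nseq // size_drop se size_cat addKn.
apply: Csp_N.
have sd : size (drop (size ul) e) = size cl by rewrite size_drop se size_cat addKn.
rewrite pw_split // act_cat.
have h : hN A (act (hE A) (pw cl (drop (size ul) e)) (hv A)).
  apply: (cword_N sN (gap1_N iA)).
    by apply: pw_all; apply/allP => z; rewrite cletter_mem.
  by rewrite -size_eq0 size_pw // -lt0n.
apply: act_sub => //; apply/low_okw/pw_all/allP => z.
by rewrite mem_filter -lowletter_mem => /andP[_].
Qed.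


Lemma freeL_coef (M : lmodType K) (E : rep n bl M) (N : M -> Prop) v L (t : seq (K * seq nat)) :
  freeL E N v L -> (forall a, a \in t -> size a.2 = size L) ->
  N (\sum_(a <- t) a.1 *: act E (pw L a.2) v) -> forall e, \sum_(a <- t | a.2 == e) a.1 = 0.
Proof.
move=> fr ht h e; have [et|et] := boolP (e \in undup (map snd t)); last first.
  rewrite big_seq_cond big1 // => a /andP[ta /eqP ae]; case/negP: et.
  by rewrite mem_undup -ae; exact: map_f.
apply: (fr _ (fun e => \sum_(a <- t | a.2 == e) a.1) (undup_uniq (map snd t))) => //.
  by move=> e'; rewrite mem_undup => /mapP[a ta ->]; exact: ht.
move: h; apply: prop_eq.
transitivity (\sum_(e <- undup (map snd t)) \sum_(a <- t) (if a.2 == e then a.1 *: act E (pw L a.2) v else 0)).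
  apply: eq_bigr => e' _; rewrite scaler_suml big_mkcond; apply: eq_bigr => a _.
  by case: eqP => [->|].
rewrite exchange_big /= big_seq [RHS]big_seq; apply: eq_bigr => a ta.
rewrite -big_mkcond -big_filter (eq_filter (a2 := pred1 a.2)); last by move=> x; rewrite /= eq_sym.
by rewrite filter_pred1_uniq ?undup_uniq ?mem_undup ?map_f // big_seq1.
Qed.

Section Parabolic.
Variables (R : realFieldType) (re : {additive K -> R}) (av : nat -> R).
Hypothesis re1 : re 1 = 1.
Hypothesis av_mono : forall p q, okp n bl p q -> (p < q)%N -> av p <= av q.
Hypothesis av_col : forall i, okp n cb i i.+1 -> av i = av i.+1.
Hypothesis av_sum : forall b, \sum_(p < n | cb p == b) (re (lam p - p%:R) - av p) = 0.

Variable A0 : hwm lam.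
Hypothesis fr0 : freeL (hE A0) (hN A0) (hv A0) (ul ++ cl).
Local Notation M := (hM A0).
Local Notation E := (hE A0).
Local Notation N0 := (hN A0).
Local Notation v := (hv A0).
Let sN0 := hsub A0.
Let colstep i := okp n cb i i.+1.

(** The kernel of the projection of the Verma module on the parabolic Verma module of the columns. *)
Definition parN (m : M) := exists2 t : seq (K * (seq (nat * nat) * nat)),
  all (fun a => okw n bl a.2.1 && colstep a.2.2) t &
  N0 (m - \sum_(a <- t) a.1 *: act E a.2.1 (E a.2.2.+1 a.2.2 v)).

Lemma parN_N m : N0 m -> parN m.
Proof. by move=> h; exists [::] => //; rewrite big_nil subr0. Qed.

Lemma parN_submod : submod E parN.
Proof.
split; first split.
- exact/parN_N/(sub0 sN0.1).
- move=> c x y [t1 h1 e1] [t2 h2 e2].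
  exists ([seq (c * a.1, a.2) | a <- t1] ++ t2).
    by rewrite all_cat all_map; apply/andP.
  have := sN0.1.2 c _ _ e1 e2; apply: prop_eq; rewrite big_cat big_map /=.
  rewrite (eq_bigr (fun a => c *: (a.1 *: act E a.2.1 (E a.2.2.+1 a.2.2 v)))).
    by rewrite -scaler_sumr scalerBr opprD addrACA.
  by move=> a _; rewrite scalerA.
move=> p q ok m [t ht et]; exists [seq (a.1, ((p, q) :: a.2.1, a.2.2)) | a <- t].
  by rewrite all_map; apply: sub_all ht => a /=; rewrite ok.
have := sN0.2 _ _ ok _ et; apply: prop_eq; rewrite opB op_sum big_map.
by congr (_ - _); apply: eq_bigr => a _; rewrite opZ.
Qed.

Lemma parN_f i : colstep i -> parN (E i.+1 i v).
Proof.
move=> oki; exists [:: (1, ([::], i))]; first by rewrite /= oki.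
by rewrite big_seq1 scale1r subrr; exact: sub0 sN0.1.
Qed.

Lemma parN_min (P : M -> Prop) : submod E P -> (forall m, N0 m -> P m) ->
  (forall i, colstep i -> P (E i.+1 i v)) -> forall m, parN m -> P m.
Proof.
move=> sP NP fP m [t ht et]; apply: (sub_congr sP.1 (sub_sym sP.1 (NP _ et))).
rewrite big_seq; apply: sub_sum => [|a ta]; first exact: sP.1.
have /andP[h1 h2] := allP ht _ ta; apply: subZ; first exact: sP.1.
by apply: act_sub => //; exact: fP.
Qed.

Lemma parN_hw : ishw E parN v lam.
Proof.
split; [exact: parN_submod| |by move=> *; apply/parN_N/hraise|by move=> *; exact/parN_N/hdiag].
have [N' [NN' [hw iB]]] := exists_irr_quotient A0.
move=> h; apply: (@hvN _ _ _ _ (Hwm hw)); apply: (parN_min _ NN' _ h); first exact: (hsub (Hwm hw)).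
by move=> i oki; exact: (gap1_N iB oki).
Qed.

Let B := Hwm parN_hw.

(** Let [g] be the difference of a singular weight with [lam], and let [x] be the real part of the
word. Equality of the Casimir values says that [2 (x, g) + (g, g) = 0]. Since [(av, g)] and
[(x - av, g)] are nonnegative, [g] vanishes. *)
Lemma par_irr : irr B.
Proof.
apply: irr_crit => y kap gy Ny up dg.
have sB := hsub B; have [w lw ew] := wt_of gy Ny dg.
have hy : ishw E parN y kap by split.
have step i : colstep i -> (wt w i.+1 <= wt w i).
  move=> oki; have okb := cb_bl oki.
  have [m em] : exists m, kap i - kap i.+1 = m%:R.
    apply: contrapT => h.
    have := @f_free K n bl kap (Hwm hy) i okb _.
    have [m hm] := gen_min (torsion_submod okb sB) (ex_intro _ 1%N (parN_f oki)) gy.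
    move=> h'; apply: (h' _ m hm) => m'; apply/eqP => e; apply: h; by exists m'.
  have : (wt w i - wt w i.+1)%:~R = m%:~R :> K.
    rewrite -[RHS]/(m%:R : K) -em !ew ?(okp_l okb) ?(okp_r okb) // /shift_wt (gap1 oki) rmorphB /=; ring.
  by move/intr_inj => e; rewrite -subr_ge0 e.
pose g p : R := (wt w p)%:~R; pose x p := re (lam p - p%:R).
have sq := central_sq bl_mono gy Ny up dg.
have xg : \sum_(p < n) (x p * g p *+ 2 + g p ^+ 2) = 0.
  have : \sum_(p < n) ((kap p - p%:R) ^+ 2 - (lam p - p%:R) ^+ 2) = 0 by rewrite sumrB sq subrr.
  move/(congr1 re); rewrite raddf0 raddf_sum /= => e; rewrite -[RHS]e; apply: eq_bigr => p _.
  rewrite ew // /shift_wt /g /x; move: (lam p) => l; set z : int := wt w p.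
  have -> : (l + z%:~R - p%:R) ^+ 2 - (l - p%:R) ^+ 2 = (l - p%:R) *~ (z *+ 2) + (z ^+ 2)%:~R.
    have -> : (z ^+ 2)%:~R = z%:~R ^+ 2 :> K by rewrite rmorphXn.
    have -> : (l - p%:R) *~ (z *+ 2) = (l - p%:R) * (z%:~R *+ 2) by rewrite -mulrzr rmorphMn.
    by ring.
  have e2 : (z ^+ 2)%:~R = z%:~R ^+ 2 :> R by rewrite rmorphXn.
  have e3 (y1 : R) : y1 *~ (z *+ 2) = y1 * (z%:~R *+ 2) by rewrite -mulrzr rmorphMn.
  have e4 u (y1 : int) : re (u *~ y1) = re u *~ y1.
    by case: y1 => y1; rewrite ?NegzE ?mulrNz ?raddfN /= -!pmulrn raddfMn.
  rewrite [RHS]raddfD e4 (re_int re1) e2 e3; ring.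
(* [g] is a sum of negative roots, on which [av] is nonnegative *)
have ag : 0 <= \sum_(p < n) av p * g p.
  rewrite (wt_sum av (low_okw lw)) big_seq; apply: sumr_ge0 => l /(allP lw) /andP[ok lt].
  by rewrite subr_ge0; apply: av_mono => //; rewrite okpC.
(* Chebyshev inequality: in each column both [x - av], of mean zero, and [g] decrease *)
have yg : 0 <= \sum_(p < n) (x p - av p) * g p.
  pose s b : R := \sum_(p < n | cb p == b) 1.
  have s0 (p : 'I_n) : 0 < s (cb p).
    by rewrite /s (bigD1 p) //= ltr_pwDl // sumr_ge0.
  have x_col p q : okp n cb p q -> (p <= q)%N -> x q - av q <= x p - av p.
    apply: (col_homo (f := fun p => x p - av p)) => i oki.
    rewrite /x (gap1 oki) (av_col oki) lerD2r !raddfB /= !(re_nat re1).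
    by rewrite lerD2l lerN2 ler_nat.
  have g_col p q : okp n cb p q -> (p <= q)%N -> g q <= g p.
    by apply: col_homo => i oki; rewrite ler_int; exact: step.
  have pos : 0 <= \sum_(p < n) \sum_(q < n | cb p == cb q)
      (s (cb p))^-1 * ((x p - av p - (x q - av q)) * (g p - g q)).
    apply: sumr_ge0 => p _; apply: sumr_ge0 => q cpq; apply: mulr_ge0; first by rewrite invr_ge0 ltW.
    have ok1 : okp n cb p q by rewrite okpE.
    have ok2 : okp n cb q p by rewrite okpC.
    case: (leqP p q) => pq; first by rewrite mulr_ge0 // subr_ge0 ?x_col ?g_col.
    by rewrite mulr_le0 // subr_le0 ?x_col ?g_col // ltnW.
  have t1 : \sum_(p < n) \sum_(q < n | cb p == cb q) (s (cb p))^-1 * ((x p - av p) * g p) =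
     \sum_(p < n) (x p - av p) * g p.
    apply: eq_bigr => p _; rewrite -[RHS]mul1r -[in RHS](mulVf (lt0r_neq0 (s0 p))) -mulrA.
    rewrite -mulr_sumr; congr (_ * _); rewrite /s mulr_suml; apply: eq_big => q; last by rewrite mul1r.
    by rewrite eq_sym.
  have t2 : \sum_(p < n) \sum_(q < n | cb p == cb q) (s (cb p))^-1 * ((x q - av q) * g q) =
     \sum_(p < n) (x p - av p) * g p.
    rewrite -[RHS]t1 (exchange_big_dep predT) //=; apply: eq_bigr => q _.
    by apply: eq_big => p; [rewrite eq_sym|move=> /eqP ->].
  have t3 : \sum_(p < n) \sum_(q < n | cb p == cb q) (s (cb p))^-1 * ((x q - av q) * g p) = 0.
    rewrite big1 // => p _; rewrite -mulr_sumr -mulr_suml.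
    rewrite (eq_bigl (fun q : 'I_n => cb q == cb p)); last by move=> q; rewrite eq_sym.
    by rewrite av_sum mul0r mulr0.
  have t4 : \sum_(p < n) \sum_(q < n | cb p == cb q) (s (cb p))^-1 * ((x p - av p) * g q) = 0.
    rewrite (exchange_big_dep predT) //= big1 // => q _.
    rewrite (eq_bigr (fun p : 'I_n => (s (cb q))^-1 * g q * (x p - av p))); last first.
      by move=> p /eqP ->; ring.
    by rewrite -mulr_sumr av_sum mulr0.
  have : 0 <= (\sum_(p < n) (x p - av p) * g p) *+ 2.
    apply: le_trans pos _; rewrite le_eqVlt; apply/orP; left; apply/eqP.
    transitivity (\sum_(p < n) \sum_(q < n | cb p == cb q)
      ((s (cb p))^-1 * ((x p - av p) * g p) + (s (cb p))^-1 * ((x q - av q) * g q)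
       - (s (cb p))^-1 * ((x q - av q) * g p) - (s (cb p))^-1 * ((x p - av p) * g q))).
      by apply: eq_bigr => p _; apply: eq_bigr => q _; ring.
    under eq_bigr do rewrite !(sumrB, big_split) /=.
    by rewrite !(sumrB, big_split) /= t1 t2 t3 t4 !subr0 mulr2n.
  by rewrite pmulrn_lge0.
have sg : \sum_(p < n) g p ^+ 2 = 0.
  apply/eqP; rewrite eq_le sumr_ge0 ?andbT; last by move=> p _; exact: sqr_ge0.
  have e : \sum_(p < n) g p ^+ 2 = - ((\sum_(p < n) (x p - av p) * g p + \sum_(p < n) av p * g p) *+ 2).
    apply/eqP; rewrite -addr_eq0 -[X in _ == X]xg -big_split -sumrMnl -big_split; apply/eqP.
    by apply: eq_bigr => p _ /=; ring.
  by rewrite e oppr_le0 mulrn_wge0 // addr_ge0.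
have /psumr_eq0P/(_ sg) g0 : forall p : 'I_n, true -> 0 <= g p ^+ 2 by move=> p _; exact: sqr_ge0.
move=> p pn; have /eqP := g0 (Ordinal pn) isT.
by rewrite expf_eq0 /= /g intr_eq0 ew // /shift_wt => /eqP ->; rewrite addr0.
Qed.

Let P0 (e : seq nat) := (size e == size (ul ++ cl)) && (0 < sumn (drop (size ul) e))%N.

Lemma parN_span m : parN m -> exists2 y, pspan E (ul ++ cl) P0 v y & N0 (m - y).
Proof.
pose Q x := exists2 y, pspan E (ul ++ cl) P0 v y & N0 (x - y).
have sP := pspan_subspace E (ul ++ cl) P0 v.
have sQ : is_subspace Q.
  split; first by exists 0; [exact: sub0 sP|rewrite subrr; exact: sub0 sN0.1].
  move=> c x1 x2 [y1 h1 e1] [y2 h2 e2]; exists (c *: y1 + y2); first exact: sP.2.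
  have := sN0.1.2 c _ _ e1 e2; apply: prop_eq.
  by rewrite scalerBr opprD addrACA.
have NQ x : N0 x -> Q x by move=> h; exists 0; [exact: sub0 sP|rewrite subr0].
have PQ x : pspan E (ul ++ cl) P0 v x -> Q x.
  by move=> h; exists x => //; rewrite subrr; exact: sub0 sN0.1.
suff key w i : okw n bl w -> colstep i -> Q (act E w (E i.+1 i v)).
  move=> [t ht et]; apply: (sub_congr sQ (sub_sym sQ (NQ _ et))).
  rewrite big_seq; apply: sub_sum => // a ta; have /andP[h1 h2] := allP ht _ ta.
  by apply: subZ => //; exact: key.
move=> okw_w oki; have okb := cb_bl oki.
have [Nf|Nf] := pselect (N0 (E i.+1 i v)); first by apply: NQ; exact: (act_sub sN0 okw_w Nf).
have hwf : ishw E N0 (E i.+1 i v) (fun p => lam p + 1%:R * ((p == i.+1)%:R - (p == i)%:R)).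
  split=> //.
    apply: (simple_up bl_mono sN0) => j okj; have [->|ji] := eqVneq j i.
      have := sl2_ef okb 0 sN0 (hraise A0 okb (ltnSn i)) (hdiag A0 (okp_l okb)) (hdiag A0 (okp_r okb)).
      by rewrite (gap1 oki) !subrr mulr0 scale0r subr0.
    rewrite comm_ef //; apply: sN0.2; first by rewrite okpC.
    exact: hraise.
  move=> p pn; exact: (iter_wt okb 1 sN0 pn (hdiag A0 pn)).
have [t lt et] := reduce_word (fun p => lam p + 1%:R * ((p == i.+1)%:R - (p == i)%:R)) okw_w.
have := et (Hwm hwf); rewrite /hcomb /= => {}et.
apply: (sub_congr sQ (sub_sym sQ (NQ _ et))); rewrite /comb big_seq.
apply: sub_sum => // a ta; apply: subZ => //; have /andP[la _] := allP lt _ ta.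
apply: pspan_sub (pbw_span E (@lowletter_ok n bl) (@lowletter_closed n bl) (E i.+1 i v) uniq_ucl ucl_mem la) => //.
move=> e /and3P[/eqP se _ _]; rewrite pw_split // act_cat.
have sd : size (drop (size ul) e) = size cl by rewrite size_drop se size_cat addKn.
have su : size (take (size ul) e) = size ul by rewrite size_takel // se size_cat leq_addr.
have ci : cletter (i.+1, i).
  rewrite /cletter /lowletter /= okpC okb ltnSn /= eq_sym.
  by move: oki; rewrite /colstep okpE ?(okp_l okb) ?(okp_r okb).
have cw : all cletter (pw cl (drop (size ul) e) ++ [:: (i.+1, i)]).
  rewrite all_cat /= ci andbT andbT; apply: pw_all; apply/allP => z; by rewrite cletter_mem.
have := pbw_span E cletter_ok cletter_closed v uniq_cl cletter_mem cw.
rewrite act_cat /= size_cat addn1 /= => h; apply: PQ.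
case: h => t' ht' ->.
have lact := act_lin E (pw ul (take (size ul) e)).
have -> : act E (pw ul (take (size ul) e)) (\sum_(a <- t') a.1 *: act E (pw cl a.2) v) =
    \sum_(a <- t') a.1 *: act E (pw ul (take (size ul) e)) (act E (pw cl a.2) v).
  elim: (t') => [|b t'' IH]; first by rewrite !big_nil; exact: linop0 lact.
  by rewrite !big_cons lact IH.
rewrite big_seq; apply: sub_sum => // b tb; apply: subZ => //.
have /and3P[/eqP sb _ b0] := allP ht' _ tb.
have := pspan_one E (ul ++ cl) (P := P0) (e := take (size ul) e ++ b.2) v _.
rewrite pw_cat ?su // act_cat; apply.
by rewrite /P0 !size_cat su sb eqxx /= drop_size_cat.
Qed.

Lemma par_free : freeL E parN v ul.
Proof.
move=> s c us ss /parN_span[_ [t ht ->] hN] e0 e0s.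
pose z := nseq (size cl) 0%N.
pose tt := [seq (c e, e ++ z) | e <- s] ++ [seq (- a.1, a.2) | a <- t].
have zI : injective (fun e => e ++ z).
  move=> e1 e2 h; have := congr1 size h; rewrite !size_cat => /addIn se.
  by move/eqP: h; rewrite eqseq_cat // => /andP[/eqP].
have h : \sum_(a <- tt | a.2 == e0 ++ z) a.1 = 0.
  apply: (@freeL_coef _ E N0 v (ul ++ cl) tt fr0).
    move=> a; rewrite mem_cat => /orP[/mapP[e es ->]|/mapP[b bt ->]] /=.
      by rewrite !size_cat ss // size_nseq.
    by have /andP[/eqP] := allP ht _ bt.
  move: hN; apply: prop_eq; rewrite big_cat !big_map /= -sumrN; congr (_ + _).
    rewrite big_seq [RHS]big_seq; apply: eq_bigr => e es.
    by rewrite pw_cat ?ss // pw_nseq0 cats0.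
  by apply: eq_bigr => a _; rewrite scaleNr.
move: h; rewrite /tt big_cat !big_map /= [X in _ + X]big_seq_cond [X in _ + X]big1 ?addr0; last first.
  move=> a /andP[ta /eqP ea]; have /andP[_] := allP ht _ ta.
  by rewrite ea drop_size_cat ?ss // sumn_nseq.
rewrite (eq_bigl (pred1 e0)); last by move=> e /=; rewrite (inj_eq zI).
by rewrite -big_filter filter_pred1_uniq // big_seq1.
Qed.

Lemma par_lower : lower (size ul) B.
Proof.
exists (size ul).+1 => k d hd.
pose ek := [seq map val (val t) | t <- enum {: (size ul).-tuple 'I_k.+1}].
have uk : uniq ek.
  rewrite map_inj_uniq ?enum_uniq // => t1 t2 h.
  by apply/val_inj/(inj_map val_inj).
have -> : (k.+1 ^ size ul)%N = size ek by rewrite size_map -cardE card_tuple card_ord.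
have : (size ek <= d)%N.
  apply: (@freeL_sub K n bl M E parN v ul ek d _ par_free uk _ _ hd).
    by move=> e /mapP[t _ ->]; rewrite size_map size_tuple.
  move=> e /mapP[t _ ->]; apply: Bk_act.
    by apply: pw_all; apply/allP => z; rewrite mem_filter -lowletter_mem => /andP[_].
  rewrite size_pw; last by rewrite size_map size_tuple.
  have : (sumn (map val t) <= size ul * k)%N.
    rewrite -{2}(size_tuple t); elim: (val t) => //= i l IH.
    by rewrite mulSn leq_add // -ltnS.
  by move=> h; apply: leq_trans h _; nia.
by nia.
Qed.

End Parabolic.

(** The parabolic Verma module of the columns is irreducible when the averages [av] of the columns
increase, and it is free over the lowering operators [ul] outside the columns. *)
Lemma Lower_columns (R : realFieldType) (re : {additive K -> R}) (av : nat -> R) :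
  re 1 = 1 -> (forall p q, okp n bl p q -> (p < q)%N -> av p <= av q) ->
  (forall i, okp n cb i i.+1 -> av i = av i.+1) ->
  (forall b, \sum_(p < n | cb p == b) (re (lam p - p%:R) - av p) = 0) ->
  Lower (size ul) lam.
Proof.
move=> re1 h1 h2 h3 A iA; have [A0 fr] := exists_verma n bl lam.
have fr0 : freeL (hE A0) (hN A0) (hv A0) (ul ++ cl).
  apply: (freeL_perm (hss A0) (uniq_letters n bl n) _ uniq_ucl ucl_mem fr).
  exact: lowletter_mem.
have iB := par_irr re1 h1 h2 h3 (A0 := A0).
exact: lower_gle (gle_irr A iB) (par_lower fr0).
Qed.

End Columns.
End Growth.

(** * Moves on words *)

Section WordMoves.
Variables (K : numFieldType) (n : nat) (bl : nat -> nat).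
Hypothesis bl_mono : forall p q, (p <= q)%N -> (q < n)%N -> (bl p <= bl q)%N.
Local Notation okp := (okp n bl).
Local Notation Gle := (@Gle K n bl).
Implicit Types (u v w s : seq K) (x y : nat -> K).

(** The word of a weight [lam] has the entries [lam p - p]; in this normalization the reflection in
a simple root exchanges two neighbours. *)
Definition shw x : nat -> K := fun p => x p + p%:R.
Definition Gx x y := Gle (shw x) (shw y).

Lemma Gx_trans y x z : Gx x y -> Gx y z -> Gx x z.
Proof. exact: Gle_trans. Qed.

Lemma Gx_ext x y : (forall p, (p < n)%N -> x p = y p) -> Gx x y.
Proof. by move=> e; apply: Gle_ext => p pn; rewrite /shw e. Qed.

Lemma Gx_om x k : (k <= n)%N -> Gx x (fun p => x p + (p < k)%N%:R).
Proof.
move=> kn; apply: (Gle_trans (mu := om_wt (shw x) k)); first exact: Gle_om.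
apply: Gle_ext => p _.
by rewrite /om_wt /shw addrAC.
Qed.

Lemma Gx_twist x (c : nat -> K) : Gx x (fun p => x p + c (bl p)).
Proof.
apply: (Gle_trans (mu := fun p => shw x p + c (bl p))); first exact: Gle_twist.
apply: Gle_ext => p _.
by rewrite /shw addrAC.
Qed.

Lemma block_const (g : nat -> K) : (forall p, okp p p.+1 -> g p = g p.+1) ->
  exists c, forall p, (p < n)%N -> g p = c (bl p).
Proof.
move=> h.
have const p q : okp p q -> (p <= q)%N -> g p = g q.
  elim: q => [|q IH] ok; first by rewrite leqn0 => /eqP ->.
  rewrite leq_eqVlt => /predU1P[->//|]; rewrite ltnS => pq.
  have [h1 h2] := okp_between bl_mono ok (introT andP (conj pq (leqnSn q))).
  by rewrite (IH h1 pq) h.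
exists (fun b => g (find (fun p => bl p == b) (iota 0 n))) => p pn.
set s := iota 0 n; set q := find _ _.
have hs : has (fun q => bl q == bl p) s by apply/hasP; exists p; rewrite ?mem_iota.
have qs : (q < size s)%N by rewrite -has_find.
have qn : (q < n)%N by rewrite size_iota in qs.
have := nth_find 0%N hs; rewrite nth_iota // add0n => /eqP e.
have ok : okp q p by rewrite okpE // e.
have [qp|pq] := leqP q p; first by rewrite (const q p).
by apply: const; [rewrite okpC|exact: ltnW].
Qed.

Lemma Gx_oms x l : all (fun k => k <= n)%N l ->
  Gx x (fun p => x p + \sum_(k <- l) (p < k)%N%:R).
Proof.
elim: l x => [|k l IH] x /=; first by move=> _; apply: Gx_ext => p _; rewrite big_nil addr0.
move=> /andP[kn /IH h]; apply: (Gx_trans (y := fun p => x p + (p < k)%N%:R)); first exact: Gx_om.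
apply: Gx_trans (h _) _.
by apply: Gx_ext => p _; rewrite big_cons addrA.
Qed.

Lemma sum_step (e : nat -> nat) p m : (p.+1 < m)%N ->
  \sum_(k <- flatten [seq nseq (e k) k | k <- iota 0 m]) (p < k)%N%:R
  - \sum_(k <- flatten [seq nseq (e k) k | k <- iota 0 m]) (p.+1 < k)%N%:R = (e p.+1)%:R :> K.
Proof.
move=> pm; rewrite -sumrB big_flatten big_map /=.
rewrite (bigD1_seq p.+1) ?mem_iota ?iota_uniq //= [X in _ + X]big1_seq => [|k /andP[kp _]].
  rewrite addr0; elim: (e p.+1) => [|i IH]; rewrite /= ?big_nil // big_cons IH.
  by rewrite ltnS leqnn ltnn subr0 -natr1 addrC.
have e0 : (p < k)%N%:R - (p.+1 < k)%N%:R = 0 :> K.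
  by rewrite [(p < k)%N]leq_eqVlt eq_sym (negbTE kp) subrr.
by elim: (e k) => [|i IH]; rewrite /= ?big_nil // big_cons e0 IH addr0.
Qed.

(** Adding a dominant integral weight does not increase the growth, as it is a composition of the
steps [Gx_om], up to a twist that is constant on the blocks. *)
Lemma Gx_dom x y :
  (forall p, okp p p.+1 -> exists e : nat, (y p - x p) - (y p.+1 - x p.+1) = e%:R) -> Gx x y.
Proof.
move=> /= h.
have /choice[e he] p : exists e : nat, okp p p.+1 -> (y p - x p) - (y p.+1 - x p.+1) = e%:R.
  by have [/h[e he]|no] := boolP (okp p p.+1); [exists e|exists 0%N].
pose l := flatten [seq nseq (e k.-1) k | k <- iota 0 n].
have ln : all (fun k => k <= n)%N l.
  apply/allP => k /flatten_mapP[k' hk']; rewrite mem_nseq => /andP[_ /eqP ->].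
  by move: hk'; rewrite mem_iota => /andP[_ /ltnW].
pose x1 p := x p + \sum_(k <- l) (p < k)%N%:R.
have [|c hc] := @block_const (fun p => y p - x1 p).
  move=> p ok; have pn := okp_r ok; apply/eqP; rewrite -subr_eq0 /x1.
  have := sum_step (fun k => e k.-1) pn; rewrite /= -/l -(he p ok).
  by set S1 := \sum_(k <- l) _; set S2 := \sum_(k <- l) _ => es; apply/eqP; rewrite -[S1](subrK S2) es; ring.
apply: (Gx_trans (y := x1)); first exact: Gx_oms.
apply: (Gx_trans (y := fun p => x1 p + c (bl p))); first exact: Gx_twist.
by apply: Gx_ext => p pn; rewrite -hc // /x1; ring.
Qed.

Variables (R : realDomainType) (re : {additive K -> R}).
Hypothesis re1 : re 1 = 1.

Let sorted_at x k := (forall p, okp p k.-1 -> (p < k.-1)%N -> re (x k.-1) <= re (x p)) /\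
  (forall q, okp k.-1 q -> (k <= q)%N -> re (x q) < re (x k.-1)).

Lemma Gx_oms_inv x l : all (fun k => k <= n)%N l -> (forall k, k \in l -> sorted_at x k) ->
  Gx (fun p => x p + \sum_(k <- l) (p < k)%N%:R) x.
Proof.
elim: l x => [|k l IH] x /=; first by move=> _ _; apply: Gx_ext => p _; rewrite big_nil addr0.
move=> /andP[kn ln] h; pose x1 p := x p + (p < k)%N%:R.
have step : Gx x1 x.
  have e p : shw x p - p%:R = x p by rewrite /shw addrK.
  have [s1 s2] := h k (mem_head _ _).
  apply: (Gle_trans (mu := om_wt (shw x) k)).
    by apply: Gle_ext => p _; rewrite /om_wt /shw /x1 addrAC.
  by apply: (Gle_om_inv bl_mono re1 kn) => p; rewrite !e; [exact: s1|exact: s2].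
apply: Gx_trans _ step; apply: Gx_trans (Gx_ext _) (IH x1 ln _).
  by move=> p _; rewrite /x1 big_cons addrA.
move=> j jl; have [s1 s2] := h j (mem_behead (s := k :: l) jl).
have rx p : re (x1 p) = re (x p) + (p < k)%N%:R by rewrite /x1 raddfD /= (re_nat re1).
split=> [p ok pj|q ok jq]; rewrite !rx.
  by rewrite lerD ?s1 // ler_nat; case: (ltnP j.-1 k) => // h1; rewrite (ltn_trans pj h1).
rewrite ltr_leD ?s2 // ler_nat; case: (ltnP q k) => // qk.
by rewrite (leq_trans _ qk) // ltnS (leq_trans (leq_pred j)).
Qed.

(** Adding a large multiple of a dominant weight to [y], constant on the rows of [y], makes its
difference with [x] dominant, so that [Gx_dom] applies. The multiple is removed again with
[Gx_oms_inv], whose hypothesis only concerns the boundaries between the rows of [y]. *)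
Lemma Gx_flat x y :
  (forall p, (p < n)%N -> exists z : int, y p - x p = z%:~R) ->
  (forall p, okp p p.+1 -> (y p = y p.+1 /\ exists e : nat, x p.+1 - x p = e%:R)
     \/ re (y p.+1) < re (y p)) -> Gx x y.
Proof.
move=> hz hr.
have /choice[z ez] p : exists z : int, (p < n)%N -> y p - x p = z%:~R.
  by have [/hz[z e]|no] := boolP (p < n)%N; [exists z|exists 0].
pose B := (\sum_(p < n) (`|z p| + `|z p.+1|))%N.
pose bd p := okp p p.+1 && (re (y p.+1) < re (y p)).
pose e k := (bd k.-1 && (0 < k)%N * B)%N.
pose l := flatten [seq nseq (e k) k | k <- iota 0 n].
have lP k : k \in l -> [/\ (k < n)%N, bd k.-1 & (0 < k)%N].
  move=> /flatten_mapP[k' hk']; rewrite mem_nseq /e => /andP[h /eqP ->].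
  move: h hk'; rewrite mem_iota add0n; case: (bd k'.-1); case: k' => //= k' h ->.
have ln : all (fun k => k <= n)%N l by apply/allP => k /lP[/ltnW].
have mono p q : okp p q -> (p <= q)%N -> re (y q) <= re (y p).
  elim: q => [|q IH] ok; first by rewrite leqn0 => /eqP ->.
  rewrite leq_eqVlt => /predU1P[->//|]; rewrite ltnS => pq.
  have [h1 h2] := okp_between bl_mono ok (introT andP (conj pq (leqnSn q))).
  apply: le_trans (IH h1 pq); case: (hr _ h2) => [[-> _]//|/ltW //].
apply: (Gx_trans (y := fun p => y p + \sum_(k <- l) (p < k)%N%:R)); last first.
  apply: Gx_oms_inv => // k /lP[kn /andP[ok lt] k0]; rewrite prednK // in ok lt.
  split=> [p ok' pk|q ok' kq]; first by apply: mono => //; exact: ltnW.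
  by apply: le_lt_trans lt; apply: mono => //; apply: okp_trans ok'; rewrite okpC.
apply: Gx_dom => p ok; have pn := okp_r ok; have pn' := okp_l ok.
have := sum_step e pn; rewrite -/l.
set S1 := \sum_(k <- l) _; set S2 := \sum_(k <- l) _ => es.
have -> : y p + S1 - x p - (y p.+1 + S2 - x p.+1) = (z p - z p.+1)%:~R + (e p.+1)%:R.
  by rewrite -es rmorphB /= -!ez //; ring.
have [lt|ge] := boolP (re (y p.+1) < re (y p)).
  have -> : e p.+1 = B by rewrite /e /bd ok lt /= mul1n.
  have zB : (`|z p| + `|z p.+1| <= B)%N.
    by rewrite /B (bigD1 (Ordinal pn')) //= leq_addr.
  exists `|(z p - z p.+1 + Posz B)%R|%N.
  by rewrite -[RHS]/((Posz _)%:~R) gez0_abs ?rmorphD //=; lia.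
have -> : e p.+1 = 0%N by rewrite /e /bd ok (negbTE ge).
case: (hr p ok) => [[ey [k ek]]|h]; last by rewrite h in ge.
by exists k; rewrite addr0 rmorphB /= -!ez // -ek ey; ring.
Qed.

(** The quantification over the context makes this a congruence for concatenation. *)
Definition LE w w' := size w = size w' /\ forall u v,
  (size u + size w + size v)%N = n ->
  (forall p q, (size u <= p < size u + size w)%N -> (size u <= q < size u + size w)%N -> okp p q) ->
  Gx (nth 0 (u ++ w ++ v)) (nth 0 (u ++ w' ++ v)).

Definition EQ w w' := LE w w' /\ LE w' w.

Lemma LE_refl w : LE w w.
Proof. by split=> // u v _ _; exact: Gx_ext. Qed.

Lemma LE_trans w2 w1 w3 : LE w1 w2 -> LE w2 w3 -> LE w1 w3.
Proof.
move=> [s1 h1] [s2 h2]; split; first by rewrite s1.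
by move=> u v su ok; apply: Gx_trans (h1 u v su ok) (h2 u v _ _); rewrite -s1.
Qed.

Lemma LE_ctx a b w w' : LE w w' -> LE (a ++ w ++ b) (a ++ w' ++ b).
Proof.
move=> [s h]; split; first by rewrite !size_cat s.
move=> u v; rewrite !size_cat => su ok.
have := h (u ++ a) (b ++ v); rewrite !size_cat -!catA; apply; first lia.
by move=> p q hp hq; apply: ok; lia.
Qed.

Lemma EQ_refl w : EQ w w. Proof. by split; exact: LE_refl. Qed.
Lemma EQ_sym w w' : EQ w w' -> EQ w' w. Proof. by case. Qed.
Lemma EQ_trans w2 w1 w3 : EQ w1 w2 -> EQ w2 w3 -> EQ w1 w3.
Proof. by move=> [a b] [c d]; split; [exact: LE_trans a c|exact: LE_trans d b]. Qed.
Lemma EQ_ctx a b w w' : EQ w w' -> EQ (a ++ w ++ b) (a ++ w' ++ b).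
Proof. by move=> [h1 h2]; split; exact: LE_ctx. Qed.
Lemma EQ_size w w' : EQ w w' -> size w = size w'. Proof. by case=> -[]. Qed.

Lemma LE_swap a b : (forall k : nat, a - b != k.+1%:R) -> LE [:: a; b] [:: b; a].
Proof.
move=> h; split=> // u v; rewrite /= => su ok; set i := size u in su ok *.
have oki : okp i i.+1 by apply: ok; lia.
pose x := nth 0 (u ++ [:: a, b & v]).
have xi : x i = a by rewrite /x nth_cat ltnn subnn.
have xi1 : x i.+1 = b by rewrite /x nth_cat ltnNge leqnSn subSnn.
apply: (Gle_trans (mu := swap_wt (shw x) i)).
  rewrite -/x; apply: (Gle_swap bl_mono oki) => m; rewrite /shw xi xi1.
  apply: contraNN (h m) => /eqP e; apply/eqP; rewrite -[m.+1]addn1 natrD -e -[i.+1]addn1 natrD; ring.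
apply: Gle_ext => p _; rewrite /swap_wt /shw xi xi1.
case: eqP => [->|/eqP pi].
  by rewrite nth_cat ltnn subnn /= -[i.+1]addn1 natrD; ring.
case: eqP => [->|/eqP pi1].
  by rewrite nth_cat ltnNge leqnSn subSnn /= -[i.+1]addn1 natrD; ring.
congr (_ + _); rewrite /x !nth_cat -/i; case: ltnP => // ip.
by case e : (p - i)%N => [|[|k]] //; exfalso; move: e pi pi1 ip; clear; lia.
Qed.

Lemma natr_neqN (k l : nat) : - k%:R != l.+1%:R :> K.
Proof. by rewrite eq_sym -subr_eq0 opprK -natrD pnatr_eq0. Qed.

Lemma EQ_comm a b : (forall z : int, a - b != z%:~R) -> EQ [:: a; b] [:: b; a].
Proof.
move=> h; split; apply: LE_swap => k; first by have := h (Posz k.+1).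
apply: contraNN (h (- Posz k.+1)) => /eqP e; by rewrite rmorphN /= -[_%:~R]/(_.+1%:R) -e opprB.
Qed.

(** The two elementary Knuth transformations. One comparison is [LE_swap]; the opposite one is
[Gle_knuth], in which the neighbour of the two exchanged entries supplies the second simple root. *)
Lemma EQ_kn1 (x : K) (s k : nat) : let y := x + s%:R in let z := y + k.+1%:R in
  EQ [:: z; x; y] [:: x; z; y].
Proof.
move=> y z; split; last first.
  apply: (@LE_ctx [::] [:: y] [:: x; z] [:: z; x]); apply: LE_swap => l.
  rewrite (_ : x - z = - (s + k.+1)%:R) ?natr_neqN // /z /y natrD; ring.
split=> // u v; rewrite /= => su ok; set i := size u in su ok *.
have ok1 : okp i i.+1 by apply: ok; lia.
have ok2 : okp i.+1 i.+2 by apply: ok; lia.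
pose f := nth 0 (u ++ [:: z, x, y & v]).
have f0 : f i = z by rewrite /f nth_cat ltnn subnn.
have f1 : f i.+1 = x by rewrite /f nth_cat ltnNge leqnSn subSnn.
have f2 : f i.+2 = y.
  by rewrite /f nth_cat ltnNge (leq_trans (leqnSn _) (leqnSn _)) /= -addn2 addKn.
apply: (Gle_trans (mu := swap_wt (shw f) i)).
  rewrite -/f; apply: (@Gle_knuth _ _ _ _ i i.+1 (s + k)%N s bl_mono ok1 ok2); rewrite ?eqxx ?leq_addr //.
    by rewrite /shw f0 f1 /z /y -[k.+1]addn1 -[i.+1]addn1 !natrD; ring.
  by rewrite /shw f1 f2 /y -[i.+2]addn1 -[i.+1]addn1 !natrD; ring.
apply: Gle_ext => p _; rewrite /swap_wt /shw f0 f1.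
case: eqP => [->|/eqP pi].
  by rewrite nth_cat ltnn subnn /= -[i.+1]addn1 natrD; ring.
case: eqP => [->|/eqP pi1].
  by rewrite nth_cat ltnNge leqnSn subSnn /= -[i.+1]addn1 natrD; ring.
congr (_ + _); rewrite /f !nth_cat -/i; case: ltnP => // ip.
by case e : (p - i)%N => [|[|j]] //; exfalso; move: e pi pi1 ip; clear; lia.
Qed.

Lemma EQ_kn2 (x : K) (s k : nat) : let y := x + k.+1%:R in let z := y + s%:R in
  EQ [:: y; z; x] [:: y; x; z].
Proof.
move=> y z; split; last first.
  apply: (@LE_ctx [:: y] [::] [:: x; z] [:: z; x]); apply: LE_swap => l.
  rewrite (_ : x - z = - (s + k.+1)%:R) ?natr_neqN // /z /y natrD; ring.
split=> // u v; rewrite /= => su ok; set i := size u in su ok *.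
have ok1 : okp i i.+1 by apply: ok; lia.
have ok2 : okp i.+1 i.+2 by apply: ok; lia.
pose f := nth 0 (u ++ [:: y, z, x & v]).
have f0 : f i = y by rewrite /f nth_cat ltnn subnn.
have f1 : f i.+1 = z by rewrite /f nth_cat ltnNge leqnSn subSnn.
have f2 : f i.+2 = x.
  by rewrite /f nth_cat ltnNge (leq_trans (leqnSn _) (leqnSn _)) /= -addn2 addKn.
apply: (Gle_trans (mu := swap_wt (shw f) i.+1)).
  rewrite -/f; apply: (@Gle_knuth _ _ _ _ i.+1 i (s + k)%N s bl_mono ok2 ok1); rewrite ?eqxx ?orbT ?leq_addr //.
    by rewrite /shw f1 f2 /z /y -[k.+1]addn1 -[i.+2]addn1 -[i.+1]addn1 !natrD; ring.
  by rewrite /shw f0 f1 /z -[i.+1]addn1 !natrD; ring.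
have i2 : (i.+2 - i)%N = 2%N by rewrite -addn2 addKn.
apply: Gle_ext => p _; rewrite /swap_wt /shw f1 f2.
case: eqP => [->|/eqP pi].
  by rewrite nth_cat ltnNge leqnSn subSnn /= -[i.+2]addn1 natrD; ring.
case: eqP => [->|/eqP pi1].
  rewrite nth_cat ltnNge (leq_trans (leqnSn _) (leqnSn _)) i2 /= -[i.+2]addn1 natrD; ring.
congr (_ + _); rewrite /f !nth_cat -/i; case: ltnP => // ip.
by case e : (p - i)%N => [|[|[|j]]] //; exfalso; move: e pi pi1 ip; clear; lia.
Qed.

End WordMoves.

(** * Insertion tableaux *)

Section RobinsonSchensted.
Variable K : numFieldType.
Implicit Types (a b c : K) (r s w col : seq K) (T t : seq (seq K)).

Definition natle a b : bool := `[< exists k : nat, b - a = k%:R >].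

Lemma natleP a b : reflect (exists k : nat, b = a + k%:R) (natle a b).
Proof.
by apply: (iffP (asboolP _)) => -[k e]; exists k; [rewrite -e addrC subrK|rewrite e addrC addKr].
Qed.

Lemma zltP a b : reflect (exists k : nat, b = a + k.+1%:R) (zlt a b).
Proof.
by apply: (iffP (asboolP _)) => -[k e]; exists k; [rewrite -e addrC subrK|rewrite e addrC addKr].
Qed.

Lemma intdiffP a b : reflect (exists k : int, b = a + k%:~R) (intdiff a b).
Proof.
by apply: (iffP (asboolP _)) => -[k e]; exists k; [rewrite -e addrC subrK|rewrite e addrC addKr].
Qed.

Lemma natle_refl a : natle a a. Proof. by apply/natleP; exists 0%N; rewrite addr0. Qed.

Lemma natle_trans : transitive natle.
Proof.
move=> b a c /natleP[k ->] /natleP[l ->]; apply/natleP; exists (k + l)%N.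
by rewrite natrD addrA.
Qed.

Lemma zlt_natle a b : zlt a b -> natle a b.
Proof. by move=> /zltP[k ->]; apply/natleP; exists k.+1. Qed.

Lemma zlt_le_trans b a c : zlt a b -> natle b c -> zlt a c.
Proof.
move=> /zltP[k ->] /natleP[l ->]; apply/zltP; exists (k + l)%N.
by rewrite -addSn natrD addrA.
Qed.

Lemma le_zlt_trans b a c : natle a b -> zlt b c -> zlt a c.
Proof.
move=> /natleP[k ->] /zltP[l ->]; apply/zltP; exists (k + l)%N.
by rewrite -addnS natrD addrA.
Qed.

Lemma zlt_ge a b : zlt a b -> natle b a -> False.
Proof.
move=> /zltP[k ->] /natleP[l /eqP]; rewrite -addrA -[X in X == _]addr0.
by rewrite (inj_eq (addrI a)) -natrD eq_sym pnatr_eq0.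
Qed.

Lemma intdiff_sym a b : intdiff a b -> intdiff b a.
Proof. by move=> /intdiffP[k ->]; apply/intdiffP; exists (- k); rewrite rmorphN addrK. Qed.

Lemma intdiff_refl a : intdiff a a.
Proof. by apply/intdiffP; exists 0; rewrite addr0. Qed.

Lemma intdiff_trans b a c : intdiff a b -> intdiff b c -> intdiff a c.
Proof.
move=> /intdiffP[k ->] /intdiffP[l ->]; apply/intdiffP; exists (k + l).
by rewrite rmorphD addrA.
Qed.

Lemma not_zlt a b : intdiff a b -> zlt a b = false -> natle b a.
Proof.
move=> /intdiffP[[[|k]|k] ->].
- by rewrite addr0 => _; exact: natle_refl.
- by move/negP; case; apply/zltP; exists k.
by move=> _; apply/natleP; exists k.+1; rewrite NegzE rmorphN /= subrK.
Qed.

Lemma row_insertP a r : all (intdiff a) r ->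
  match row_insert a r with
  | (r', None) => r' = rcons r a /\ all (fun b => natle b a) r
  | (r', Some b) => exists r1 r2, [/\ r = r1 ++ b :: r2, r' = r1 ++ a :: r2,
       all (fun b => natle b a) r1 & zlt a b]
  end.
Proof.
elim: r => [//|b r IH] /= /andP[ab /IH{}IH]; case: ifP => zab; first by exists [::], r.
have ba : natle b a by exact: not_zlt zab.
case: (row_insert a r) IH => r' [d [r1 [r2 [-> -> h z]]]|[-> h]]; last by rewrite ba.
by exists (b :: r1), r2; rewrite /= ba.
Qed.

Definition dom r s := (size s <= size r)%N && all (fun i => zlt (nth 0 r i) (nth 0 s i)) (iota 0 (size s)).

Lemma domP r s : reflect ((size s <= size r)%N /\ forall i, (i < size s)%N -> zlt (nth 0 r i) (nth 0 s i)) (dom r s).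
Proof.
apply: (iffP andP) => -[h1 h2]; split=> //.
  by move=> i il; apply: (allP h2); rewrite mem_iota.
by apply/allP => i; rewrite mem_iota => /andP[_]; exact: h2.
Qed.

(** Semistandard tableaux: [natle] along the rows, [zlt] down the columns. *)
Definition tableau c T := [&& all (all (intdiff c)) T, all (sorted natle) T & sorted dom T].

(** The entry [b] bumped out of a row enters the next row no further to the right than the place
that it has left, where a smaller entry now stands above it. *)
Lemma dom_step c a b r r' s : all (intdiff c) r -> all (intdiff c) s -> intdiff c a ->
  dom r s -> row_insert a r = (r', Some b) -> dom r' (row_insert b s).1.
Proof.
move=> ir is_ ca /domP[ss d] e.
have ia : all (intdiff a) r.
  by apply: sub_all ir => x cx; apply: intdiff_trans cx; exact: intdiff_sym.
have := row_insertP ia; rewrite e => -[r1 [r2 [er er' h z]]].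
have cb : intdiff c b by move: ir; rewrite er all_cat /= => /and3P[].
have ib : all (intdiff b) s.
  by apply: sub_all is_ => x cx; apply: intdiff_trans cx; exact: intdiff_sym.
have rb : nth 0 r (size r1) = b by rewrite er nth_cat ltnn subnn.
have r'b : nth 0 r' (size r1) = a by rewrite er' nth_cat ltnn subnn.
have r'o i : i != size r1 -> nth 0 r' i = nth 0 r i.
  move=> ne; rewrite er er' !nth_cat; case: ltnP => // h'.
  by case e' : (i - size r1)%N => [|k] //; move: ne; rewrite -(subnK h') e' eqxx.
have sr : size r' = size r by rewrite er er' !size_cat.
have r1a i : (i < size r1)%N -> natle (nth 0 r i) a.
  by move=> il; rewrite er nth_cat il; apply: (allP h); exact: mem_nth.
have j'le s1 : (forall i, (i < size s1)%N -> nth 0 s i = nth 0 s1 i) -> (size s1 <= size s)%N ->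
   all (fun x => natle x b) s1 -> (size s1 <= size r1)%N.
  move=> es les hs; rewrite leqNgt; apply/negP => lt.
  have := d _ (leq_trans lt les); rewrite rb => z'.
  by apply: (zlt_ge z'); rewrite es //; apply: (allP hs); exact: mem_nth.
have lt1 : (size r1 < size r)%N by rewrite er size_cat /= -addSnnS leq_addr.
have key s1 s2 s' : (forall i, (i < size s')%N -> i != size s1 -> nth 0 s' i = nth 0 s i /\ (i < size s)%N) ->
    nth 0 s' (size s1) = b -> (size s1 <= size r1)%N -> (size s' <= size r)%N -> s2 = s' -> dom r' s2.
  move=> h1 h2 h3 h4 ->; apply/domP; rewrite sr; split=> // i il.
  have [ei|ne] := eqVneq i (size s1).
    rewrite ei h2; have [e1|ne1] := eqVneq (size s1) (size r1); first by rewrite e1 r'b.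
    rewrite r'o //; apply: le_zlt_trans z; apply: r1a.
    by rewrite ltn_neqAle ne1.
  have [-> is'] := h1 i il ne.
  have [ej|nej] := eqVneq i (size r1); last by rewrite r'o //; exact: d.
  rewrite ej r'b; apply: zlt_le_trans (zlt_natle (d _ _)); first by rewrite rb.
  by rewrite -ej.
have := row_insertP ib; case: (row_insert b s) => s' [x [s1 [s2 [es es' hs zs]]]|[es' hs]] /=.
  have le1 : (size s1 <= size r1)%N.
    apply: j'le => //; last by rewrite es size_cat leq_addr.
    by move=> i il; rewrite es nth_cat il.
  apply: (key s1 s' s') => //; last by rewrite es' size_cat; move: ss; rewrite es size_cat.
  - move=> i il ne; have ss' : size s' = size s by rewrite es es' !size_cat.
    split; last by rewrite -ss'.
    rewrite es es' !nth_cat; case: ltnP => // h'.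
    by case e' : (i - size s1)%N => [|k] //; move: ne; rewrite -(subnK h') e' eqxx.
  - by rewrite es' nth_cat ltnn subnn.
have le1 : (size s <= size r1)%N by apply: j'le.
apply: (key s s' s') => //.
- by move=> i; rewrite es' size_rcons ltnS leq_eqVlt nth_rcons => /predU1P[->|il _]; rewrite ?eqxx // il.
- by rewrite es' nth_rcons ltnn eqxx.
- by rewrite es' size_rcons; exact: leq_ltn_trans le1 lt1.
Qed.

Lemma dom_rcons r s a : dom r s -> dom (rcons r a) s.
Proof.
move=> /domP[h1 h2]; apply/domP; rewrite size_rcons; split=> [|i il]; first exact: leqW.
by rewrite nth_rcons (leq_trans il h1); exact: h2.
Qed.

Lemma tab_insertE a T : tab_insert a T =
  (row_insert a (head [::] T)).1 ::
   (if (row_insert a (head [::] T)).2 is Some b then tab_insert b (behead T) else behead T).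
Proof. by case: T => [|r T] //=; case: (row_insert a r) => r' [b|]. Qed.

Lemma sorted_natle_cat r1 r2 a : sorted natle (r1 ++ r2) -> all (fun b => natle b a) r1 ->
  (forall b, ohead r2 = Some b -> natle a b) -> sorted natle (r1 ++ a :: r2).
Proof.
case: r1 => [|x r1] /=; first by case: r2 => //= b r2 -> _ /(_ b erefl) ->.
rewrite !cat_path /= => /andP[-> h] /andP[xa r1a] hb; rewrite /=.
have -> : natle (last x r1) a.
  by case/lastP: r1 r1a {h} => //= r1 y; rewrite all_rcons last_rcons => /andP[].
by case: r2 h hb => //= b r2 /andP[_ ->] /(_ b erefl) ->.
Qed.

Lemma tableau_insert c a T : tableau c T -> intdiff c a -> tableau c (tab_insert a T).
Proof.
elim: T a => [|r T IH] a; first by rewrite /tableau /= andbT => _ ->.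
case/and3P => /= /andP[ir iT] /andP[sr sT] dT ca.
have ia : all (intdiff a) r.
  by apply: sub_all ir => x cx; apply: intdiff_trans cx; exact: intdiff_sym.
have := row_insertP ia; case e : (row_insert a r) => [r' [b|]]; last first.
  case=> -> h; rewrite /tableau /= all_rcons ca ir iT sT /= !andbT; apply/andP; split.
    by rewrite -cats1; apply: sorted_natle_cat; rewrite ?cats0.
  by case: T dT {IH iT sT} => //= s T /andP[d ->]; rewrite dom_rcons.
case=> r1 [r2 [er er' h z]].
have cb : intdiff c b by move: ir; rewrite er all_cat /= => /and3P[].
have dT' : sorted dom T by exact: path_sorted dT.
have /and3P[i1 i2 i3] := IH b (introT and3P (And3 iT sT dT')) cb.
apply/and3P; split=> /=.
- by rewrite i1 andbT er' all_cat /=; move: ir; rewrite er all_cat /= ca => /and3P[-> _ ->].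
- rewrite i2 andbT er'; move: sr; rewrite er => sr; apply: sorted_natle_cat => //.
    have hs : subseq (r1 ++ r2) (r1 ++ b :: r2) by rewrite subseq_cat2l; exact: subseq_cons.
    exact: (subseq_sorted natle_trans hs sr).
  case: (r2) sr => // y r3; rewrite -cat_rcons -[_ ++ _]cats0 => sr x [<-].
  apply: zlt_natle; apply: zlt_le_trans z _.
  have hs : subseq [:: b; y] (r1 ++ [:: b, y & r3]).
    by apply: (@subseq_trans _ [:: b, y & r3]); [rewrite /= !eqxx; exact: sub0seq|exact: suffix_subseq].
  rewrite cats0 cat_rcons in sr.
  by have := subseq_sorted natle_trans hs sr; rewrite /= andbT.
move: i3; rewrite tab_insertE /= => ->; rewrite andbT.
apply: (dom_step ir _ ca _ e); first by case: (T) iT => //= s t' /andP[].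
by case: (T) dT => //= s t' /andP[].
Qed.

Lemma tableau_RS c w : all (intdiff c) w -> tableau c (RStab w).
Proof.
rewrite /RStab; have : tableau c [::] by [].
by elim: w [::] => //= a w IH T hT /andP[ca]; apply: IH; exact: tableau_insert.
Qed.

(** * Knuth equivalence with the row word *)

Variable EQ : seq K -> seq K -> Prop.
Hypotheses (EQ_refl : forall w, EQ w w) (EQ_sym : forall w w', EQ w w' -> EQ w' w).
Hypotheses (EQ_trans : forall w2 w1 w3, EQ w1 w2 -> EQ w2 w3 -> EQ w1 w3).
Hypothesis EQ_ctx : forall u v w w', EQ w w' -> EQ (u ++ w ++ v) (u ++ w' ++ v).
Hypothesis kn1 : forall (x : K) (s k : nat),
  EQ [:: x + s%:R + k.+1%:R; x; x + s%:R] [:: x; x + s%:R + k.+1%:R; x + s%:R].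
Hypothesis kn2 : forall (x : K) (s k : nat),
  EQ [:: x + k.+1%:R; x + k.+1%:R + s%:R; x] [:: x + k.+1%:R; x; x + k.+1%:R + s%:R].

Lemma EQ_left u w w' : EQ w w' -> EQ (u ++ w) (u ++ w').
Proof. by move=> h; have := EQ_ctx u [::] h; rewrite !cats0. Qed.
Lemma EQ_right v w w' : EQ w w' -> EQ (w ++ v) (w' ++ v).
Proof. by move=> h; have := EQ_ctx [::] v h. Qed.

Lemma knuth1 x y z : natle x y -> zlt y z -> EQ [:: z; x; y] [:: x; z; y].
Proof. by move=> /natleP[s ->] /zltP[k ->]; exact: kn1. Qed.
Lemma knuth2 x y z : zlt x y -> natle y z -> EQ [:: y; z; x] [:: y; x; z].
Proof. by move=> /zltP[k ->] /natleP[s ->]; exact: kn2. Qed.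

(** The two sides of inserting [a] into a row: the bumped entry stays while [a] travels left over the
larger entries, by [move_small], and then it travels left over the smaller ones, by [move_big]. *)
Lemma move_small y r a : path natle y r -> zlt a y -> EQ (y :: r ++ [:: a]) [:: y, a & r].
Proof.
elim: r y => [|z r IH] y /=; first by move=> _ _; exact: EQ_refl.
move=> /andP[yz pz] ay; have az := zlt_le_trans ay yz.
apply: (EQ_trans (w2 := [:: y, z, a & r])); first exact: (EQ_left [:: y] (IH z pz az)).
exact: (EQ_right r (knuth2 ay yz)).
Qed.

Lemma move_big r a b : sorted natle (rcons r a) -> zlt a b -> EQ (r ++ [:: b; a]) (b :: rcons r a).
Proof.
elim/last_ind: r a => [|r x IH] a; first by move=> _ _; exact: EQ_refl.
move=> sr ab.
have hs : subseq (rcons r x) (rcons (rcons r x) a) by rewrite -[X in subseq _ X]cats1 prefix_subseq.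
have sx := subseq_sorted natle_trans hs sr.
have hx : subseq [:: x; a] (rcons (rcons r x) a) by rewrite -!cats1 -catA suffix_subseq.
have /= := subseq_sorted natle_trans hx sr; rewrite andbT => xa.
apply: (EQ_trans (w2 := (r ++ [:: b; x]) ++ [:: a])).
  rewrite -cats1 -!catA; apply: EQ_left; apply: EQ_sym; exact: knuth1.
rewrite -[b :: rcons _ _]cat1s -[rcons (rcons r x) a]cats1 catA.
exact: EQ_right (IH x sx (le_zlt_trans xa ab)).
Qed.

Definition rowword T := flatten (rev T).

Lemma rowword_cons r T : rowword (r :: T) = rowword T ++ r.
Proof. by rewrite /rowword rev_cons -cats1 flatten_cat /= cats0. Qed.

Lemma rowword_rcons r T : rowword (rcons T r) = r ++ rowword T.
Proof. by rewrite /rowword rev_rcons. Qed.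

Lemma EQ_insert c a T : tableau c T -> intdiff c a ->
  EQ (rowword T ++ [:: a]) (rowword (tab_insert a T)).
Proof.
elim: T a => [|r T IH] a; first by move=> _ _; exact: EQ_refl.
case/and3P => /= /andP[ir iT] /andP[sr sT] dT ca.
have ia : all (intdiff a) r.
  by apply: sub_all ir => x cx; apply: intdiff_trans cx; exact: intdiff_sym.
have := row_insertP ia; case e : (row_insert a r) => [r' [b|]]; last first.
  by case=> -> _; rewrite !rowword_cons -catA cats1; exact: EQ_refl.
case=> r1 [r2 [er er' h z]]; rewrite !rowword_cons.
have cb : intdiff c b by move: ir; rewrite er all_cat /= => /and3P[].
have dT' : sorted dom T by exact: path_sorted dT.
apply: EQ_trans (EQ_right r' (IH b (introT and3P (And3 iT sT dT')) cb)).
rewrite -!catA; apply: EQ_left; rewrite er er' -catA.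
have hs : subseq (b :: r2) (r1 ++ b :: r2) by exact: suffix_subseq.
rewrite er in sr.
apply: (EQ_trans (w2 := r1 ++ [:: b, a & r2])).
  apply: EQ_left; apply: move_small z; exact: (subseq_sorted natle_trans hs sr).
have -> : r1 ++ [:: b, a & r2] = (r1 ++ [:: b; a]) ++ r2 by rewrite -catA.
have -> : [:: b] ++ r1 ++ a :: r2 = (b :: rcons r1 a) ++ r2 by rewrite /= cat_rcons.
apply: EQ_right; apply: move_big => //.
have hs1 : subseq r1 (r1 ++ b :: r2) by exact: prefix_subseq.
rewrite -cats1; apply: sorted_natle_cat; rewrite ?cats0 //.
exact: (subseq_sorted natle_trans hs1 sr).
Qed.

Lemma EQ_RS c w : all (intdiff c) w -> EQ w (rowword (RStab w)).
Proof.
suff h T : tableau c T -> all (intdiff c) w ->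
    EQ (rowword T ++ w) (rowword (foldl (fun t a => tab_insert a t) T w)) by exact: (h [::]).
elim: w T => [|a w IH] T hT /=; first by rewrite cats0 => _; exact: EQ_refl.
case/andP=> ca iw; apply: EQ_trans (IH _ (tableau_insert hT ca) iw).
by rewrite -cat1s catA; apply: EQ_right; exact: EQ_insert hT ca.
Qed.

Definition firstcol T := [seq head 0 r | r <- T & (0 < size r)%N].

(** The entries of [col] travel to the left over [r] one after the other, each of them guarded by
the entry in front of it, which is larger than it and not larger than [r]. *)
Lemma move_col y r col : path natle y r -> path (fun a b => zlt b a) y col ->
  EQ (y :: r ++ col) (y :: col ++ r).
Proof.
elim: col y => [|b col IH] y /=; first by rewrite cats0 => _ _; exact: EQ_refl.
move=> yr /andP[yb bc].
apply: (EQ_trans (w2 := [:: y, b & r] ++ col)).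
  have -> : y :: r ++ b :: col = (y :: r ++ [:: b]) ++ col by rewrite /= -catA.
  by apply: EQ_right; exact: move_small.
apply: (EQ_left [:: y]); apply: IH => //.
by case: (r) yr => //= x r0 /andP[yx ->]; rewrite (natle_trans (zlt_natle yb) yx).
Qed.

Lemma sorted_dom_rcons T r : sorted dom (rcons T r) -> sorted dom T.
Proof. by case: T => //= s T; rewrite rcons_path => /andP[]. Qed.

Lemma dom_prefix T s r : sorted dom (rcons (rcons T s) r) -> dom s r.
Proof. by case: T => [|t T] /=; rewrite ?rcons_path ?last_rcons => /andP[]. Qed.

Lemma dom_nonempty T r : sorted dom (rcons T r) -> (0 < size r)%N -> all (fun s => (0 < size s)%N) T.
Proof.
elim/last_ind: T r => // T s IH r h r0; rewrite all_rcons.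
have s0 : (0 < size s)%N by have /domP[h1 _] := dom_prefix h; exact: leq_trans h1.
by rewrite s0; apply: (IH s) => //; exact: sorted_dom_rcons h.
Qed.

Lemma firstcol_sorted T : sorted dom T -> sorted (@zlt K) (firstcol T).
Proof.
elim/last_ind: T => // T r IH h; rewrite /firstcol filter_rcons; case: ltnP => r0; last first.
  exact: IH (sorted_dom_rcons h).
have /all_filterP e := dom_nonempty h r0; rewrite e map_rcons.
have {IH} := IH (sorted_dom_rcons h); rewrite /firstcol e.
case/lastP: T h e => [|T s] // h _; rewrite map_rcons.
have /domP[_ /(_ 0%N r0)] := dom_prefix h; rewrite !nth0 => z.
by case: (map _ T) => [|t T'] /=; rewrite ?z // !rcons_path last_rcons => ->.
Qed.

Lemma EQ_firstcol T : all (sorted natle) T -> sorted dom T ->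
  EQ (rowword T) (rev (firstcol T) ++ rowword (map behead T)).
Proof.
elim/last_ind: T => [|T r IH]; first by move=> _ _; exact: EQ_refl.
rewrite all_rcons => /andP[sr sT] dT; have dT' := sorted_dom_rcons dT.
have hf := firstcol_sorted dT.
rewrite map_rcons !rowword_rcons; case: r sr dT hf => [|y r] sr dT hf.
  by rewrite /firstcol filter_rcons /=; exact: IH.
have -> : rev (firstcol (rcons T (y :: r))) = y :: rev (firstcol T).
  by rewrite /firstcol filter_rcons /= map_rcons rev_rcons.
apply: (EQ_trans (w2 := (y :: r ++ rev (firstcol T)) ++ rowword (map behead T))).
  by rewrite /= -catA; apply: (EQ_left (y :: r)); exact: IH.
rewrite /= catA -cat_cons -[X in EQ _ X]cat_cons; apply: EQ_right; apply: move_col => //.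
have : rev (firstcol (rcons T (y :: r))) = y :: rev (firstcol T).
  by rewrite /firstcol filter_rcons /= map_rcons rev_rcons.
move: hf; rewrite -rev_sorted => hf e; by move: hf; rewrite e.
Qed.

Fixpoint tabcols N T := if N is N'.+1 then rev (firstcol T) :: tabcols N' (map behead T) else [::].

Lemma natle_path_behead r : sorted natle r -> sorted natle (behead r).
Proof. by case: r => //= a r; exact: path_sorted. Qed.

Lemma dom_behead r s : dom r s -> dom (behead r) (behead s).
Proof.
move=> /domP[h1 h2]; apply/domP; rewrite !size_behead; split; first by rewrite -!subn1 leq_sub2r.
by move=> i il; rewrite !nth_behead; apply: h2; case: (size s) il.
Qed.

Lemma sorted_dom_behead T : sorted dom T -> sorted dom (map behead T).
Proof. exact/homo_sorted/dom_behead. Qed.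

Lemma EQ_tabcols N T : all (sorted natle) T -> sorted dom T -> all (fun r => (size r <= N)%N) T ->
  EQ (rowword T) (flatten (tabcols N T)).
Proof.
elim: N T => [|N IH] T sT dT hN.
  rewrite /= (_ : rowword T = [::]); first exact: EQ_refl.
  apply/nilP; rewrite /nilp /rowword size_flatten sumnE big_map big1_seq // => r /andP[_].
  by rewrite mem_rev => /(allP hN); rewrite leqn0 => /eqP.
apply: EQ_trans (EQ_firstcol sT dT) _ => /=; apply: EQ_left; apply: IH.
- by rewrite all_map; apply: sub_all sT => r; exact: natle_path_behead.
- exact: sorted_dom_behead.
by rewrite all_map; apply: sub_all hN => r /=; rewrite size_behead; case: (size r).
Qed.

Lemma size_tabcols N T : [seq size col | col <- tabcols N T] = mkseq (col_length T) N.
Proof.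
elim: N T => //= N IH T; rewrite /mkseq /= IH size_rev size_map size_filter; congr (_ :: _).
rewrite /mkseq (iotaDl 1 0) -map_comp; apply: eq_map => i /=.
by rewrite /col_length count_map; apply: eq_count => r /=; rewrite size_behead; case: (size r).
Qed.

Lemma tabcols_sorted N T : sorted dom T -> all (sorted (fun a b => zlt b a)) (tabcols N T).
Proof.
elim: N T => //= N IH T dT; rewrite rev_sorted firstcol_sorted //=; apply: IH.
exact: sorted_dom_behead.
Qed.

Lemma Atab_bin T N : {in T, forall r, (size r <= N)%N} -> Atab T = (\sum_(j < N) 'C(col_length T j, 2))%N.
Proof.
move=> hN; have hm : (\max_(r <- T) size r <= N)%N.
  by apply/bigmax_leqP_seq => r rT _; exact: hN.
rewrite /Atab -(big_mkord xpredT (fun i => (col_length T i * (col_length T i).-1) %/ 2)%N).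
rewrite -(big_mkord xpredT (fun j => 'C(col_length T j, 2))) (big_cat_nat (n := \max_(r <- T) size r) _ hm) //=.
rewrite [X in (_ = _ + X)%N]big_nat_cond [X in (_ = _ + X)%N]big1 ?addn0; last first.
  move=> j; rewrite andbT => /andP[jm _]; suff -> : col_length T j = 0%N by [].
  apply/eqP; rewrite /col_length -leqn0 leqNgt -has_count; apply/hasPn => r rT.
  by rewrite -leqNgt; apply: leq_trans jm; exact: leq_bigmax_seq.
by apply: eq_bigr => j _; rewrite bin2 divn2.
Qed.

Lemma RS_columns c w : all (intdiff c) w -> exists cols,
  [/\ EQ w (flatten cols), all (sorted (fun a b => zlt b a)) cols
    & (\sum_(col <- cols) 'C(size col, 2))%N = Atab (RStab w)].
Proof.
move=> hw; have /and3P[_ sT dT] := tableau_RS hw; set T := RStab w in sT dT *.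
pose N := (\max_(r <- T) size r)%N.
have hN : {in T, forall r, (size r <= N)%N} by move=> r rT; exact: leq_bigmax_seq.
exists (tabcols N T); split.
- by apply: EQ_trans (EQ_RS hw) _; apply: EQ_tabcols => //; apply/allP.
- exact: tabcols_sorted.
rewrite (Atab_bin hN) -(big_map size xpredT (fun q => 'C(q, 2))) size_tabcols /mkseq big_map.
by rewrite -{1}(subn0 N) -/(index_iota 0 N) big_mkord.
Qed.

(** ** Constant rows *)

(** The tableau of constant rows, in which columns may also be split off on the right; this puts
the short columns first. *)
Definition flattab (be : K) (f : nat -> nat) m : seq (seq K) :=
  mkseq (fun i => nseq (f i) (be + i%:R)) m.

Definition fcol (be : K) q : seq K := rev (mkseq (fun i => be + i%:R) q).

Lemma fcolS be q : fcol be q.+1 = rcons (fcol (be + 1) q) be.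
Proof.
rewrite /fcol /mkseq /= rev_cons addr0; congr (rcons (rev _) _).
rewrite (iotaDl 1 0) -map_comp; apply: eq_map => i /=.
by rewrite natrD addrA.
Qed.

Lemma flattabS be f m :
  flattab be f m.+1 = nseq (f 0%N) be :: flattab (be + 1) (fun i => f i.+1) m.
Proof.
rewrite /flattab /mkseq /= addr0; congr (_ :: _).
rewrite (iotaDl 1 0) -map_comp; apply: eq_map => i /=.
by rewrite natrD addrA.
Qed.

Lemma move_col_right r a col : sorted natle (rcons r a) -> sorted (fun a b => zlt b a) (rcons col a) ->
  EQ (col ++ rcons r a) (r ++ rcons col a).
Proof.
elim/last_ind: col a => [|col b IH] a sr sc; first by rewrite /= cats1; exact: EQ_refl.
have ab : zlt a b.
  by move: sc; case: (col) => [|x s] /=; rewrite ?andbT // rcons_path last_rcons => /andP[].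
have sc' : sorted (fun a b => zlt b a) (rcons col b).
  by move: sc; case: (col) => [|x s] //=; rewrite rcons_path => /andP[].
have sr' : sorted natle (rcons r b).
  move: sr; case: (r) => [|x s] //=; rewrite !rcons_path => /andP[-> /natle_trans]; apply.
  exact: zlt_natle.
apply: (EQ_trans (w2 := (col ++ rcons r b) ++ [:: a])).
  rewrite cat_rcons -cats1 -!catA; apply: EQ_left; apply: EQ_sym.
  rewrite cat_rcons ?cats1; exact: move_big.
by rewrite -[rcons (rcons _ _) a]cats1 catA; apply: EQ_right; exact: IH.
Qed.

Lemma fcol_sorted be q : sorted (fun a b => zlt b a) (fcol be q).
Proof.
elim: q be => // q IH be; rewrite fcolS; case: q IH => // q IH; rewrite fcolS.
have := IH (be + 1); rewrite fcolS; case: (fcol _ q) => [|x s] /=.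
  by move=> _; rewrite andbT; apply/zltP; exists 0%N.
by rewrite !rcons_path last_rcons => ->; apply/zltP; exists 0%N.
Qed.

Lemma nseq_natle k a : sorted natle (nseq k a).
Proof. by case: k => //= k; elim: k => //= k ->; rewrite natle_refl. Qed.

Lemma nseqS_rcons (k : nat) (a : K) : nseq k.+1 a = rcons (nseq k a) a.
Proof. by elim: k => //= k <-. Qed.

(** The last entries of the rows are moved behind the rest of the word, from the bottom row to the
top row, by [move_col_right]. *)
Lemma EQ_flat be f m : (forall i, (f i.+1 <= f i)%N) ->
  EQ (rowword (flattab be f m))
     (rowword (flattab be (fun i => (f i).-1) m) ++ fcol be (count (fun i => (0 < f i)%N) (iota 0 m))).
Proof.
elim: m be f => [|m IH] be f fd; first exact: EQ_refl.
have {}IH := IH (be + 1) (fun i => f i.+1) (fun i => fd i.+1).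
rewrite !flattabS !rowword_cons [count _ _]/=.
have -> : count (fun i => (0 < f i)%N) (iota 1 m) = count (fun i => (0 < f i.+1)%N) (iota 0 m).
  by rewrite (iotaDl 1 0) count_map; apply: eq_count.
case e : (f 0%N) => [|k].
  have f0 i : f i = 0%N by elim: i => // i IHi; apply/eqP; rewrite -leqn0 -IHi.
  rewrite cats0 (_ : count _ _ = 0%N) ?cats0 //=; last first.
    by apply/eqP; rewrite -leqn0 leqNgt -has_count; apply/hasPn => i _; rewrite f0.
  rewrite (_ : flattab _ (fun i => (f i.+1).-1) m = flattab (be + 1) (fun i => f i.+1) m).
    exact: EQ_refl.
  by apply: eq_map => i; rewrite f0.
rewrite nseqS_rcons add1n fcolS.
apply: EQ_trans (EQ_right _ IH) _; rewrite -!catA; apply: EQ_left.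
apply: move_col_right; first by rewrite -nseqS_rcons; exact: nseq_natle.
by rewrite -fcolS; exact: fcol_sorted.
Qed.

Lemma EQ_flats N be f m : (forall i, (f i.+1 <= f i)%N) -> (f 0%N <= N)%N ->
  EQ (rowword (flattab be f m))
     (flatten (rev (mkseq (fun j => fcol be (count (fun i => (j < f i)%N) (iota 0 m))) N))).
Proof.
elim: N f => [|N IH] f fd fN.
  rewrite /= (_ : rowword _ = [::]); first exact: EQ_refl.
  have f0 i : f i = 0%N.
    by elim: i => [|i IHi]; apply/eqP; rewrite -leqn0 // -IHi.
  apply/nilP; rewrite /nilp /rowword size_flatten sumnE big_map big1_seq // => r /andP[_].
  by rewrite mem_rev => /mapP[i _ ->]; rewrite f0.
have e : mkseq (fun j => fcol be (count (fun i => (j < f i)%N) (iota 0 m))) N.+1 =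
   fcol be (count (fun i => (0 < f i)%N) (iota 0 m)) ::
   mkseq (fun j => fcol be (count (fun i => (j < (f i).-1)%N) (iota 0 m))) N.
  rewrite /mkseq /=; congr (_ :: _); rewrite (iotaDl 1 0) -map_comp; apply: eq_map => j /=.
  by congr fcol; apply: eq_count => i; case: (f i).
rewrite e rev_cons flatten_rcons; apply: EQ_trans (EQ_flat be m fd) _; apply: EQ_right.
apply: IH => [i|]; last by case: (f 0%N) fN.
by have := fd i; case: (f i) => [|a]; case: (f i.+1).
Qed.

Variables (R : archiRealFieldType) (re : {additive K -> R}).
Hypothesis re1 : re 1 = 1.

(** The pairs consist of an entry of a tableau and the entry of a flat tableau at the same place.
Pairs in the same row satisfy the first alternative, pairs in different rows the second one; this is
the hypothesis under which a weight may be flattened. *)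
Definition flatrel (p q : K * K) := ((p.2 == q.2) && natle p.1 q.1) || (re q.2 < re p.2).

Lemma re_natr (k : nat) : re k%:R = k%:R.
Proof. by rewrite raddfMn re1. Qed.

Lemma pairwise_frel be T : all (sorted natle) T ->
  let T' := flattab be (fun i => size (nth [::] T i)) (size T) in
  [/\ size (rowword T) = size (rowword T'), pairwise flatrel (zip (rowword T) (rowword T'))
    & all (fun a => re be <= re a < re be + (size T)%:R) (rowword T')].
Proof.
elim/last_ind: T => [|T r IH] //=; rewrite all_rcons => /andP[sr /IH{IH}[h1 h2 h3]].
rewrite /flattab size_rcons mkseqS nth_rcons ltnn eqxx.
have -> : mkseq (fun i => nseq (size (nth [::] (rcons T r) i)) (be + i%:R)) (size T) =
    flattab be (fun i => size (nth [::] T i)) (size T).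
  by apply/eq_in_map => i; rewrite mem_iota nth_rcons => /andP[_ ->].
rewrite !rowword_rcons !size_cat size_nseq h1; split=> //.
  rewrite zip_cat ?size_nseq // pairwise_cat h2 andbT; apply/andP; split.
    apply/allrelP => -[a a'] [b b'] /= ha hb.
    have /= := map_f snd ha; rewrite -/(unzip2 _) unzip2_zip ?size_nseq // => /nseqP[-> _].
    have /= := map_f snd hb; rewrite -/(unzip2 _) unzip2_zip ?h1 // => /(allP h3) /andP[_ hb'].
    by rewrite /flatrel /= raddfD re_natr hb' orbT.
  have : pairwise natle r by rewrite -sorted_pairwise //; exact: natle_trans.
  elim: (r) => //= a s IHs /andP[/allP as_ /IHs ->]; rewrite andbT.
  apply/allP => -[b b'] hb; have /= := map_f snd hb; rewrite -/(unzip2 _) unzip2_zip ?size_nseq //.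
  move=> /nseqP[-> _]; rewrite /flatrel /= eqxx as_ //.
  by have /= := map_f fst hb; rewrite -/(unzip1 _) unzip1_zip ?size_nseq.
rewrite all_cat; apply/andP; split.
  by apply/allP => a /nseqP[-> _]; rewrite raddfD re_natr lerDl ler0n ltrD2l ltr_nat ltnSn.
apply: sub_all h3 => a /andP[-> h] /=; apply: lt_le_trans h _; rewrite lerD2l ler_nat; exact: leqnSn.
Qed.

(** The mean real part of the entries of a column of length [z.2] whose lowest entry is [z.1]. *)
Definition avg (z : K * nat) : R := re z.1 + (z.2%:R - 1) / 2.

Definition fcols (zs : seq (K * nat)) := flatten [seq fcol z.1 z.2 | z <- zs].

Lemma all_flat P (ss : seq (seq K)) : all P (flatten ss) = all (all P) ss.
Proof. by elim: ss => //= s ss <-; rewrite all_cat. Qed.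

Lemma RS_flat c be w : all (intdiff c) w -> intdiff c be -> exists y y' zs,
  [/\ EQ w y, EQ y' (fcols zs), size y = size y' & pairwise flatrel (zip y y')] /\
  [/\ all (intdiff c) y, all (intdiff c) y', all (fun a => re be <= re a) y',
      all (fun z => re be - 1 <= avg z) zs
    & pairwise (fun z z' => avg z <= avg z') zs /\ (\sum_(z <- zs) 'C(z.2, 2))%N = Atab (RStab w)].
Proof.
move=> hw cb; have /and3P[iT sT dT] := tableau_RS hw; have := EQ_RS hw.
set T := RStab w in iT sT dT * => hE.
pose N := (\max_(r <- T) size r)%N.
have hN : {in T, forall r, (size r <= N)%N} by move=> r rT; exact: leq_bigmax_seq.
pose f i := size (nth [::] T i).
have fd i : (f i.+1 <= f i)%N.
  have [iT1|iT1] := ltnP i.+1 (size T); last by rewrite {1}/f nth_default.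
  by have /(sortedP [::]) /(_ i iT1) /domP[] := dT.
have cE j : count (fun i => (j < f i)%N) (iota 0 (size T)) = col_length T j.
  by rewrite /col_length -[in RHS](mkseq_nth [::] T) count_map.
have [h1 h2 h3] := pairwise_frel be sT.
pose zs := rev (mkseq (fun j => (be, count (fun i => (j < f i)%N) (iota 0 (size T)))) N).
exists (rowword T), (rowword (flattab be f (size T))), zs; split; split=> //.
- rewrite /fcols /zs map_rev /mkseq -map_comp; apply: EQ_flats => //.
  by rewrite /f nth0; case: (T) hN => //= r t h; apply: h; exact: mem_head.
- by rewrite /rowword all_flat all_rev.
- rewrite /rowword all_flat all_rev; apply/allP => r /mapP[i _ ->]; apply/allP => a /nseqP[-> _].
  by apply: intdiff_trans cb _; apply/intdiffP; exists (Posz i).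
- by apply: sub_all h3 => a /andP[].
- rewrite all_rev; apply/allP => z /mapP[j _ ->]; rewrite /avg /=.
  have := ler0n R (count (fun i => (j < f i)%N) (iota 0 (size T))).
  by move: (_%:R) => q; lra.
split.
  rewrite -sorted_pairwise; last by move=> ? ? ?; exact: le_trans.
  rewrite /zs rev_sorted /mkseq sorted_map; have := iota_sorted 0 N; apply: sub_sorted => i j ij /=.
  rewrite /avg /= lerD2l ler_pM2r // lerD2r ler_nat; apply: sub_count => l /=; exact: leq_ltn_trans.
rewrite (Atab_bin hN) (perm_big (rev zs)); last by rewrite perm_sym perm_rev.
rewrite /zs revK /mkseq big_map.
by rewrite -{1}(subn0 N) -/(index_iota 0 N) big_mkord; apply: eq_bigr => j _; rewrite cE.
Qed.

(** * Several integrality classes *)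

Hypothesis EQ_comm : forall a b, ~~ intdiff a b -> EQ [:: a; b] [:: b; a].

Lemma EQ_commw u v : allrel (fun a b => ~~ intdiff a b) u v -> EQ (u ++ v) (v ++ u).
Proof.
elim: u => [|a u IH]; first by rewrite cats0 => _; exact: EQ_refl.
rewrite allrel_consl => /andP[av /IH{}IH] /=.
apply: (EQ_trans (w2 := (a :: v) ++ u)); first exact: (EQ_left [:: a]).
rewrite -[X in EQ _ (_ ++ X)]cat1s catA; apply: EQ_right.
elim: v av {IH} => [|b v IH] /=; first by move=> _; exact: EQ_refl.
case/andP=> ab av; apply: (EQ_trans (w2 := [:: b, a & v])); first exact: (EQ_right v (EQ_comm ab)).
exact: (EQ_left [:: b] (IH av)).
Qed.

Lemma EQ_concat w1 w1' w2 w2' : EQ w1 w1' -> EQ w2 w2' -> EQ (w1 ++ w2) (w1' ++ w2').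
Proof. by move=> h1 h2; apply: EQ_trans (EQ_right _ h1) _; exact: EQ_left. Qed.

Definition classes (ws : seq (K * seq K)) :=
  all (fun cw => all (intdiff cw.1) cw.2) ws &&
  pairwise (fun cw cw' => ~~ intdiff cw.1 cw'.1) ws.

Definition Aclass (ws : seq (K * seq K)) : nat := (\sum_(cw <- ws) Atab (RStab cw.2))%N.

Definition words (ws : seq (K * seq K)) := flatten [seq cw.2 | cw <- ws].

Lemma classes_columns ws : classes ws -> exists cols,
  [/\ EQ (words ws) (flatten cols), all (sorted (fun a b => zlt b a)) cols
    & (\sum_(col <- cols) 'C(size col, 2))%N = Aclass ws].
Proof.
rewrite /classes /Aclass /words.
elim: ws => [_|[c w] ws IH] /=; first by exists [::]; rewrite !big_nil; split=> //; exact: EQ_refl.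
case/andP=> /andP[hw hws] /andP[_ hp].
have [|cols [h1 h2 h3]] := IH; first by rewrite hws.
have [cols' [h1' h2' h3']] := RS_columns hw.
exists (cols' ++ cols); rewrite flatten_cat all_cat h2' h2 big_cat big_cons /= h3 h3'; split=> //.
exact: EQ_concat.
Qed.

(** The base of each class is chosen so large that its flat tableau lies above those of the classes
behind it. The columns of the new class then come last, which is possible because words of
different classes commute. *)
Lemma classes_flat ws : classes ws -> exists y y' zs,
  [/\ EQ (words ws) y, EQ y' (fcols zs), size y = size y' & pairwise flatrel (zip y y')] /\
  [/\ all (fun a => has (fun cw => intdiff cw.1 a) ws) y',
      all (fun p => intdiff p.1 p.2) (zip y y')
    & pairwise (fun z z' => avg z <= avg z') zs /\ (\sum_(z <- zs) 'C(z.2, 2))%N = Aclass ws].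
Proof.
rewrite /classes /Aclass /words.
elim: ws => [_|[c w] ws IH] /=.
  by exists [::], [::], [::]; rewrite !big_nil; split; split=> //; exact: EQ_refl.
case/andP=> /andP[hw hws] /andP[hc hp].
have [|y [y' [zs [[h1 h2 h3 h4] [h5 h6 [h7 h8]]]]]] := IH; first by rewrite hws.
have [B [B1 B2]] : exists B : R, all (fun a => re a <= B) y' /\ all (fun z => avg z <= B) zs.
  pose l := [seq re a | a <- y'] ++ [seq avg z | z <- zs].
  have hl : all (fun x => x <= \sum_(x <- l) `|x|) l.
    elim: l => //= x l IHl; rewrite big_cons (le_trans (ler_norm x)) ?lerDl ?sumr_ge0 //=.
    by apply: sub_all IHl => z hz; apply: le_trans hz _; rewrite lerDr.
  by exists (\sum_(x <- l) `|x|); move: hl; rewrite all_cat !all_map => /andP[].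
pose k := Num.bound `|B + 1 - re c|; pose be := c + k%:R.
have hbe : B + 1 < re be.
  rewrite /be raddfD re_natr -ltrBlDl; apply: le_lt_trans (ler_norm _) _; exact: archi_boundP (normr_ge0 _).
have cbe : intdiff c be by apply/intdiffP; exists (Posz k).
have [x [x' [us [[g1 g2 g3 g4] [g5 g6 g7 g8 [g9 g10]]]]]] := RS_flat hw cbe.
exists (x ++ y), (x' ++ y'), (zs ++ us).
rewrite zip_cat // !all_cat !pairwise_cat h7 g9 big_cat big_cons /= h8 g10 addnC.
split; split=> //.
- exact: EQ_concat.
- rewrite /fcols map_cat flatten_cat; apply: EQ_trans (EQ_concat h2 g2); apply: EQ_commw.
  apply/allrelP => a b /(allP g6) ca /(allP h5) /hasP[[d v] dws /= db].
  apply: contraNN (allP hc _ dws) => ab /=.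
  exact: intdiff_trans ca (intdiff_trans ab (intdiff_sym db)).
- by rewrite !size_cat g3 h3.
- rewrite g4 h4 !andbT; apply/allrelP => -[a a'] [b b'] /= ha hb.
  have /= := map_f snd ha; rewrite -/(unzip2 _) unzip2_zip ?g3 // => /(allP g7) ha'.
  have /= := map_f snd hb; rewrite -/(unzip2 _) unzip2_zip ?h3 // => /(allP B1) hb'.
  by rewrite /flatrel /= (lt_le_trans _ ha') ?orbT //; lra.
- rewrite (sub_all _ h5) ?(sub_all _ g6) => [//|a ->|a /= ->]; rewrite ?orbT //.
- rewrite h6 andbT; apply/allP => -[a a'] ha /=.
  have /= := map_f snd ha; rewrite -/(unzip2 _) unzip2_zip ?g3 // => /(allP g6) ha'.
  have /= := map_f fst ha; rewrite -/(unzip1 _) unzip1_zip ?g3 // => /(allP g5) ha2.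
  exact: intdiff_trans (intdiff_sym ha2) ha'.
split=> //; rewrite !andbT; apply/allrelP => z u /(allP B2) hz /(allP g8) hu; lra.
Qed.

Section Split.
Variables (I : finType) (x : I -> K).

Lemma EQ_sep (p : pred I) l : (forall i j, p i -> ~~ p j -> ~~ intdiff (x i) (x j)) ->
  EQ (map x l) (map x [seq i <- l | p i] ++ map x [seq i <- l | ~~ p i]).
Proof.
move=> hp; elim: l => [|i l IH] /=; first exact: EQ_refl.
case: ifP => pi /=; first exact: (EQ_left [:: x i] IH).
apply: EQ_trans (EQ_left [:: x i] IH) _; rewrite /= -[x i :: map x _]cat1s -cat1s !catA.
apply: EQ_right; apply: EQ_commw; apply/allrelP => a b; rewrite inE => /eqP-> /mapP[j].
rewrite mem_filter => /andP[pj _] ->; apply/negP => /intdiff_sym; apply/negP.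
by apply: hp; rewrite ?pi.
Qed.

Lemma EQ_classes (Js : seq {set I}) l :
  (forall (J : {set I}) i j, J \in Js -> i \in J -> j \notin J -> ~~ intdiff (x i) (x j)) ->
  uniq Js -> (forall J J' : {set I}, J \in Js -> J' \in Js -> J != J' -> [disjoint J & J']) ->
  all (fun i => has (fun J : {set I} => i \in J) Js) l ->
  EQ (map x l) (flatten [seq map x [seq i <- l | i \in J] | J : {set I} <- Js]).
Proof.
elim: Js l => [|J Js IH] l hJ; first by case: l => //= _ _ _; exact: EQ_refl.
move=> /= /andP[JJs uJs] dJ hl.
apply: EQ_trans (EQ_sep l (p := mem J) _) _.
  by move=> i j iJ jJ; apply: (hJ J) => //; exact: mem_head.
apply: EQ_left.
have -> : [seq map x [seq i <- l | i \in J'] | J' : {set I} <- Js] =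
   [seq map x [seq i <- [seq i <- l | i \notin J] | i \in J'] | J' : {set I} <- Js].
  apply/eq_in_map => J' J'Js; congr map; rewrite -filter_predI; apply: eq_filter => i /=.
  have d : [disjoint J & J'].
    by apply: dJ; rewrite ?mem_head ?inE ?J'Js ?orbT //; apply: contraNneq JJs => ->.
  by case iJ : (i \in J'); rewrite //= (disjointFl d iJ).
apply: IH => //.
- by move=> J' i j J'Js; apply: hJ; rewrite inE J'Js orbT.
- by move=> J1 J2 h1 h2; apply: dJ; rewrite inE ?h1 ?h2 orbT.
apply/allP => i; rewrite mem_filter => /andP[/negbTE iJ il].
have {}iJ : (i \in J) = false := iJ.
by have := allP hl i il; rewrite /= iJ.
Qed.

End Split.

Section Collections.
Variables (d : nat) (x : 'rV[K]_d).

Lemma int_relatedP (J : {set 'I_d}) : reflect {in J &, forall i j, intdiff (x 0 i) (x 0 j)} (int_related x J).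
Proof.
apply: (iffP idP) => [/'forall_in_'forall_in_idP h i j iJ jJ|h]; first exact: h.
by apply/'forall_in_'forall_in_idP => i iJ j jJ; exact: h.
Qed.

Definition intclass (i : 'I_d) : {set 'I_d} := [set j | intdiff (x 0 i) (x 0 j)]%SET.

Lemma intclassE i j : (j \in intclass i) = intdiff (x 0 i) (x 0 j).
Proof. by rewrite finset.in_set. Qed.

Lemma maxset_class J i : maxset (int_related x) J -> i \in J -> J = intclass i.
Proof.
case/maxsetP => /int_relatedP hJ mJ iJ; apply/esym/mJ; last first.
  by apply/fintype.subsetP => j jJ; rewrite intclassE; exact: hJ.
apply/int_relatedP => j k; rewrite !intclassE => ij ik.
exact: intdiff_trans (intdiff_sym ij) ik.
Qed.

Lemma class_maxset i : maxset (int_related x) (intclass i).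
Proof.
apply/maxsetP; split=> [|J /int_relatedP hJ sJ].
  apply/int_relatedP => j k; rewrite !intclassE => ij ik; exact: intdiff_trans (intdiff_sym ij) ik.
apply/eqP; rewrite finset.eqEsubset sJ andbT; apply/fintype.subsetP => j jJ; rewrite intclassE.
by apply: hJ => //; apply: (fintype.subsetP sJ); rewrite intclassE; exact: intdiff_refl.
Qed.

(** A maximal set of positions with pairwise integral differences is a full integrality class. *)
Lemma RScoll_classes : exists ws,
  [/\ classes ws, Aclass ws = Acoll (RScoll x) & EQ [seq x 0 i | i <- enum 'I_d] (words ws)].
Proof.
pose Js := [seq J : {set 'I_d} <- enum {set 'I_d} | maxset (int_related x) J].
pose wd (J : {set 'I_d}) := [seq x 0 i | i <- enum J].
have JsP J : J \in Js -> maxset (int_related x) J by rewrite mem_filter => /andP[].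
have hd J : maxset (int_related x) J -> J != finset.set0 -> exists2 i, i \in J & head 0 (wd J) = x 0 i.
  move=> mJ /finset.set0Pn[i]; rewrite /wd -mem_enum; case e : (enum J) => [|j s] // _.
  by exists j; rewrite // -mem_enum e mem_head.
have dJ (J J' : {set 'I_d}) : J \in Js -> J' \in Js -> J != J' -> [disjoint J & J'].
  move=> /JsP mJ /JsP mJ'; apply: contraR => /pred0Pn[i /andP[/= iJ iJ']].
  by rewrite (maxset_class mJ iJ) (maxset_class mJ' iJ').
have uJ : uniq Js by rewrite filter_uniq // enum_uniq.
exists [seq (head 0 (wd J), wd J) | J <- Js]; split.
- apply/andP; split.
    rewrite all_map; apply/allP => J /JsP mJ /=; have [->|/hd[//|i iJ ->]] := eqVneq J finset.set0.
      by rewrite /wd enum_set0.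
    apply/allP => a /mapP[j]; rewrite mem_enum => jJ ->.
    by have /maxsetP[/int_relatedP h _] := mJ; exact: h.
  rewrite pairwise_map; move: uJ; rewrite uniq_pairwise; apply: sub_in_pairwise (allss Js).
  move=> J J' JJs J'Js /= JJ'; have mJ := JsP _ JJs; have mJ' := JsP _ J'Js.
  have ne J1 J2 : maxset (int_related x) J1 -> maxset (int_related x) J2 -> J1 != J2 -> J1 != finset.set0.
    move=> m1 m2; apply: contraNneq => e; have /maxsetP[h _] := m2; have /maxsetP[_ m] := m1.
    by rewrite e; apply/eqP/esym; rewrite -e; apply: m; rewrite ?e ?finset.sub0set.
  have [i iJ ->] := hd J mJ (ne _ _ mJ mJ' JJ').
  have [j jJ' ->] := hd J' mJ' (ne _ _ mJ' mJ (introN eqP (fun e => elimN eqP JJ' (esym e)))).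
  apply: contraNN JJ' => ij; rewrite (maxset_class mJ iJ) (maxset_class mJ' jJ'); apply/eqP/finset.setP => k.
  rewrite !intclassE; apply/idP/idP; last exact: intdiff_trans.
  exact: intdiff_trans (intdiff_sym ij).
- by rewrite /Aclass /Acoll /RScoll !big_map.
have -> : words [seq (head 0 (wd J), wd J) | J <- Js] =
   flatten [seq map (x 0) [seq i <- enum 'I_d | i \in J] | J : {set 'I_d} <- Js].
  rewrite /words -map_comp; congr flatten; apply: eq_map => J /=; congr map.
  by rewrite enumT.
apply: EQ_classes => //.
  move=> J i j /JsP mJ iJ; by rewrite (maxset_class mJ iJ) intclassE.
apply/allP => i _; apply/hasP; exists (intclass i); last by rewrite intclassE intdiff_refl.
by rewrite mem_filter class_maxset mem_enum.
Qed.

Lemma RScoll_columns : exists cols,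
  [/\ EQ [seq x 0 i | i <- enum 'I_d] (flatten cols), all (sorted (fun a b => zlt b a)) cols
    & (\sum_(col <- cols) 'C(size col, 2))%N = Acoll (RScoll x)].
Proof.
have [ws [hw <- h1]] := RScoll_classes; have [cols [h2 h3 h4]] := classes_columns hw.
by exists cols; split=> //; exact: EQ_trans h2.
Qed.

Lemma RScoll_flat : exists y y' zs,
  [/\ EQ [seq x 0 i | i <- enum 'I_d] y, EQ y' (fcols zs), size y = size y' & pairwise flatrel (zip y y')] /\
  [/\ all (fun p => intdiff p.1 p.2) (zip y y'), pairwise (fun z z' => avg z <= avg z') zs
    & (\sum_(z <- zs) 'C(z.2, 2))%N = Acoll (RScoll x)].
Proof.
have [ws [hw <- h1]] := RScoll_classes.
have [y [y' [zs [[h2 h3 h4 h5] [_ h6 [h7 h8]]]]]] := classes_flat hw.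
by exists y, y', zs; split; split=> //; exact: EQ_trans h2.
Qed.

End Collections.

End RobinsonSchensted.

(** * From the even part to the superalgebra *)

Section Blocks.
Variables (m n : nat).
Local Notation N := (m + n)%N.

Definition blk (i : nat) : nat := (m <= i)%N.

Definition par (p q : nat) : bool := (m <= p)%N != (m <= q)%N.

Lemma okp_blk p q : okp N blk p q = [&& (p < N)%N, (q < N)%N & (m <= p)%N == (m <= q)%N].
Proof. by rewrite /okp /blk; do 2 congr andb; case: (m <= p)%N; case: (m <= q)%N. Qed.

Lemma okp_par p q : okp N blk p q -> par p q = false.
Proof. by rewrite okp_blk /par => /and3P[_ _ ->]. Qed.

End Blocks.

Section Super.
Variables (K : numFieldType) (m n : nat) (V : lmodType K) (X : nat -> nat -> V -> V).
Local Notation N := (m + n)%N.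
Local Notation blk := (blk m).
Local Notation okb := (okp N blk).
Local Notation par := (par m).
Local Ltac lmod := lmod_with K V.
Hypothesis X_lin : forall p q, linear (X p q).
Hypothesis X_rel : forall p q r s v, (p < N)%N -> (q < N)%N -> (r < N)%N -> (s < N)%N ->
  X p q (X r s v) = (-1) ^+ (par p q && par r s) *: X r s (X p q v)
    + ((q == r)%:R *: X p s v - ((-1) ^+ (par p q && par r s) * (s == p)%:R) *: X r q v).

Lemma X_okrel p q r s : okb p q -> okb r s -> forall v,
    X p q (X r s v) = X r s (X p q v) + ((q == r)%:R *: X p s v - (s == p)%:R *: X r q v).
Proof.
move=> h1 h2 v; rewrite X_rel ?(okp_l h1) ?(okp_r h1) ?(okp_l h2) ?(okp_r h2) //.
by rewrite (okp_par h1) /= expr0 scale1r mul1r.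
Qed.

Definition evenrep : rep N blk V := Rep X_lin X_okrel.
Local Notation E := evenrep.

Let X0 p q : X p q 0 = 0 := op0 E p q.
Let XZ p q k u : X p q (k *: u) = k *: X p q u := opZ E p q k u.
Let X_sum p q (r : seq 'I_m) F : X p q (\sum_(i <- r) F i) = \sum_(i <- r) X p q (F i) :=
  op_sum E p q r xpredT F.

Definition odn (a : nat * nat) := [&& (a.1 < N)%N, (m <= a.1)%N & (a.2 < m)%N].
Definition oup p q := [&& (q < N)%N, (m <= q)%N & (p < m)%N].

Lemma odn_r a : odn a -> (a.2 < N)%N.
Proof. by case/and3P=> _ _ h; exact: leq_trans h (leq_addr _ _). Qed.

Lemma odn_par a : odn a -> par a.1 a.2.
Proof. by case/and3P=> _ h1 h2; rewrite /par h1 leqNgt h2. Qed.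

Lemma odn_anti a b v : odn a -> odn b -> X a.1 a.2 (X b.1 b.2 v) = - X b.1 b.2 (X a.1 a.2 v).
Proof.
move=> ha hb; have /and3P[a1 ma a2] := ha; have /and3P[b1 mb b2] := hb.
rewrite X_rel ?odn_par ?odn_r //= expr1.
rewrite (_ : (a.2 == b.1) = false) 1?(_ : (b.2 == a.1) = false); try lia.
by rewrite mulr0 !scale0r subr0 addr0 scaleN1r.
Qed.

Lemma odn_sq a v : odn a -> X a.1 a.2 (X a.1 a.2 v) = 0.
Proof.
move=> ha; have e := odn_anti v ha ha.
have : (2%:R : K) *: X a.1 a.2 (X a.1 a.2 v) = 0.
  by rewrite scaler_nat mulr2n -{2}[X _ _ _]opprK -e subrr.
by move/eqP; rewrite scaler_eq0 pnatr_eq0 /= => /eqP.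
Qed.

Lemma odn_rep a w v : odn a -> all odn w -> a \in w -> X a.1 a.2 (act E w v) = 0.
Proof.
move=> ha; elim: w => //= b w IH /andP[hb hw]; rewrite inE => /predU1P[<-|aw]; first exact: odn_sq.
by rewrite odn_anti // IH // X0 oppr0.
Qed.

Lemma act_nuniq w v : all odn w -> ~~ uniq w -> act E w v = 0.
Proof.
elim: w => //= a w IH /andP[ha hw]; rewrite negb_and negbK => /orP[aw|nu].
  exact: odn_rep.
by rewrite IH // X0.
Qed.

(** The words of bounded length; those without repetition occur among them, and the others act by
zero. *)
Definition owords := {bseq (N * N)%N of 'I_N * 'I_N}.
Definition oword (t : owords) : seq (nat * nat) := [seq (val a.1, val a.2) | a <- val t].

Lemma owordP w : all odn w -> uniq w -> exists t, oword t = w.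
Proof.
move=> hw uw.
have hN a : a \in w -> (a.1 < N)%N /\ (a.2 < N)%N.
  by move=> /(allP hw) ha; split; [case/and3P: ha|exact: odn_r].
have [s es] : exists s : seq ('I_N * 'I_N), [seq (val a.1, val a.2) | a <- s] = w.
  elim: (w) hN => [|a w' IH] h; first by exists [::].
  have [|s es] := IH; first by move=> b bw; apply: h; rewrite inE bw orbT.
  have [h1 h2] := h a (mem_head _ _).
  by exists ((Ordinal h1, Ordinal h2) :: s); rewrite /= es -surjective_pairing.
have us : uniq s by move: uw; rewrite -es => /map_uniq.
have ss : (size s <= N * N)%N.
  by have := max_card (mem s); rewrite card_prod card_ord (card_uniqP us).
by exists (Bseq ss).
Qed.

Lemma size_oword w : all odn w -> uniq w -> (size w <= N * N)%N.
Proof. by move=> h u; have [t <-] := owordP h u; rewrite size_map size_bseq. Qed.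

Section Family.
(** A filtration [Q] of a module over the even part, annihilated by the odd raising operators,
induces the filtration [W] of the submodule that it generates. *)
Variable Q : nat -> V -> Prop.
Hypothesis Q_sub : forall k, is_subspace (Q k).
Hypothesis Q_mono : forall k v, Q k v -> Q k.+1 v.
Hypothesis Q_even : forall k p q v, okb p q -> Q k v -> Q k.+1 (X p q v).
Hypothesis Q_up : forall k p q v, oup p q -> Q k v -> X p q v = 0.

Definition Wgen k (y : V) := exists w u, [/\ all odn w, Q k u & y = act E w u].
Definition W k := span (Wgen k).

Lemma W_sub k : is_subspace (W k). Proof. exact: spanP. Qed.

Lemma W_ind k (P : V -> Prop) : is_subspace P ->
  (forall w u, all odn w -> Q k u -> P (act E w u)) -> forall v, W k v -> P v.
Proof. by move=> sP h; apply: span_min => // _ [w [u [hw hu ->]]]; exact: h. Qed.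

Lemma W_act k w u : all odn w -> Q k u -> W k (act E w u).
Proof. by move=> hw hu; apply: span_gen; exists w, u. Qed.

Lemma W_mono k v : W k v -> W k.+1 v.
Proof.
by move: v; apply: W_ind => [|w u hw hu]; [exact: W_sub|apply: W_act => //; exact: Q_mono].
Qed.

Lemma sub_X k p q : is_subspace (fun v => W k (X p q v)).
Proof.
split; first by rewrite X0; exact: sub0 (W_sub k).
by move=> a u v hu hv; rewrite X_lin; exact: (W_sub k).2.
Qed.

Lemma W_odn k a v : odn a -> W k v -> W k (X a.1 a.2 v).
Proof.
move=> ha; move: v; apply: W_ind => [|w u hw hu]; first exact: sub_X.
by apply: (W_act (w := a :: w)) => //=; rewrite ha.
Qed.

(** Commuting an operator past a word of odd lowering operators costs at most one step. *)
Lemma W_X k p q v : (p < N)%N -> (q < N)%N -> W k v -> W k.+1 (X p q v).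
Proof.
move=> pN qN hv; move: v hv p q pN qN.
suff h w u p q : all odn w -> Q k u -> (p < N)%N -> (q < N)%N -> W k.+1 (X p q (act E w u)).
  move=> v hv p q pN qN; move: v hv; apply: W_ind => [|w u hw hu]; first exact: sub_X.
  exact: h.
move=> + hu; elim: w p q => [|a w IH] p q /=.
  move=> _ pN qN; have [ok|nok] := boolP (okb p q).
    by apply: (W_act (w := [::])) => //; exact: Q_even.
  have [hp|hp] := leqP m p.
    have hq : (q < m)%N by move: nok; rewrite okp_blk; lia.
    apply: (W_act (w := [:: (p, q)])); last exact: Q_mono.
    by rewrite /= /odn /= pN hp hq.
  have hq : (m <= q)%N by move: nok; rewrite okp_blk; lia.
  by rewrite (Q_up _ hu) ?/oup ?qN ?hq //; exact: sub0 (W_sub _).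
move=> /andP[ha hw] pN qN; have /and3P[a1 _ _] := ha; have a2 := odn_r ha.
have sW := W_sub k.+1.
rewrite X_rel //; apply: subD => //; first by apply: subZ => //; apply: W_odn => //; exact: IH.
by apply: subB => //; apply: subZ => //; exact: IH.
Qed.

Lemma W_dle k d : dle (fun v => v = 0) (Q k) d -> dle (fun v => v = 0) (W k) (#|{: owords}| * d).
Proof.
have s0 : is_subspace (fun v : V => v = 0) by split=> // a u v -> ->; rewrite scaler0 addr0.
move=> /(dle_basis s0 (Q_sub k))[b Qb hb].
apply: (span_dle (T := (owords * 'I_d)%type) (b := fun t => act E (oword t.1) (b t.2))) => //.
  by rewrite card_prod card_ord.
apply: W_ind.
  split; first by exists (fun _ => 0); rewrite big1 ?subr0 // => i _; rewrite scale0r.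
  move=> a u v [c /subr0_eq ->] [c' /subr0_eq ->]; exists (fun t => a * c t + c' t).
  rewrite scaler_sumr -big_split /= -sumrB big1 // => i _; lmod; ring.
move=> w u hw /hb[c /subr0_eq ->]; have [uw|nu] := boolP (uniq w); last first.
  by exists (fun _ => 0); rewrite act_nuniq // big1 ?subr0 // => i _; rewrite scale0r.
have [t <-] := owordP hw uw.
exists (fun t' => if t'.1 == t then c t'.2 else 0).
rewrite -(pair_bigA _ (fun t' i => (if t' == t then c i else 0) *: act E (oword t') (b i))) /=.
rewrite (bigD1 t) //= [X in _ - (_ + X)]big1 ?addr0; last first.
  by move=> t' /negbTE ->; rewrite big1 // => i _; rewrite scale0r.
apply/eqP; rewrite subr_eq0; apply/eqP; elim/big_rec2: _ => [|i x y _ IH]; first exact: act0.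
by rewrite actD actZ IH eqxx.
Qed.

End Family.

(** ** Highest weight vectors *)

Variable part : bool -> V -> Prop.
Hypothesis part_sub : forall b, is_subspace (part b).
Hypothesis X_part : forall p q b v, (p < N)%N -> (q < N)%N -> part b v -> part (par p q (+) b) (X p q v).
Hypothesis simple : forall P : V -> Prop, is_subspace P ->
  (forall p q v, (p < N)%N -> (q < N)%N -> P v -> P (X p q v)) ->
  (forall v, P v -> exists v0 v1, [/\ P v0 /\ part false v0, P v1 /\ part true v1 & v = v0 + v1]) ->
  (exists2 v, P v & v != 0) -> forall v, P v.
Variables (v0 : V) (b0 : bool) (lam : nat -> K).
Hypothesis v0N : v0 != 0.
Hypothesis v0b : part b0 v0.
Hypothesis v0up : forall p q, (q < N)%N -> (p < q)%N -> X p q v0 = 0.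
Hypothesis v0diag : forall p, (p < N)%N -> X p p v0 = lam p *: v0.

Let s0 : is_subspace (fun v : V => v = 0).
Proof. by split=> // a u v -> ->; rewrite scaler0 addr0. Qed.

Lemma even_hw : ishw E (fun v => v = 0) v0 lam.
Proof.
split; first by split=> // p q _ v ->; exact: X0.
- by apply/eqP.
- by move=> p q ok pq; apply: v0up => //; exact: okp_r ok.
by move=> p pN; rewrite /= v0diag // subrr.
Qed.

Definition even_hwm : @hwm K N blk lam := Hwm even_hw.
Local Notation A := even_hwm.

Definition topv v := part b0 v /\ forall p q, oup p q -> X p q v = 0.

Lemma topv_submod : submod E topv.
Proof.
split.
  split; first by split; [exact: sub0|move=> p q _; exact: X0].
  move=> a u v [u1 u2] [v1 v2]; split; first exact: (part_sub b0).2.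
  by move=> p q h; rewrite X_lin u2 // v2 // scaler0 addr0.
move=> r s ok v [v1 v2]; split.
  by have := X_part (okp_l ok) (okp_r ok) v1; rewrite (okp_par ok).
move=> p q h; have /and3P[qN mq pm] := h; have pN : (p < N)%N := leq_trans pm (leq_addr _ _).
have := ok; rewrite okp_blk => /and3P[rN sN /eqP rs].
rewrite X_rel // (okp_par ok) andbF expr0 scale1r mul1r v2 // X0 add0r.
have -> : (q == r)%:R *: X p s v = 0.
  case: eqP => [e|_]; last by rewrite scale0r.
  by rewrite v2 ?scaler0 // /oup sN -rs -e mq.
have -> : (s == p)%:R *: X r q v = 0; last by rewrite subr0.
case: eqP => [e|_]; last by rewrite scale0r.
by rewrite v2 ?scaler0 // /oup qN mq ltnNge rs e -ltnNge.
Qed.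

Lemma gen_topv v : gen E v0 v -> topv v.
Proof.
apply: gen_min topv_submod _; split=> // p q /and3P[qN mq pm].
by apply: v0up => //; exact: leq_trans pm mq.
Qed.

Lemma gen_trans x u : gen E v0 x -> gen E x u -> gen E v0 u.
Proof. by move=> gx; apply: gen_min gx; exact: gen_submod. Qed.

(** The span is a submodule, and it is nonzero. *)
Lemma W_full x : gen E v0 x -> x != 0 -> forall v, W (fun _ => gen E x) 0 v.
Proof.
move=> gx x0; have sG := gen_subspace E x; apply: simple; first exact: W_sub.
- move=> p q v pN qN; apply: (W_X (Q := fun _ => gen E x)) => //.
    by move=> _ r s u ok; exact: (gen_submod E x).2.
  by move=> _ r s u h /(gen_trans gx) /gen_topv[_]; apply.
- pose Wp := W (fun _ => gen E x) 0.
  pose P v := exists u0 u1, [/\ Wp u0 /\ part false u0, Wp u1 /\ part true u1 & v = u0 + u1].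
  have sWp : is_subspace Wp by exact: W_sub.
  apply: (W_ind (P := P)).
    split; first by exists 0, 0; split; rewrite ?addr0 //; split; exact: sub0.
    move=> a _ _ [u1 [u2 [[h1 h2] [h3 h4] ->]]] [u1' [u2' [[h1' h2'] [h3' h4'] ->]]].
    exists (a *: u1 + u1'), (a *: u2 + u2'); split.
    - by split; [exact: sWp.2|exact: (part_sub false).2].
    - by split; [exact: sWp.2|exact: (part_sub true).2].
    by rewrite scalerDr addrACA.
  move=> w u hw gu; have Wu : Wp (act E w u) by exact: W_act.
  have [c hc] : exists c, part c (act E w u).
    elim: w hw {Wu} => [_|a w IH /= /andP[ha /IH[c hc]]].
      by exists b0; have [] := gen_topv (gen_trans gx gu).
    have /and3P[a1 _ _] := ha; exists (par a.1 a.2 (+) c); apply: X_part => //; exact: odn_r.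
  case: c hc => hc; [exists 0, (act E w u)|exists (act E w u), 0]; split; rewrite ?addr0 ?add0r //.
    by split; exact: sub0.
  by split; exact: sub0.
by exists x => //; apply: (W_act (w := [::])) => //; exact: gen_refl.
Qed.

Lemma Bk_full v : exists k, W (Bk E v0) k v.
Proof.
have mono k l u : (k <= l)%N -> W (Bk E v0) k u -> W (Bk E v0) l u.
  move=> kl; elim: l kl => [|l IH]; first by rewrite leqn0 => /eqP ->.
  rewrite leq_eqVlt => /predU1P[->//|]; rewrite ltnS => kl hu.
  by apply: W_mono (IH kl hu) => k' u'; exact: Bk_mono.
have := W_full (gen_refl E v0) v0N v; move: v; apply: W_ind.
  split; first by exists 0%N; exact: sub0 (W_sub _ _).
  move=> a u v [k hk] [l hl]; exists (k + l)%N; apply: (W_sub _ _).2.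
    exact: mono (leq_addr _ _) hk.
  exact: mono (leq_addl _ _) hl.
move=> w u hw [t /(reduce_all lam)[k [t' lt' e']] ->]; exists k; apply: W_act => //.
by exists t' => //; have := e' A => /subr0_eq.
Qed.

Lemma Bk_even k p q v : okb p q -> Bk E v0 k v -> Bk E v0 k.+1 (X p q v).
Proof.
move=> ok [t lt ->]; have [t' lt' e'] := reduce_comb lam lt ok; exists t'.
  by apply: lowc_mono lt'; case: (q < p)%N; rewrite ?addn1 ?addn0.
by have := e' A => /subr0_eq.
Qed.

Lemma Bk_up k p q v : oup p q -> Bk E v0 k v -> X p q v = 0.
Proof. by move=> h /Bk_gen /gen_topv[_]; apply. Qed.

Lemma Wk_X k p q v : (p < N)%N -> (q < N)%N -> W (Bk E v0) k v -> W (Bk E v0) k.+1 (X p q v).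
Proof.
apply: W_X => [k' u|k' r s u|k' r s u]; [exact: Bk_mono|exact: Bk_even|exact: Bk_up].
Qed.

(** ** Irreducibility of the top component *)

(** The central element of the even part that measures the length of the odd words. *)
Definition zop v := \sum_(i < m) X i i v.

Lemma zop_lin : linear zop.
Proof.
move=> a u v; rewrite /zop scaler_sumr -big_split /=; apply: eq_bigr => i _.
by rewrite X_lin.
Qed.

Definition zc := \sum_(i < m) lam i.

Lemma zop_eigen c : submod E (fun v => zop v = c *: v).
Proof.
split.
  split; first by rewrite scaler0 /zop big1 // => i _; exact: X0.
  by move=> a u v hu hv; rewrite zop_lin hu hv scalerDr !scalerA mulrC.
move=> p q ok v hv; have := ok; rewrite okp_blk => /and3P[pN qN /eqP pq].
rewrite -XZ -hv /zop X_sum /=.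
have e0 : 0 = (\sum_(i < m) ((i == p :> nat)%:R *: X p q v - (q == i)%:R *: X p q v)).
  rewrite sumrB -!scaler_suml -!natr_sum.
  case: (ltnP p m) => hp; last first.
    have hq : (m <= q)%N by rewrite -pq.
    by rewrite !big1 ?subrr // => i _; rewrite ?(gtn_eqF (leq_trans (ltn_ord i) hq)) ?(ltn_eqF (leq_trans (ltn_ord i) hp)).
  have hq : (q < m)%N by rewrite ltnNge -pq -ltnNge.
  rewrite (bigD1 (Ordinal hp)) //= eqxx big1 => [|i]; last by rewrite -val_eqE /= => /negbTE ->.
  rewrite (bigD1 (Ordinal hq)) //= eqxx big1 => [|i]; last by rewrite -val_eqE /= eq_sym => /negbTE ->.
  by rewrite subrr.
transitivity (\sum_(i < m) X p q (X i i v) + \sum_(i < m) ((i == p :> nat)%:R *: X p q v - (q == i)%:R *: X p q v)).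
  rewrite -big_split /=; apply: eq_bigr => i _.
  have ii : okb i i by rewrite okpp (leq_trans (ltn_ord i) (leq_addr _ _)).
  rewrite X_okrel //; congr (_ + (_ - _)); by case: eqP => [->|]; rewrite ?scale0r.
by rewrite -e0 addr0.
Qed.

Lemma zop_word w u : all odn w -> gen E v0 u ->
  zop (act E w u) = (zc - (size w)%:R) *: act E w u.
Proof.
move=> + gu; elim: w => [_|a w IH /= /andP[ha hw]].
  rewrite subr0 /=; apply: (gen_min (zop_eigen zc)) gu.
  rewrite /zop /zc scaler_suml; apply: eq_bigr => i _; apply: v0diag.
  exact: leq_trans (ltn_ord i) (leq_addr _ _).
have {IH}IH := IH hw; have /and3P[a1 ma a2] := ha.
have -> : zop (X a.1 a.2 (act E w u)) = X a.1 a.2 (zop (act E w u)) - X a.1 a.2 (act E w u).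
  rewrite /zop X_sum /=.
  have e : X a.1 a.2 (act E w u) = \sum_(i < m) (a.2 == i)%:R *: X a.1 a.2 (act E w u).
    rewrite -scaler_suml -natr_sum (bigD1 (Ordinal a2)) //= eqxx big1 ?addn0 ?scale1r // => i.
    by rewrite -val_eqE /= eq_sym => /negbTE ->.
  rewrite {2}e -sumrB; apply: eq_bigr => i _.
  have iN : (i < N)%N := leq_trans (ltn_ord i) (leq_addr _ _).
  rewrite X_rel ?odn_r // /par eqxx /= expr0 scale1r mul1r.
  rewrite (ltn_eqF (leq_trans (ltn_ord i) ma)) scale0r sub0r.
  by congr (_ - _); case: eqP => [->|]; rewrite ?scale0r.
rewrite IH XZ /= -natr1; lmod; ring.
Qed.

Definition zproj L v := foldr (fun d x => zop x - (zc - d%:R) *: x) v (iota 1 L).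

Lemma zproj_eigen L v c : zop v = (zc - c) *: v -> zproj L v = (\prod_(d <- iota 1 L) (d%:R - c)) *: v.
Proof.
move=> hv; rewrite /zproj; elim: (iota 1 L) => [|d s IH] /=; first by rewrite big_nil scale1r.
have hz a : zop (a *: v) = a *: zop v.
  by have := zop_lin a v 0; rewrite addr0 => ->; rewrite (_ : zop 0 = 0) ?addr0 // /zop big1 // => i _; exact: X0.
rewrite IH big_cons hz hv; lmod; ring.
Qed.

Lemma zproj_lin L : linear (zproj L).
Proof.
move=> a u v; rewrite /zproj; elim: (iota 1 L) => //= d s ->.
rewrite zop_lin; set x := foldr _ u _; set y := foldr _ v _; lmod; ring.
Qed.

(** The highest weight vector is a combination of odd words applied to the even submodule generated
by [x]. Projecting on the eigenspace of [zop] that contains it removes the nonempty words. *)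
Lemma even_irr_gen x : gen E v0 x -> x != 0 -> gen E x v0.
Proof.
move=> gx x0; pose L := (N * N)%N.
have sG := gen_subspace E x.
have hW v : W (fun _ => gen E x) 0 v -> gen E x (zproj L v).
  move: v; apply: W_ind.
    split; first by rewrite (_ : zproj L 0 = 0); [exact: sub0|rewrite /zproj; elim: (iota 1 L) => //= d s ->;
      rewrite scaler0 subr0 /zop big1 // => i _; exact: X0].
    by move=> a u v hu hv; rewrite zproj_lin; exact: sG.2.
  move=> w u hw gu; rewrite (zproj_eigen _ (zop_word hw (gen_trans gx gu))).
  case: w hw => [|a w] hw; first by rewrite /=; apply: subZ.
  have [uw|nu] := boolP (uniq (a :: w)); last by rewrite act_nuniq // scaler0; exact: sub0.
  have sw := size_oword hw uw.
  have hin : (size w).+1 \in iota 1 L by rewrite mem_iota /= add1n ltnS.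
  suff -> : \prod_(d <- iota 1 L) (d%:R - (size (a :: w))%:R) = 0 :> K by rewrite scale0r; exact: sub0.
  by apply/eqP; rewrite prodf_seq_eq0; apply/hasP; exists (size w).+1; rewrite //= subrr.
have := hW _ (W_full gx x0 v0).
have := zproj_eigen L (v := v0) (c := 0); rewrite subr0 => ->; last first.
  by have := zop_word (w := [::]) isT (gen_refl E v0); rewrite subr0.
apply: subZ_inv => //; rewrite prodf_seq_neq0; apply/allP => d; rewrite mem_iota => /andP[d0 _].
by rewrite subr0 pnatr_eq0 -lt0n.
Qed.

Lemma even_irr : irr A.
Proof.
move=> x gx x0; exists v0; last exact: subrr.
by apply: even_irr_gen => //; apply/eqP.
Qed.

(** The filtration [F] of the supermodule consists of odd words applied to the filtration of its top
component, and [B] is the latter. Up to rescaling and shift, both lie in any filtration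
[G] that contains the highest weight vector and that the algebra raises by one step. *)
Lemma super_filtration D : Lower N blk D lam -> Upper N blk D lam ->
  exists (F B : nat -> V -> Prop) (c : nat),
  [/\ forall k, is_subspace (F k), forall k l v, (k <= l)%N -> F k v -> F l v, F 0%N v0,
      forall k p q v, (p < N)%N -> (q < N)%N -> F k v -> F k.+1 (X p q v)
    & forall v, exists k, F k v] /\
  [/\ forall k, dle (fun v => v = 0) (F k) (c * k.+1 ^ D),
      forall k d, dle (fun v => v = 0) (B k) d -> (k.+1 ^ D <= c * d)%N
    & forall G : nat -> V -> Prop, (forall k, is_subspace (G k)) ->
       (forall k l v, (k <= l)%N -> G k v -> G l v) -> G 0%N v0 ->
       (forall k p q v, (p < N)%N -> (q < N)%N -> G k v -> G k.+1 (X p q v)) ->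
       (forall k v, B k v -> G (c * k + c)%N v) /\ (forall k v, F k v -> G (k + c)%N v)].
Proof.
move=> /(_ A even_irr)[c1 lo] /(_ A even_irr)[c2 up].
have Bmono k v : Bk E v0 k v -> Bk E v0 k.+1 v by exact: Bk_mono.
have sB k : is_subspace (Bk E v0 k) by exact: Bk_subspace.
pose c := (c1 + #|{: owords}| * c2 + N * N)%N.
exists (W (Bk E v0)), (fun k => Bk E v0 (c1 * k + c1)), c; split; split.
- by move=> k; exact: W_sub.
- move=> k l v kl hv; elim: l kl => [|l IH]; first by rewrite leqn0 => /eqP <-.
  by rewrite leq_eqVlt => /predU1P[<-//|]; rewrite ltnS => kl; apply: W_mono => //; exact: IH.
- apply: (W_act (w := [::])) => //; exists [:: (1, [::])] => //.
  by rewrite comb1 scale1r.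
- by move=> k p q v pN qN; exact: Wk_X.
- exact: Bk_full.
- move=> k; have := W_dle sB (up k).
  apply: dle_mono => //; [exact: W_sub|rewrite mulnA leq_mul2r /c; apply/orP; right; lia].
- move=> k d /lo h; apply: leq_trans h _; rewrite leq_mul2r /c; apply/orP; right; lia.
move=> G sG Gm G0 GX.
have Gact w k u : all (fun a => (a.1 < N)%N && (a.2 < N)%N) w -> G k u -> G (size w + k)%N (act E w u).
  by elim: w => //= a w IH /andP[/andP[a1 a2] /IH{}IH] /IH; exact: GX.
have BG k v : Bk E v0 k v -> G k v.
  case=> t ht ->; rewrite /comb big_seq; apply: (sub_sum (sG k)) => a /(allP ht) /andP[la sa].
  apply: (subZ (sG k)); apply: (Gm (size a.2 + 0)%N); first by rewrite addn0.
  apply: Gact => //; move: la; apply: sub_all => b /andP[ok _].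
  by rewrite (okp_l ok) (okp_r ok).
split=> k v.
  move=> /BG; apply: Gm; rewrite /c; nia.
move: v; apply: W_ind => [|w u hw /BG hu]; first exact: sG.
have [uw|nu] := boolP (uniq w); last by rewrite act_nuniq //; exact: (sub0 (sG _)).
apply: (Gm (size w + k)%N); last first.
  apply: Gact => //; move: hw; apply: sub_all => a ha; rewrite odn_r // andbT.
  by case/and3P: ha.
by have := size_oword hw uw; rewrite /c; lia.
Qed.

End Super.

(** * Positions and columns *)

Fixpoint cix (sh : seq nat) p : nat :=
  if sh is q :: sh' then if (p < q)%N then 0%N else (cix sh' (p - q)%N).+1 else 0%N.

Lemma cix_mono sh p q : (p <= q)%N -> (cix sh p <= cix sh q)%N.
Proof.
elim: sh p q => //= r sh IH p q pq; case: (ltnP q r) => hq; first by rewrite (leq_ltn_trans pq hq).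
by case: ltnP => // hp; rewrite ltnS; apply: IH; exact: leq_sub2r.
Qed.

Lemma cix_lt sh p : (p < sumn sh)%N -> (cix sh p < size sh)%N.
Proof.
elim: sh p => //= r sh IH p ps; case: (ltnP p r) => // hp; rewrite ltnS; apply: IH.
by rewrite ltn_subLR.
Qed.

Lemma cix_catl sh1 sh2 p : (p < sumn sh1)%N -> cix (sh1 ++ sh2) p = cix sh1 p.
Proof.
elim: sh1 p => //= r sh IH p ps; case: ltnP => // hp; rewrite IH //.
by rewrite ltn_subLR.
Qed.

Lemma cix_catr sh1 sh2 p : (sumn sh1 <= p)%N -> cix (sh1 ++ sh2) p = (size sh1 + cix sh2 (p - sumn sh1)%N)%N.
Proof.
elim: sh1 p => [|r sh IH] p /=; first by rewrite subn0.
move=> ps; rewrite ltnNge (leq_trans (leq_addr _ _) ps) /= IH ?subnDA //.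
by rewrite leq_subRL // (leq_trans (leq_addr _ _) ps).
Qed.

Lemma npairs_cix sh : (\sum_(0 <= i < sumn sh) count (fun j => cix sh j == cix sh i) (iota 0 i))%N =
  (\sum_(q <- sh) 'C(q, 2))%N.
Proof.
elim: sh => [|q sh IH] /=; first by rewrite big_nil big_geq.
rewrite big_cons (big_cat_nat (n := q)) //= ?leq_addr //; congr addn.
  rewrite -bin2_sum [LHS]big_nat [RHS]big_nat; apply: eq_bigr => i /andP[_ iq].
  rewrite iq -[RHS](size_iota 0); apply/eqP; rewrite -all_count; apply/allP => j.
  by rewrite mem_iota => /andP[_ ji]; rewrite (ltn_trans ji iq).
rewrite -IH -{1}[q]add0n big_addn addKn; apply: eq_bigr => i _.
rewrite [in LHS]ltnNge leq_addl /= addnK addnC iotaD count_cat add0n.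
rewrite (_ : count _ (iota 0 q) = 0%N) ?add0n; last first.
  apply/eqP; rewrite -leqn0 leqNgt -has_count; apply/hasPn => j.
  by rewrite mem_iota => /andP[_ ->].
have -> : iota q i = map (addn q) (iota 0 i) by rewrite -iotaDl addn0.
rewrite count_map; apply: eq_count => j /=.
by rewrite ltnNge leq_addr /= addKn.
Qed.

Lemma size_lettersf n bl P k : size [seq a <- letters n bl k | P a] =
  (\sum_(0 <= i < k) count (fun j => okp n bl i j && P (i, j)) (iota 0 i))%N.
Proof.
elim: k => [|k IH]; first by rewrite big_geq.
rewrite lettersS filter_cat size_cat IH big_nat_recr //=; congr addn.
rewrite size_filter /row_letters count_map count_filter; apply: eq_count => j /=.
by rewrite andbC.
Qed.

Lemma cix_desc (K : numFieldType) (cols : seq (seq K)) p : all (sorted (fun a b => zlt b a)) cols ->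
  (p.+1 < size (flatten cols))%N -> cix (map size cols) p = cix (map size cols) p.+1 ->
  zlt (nth 0 (flatten cols) p.+1) (nth 0 (flatten cols) p).
Proof.
elim: cols p => //= c cols IH p /andP[sc scs]; rewrite size_cat => ps.
case: (ltnP p.+1 (size c)) => h1.
  by move=> _; rewrite !nth_cat h1 (ltnW h1); apply: (sortedP 0 sc).
case: (ltnP p (size c)) => // h2 [e]; rewrite !nth_cat !ltnNge h1 h2 /=.
rewrite subSn //; apply: IH => //; last by rewrite -subSn.
by rewrite -subSn // ltn_subLR.
Qed.

Section Assembly.
Variables (K : numFieldType) (R : archiRealFieldType) (re : {additive K -> R}).
Hypothesis re1 : re 1 = 1.
Variables (m n : nat).
Local Notation N := (m + n)%N.

Local Notation blk := (blk m).

Lemma blk_mono p q : (p <= q)%N -> (q < N)%N -> (blk p <= blk q)%N.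
Proof. by rewrite /blk => pq _; case: (leqP m p) => // mp; rewrite (leq_trans mp pq). Qed.

Local Notation EQ := (@EQ K N blk).
Local Notation Gx := (@Gx K N blk).
Local Notation okb := (okp N blk).

Lemma Gx_words (w1 w1' w2 w2' : seq K) : size w1 = m -> size w2 = n -> EQ w1 w1' -> EQ w2 w2' ->
  Gx (nth 0 (w1 ++ w2)) (nth 0 (w1' ++ w2')).
Proof.
move=> s1 s2 [[s1' h1] _] [[s2' h2] _].
apply: (Gx_trans (y := nth 0 (w1' ++ w2))).
  apply: (h1 [::] w2); first by rewrite s1 s2.
  by move=> p q /=; rewrite s1 okp_blk; lia.
have := h2 w1' [::]; rewrite !cats0; apply; first by rewrite -s1' s1 s2 addn0.
by move=> p q /=; rewrite -s1' s1 s2 okp_blk; lia.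
Qed.

Lemma size_ul_cix sh1 sh2 : sumn sh1 = m -> sumn sh2 = n ->
  (size (ul N blk (cix (sh1 ++ sh2))) + \sum_(q <- sh1 ++ sh2) 'C(q, 2) = 'C(m, 2) + 'C(n, 2))%N.
Proof.
move=> s1 s2; set sh := sh1 ++ sh2; have s : sumn sh = N by rewrite sumn_cat s1 s2.
have cb_bl p q : (p < N)%N -> (q < N)%N -> cix sh p == cix sh q -> okb p q.
  move=> pN qN; rewrite okp_blk pN qN /=.
  wlog pq : p q pN qN / (p <= q)%N.
    by move=> h; case: (leqP p q) => [|/ltnW] pq; [exact: h|rewrite eq_sym => /(h _ _ qN pN pq); rewrite eq_sym].
  case: (leqP m p) => mp; first by rewrite (leq_trans mp pq).
  case: (leqP m q) => // mq; rewrite cix_catl ?s1 // cix_catr ?s1 //.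
  by rewrite ltn_eqF // (leq_trans (cix_lt _)) ?s1 // leq_addr.
have -> : (\sum_(q <- sh) 'C(q, 2))%N = size [seq a <- letters N blk N | cix sh a.1 == cix sh a.2].
  rewrite -npairs_cix s size_lettersf !big_nat; apply: eq_bigr => i /andP[_ iN].
  apply: eq_in_count => j; rewrite mem_iota => /andP[_ ji] /=; rewrite eq_sym.
  by apply/idP/andP => [h|[]//]; split=> //; apply: cb_bl => //; exact: ltn_trans ji iN.
rewrite /ul !size_filter addnC count_predC -(filter_predT (letters N blk N)) size_lettersf.
have -> : ('C(m, 2) + 'C(n, 2) = \sum_(q <- [:: m; n]) 'C(q, 2))%N.
  by rewrite !big_cons big_nil addn0.
rewrite -npairs_cix /= addn0 !big_nat; apply: eq_bigr => i /andP[_ iN].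
apply: eq_in_count => j; rewrite mem_iota => /andP[_ ji] /=; rewrite andbT okp_blk iN (ltn_trans ji iN) /=.
case: (ltnP j m) => hj; case: (ltnP i m) => hi //=.
have -> : (j - m < n)%N by lia.
by have -> : (i - m < n)%N by lia.
Qed.


Lemma cb_bl sh1 sh2 : sumn sh1 = m -> sumn sh2 = n -> forall p q,
  okp N (cix (sh1 ++ sh2)) p q -> okb p q.
Proof.
move=> s1 s2 p q; rewrite /okp; set sh := sh1 ++ sh2 => /and3P[pN qN e]; rewrite pN qN /=.
suff e1 : (m <= p)%N = (m <= q)%N by rewrite /blk e1.
have H r : (r < N)%N -> (m <= r)%N = (size sh1 <= cix sh r)%N.
  move=> rN; case: (leqP m r) => mr; first by rewrite cix_catr ?s1 // leq_addr.
  by rewrite cix_catl ?s1 // leqNgt cix_lt ?s1.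
by rewrite !H // (eqP e).
Qed.

Lemma sumn_sizes (I : eqType) (cols : seq (seq I)) : sumn (map size cols) = size (flatten cols).
Proof. by rewrite size_flatten. Qed.

Variables (y1 : 'rV[K]_m) (y2 : 'rV[K]_n).
Let w1 := [seq y1 0 i | i <- enum 'I_m].
Let w2 := [seq y2 0 i | i <- enum 'I_n].

Let s1 : size w1 = m. Proof. by rewrite size_map size_enum_ord. Qed.
Let s2 : size w2 = n. Proof. by rewrite size_map size_enum_ord. Qed.

Let ref w := @EQ_refl K N blk w.
Let sym w w' := @EQ_sym K N blk w w'.
Let trans w2 w1 w3 := @EQ_trans K N blk w2 w1 w3.
Let ctx u v w w' := @EQ_ctx K N blk u v w w'.
Let kn1 (x : K) (s k : nat) : EQ [:: x + s%:R + k.+1%:R; x; x + s%:R] [:: x; x + s%:R + k.+1%:R; x + s%:R] :=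
  EQ_kn1 blk_mono x s k.
Let kn2 (x : K) (s k : nat) : EQ [:: x + k.+1%:R; x + k.+1%:R + s%:R; x] [:: x + k.+1%:R; x; x + k.+1%:R + s%:R] :=
  EQ_kn2 blk_mono x s k.
Let comm (a b : K) : ~~ intdiff a b -> EQ [:: a; b] [:: b; a].
Proof.
move=> h; apply: EQ_comm => [|z]; first exact: blk_mono.
by apply: contraNneq h => e; apply/intdiffP; exists (- z); rewrite rmorphN /= -e; ring.
Qed.

(** The word is equivalent to its columns, whose entries decrease by positive integers. These columns
are obtained from columns with gaps one by adding a dominant integral weight. *)
Lemma Upper_weight : exists2 D, Upper N blk D (shw (nth 0 (w1 ++ w2))) &
  (D + (Acoll (RScoll y1) + Acoll (RScoll y2)) = 'C(m, 2) + 'C(n, 2))%N.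
Proof.
have [c1 [e1 d1 a1]] := RScoll_columns ref sym trans ctx kn1 kn2 comm y1.
have [c2 [e2 d2 a2]] := RScoll_columns ref sym trans ctx kn1 kn2 comm y2.
pose cols := c1 ++ c2; pose cb := cix (map size c1 ++ map size c2).
have t1 : sumn (map size c1) = m by rewrite sumn_sizes -(EQ_size e1).
have t2 : sumn (map size c2) = n by rewrite sumn_sizes -(EQ_size e2).
exists (size (ul N blk cb)); last first.
  by rewrite -(size_ul_cix t1 t2); congr addn; rewrite big_cat !big_map a1 a2.
pose y := nth 0 (flatten cols).
pose g p : K := if cb p == cb p.+1 then y p - y p.+1 - 1 else 0.
pose x0 p := y p - \sum_(p <= i < N) g i.
have gE p : (p < N)%N -> y p - x0 p - (y p.+1 - x0 p.+1) = g p.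
  by move=> pN; rewrite /x0 [X in y p - (y p - X)]big_ltn //; ring.
apply: (Upper_Gle (lam := shw x0)).
  apply: (Gx_trans (y := y)).
    apply: Gx_dom => [|p ok]; first exact: blk_mono.
    rewrite gE ?(okp_l ok) // /g; case: eqP => [e|_]; last by exists 0%N.
    have /zltP[k ek] : zlt (y p.+1) (y p).
      apply: cix_desc; rewrite ?all_cat ?d1 //; last by rewrite map_cat.
      by rewrite flatten_cat size_cat -!sumn_sizes t1 t2; exact: okp_r ok.
    by exists k; rewrite ek -natr1; ring.
  rewrite /y /cols flatten_cat; apply: Gx_words; rewrite -?sumn_sizes //; exact: sym.
apply: Upper_columns => [|p q pq _||i ok]; [exact: blk_mono|exact: cix_mono|exact: cb_bl|].
have /gE := okp_l ok; rewrite /g; have /and3P[_ _ ->] := ok => e.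
have e' : x0 i = x0 i.+1 + 1.
  move: (x0 i) (x0 i.+1) e => a b e; apply: (addrI (y i - a - (y i.+1 - b))); rewrite {2}e; ring.
by rewrite /shw e' -natr1; ring.
Qed.

Lemma sum_fcol (be : K) q : \sum_(a <- fcol be q) re a = q%:R * avg re (be, q).
Proof.
elim: q be => [|q IH] be; first by rewrite big_nil mul0r.
rewrite fcolS -cats1 big_cat big_seq1 IH /avg /= raddfD re1 -natr1; by field.
Qed.

Lemma sum_fcols (zs : seq (K * nat)) b :
  \sum_(0 <= p < size (fcols zs) | cix [seq z.2 | z <- zs] p == b)
     (re (nth 0 (fcols zs) p) - nth 0 (map (avg re) zs) (cix [seq z.2 | z <- zs] p)) = 0.
Proof.
elim: zs b => [|[be q] zs IH] b; first by rewrite big_geq.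
rewrite /fcols /= size_cat -/(fcols zs) size_rev size_mkseq (big_cat_nat (n := q)) ?leq_addr //=.
rewrite [X in _ + X](_ : _ = 0) ?addr0; last first.
  rewrite -{1}[q]add0n big_addn addKn.
  case: b => [|b].
    by rewrite big_pred0 // => i; rewrite ltnNge leq_addl.
  rewrite -[RHS](IH b); apply: eq_big => [i|i _].
    by rewrite ltnNge leq_addl /= addnK eqSS.
  by rewrite nth_cat size_rev size_mkseq ltnNge leq_addl /= addnK.
case: b => [|b]; last first.
  rewrite big_nat_cond big_pred0 // => i; by case: ltnP => //=; rewrite ?andbF.
rewrite big_nat_cond (eq_bigl (fun i => (0 <= i < q)%N)); last first.
  by move=> i; case: ltnP => //=.
rewrite -big_nat (eq_big_nat _ _ (F2 := fun p => re (nth 0 (fcol be q) p) - avg re (be, q))); last first.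
  by move=> i /andP[_ iq]; rewrite nth_cat size_rev size_mkseq iq.
have := sum_fcol be q; rewrite (big_nth 0) size_rev size_mkseq => e.
by rewrite sumrB sumr_const_nat subn0 e mulr_natl subrr.
Qed.

Lemma size_fcols (zs : seq (K * nat)) : size (fcols zs) = sumn [seq z.2 | z <- zs].
Proof.
rewrite /fcols size_flatten /shape -map_comp; congr sumn; apply: eq_map => z /=.
by rewrite size_rev size_mkseq.
Qed.

Lemma fcols_step (zs : seq (K * nat)) p : (p.+1 < size (fcols zs))%N ->
  cix [seq z.2 | z <- zs] p = cix [seq z.2 | z <- zs] p.+1 ->
  nth 0 (fcols zs) p = nth 0 (fcols zs) p.+1 + 1.
Proof.
elim: zs p => //= -[be q] zs IH p; rewrite /fcols /= size_cat -/(fcols zs) !nth_cat size_rev size_mkseq.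
case: (ltnP p.+1 q) => h1.
  move=> _ _; rewrite (ltnW h1) !nth_rev ?size_mkseq ?(ltnW h1) // !nth_mkseq; try lia.
  by rewrite -(subnSK h1) -natr1 addrA.
move=> ps; case: (ltnP p q) => // h2 [e].
rewrite subSn // in e *; apply: IH => //.
by rewrite -subSn // ltn_subLR.
Qed.

(** The rows of the tableaux are made constant, after which the columns have gaps one and can be
ordered by increasing averages. *)
Lemma Lower_weight : exists2 D, Lower N blk D (shw (nth 0 (w1 ++ w2))) &
  (D + (Acoll (RScoll y1) + Acoll (RScoll y2)) = 'C(m, 2) + 'C(n, 2))%N.
Proof.
have [u1 [u1' [z1 [[e1 f1 g1 h1] [i1 j1 a1]]]]] := RScoll_flat ref sym trans ctx kn1 kn2 re1 comm y1.
have [u2 [u2' [z2 [[e2 f2 g2 h2] [i2 j2 a2]]]]] := RScoll_flat ref sym trans ctx kn1 kn2 re1 comm y2.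
pose sh1 := [seq z.2 | z <- z1]; pose sh2 := [seq z.2 | z <- z2].
pose cb := cix (sh1 ++ sh2).
have q1 : size u1 = m by rewrite -(EQ_size e1).
have q2 : size u2 = n by rewrite -(EQ_size e2).
have t1 : sumn sh1 = m by rewrite -size_fcols -(EQ_size f1) -g1.
have t2 : sumn sh2 = n by rewrite -size_fcols -(EQ_size f2) -g2.
exists (size (ul N blk cb)); last first.
  by rewrite -(size_ul_cix t1 t2); congr addn; rewrite big_cat !big_map a1 a2.
have q : size (u1 ++ u2) = N by rewrite size_cat q1 q2.
have q' : size (u1' ++ u2') = N by rewrite size_cat -g1 -g2 q1 q2.
apply: (Lower_Gle (mu := shw (nth 0 (fcols (z1 ++ z2))))).
  apply: (Gx_trans (y := nth 0 (u1 ++ u2))); first exact: Gx_words.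
  apply: (Gx_trans (y := nth 0 (u1' ++ u2'))); last first.
    by rewrite /fcols map_cat flatten_cat; apply: Gx_words => //; rewrite -?g1 -?g2.
  apply: (Gx_flat blk_mono re1) => [p pN|p ok].
    have : all (fun p => intdiff p.1 p.2) (zip (u1 ++ u2) (u1' ++ u2')).
      by rewrite zip_cat // all_cat i1 i2.
    move/(all_nthP (0, 0)) => /(_ p); rewrite size_zip q q' minnn => /(_ pN).
    by rewrite nth_zip ?q ?q' //= => /asboolP.
  have : flatrel re (nth (0, 0) (zip (u1 ++ u2) (u1' ++ u2')) p) (nth (0, 0) (zip (u1 ++ u2) (u1' ++ u2')) p.+1).
    rewrite zip_cat // !nth_cat !size_zip -g1 q1 minnn.
    have := ok; rewrite okp_blk => /and3P[pN pN' /eqP eb].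
    case: (ltnP p.+1 m) => hp.
      by rewrite (ltnW hp); have /(pairwiseP (0, 0)) := h1; apply; rewrite ?inE ?size_zip -?g1 ?q1 ?minnn //; exact: ltnW.
    rewrite (ltnNge p) eb hp /=; rewrite hp in eb.
    by have /(pairwiseP (0, 0)) := h2; apply; rewrite ?inE ?size_zip -?g2 ?q2 ?minnn //; lia.
  rewrite !nth_zip ?q ?q' // /flatrel /= => /orP[/andP[/eqP h /asboolP k]|]; last by right.
  by left.
pose av p := nth 0 (map (avg re) (z1 ++ z2)) (cb p).
apply: (Lower_columns (av := av) blk_mono _ _ _ re1) => [p q'' pq _||i ok|p q'' ok lt|i ok|b].
- exact: cix_mono.
- exact: cb_bl.
- have /and3P[_ iN /eqP e] := ok.
  rewrite /shw fcols_step -?natr1 ?size_fcols ?map_cat ?sumn_cat -/sh1 -/sh2 ?t1 ?t2 //; ring.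
- have := ok; rewrite okp_blk => /and3P[pN qN /eqP eb]; rewrite /av /cb.
  have cm := cix_mono (sh1 ++ sh2) (ltnW lt).
  have tw : transitive (fun z z' : K * nat => avg re z <= avg re z') by move=> ? ? ?; exact: le_trans.
  have av_mono (z : seq (K * nat)) i j : pairwise (fun z z' => avg re z <= avg re z') z -> (i <= j < size z)%N ->
      nth 0 (map (avg re) z) i <= nth 0 (map (avg re) z) j.
    move=> hz /andP[]; rewrite leq_eqVlt => /predU1P[->//|ij jz].
    rewrite !(nth_map (0, 0%N)) ?(ltn_trans ij jz) //; have /(pairwiseP (0, 0%N)) := hz; apply=> //.
    by rewrite inE (ltn_trans ij jz).
  have sz1 : size sh1 = size z1 by rewrite size_map.
  have sz2 : size sh2 = size z2 by rewrite size_map.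
  case: (ltnP q'' m) => hq.
    have hp : (p < m)%N by rewrite ltnNge eb -ltnNge.
    rewrite !cix_catl ?t1 // in cm *; have cl := cix_lt (sh := sh1) (p := q''); rewrite t1 sz1 in cl.
    rewrite map_cat !nth_cat !size_map cl // (leq_ltn_trans cm (cl hq)); apply: av_mono => //.
    by rewrite cm cl.
  have hp : (m <= p)%N by rewrite eb.
  move: cm; rewrite !cix_catr ?t1 // sz1 leq_add2l => cm.
  rewrite map_cat !nth_cat !size_map !ltnNge !leq_addr /= !addKn.
  apply: av_mono => //; rewrite cm -sz2 cix_lt // t2.
  by rewrite ltn_subLR.
- by rewrite /av; have /and3P[_ _ /eqP->] := ok.
have := sum_fcols (z1 ++ z2) b; rewrite size_fcols map_cat sumn_cat t1 t2 -/cb big_mkord.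
by move=> h; rewrite -[RHS]h; apply: eq_bigr => p _; rewrite /shw addrK.
Qed.

End Assembly.

Import numFieldNormedType.Exports.

(** * Dimensions *)

Section Dimension.
Variables (K : fieldType) (M : lmodType K).
Implicit Types (W P : set M).
Local Notation z0 := (fun v : M => v = 0).

Lemma zero_subspace : is_subspace z0.
Proof. by split=> // a u v -> ->; rewrite scaler0 addr0. Qed.

Lemma lspan_min (S W : set M) : is_subspace W -> (forall v, S v -> W v) -> forall v, lspan S v -> W v.
Proof. by move=> sW SW v; apply; split. Qed.

Lemma lspan_subspace (S : set M) : is_subspace (lspan S).
Proof.
split=> [W [[W0 _] _] //|a u v hu hv W hW]; have [sW _] := hW.
by apply: sW.2; [exact: hu|exact: hv].
Qed.

Lemma lspan_gen (S : set M) v : S v -> lspan S v.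
Proof. by move=> Sv W [_]; apply. Qed.

Lemma lspan_range d (b : 'I_d -> M) v : lspan (range b) v -> exists c : 'I_d -> K, v = \sum_i c i *: b i.
Proof.
move: v; apply: lspan_min => [|_ [i _ <-]].
  split; first by exists (fun _ => 0); rewrite big1 // => i _; rewrite scale0r.
  move=> a _ _ [c ->] [c' ->]; exists (fun i => a * c i + c' i).
  by rewrite scaler_sumr -big_split /=; apply: eq_bigr => i _; rewrite scalerDl scalerA.
exists (fun j => (j == i)%:R); rewrite (bigD1 i) //= eqxx scale1r big1 ?addr0 // => j /negbTE ->.
by rewrite scale0r.
Qed.

Lemma has_dim_dle W d : has_dim W d -> dle z0 W d.
Proof.
case=> b [_ <-]; apply: (span_dle (b := b)) zero_subspace _ _; first by rewrite card_ord.
by move=> v /lspan_range[c ->]; exists c; rewrite subrr.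
Qed.

Lemma has_dim_le W d e : has_dim W d -> dle z0 W e -> (d <= e)%N.
Proof.
case=> b [hb bW] hd; rewrite leqNgt; apply/negP => lt.
have [|c [i ci] e0] := hd (fun i => b (widen_ord lt i)).
  by move=> i; rewrite -bW; apply: lspan_gen; exists (widen_ord lt i).
pose f (j : 'I_d) := if insub (val j) is Some i then c i else 0.
have fw k : f (widen_ord lt k) = c k by rewrite /f /= valK.
have : \sum_j f j *: b j = 0.
  rewrite -[RHS]e0 (bigID (fun j : 'I_d => j < e.+1)%N) /= [X in _ + X]big1 ?addr0; last first.
    by move=> j hj; rewrite /f insubF ?scale0r //; exact: negbTE.
  rewrite (big_ord_narrow lt); apply: eq_bigr => k _; by rewrite fw.
by move/hb => /(_ (widen_ord lt i)); rewrite fw; move/eqP; rewrite (negbTE ci).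
Qed.

Lemma dle_has_dim W e : is_subspace W -> dle z0 W e -> exists d, has_dim W d.
Proof.
move=> sW; elim: e => [|e IH] h.
  have [b Wb hb] := dle_basis zero_subspace sW h; exists 0%N, b; split; first by move=> c _ [].
  apply/seteqP; split=> v; first by move: v; apply: lspan_min => // _ [i _ <-].
  by move=> /hb[c /subr0_eq]; rewrite big_ord0 => ->; exact: sub0 (lspan_subspace _).
have [b Wb hb] := dle_basis zero_subspace sW h.
have [ind|dep] := pselect (forall c : 'I_e.+1 -> K, \sum_i c i *: b i = 0 -> forall i, c i = 0).
  exists e.+1, b; split=> //; apply/seteqP; split=> v; first by move: v; apply: lspan_min => // _ [i _ <-].
  move=> /hb[c /subr0_eq ->]; have sS := lspan_subspace (range b).
  by apply: (sub_sum sS) => i _; apply: (subZ sS); apply: lspan_gen; exists i.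
apply: IH; have [c [j [cj e0]]] : exists c : 'I_e.+1 -> K, exists j, c j != 0 /\ \sum_i c i *: b i = 0.
  apply: contrapT => no; apply: dep => c e0 i; apply: contrapT => ci; apply: no.
  by exists c, i; split=> //; apply/eqP.
apply: (span_dle (b := fun i => b (lift j i))) zero_subspace _ _; first by rewrite card_ord.
move=> v /hb[a /subr0_eq ->]; exists (fun i => a (lift j i) - a j / c j * c (lift j i)).
have {}e0 : b j = - (c j)^-1 *: \sum_(i < e) c (lift j i) *: b (lift j i).
  move: e0; rewrite (bigD1_ord j) //= => /eqP; rewrite addr_eq0 => /eqP e0.
  by rewrite scaleNr -scalerN -e0 scalerA mulVf // scale1r.
rewrite (bigD1_ord j) //= e0 scalerA scaler_sumr -big_split -sumrB big1 //= => i _.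
by rewrite scalerA -scalerDl -scalerBl (_ : _ - _ = 0) ?scale0r //; ring.
Qed.

Lemma ldimP W e : is_subspace W -> dle z0 W e -> (ldim W <= e)%N /\ dle z0 W (ldim W).
Proof.
move=> sW h; have [d hd] := dle_has_dim sW h.
have h' : has_dim W (ldim W) by apply: (getPex (P := [set d | has_dim W d])); exists d.
by split; [exact: has_dim_le h' h|exact: has_dim_dle].
Qed.

End Dimension.

(** * Growth exponents *)

Section Limit.
Variable R : realType.

Local Open Scope classical_set_scope.

Lemma ln_nat_cvg : (fun k : nat => ln (k%:R : R)) @ \oo --> +oo%R.
Proof.
apply/cvgryPge => A; near=> k.
have ek : expR A <= k%:R by near: k; exact: nbhs_infty_ger.
by rewrite -(expRK A) ler_ln // posrE ?expR_gt0 // (lt_le_trans (expR_gt0 A) ek).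
Unshelve. all: by end_near. Qed.

Lemma leq_expn (a b D : nat) : (a <= b)%N -> (a ^ D <= b ^ D)%N.
Proof. by case: D => // D ab; rewrite leq_exp2r. Qed.

(** The quotients of the logarithms lie between [D - C / ln k] and [D + C / ln k]. *)
Lemma growth_limit (d : nat -> nat) D c1 c2 :
  (forall k, (k.+1 ^ D <= c1 * d (c1 * k + c1))%N) ->
  (forall k l, (k <= l)%N -> (d k <= d l)%N) ->
  (forall k, (d k <= c2 * k.+1 ^ D)%N) ->
  limn_esup (fun k => (ln ((d k)%:R : R) / ln k%:R)%:E) = D%:R%:E.
Proof.
move=> lo mono up.
have c10 : (0 < c1)%N.
  by rewrite lt0n; apply/eqP => e; have := lo 0%N; rewrite e mul0n exp1n.
have d0 k : (c1 <= k)%N -> (0 < d k)%N.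
  move=> ck; apply: leq_trans (mono _ _ ck); have := lo 0%N; rewrite muln0 add0n exp1n.
  by case: (d c1) => //; rewrite muln0.
have c20 : (0 < c2)%N.
  by have := leq_trans (d0 _ (leqnn c1)) (up c1); case: (c2).
pose c3 := (c1 * (2 * c1) ^ D)%N; pose c4 := (c2 * 2 ^ D)%N.
(* the hypothesis at [k %/ c1 - 1], as [k <= 2 * c1 * (k %/ c1)] *)
have lo2 k : (c1 <= k)%N -> (k ^ D <= c3 * d k)%N.
  move=> ck; have q0 : (0 < k %/ c1)%N by rewrite divn_gt0.
  have h : (k <= 2 * c1 * (k %/ c1))%N.
    have := ltn_ceil k c10; rewrite mulSn mulnC.
    have : (c1 <= c1 * (k %/ c1))%N by rewrite leq_pmulr.
    lia.
  have e : (c1 * (k %/ c1).-1 + c1 <= k)%N.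
    by rewrite -mulnSr prednK // mulnC leq_divM.
  have := lo (k %/ c1).-1; rewrite prednK // => h1.
  apply: leq_trans (leq_expn D h) _; rewrite expnMn /c3 [(c1 * _)%N]mulnC -mulnA leq_mul2l.
  by apply/orP; right; apply: leq_trans h1 _; rewrite leq_mul2l mono ?orbT.
have up2 k : (0 < k)%N -> (d k <= c4 * k ^ D)%N.
  move=> k0; apply: leq_trans (up k) _; rewrite /c4 -mulnA -expnMn leq_mul2l leq_expn ?orbT //.
  lia.
have c30 : (0 < c3)%N by rewrite muln_gt0 c10 expn_gt0 muln_gt0 c10.
have c40 : (0 < c4)%N by rewrite muln_gt0 c20 expn_gt0.
pose L (k : nat) : R := ln k%:R.
have Linv : (L k)^-1 @[k --> \oo] --> (0 : R).
  apply/gtr0_cvgV0; last exact: ln_nat_cvg.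
  by near=> k; rewrite ln_gt0 // ltr1n; near: k; exact: nbhs_infty_gt.
have cst (c : R) : (D%:R + c * (L k)^-1) @[k --> \oo] --> (D%:R : R).
  rewrite -[X in _ --> X]addr0 -[X in _ --> _ + X](mulr0 c).
  by apply: cvgD; [exact: cvg_cst|apply: cvgM Linv; exact: cvg_cst].
suff h : (fun k => (ln ((d k)%:R : R) / ln k%:R)%:E) @ \oo --> D%:R%:E.
  by have [_ ->] := cvg_limn_einf_sup h.
apply: cvg_EFin; first by near=> k.
apply: (squeeze_cvgr _ (cst (- ln c3%:R)) (cst (ln c4%:R))).
near=> k.
have k1 : (1 < k)%N by near: k; exact: nbhs_infty_gt.
have kc : (c1 <= k)%N by near: k; exact: nbhs_infty_ge.
have k0 : (0 < k)%N := ltnW k1.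
have Lk : 0 < L k by rewrite ln_gt0 // ltr1n.
have posn (a : nat) : (0 < a)%N -> (a%:R : R) \is Num.pos by rewrite posrE ltr0n.
have lnle (a b : nat) : (0 < a)%N -> (a <= b)%N -> ln (a%:R : R) <= ln b%:R.
  by move=> a0 ab; rewrite ler_ln ?ler_nat // posn //; exact: leq_trans ab.
have lnX (a b : nat) : (0 < a)%N -> ln ((a * k ^ b)%N%:R : R) = ln a%:R + b%:R * L k.
  move=> a0; rewrite natrM lnM ?posn ?expn_gt0 ?k0 //.
  by rewrite natrX lnXn ?ltr0n // mulr_natl.
have h1 := lnle _ _ _ (lo2 k kc); have h2 := lnle _ _ (d0 _ kc) (up2 k k0).
rewrite lnX // in h2; rewrite natrM lnM ?posn ?d0 // -[(k ^ D)%N]mul1n lnX // ln1 add0r in h1.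
rewrite mul1n expn_gt0 k0 /= in h1; have {}h1 := h1 isT.
rewrite /= ler_pdivlMr // ler_pdivrMr // !mulrDl -!mulrA mulVf ?gt_eqF // !mulr1.
by rewrite -/(L k); apply/andP; split; lra.
Unshelve. all: by end_near. Qed.

End Limit.

(** * The action of gl(m|n) *)

Section MatrixUnits.
Variables (K : numFieldType) (m n : nat).
Local Notation N := (m + n)%N.
Implicit Types A B : 'M[K]_N.

(** The indices are natural numbers, as in the even part; out of range the unit is zero. *)
Definition emx (p q : nat) : 'M[K]_N := \matrix_(i, j) ((i == p :> nat) && (j == q :> nat))%:R.

Lemma emx_mul p q r s : (q < N)%N -> emx p q *m emx r s = (q == r)%:R *: emx p s.
Proof.
move=> qN; apply/matrixP => i j; rewrite !mxE (bigD1 (Ordinal qN)) //= big1 ?addr0.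
  by rewrite !mxE /= eqxx andbT; case: (i == p :> nat); case: (q == r); case: (j == s :> nat); rewrite /= ?mulr1 ?mulr0 ?mul0r.
move=> k kq; rewrite !mxE; have -> : (k == q :> nat) = false by apply: contraNF kq => /eqP e; apply/eqP/val_inj.
by rewrite andbF mul0r.
Qed.

Lemma mxparityE b A : mxparity b A = \matrix_(i, j) (if (par m i j == b) then A i j else 0).
Proof.
apply/matrixP => i j; rewrite [RHS]mxE -(splitK i) -(splitK j) /mxparity.
have ge (k : 'I_n) : (m <= m + k)%N = true by exact: leq_addr.
have lt (k : 'I_m) : (m <= k)%N = false by rewrite leqNgt ltn_ord.
by case: (fintype.split i) => i'; case: (fintype.split j) => j'; case: b;
  rewrite /= ?block_mxEul ?block_mxEur ?block_mxEdl ?block_mxEdr !mxE /par /= ?ge ?lt.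
Qed.

Definition mxhom b A := mxparity b A = A.

Lemma mxhom_other b A : mxhom b A -> mxparity (~~ b) A = 0.
Proof.
move=> h; rewrite -h !mxparityE; apply/matrixP => i j; rewrite !mxE.
by case: (par m i j); case: b {h}.
Qed.

Lemma emx_hom p q : mxhom (par m p q) (emx p q).
Proof.
rewrite /mxhom mxparityE; apply/matrixP => i j; rewrite !mxE.
by case: (i =P p :> nat) => [->|_] /=; [case: (j =P q :> nat) => [->|_] /=|]; rewrite ?eqxx ?if_same.
Qed.

Definition str A : K := \sum_(i < N) (-1) ^+ (m <= i)%N * A i i.

Lemma supertraceE A : supertrace A = str A.
Proof.
rewrite /supertrace /str big_split_ord /= /mxtrace -sumrN; congr (_ + _); apply: eq_bigr => i _.
  by rewrite !mxE leqNgt ltn_ord mul1r.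
by rewrite !mxE leq_addr expr1 mulN1r.
Qed.

Lemma mem_slE A : (A \in sl K m n) = (str A == 0).
Proof. by rewrite mem_sl supertraceE. Qed.

Lemma strP a A B : str (a *: A + B) = a * str A + str B.
Proof.
by rewrite /str mulr_sumr -big_split /=; apply: eq_bigr => i _; rewrite !mxE mulrDr mulrCA.
Qed.

Lemma str_odd A : mxhom true A -> str A = 0.
Proof.
move=> <-; rewrite /str big1 // => i _; rewrite mxparityE !mxE /par eqxx.
by rewrite mulr0.
Qed.

Lemma str_emx p q : p != q -> str (emx p q) = 0.
Proof.
move=> pq; rewrite /str big1 // => i _; rewrite mxE; case: eqP => [->|] /=; rewrite ?mulr0 //.
by rewrite (negbTE pq) mulr0.
Qed.

Lemma superbracket_hom a b A B : mxhom a A -> mxhom b B ->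
  superbracket A B = A *m B - (-1) ^+ (a && b) *: (B *m A).
Proof.
move=> hA hB; rewrite /superbracket; congr (_ - _).
rewrite (bigD1 a) //= [X in _ + X]big1 ?addr0; last first.
  move=> a' ne; have -> : a' = ~~ a by move: ne; case: a a' {hA} => -[].
  by rewrite big1 // => b' _; rewrite (mxhom_other hA) mulmx0 scaler0.
rewrite (bigD1 b) //= [X in _ + X]big1 ?addr0; last first.
  move=> b' ne; have -> : b' = ~~ b by move: ne; case: b b' {hB} => -[].
  by rewrite (mxhom_other hB) mul0mx scaler0.
by rewrite hA hB.
Qed.

Hypothesis mn : m != n.

Lemma supertrace1 : str 1%:M != 0.
Proof.
rewrite -supertraceE /supertrace; have -> : ulsubmx (1%:M : 'M[K]_N) = 1%:M by rewrite scalar_mx_block block_mxKul.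
have -> : drsubmx (1%:M : 'M[K]_N) = 1%:M by rewrite scalar_mx_block block_mxKdr.
by rewrite !mxtrace1 subr_eq0 eqr_nat.
Qed.

(** The projection of gl(m|n) on sl(m|n) along the identity matrix. *)
Definition slpr A : slT K m n := vsproj (sl K m n) (A - (str A / str 1%:M) *: 1%:M).

Lemma slprK A : vsval (slpr A) = A - (str A / str 1%:M) *: 1%:M.
Proof.
rewrite /slpr vsprojK // mem_slE -scaleNr addrC strP mulNr divfK ?addNr //.
exact: supertrace1.
Qed.

Lemma slprK0 A : str A = 0 -> vsval (slpr A) = A.
Proof. by move=> h; rewrite slprK h mul0r scale0r subr0. Qed.

Lemma slpr_val (x : slT K m n) : slpr (vsval x) = x.
Proof.
apply: val_inj; rewrite /= slprK0 //; apply/eqP; rewrite -mem_slE; exact: subvsP.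
Qed.

Lemma slpr_linear : linear slpr.
Proof.
move=> a A B; rewrite /slpr -linearP; congr (vsproj _ _).
rewrite strP; lmod_with K 'M[K]_(m + n); ring.
Qed.

Lemma one_hom : mxhom false (1%:M : 'M[K]_N).
Proof.
rewrite /mxhom mxparityE; apply/matrixP => i j; rewrite !mxE.
by case: (eqVneq i j) => [->|_]; rewrite /par ?eqxx // if_same.
Qed.

Lemma hom_lin b c A B : mxhom b A -> mxhom b B -> mxhom b (A - c *: B).
Proof.
rewrite /mxhom !mxparityE => hA hB; apply/matrixP => i j; rewrite !mxE.
have := congr1 (fun Z : 'M[K]_(m + n) => Z i j) hA; have := congr1 (fun Z : 'M[K]_(m + n) => Z i j) hB; rewrite !mxE.
by case: ifP => // _ <- <-; rewrite mulr0 subr0.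
Qed.

Lemma slpr_hom b A : mxhom b A -> slhom b (slpr A).
Proof.
move=> h; rewrite /slhom slprK; case: b h => h; last exact: hom_lin h one_hom.
by rewrite str_odd // mul0r scale0r subr0.
Qed.

Lemma slpr_bracket a b A B : mxhom a A -> mxhom b B ->
  slbracket (slpr A) (slpr B) = slpr (A *m B - (-1) ^+ (a && b) *: (B *m A)).
Proof.
move=> hA hB; apply: val_inj; rewrite /= -superbracket_hom // slprK0; last first.
  by apply/eqP; rewrite -mem_slE superbracket_sl.
rewrite /slbracket vsprojK ?superbracket_sl // (superbracket_hom (slpr_hom hA) (slpr_hom hB)).
rewrite (superbracket_hom hA hB) !slprK.
set x := str A / _; set y := str B / _.
have [e|e] : ((-1) ^+ (a && b) = 1 :> K) \/ (x = 0 /\ y = 0).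
- case: a hA => hA; last by left.
  case: b hB => hB; last by left.
  by right; rewrite /x /y (str_odd hA) (str_odd hB) !mul0r.
- rewrite e !scale1r !mulmxBl !mulmxBr -!scalemxAl -!scalemxAr !mul1mx !mulmx1 !scalerA.
  lmod_with K 'M[K]_(m + n); ring.
by case: e => -> ->; rewrite !scale0r !subr0.
Qed.


Lemma supertrace_bracket a b A B : mxhom a A -> mxhom b B ->
  str (A *m B - (-1) ^+ (a && b) *: (B *m A)) = 0.
Proof.
by move=> hA hB; rewrite -superbracket_hom //; apply/eqP; rewrite -mem_slE superbracket_sl.
Qed.

Lemma emx_sum A : A = \sum_i \sum_j A i j *: emx i j.
Proof.
rewrite [LHS]matrix_sum_delta; apply: eq_bigr => i _; apply: eq_bigr => j _; congr (_ *: _).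
by apply/matrixP => i' j'; rewrite !mxE -!val_eqE.
Qed.

(** ** The action on a module *)

Variables (V : slmodule K m n) (kap : K).

(** The extension of the module to gl(m|n) in which the identity acts by [kap]. *)
Definition gact A (v : V) : V := slact (slpr A) v + (str A / str 1%:M * kap) *: v.

Lemma gact_linl v : linear (gact^~ v).
Proof.
move=> a A B; rewrite /gact slpr_linear slact_linearl strP.
by lmod_with K V; ring.
Qed.

Lemma gact_linr A : linear (gact A).
Proof. by move=> a u v; rewrite /gact slact_linearr; lmod_with K V; ring. Qed.

Lemma gact_bracket a b A B v : mxhom a A -> mxhom b B ->
  gact A (gact B v) = (-1) ^+ (a && b) *: gact B (gact A v)
    + gact (A *m B - (-1) ^+ (a && b) *: (B *m A)) v.
Proof.
move=> hA hB; rewrite {5}/gact supertrace_bracket // !mul0r scale0r addr0.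
rewrite -slpr_bracket // (slact_bracket v (slpr_hom hA) (slpr_hom hB)) /gact.
set x := str A / _; set y := str B / _.
have sD C u w : slact (slpr C) (u + w) = slact (slpr C) u + slact (slpr C) w :> V.
  by have := slact_linearr (slpr C) 1 u w; rewrite !scale1r.
have s0 C : slact (slpr C) 0 = 0 :> V.
  by have := slact_linearr (slpr C) (-1) (0 : V) 0; rewrite scaler0 addr0 scaleN1r addNr.
have sZ C c u : slact (slpr C) (c *: u) = c *: slact (slpr C) u :> V.
  by have := slact_linearr (slpr C) c u (0 : V); rewrite s0 !addr0.
rewrite !sD !sZ.
have [e|e] : ((-1) ^+ (a && b) = 1 :> K) \/ (x = 0 /\ y = 0).
- case: a hA => hA; last by left.
  case: b hB => hB; last by left.
  by right; rewrite /x /y (str_odd hA) (str_odd hB) !mul0r.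
- rewrite e !scale1r; lmod_with K V; ring.
case: e => -> ->; rewrite !mul0r !scale0r !addr0 addrC subrK //.
Qed.

Definition X p q (v : V) : V := gact (emx p q) v.

Lemma X_lin p q : linear (X p q). Proof. exact: gact_linr. Qed.

Lemma X_rel p q r s v : (p < N)%N -> (q < N)%N -> (r < N)%N -> (s < N)%N ->
  X p q (X r s v) = (-1) ^+ (par m p q && par m r s) *: X r s (X p q v)
    + ((q == r)%:R *: X p s v - ((-1) ^+ (par m p q && par m r s) * (s == p)%:R) *: X r q v).
Proof.
move=> pN qN rN sN; rewrite /X (gact_bracket v (emx_hom p q) (emx_hom r s)); congr (_ + _).
rewrite !emx_mul // scalerA.
have g0 : gact 0 v = 0.
  by have := gact_linl v (-1) 0 0; rewrite scaler0 addr0 scaleN1r addNr.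
have gZ c A : gact (c *: A) v = c *: gact A v.
  by have := gact_linl v c A 0; rewrite g0 !addr0.
by rewrite -scaleNr addrC gact_linl gZ scaleNr addrC.
Qed.

Lemma X_part p q b v : (p < N)%N -> (q < N)%N -> slmod_part b v ->
  slmod_part (par m p q (+) b) (X p q v).
Proof.
move=> _ _ hv; have sP := slmod_part_subspace V (par m p q (+) b).
apply: (subD sP); first exact: slact_parity (slpr_hom (emx_hom p q)) hv.
case: (boolP (par m p q)) sP => [h|_] sP; last exact: (subZ sP).
have hh : mxhom true (emx p q) by have := emx_hom p q; rewrite h.
by rewrite str_odd // !mul0r scale0r; exact: (sub0 sP).
Qed.

Lemma slact_X (P : V -> Prop) (x : slT K m n) v : is_subspace P ->
  (forall p q, (p < N)%N -> (q < N)%N -> P (X p q v)) -> P (slact x v).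
Proof.
move=> sP h; have st0 : str (vsval x) = 0 by apply/eqP; rewrite -mem_slE; exact: subvsP.
have -> : slact x v = gact (vsval x) v by rewrite /gact slpr_val st0 !mul0r scale0r addr0.
have g0 : gact 0 v = 0.
  by have := gact_linl v (-1) 0 0; rewrite scaler0 addr0 scaleN1r addNr.
rewrite [vsval x]emx_sum.
have key (I : Type) (l : seq I) F : (forall i, P (gact (F i) v)) -> P (gact (\sum_(i <- l) F i) v).
  move=> hF; elim: l => [|i l IH]; first by rewrite big_nil g0; exact: (sub0 sP).
  by rewrite big_cons -[F i]scale1r gact_linl; exact: sP.2.
apply: (key) => i; apply: (key) => j; rewrite -[_ *: emx i j]addr0 gact_linl g0 addr0.
by apply: (subZ sP); exact: h.
Qed.

Lemma X_simple : is_simple V -> forall P : V -> Prop, is_subspace P ->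
  (forall p q v, (p < N)%N -> (q < N)%N -> P v -> P (X p q v)) ->
  (forall v, P v -> exists v0 v1, [/\ P v0 /\ slmod_part false v0, P v1 /\ slmod_part true v1 & v = v0 + v1]) ->
  (exists2 v, P v & v != 0) -> forall v, P v.
Proof.
move=> [_ hV] P sP PX Pg [v Pv v0] u.
have sub : is_submodule (P : set V).
  by split=> // x w Pw; apply: slact_X => // p q pN qN; exact: PX.
case: (hV P sub) => e; last by rewrite e.
by move: Pv v0; rewrite e /= => ->; rewrite eqxx.
Qed.

Variable Lam : 'rV[K]_N.
Hypothesis kapE : kap = \sum_i Lam 0 i.

Definition lamn (p : nat) : K := if insub p is Some i then Lam 0 i else 0.

Lemma lamnE (i : 'I_N) : lamn i = Lam 0 i. Proof. by rewrite /lamn valK. Qed.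

(** The value of [kap] makes the diagonal units act by the coordinates of [Lam] themselves. *)
Lemma hw_X (v : V) : is_hwvector Lam v ->
  (forall p q, (q < N)%N -> (p < q)%N -> X p q v = 0) /\
  (forall p, (p < N)%N -> X p p v = lamn p *: v).
Proof.
move=> [_ hup hd]; split=> [p q qN pq|p pN].
  have st0 : str (emx p q) = 0 by apply: str_emx; rewrite ltn_eqF.
  rewrite /X /gact st0 !mul0r scale0r addr0; apply: hup => i j ji.
  rewrite slprK0 // mxE; case: eqP => //= ei; case: eqP => //= ej.
  by move: ji; rewrite ei ej leqNgt pq.
rewrite /X /gact hd; last first.
  rewrite /slcartan slprK; apply/is_diag_mxP => i j ij.
  have ij' : (i == j) = false by apply: contraNF ij => /eqP ->.
  rewrite !mxE ij' /= mulr0n mulr0 subr0.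
  case: eqP => //= ei; case: eqP => //= ej; by case/eqP: ij; rewrite ei ej.
rewrite -scalerDl; congr (_ *: _); rewrite /weight_eval slprK kapE mulr_sumr -big_split /=.
rewrite (bigD1 (Ordinal pN)) //= big1 ?addr0 => [|i ip].
  by rewrite !mxE !eqxx /= (lamnE (Ordinal pN)); ring.
rewrite !mxE eqxx /=; have -> : (i == p :> nat) = false by apply: contraNF ip => /eqP e; apply/eqP/val_inj.
by rewrite /=; ring.
Qed.

(** The homogeneous components of a highest weight vector satisfy the same equations. *)
Lemma hom_hwvector (v : V) : is_hwvector Lam v -> exists b u, [/\ u != 0, slmod_part b u,
  forall p q, (q < N)%N -> (p < q)%N -> X p q u = 0 &
  forall p, (p < N)%N -> X p p u = lamn p *: u].
Proof.
move=> hv; have [hup hd] := hw_X hv; have [vN _ _] := hv.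
have [u [w [hu hw e]]] := slmod_part_sum v.
have X0 p q : X p q 0 = 0.
  by have := X_lin p q (-1) 0 0; rewrite scaler0 addr0 scaleN1r addNr.
have XD p q a b : X p q (a + b) = X p q a + X p q b.
  by have := X_lin p q 1 a b; rewrite !scale1r.
have sP := slmod_part_subspace V.
have dir b (a a' : V) : slmod_part b a -> slmod_part (~~ b) a' -> a + a' = 0 -> a = 0 /\ a' = 0.
  move=> ha ha' e0; have ea : a = - a' by apply/eqP; rewrite -addr_eq0 e0.
  have a0 : a = 0.
    case: b ha ha' => ha ha'; apply: slmod_part_direct => //; rewrite ea; exact: (subN (sP _)).
  by split=> //; rewrite a0 add0r in e0.
have up p q : (q < N)%N -> (p < q)%N -> X p q u = 0 /\ X p q w = 0.
  move=> qN pq; have pN := ltn_trans pq qN.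
  apply: (dir (par m p q (+) false)); [exact: X_part|by rewrite -addbN; exact: X_part|].
  by rewrite -XD -e hup.
have dg p : (p < N)%N -> X p p u = lamn p *: u /\ X p p w = lamn p *: w.
  move=> pN; have pp : par m p p = false by rewrite /par eqxx.
  have [] := dir false (X p p u - lamn p *: u) (X p p w - lamn p *: w).
  - by apply: (subB (sP _)); [have := X_part pN pN hu; rewrite pp|exact: (subZ (sP _))].
  - by apply: (subB (sP _)); [have := X_part pN pN hw; rewrite pp|exact: (subZ (sP _))].
  - by rewrite addrACA -XD -opprD -scalerDr -e hd // subrr.
  by move=> /subr0_eq -> /subr0_eq ->.
have [u0|uN] := eqVneq u 0; last first.
  exists false, u; split=> // [p q qN pq|p pN]; first by have [] := up p q qN pq.
  by have [] := dg p pN.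
exists true, w; split=> // [|p q qN pq|p pN]; first by move: vN; rewrite e u0 add0r.
  by have [] := up p q qN pq.
by have [] := dg p pN.
Qed.

End MatrixUnits.

(** * The growth of the supermodule *)

Section Ufilt.
Local Open Scope classical_set_scope.
Variables (K : fieldType) (m n : nat) (V : slmodule K m n).
Implicit Types (W : set V).

Lemma Ufilt_sub W k : is_subspace (Ufilt k W). Proof. exact: lspan_subspace. Qed.

Lemma Ufilt0 W v : W v -> Ufilt 0 W v.
Proof. by move=> Wv; apply: lspan_gen; exists [::], v. Qed.

Lemma Ufilt_mono W k l v : (k <= l)%N -> Ufilt k W v -> Ufilt l W v.
Proof.
move=> kl; move: v; apply: lspan_min; first exact: Ufilt_sub.
move=> _ [xs [v [sx Wv ->]]]; apply: lspan_gen; exists xs, v; split=> //.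
exact: leq_trans kl.
Qed.

Lemma Ufilt_act W k x v : Ufilt k W v -> Ufilt k.+1 W (slact x v).
Proof.
have sU := Ufilt_sub W k.+1.
have s0 : slact x 0 = 0 :> V.
  by have := slact_linearr x (-1) (0 : V) 0; rewrite scaler0 addr0 scaleN1r addNr.
move: v; apply: lspan_min.
  split; first by rewrite s0; exact: (sub0 sU).
  by move=> a u v hu hv; rewrite slact_linearr; exact: sU.2.
move=> _ [xs [v [sx Wv ->]]]; apply: lspan_gen; exists (x :: xs), v; split=> //.
Qed.

Lemma Ufilt_min W (F : nat -> V -> Prop) a k : (forall k, is_subspace (F k)) ->
  (forall k l v, (k <= l)%N -> F k v -> F l v) -> (forall k x v, F k v -> F k.+1 (slact x v)) ->
  (forall v, W v -> F a v) -> forall v, Ufilt k W v -> F (k + a)%N v.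
Proof.
move=> sF Fm Fx WF; apply: lspan_min; first exact: sF.
move=> _ [xs [v [sx Wv ->]]]; apply: (Fm (size xs + a)%N); first by rewrite leq_add2r.
by elim: xs {sx} => [|x xs IH] /=; [exact: WF|exact: Fx].
Qed.

End Ufilt.

Section Growth.
Local Open Scope classical_set_scope.
Variables (K : numFieldType) (m n : nat) (V : slmodule K m n) (Lam : 'rV[K]_(m + n)).
Hypotheses (mn : m != n) (hV : is_simple_hw V Lam).
Local Notation N := (m + n)%N.
Local Notation z0 := (fun v : V => v = 0).

Theorem growth_GKdim (R : realType) D :
  Lower N (blk m) D (lamn Lam) -> Upper N (blk m) D (lamn Lam) -> has_GKdim V (D%:R : R)%:E.
Proof.
move=> lo up; have [sV [w hw]] := hV.
pose kap := \sum_i Lam 0 i.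
have [b0 [v0 [v0N v0b v0up v0d]]] := hom_hwvector mn (erefl kap) hw.
have := super_filtration (@X_lin K m n V kap) (@X_rel K m n mn V kap) (slmod_part_subspace V)
  (@X_part K m n mn V kap) (X_simple mn sV (kap := kap)) v0N v0b v0up v0d lo up.
move=> [F [B [c [[sF Fm F0 FX Ffull] [upF loB hG]]]]].
have Fx k x v : F k v -> F k.+1 (slact x v).
  by move=> hv; apply: (slact_X mn (kap := kap)) => // p q pN qN; exact: FX.
have UX (W : set V) k p q v : Ufilt k W v -> Ufilt k.+1 W (X kap p q v).
  move=> hv; apply: (subD (Ufilt_sub _ _)); first exact: Ufilt_act.
  by apply: (subZ (Ufilt_sub _ _)); apply: Ufilt_mono hv.
(* both [B] and [F] lie in any filtration that reaches [v0], after a shift *)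
have UG (W : set V) b : Ufilt b W v0 ->
    (forall k v, B k v -> Ufilt (c * k + c + b) W v) /\ (forall k v, F k v -> Ufilt (k + c + b) W v).
  move=> hb; apply: (hG (fun k => Ufilt (k + b)%N W)) => //.
  - by move=> k; exact: Ufilt_sub.
  - by move=> k l v kl; apply: Ufilt_mono; rewrite leq_add2r.
  by move=> k p q v _ _; rewrite addSn; exact: UX.
split.
  exists (lspan [set v0]); split; first exact: lspan_subspace.
    apply: (dle_has_dim (e := 1)); first exact: lspan_subspace.
    apply: (span_dle (T := unit) (b := fun _ => v0)); [exact: zero_subspace|by rewrite card_unit|].
    apply: lspan_min => [|_ ->].
      split; first by exists (fun _ => 0); rewrite big1 ?subrr // => i _; rewrite scale0r.
      move=> a u v [d /subr0_eq ->] [d' /subr0_eq ->]; exists (fun t => a * d t + d' t).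
      rewrite scaler_sumr -big_split -sumrB big1 //= => i _.
      by rewrite scalerDl scalerA subrr.
    by exists (fun _ => 1); rewrite big_const card_unit /= scale1r addr0 subrr.
  apply/seteqP; split=> // v _; have [k hk] := Ffull v.
  have [_ h] := UG (lspan [set v0]) 0%N (Ufilt0 (lspan_gen (erefl v0))).
  by exists (k + c + 0)%N => //; exact: h.
move=> W [sW [dW [b [_ bW]]] genW].
have full v : exists k, Ufilt k W v.
  have : (\bigcup_k Ufilt k W) v by rewrite genW.
  by case=> k _ hk; exists k.
have [b1 hb1] := full v0; have [BU _] := UG W b1 hb1.
have [a hWa] : exists a, forall v, W v -> F a v.
  have /choice[f hf] i : exists k, F k (b i) by exact: Ffull.
  exists (\sum_i f i)%N => v; rewrite -bW; move: v; apply: lspan_min => // _ [i _ <-].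
  by apply: Fm (hf i); rewrite (bigD1 i) //= leq_addr.
have UF k v : Ufilt k W v -> F (k + a)%N v by move: v; exact: Ufilt_min.
have dU k : dle z0 (Ufilt k W) (c * (k + a).+1 ^ D).
  apply: dle_mono (upF (k + a)%N) => //; [exact: zero_subspace|exact: UF].
have ldU k := ldimP (Ufilt_sub W k) (dU k).
apply: (@growth_limit R _ D (c + b1)%N (c * a.+1 ^ D)%N) => [k|k l kl|k].
- have h : dle z0 (B k) (ldim (Ufilt (c * k + c + b1) W)).
    have [_ h] := ldU (c * k + c + b1)%N.
    apply: dle_mono h => //; [exact: zero_subspace|exact: Ufilt_sub|exact: BU].
  apply: leq_trans (loB _ _ h) _; apply: leq_mul; first exact: leq_addr.
  have kl : (c * k + c + b1 <= (c + b1) * k + (c + b1))%N by nia.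
  have [h1 _] := ldimP (Ufilt_sub W (c * k + c + b1)) (dle_mono (zero_subspace V)
    (Ufilt_sub W ((c + b1) * k + (c + b1))) (fun v => @Ufilt_mono _ _ _ _ W _ _ v kl) (leqnn _) (ldU _).2).
  exact: h1.
- have [h1 _] := ldimP (Ufilt_sub W k) (dle_mono (zero_subspace V) (Ufilt_sub W l)
    (fun v => @Ufilt_mono _ _ _ _ W _ _ v kl) (leqnn _) (ldU _).2).
  exact: h1.
have [h _] := ldU k; apply: leq_trans h _.
rewrite -mulnA leq_mul2l -expnMn; apply/orP; right; apply: leq_expn; nia.
Qed.

End Growth.

From mathcomp Require Import complex.

(** * The shift by the half sum of the even positive roots *)

Section Rho.
Variables (m n : nat).
Local Notation N := (m + n)%N.

Lemma count_gt k i : (\sum_(b < k) (i < b))%N = (k - i.+1)%N.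
Proof. by elim: k => [|k IH]; rewrite ?big_ord0 ?big_ord_recr //= IH; case: ltnP; lia. Qed.

Lemma count_lt k i : (\sum_(b < k) (b < i))%N = minn i k.
Proof. by elim: k => [|k IH]; rewrite ?big_ord0 ?big_ord_recr ?minn0 //= IH; case: ltnP; lia. Qed.

Lemma sum_blocks (P : nat -> bool -> bool) :
  (\sum_(b < N) P b (b < m)%N = \sum_(b < m) P b true + \sum_(b < n) P (m + b)%N false)%N.
Proof.
rewrite big_split_ord; congr addn; apply: eq_bigr => b _ /=; first by rewrite ltn_ord.
by rewrite ltnNge leq_addr.
Qed.

Lemma big_pair (T : Type) (idx : T) (op : Monoid.com_law idx) (I J : finType) (F : I * J -> T) :
  \big[op/idx]_p F p = \big[op/idx]_a \big[op/idx]_b F (a, b).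
Proof. by rewrite (pair_bigA _ (fun a b => F (a, b))); apply: eq_bigr => -[]. Qed.

Definition above (i : nat) : nat := if (i < m)%N then (m - i.+1)%N else (N - i.+1)%N.
Definition below (i : nat) : nat := if (i < m)%N then i else (i - m)%N.

Lemma count_above (i : nat) : (i < N)%N -> (\sum_(b < N) ((i < b)%N && ((i < m)%N == (b < m)%N)))%N = above i.
Proof.
move=> iN; rewrite (sum_blocks (fun b l => (i < b)%N && ((i < m)%N == l))) /above.
case: (ltnP i m) => im.
  rewrite [X in (_ + X)%N]big1 => [|b _]; last by rewrite andbF.
  by rewrite addn0 -(count_gt m i); apply: eq_bigr => b _; rewrite andbT.
rewrite [X in (X + _)%N]big1 => [|b _]; last by rewrite andbF.
have -> : (N - i.+1 = n - (i - m).+1)%N by lia.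
by rewrite add0n -(count_gt n (i - m)); apply: eq_bigr => b _; rewrite andbT; congr nat_of_bool; lia.
Qed.

Lemma count_below (i : nat) : (i < N)%N -> (\sum_(a < N) ((a < i)%N && ((a < m)%N == (i < m)%N)))%N = below i.
Proof.
move=> iN; rewrite (sum_blocks (fun b l => (b < i)%N && (l == (i < m)%N))) /below.
case: (ltnP i m) => im.
  rewrite [X in (_ + X)%N]big1 => [|b _]; last by rewrite andbF.
  have e : i = minn i m by lia.
  by rewrite addn0 [RHS]e -(count_lt m i); apply: eq_bigr => b _; rewrite andbT.
rewrite [X in (X + _)%N]big1 => [|b _]; last by rewrite andbF.
have e : (i - m)%N = minn (i - m) n by lia.
by rewrite add0n e -(count_lt n (i - m)); apply: eq_bigr => b _; rewrite andbT; congr nat_of_bool; lia.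
Qed.

Lemma card_Delta0p : #|Delta0p m n| = ('C(m, 2) + 'C(n, 2))%N.
Proof.
rewrite cardE -sum1_size -[RHS]/('C(m, 2) + 'C(n, 2))%N big_enum /= big_mkcond /=.
rewrite big_pair.
rewrite (eq_bigr (fun a : 'I_N => above a)) => [|a _]; last first.
  rewrite -count_above //; apply: eq_bigr => b _; rewrite inE /=.
  by case: (_ && _).
rewrite big_split_ord /=; congr addn; rewrite -bin2_sum big_mkord.
  rewrite [RHS](reindex_inj rev_ord_inj) /=; apply: eq_bigr => i _; by rewrite /above ltn_ord.
rewrite [RHS](reindex_inj rev_ord_inj) /=; apply: eq_bigr => i _.
by rewrite /above ltnNge leq_addr /=; lia.
Qed.

Lemma rho0E (K : numFieldType) (i : 'I_N) :
  rho0 K m n 0 i = ((above i)%:R - (below i)%:R) / 2.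
Proof.
rewrite /rho0 !mxE summxE mulrC; congr (_ * _).
transitivity (\sum_(p in Delta0p m n) ((p.1 == i)%:R - (p.2 == i)%:R : K)).
  by apply: eq_bigr => p _; rewrite /root_vec !mxE eqxx /= ![i == _]eq_sym.
rewrite sumrB; congr (_ - _).
  rewrite -count_above // natr_sum big_mkcond /=.
  rewrite big_pair /=.
  rewrite (bigD1 i) //= [X in _ + X]big1 ?addr0 => [|a /negbTE ai]; last first.
    by rewrite big1 // => b _; rewrite ai if_same.
  by apply: eq_bigr => b _; rewrite inE /= eqxx; case: (_ && _).
rewrite -count_below // natr_sum big_mkcond /=.
rewrite big_pair /=.
rewrite exchange_big (bigD1 i) //= [X in _ + X]big1 ?addr0 => [|b /negbTE bi]; last first.
  by rewrite big1 // => a _; rewrite bi if_same.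
by apply: eq_bigr => a _; rewrite inE /= eqxx; case: (_ && _).
Qed.

End Rho.

(** * The dimension formula *)

Section RealPart.
Variable R : realType.

Definition reC (z : R[i]) : R := complex.Re z.

Lemma reC_additive : additive reC.
Proof. by move=> [a b] [c d]. Qed.

HB.instance Definition _ := GRing.isAdditive.Build R[i] R reC reC_additive.

Lemma reC1 : reC 1 = 1. Proof. by []. Qed.

End RealPart.

Lemma nth_word (K : numFieldType) d (y : 'rV[K]_d) (i : 'I_d) :
  nth 0 [seq y 0 j | j <- enum 'I_d] i = y 0 i.
Proof. by rewrite (nth_map i) ?size_enum_ord // nth_ord_enum. Qed.

Theorem theorem1p2 (R : realType) (m n : nat)
    (hm : (0 < m)%N) (hn : (0 < n)%N) (hmn : m <> n)
    (lam : 'rV[R[i]]_m) (mu : 'rV[R[i]]_n)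
    (V : slmodule (R[i]) m n) (hV : is_simple_hw V (row_mx lam mu)) :
  has_GKdim V (#|Delta0p m n|%:R - (Acoll (Plambdamu lam mu))%:R : R)%:E /\
  #|Delta0p m n|%:R - (Acoll (Plambdamu lam mu))%:R =
    (m * m.-1)%:R / 2 - (Acoll (Plambda lam mu))%:R
    + ((n * n.-1)%:R / 2 - (Acoll (Pmu lam mu))%:R) :> R.
Proof.
have bin2R k : (k * k.-1)%:R / 2 = 'C(k, 2)%:R :> R.
  by have := mul_bin_diag k 1; rewrite bin1 => ->; rewrite natrM mulrC mulKf ?pnatr_eq0.
have eA : Acoll (Plambdamu lam mu) = (Acoll (Plambda lam mu) + Acoll (Pmu lam mu))%N.
  by rewrite /Acoll /Plambdamu big_cat.
split; last by rewrite card_Delta0p eA !bin2R !natrD; ring.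
have mn : m != n by apply/eqP.
set y := row_mx lam mu + rho0 R[i] m n.
have [D up eD] := Upper_weight (K := R[i]) (lsubmx y) (rsubmx y).
have [D' lo eD'] := Lower_weight (@reC1 R) (lsubmx y) (rsubmx y).
have {eD' D' lo} lo : Lower (m + n) (blk m) D
    (shw (nth 0 ([seq lsubmx y 0 i | i <- enum 'I_m] ++ [seq rsubmx y 0 i | i <- enum 'I_n]))).
  by have -> : D = D' by apply/eqP; rewrite -(eqn_add2r (Acoll (RScoll (lsubmx y)) + Acoll (RScoll (rsubmx y)))) eD eD'.
set w := nth 0 _ in up lo.
have wE (i : 'I_(m + n)) : w i = y 0 i.
  rewrite /w nth_cat size_map size_enum_ord; case: (splitP i) => j ij.
    by rewrite ij nth_word mxE; congr (y 0 _); exact/val_inj/esym.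
  by rewrite ij addKn nth_word mxE; congr (y 0 _); exact/val_inj/esym.
pose Lam := row_mx lam mu.
pose x p : R[i] := lamn Lam p - p%:R.
pose c (b : nat) : R[i] := if b == 0%N then (m%:R - 1) / 2 else m%:R + (n%:R - 1) / 2.
(* the two words differ by a constant on each block, which does not change the growth *)
have xE p : (p < m + n)%N -> w p = x p + c (blk m p).
  move=> pN; have := wE (Ordinal pN); rewrite /= => ->.
  rewrite /y mxE rho0E /x (lamnE Lam (Ordinal pN)) /=.
  rewrite -!addrA; congr (_ + _); rewrite /c /blk /above /below.
  case: (ltnP p m) => pm /=.
    by rewrite natrB // -natr1; field.
  by rewrite natrB // natrB // -natr1 natrD; field.
have eL : lamn Lam = shw x by apply/funext => p; rewrite /shw /x subrK.
have -> : #|Delta0p m n|%:R - (Acoll (Plambdamu lam mu))%:R = D%:R :> R.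
  by rewrite eA card_Delta0p -eD natrD addrK.
apply: (growth_GKdim mn hV); rewrite -/Lam eL.
  apply: Lower_Gle lo; apply: (Gx_trans (y := fun p => x p + c (blk m p))); first exact: Gx_twist.
  by apply: Gx_ext => p pN; rewrite xE.
apply: Upper_Gle up; apply: (Gx_trans (y := fun p => w p + - c (blk m p))).
  exact: (@Gx_twist _ _ _ _ (fun b => - c b)).
by apply: Gx_ext => p pN; rewrite xE // addrK.
Qed.
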